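(* Let $\Delta(\cdot)$ denote either exterior algebraic shifting $\Delta^e(\cdot)$ (computed over an arbitrary infinite field $K$) or symmetric algebraic shifting $\Delta^s(\cdot)$ (computed over a field of characteristic $0$). Let $\Gamma$ be a $(d-1)$-dimensional strongly edge decomposable simplicial complex on $[n]$. Then $\Delta(\Gamma)$ is pure, $h_i(\Gamma)=h_{d-i}(\Gamma)$ for $i=0,1,\dots,d$, and $\Delta(\Gamma)\subset \Delta^s(C(n,d))$, where $C(n,d)$ is the boundary complex of a cyclic $d$-polytope with $n$ vertices.
   Context: A simplicial complex on a finite set $V$ is a collection $\Gamma$ of subsets of $V$ such that $\{v\}\in\Gamma$ for all $v\in V$ and $G\subset F\in\Gamma$ implies $G\in\Gamma$; elements are faces, maximal faces are facets, $\Gamma$ is pure if all facets have the same cardinality, $\dim\Gamma=\max\{|F|-1:F\in\Gamma\}$. $f_k(\Gamma)$ is the number of faces of cardinality $k+1$, $f_{-1}=1$, and with $d=\dim\Gamma+1$ the $h$-vector is $h_i(\Gamma)=\sum_{j=0}^i(-1)^{i-j}\binom{d-j}{d-i}f_{j-1}(\Gamma)$. For $F\subset[n]$, $\mathrm{lk}_\Gamma(F)=\{G\subset[n]\setminus F: G\cup F\in\Gamma\}$; write $\mathrm{lk}_\Gamma(v)$ for $\mathrm{lk}_\Gamma(\{v\})$. For $i<j$, the contraction $\mathcal C_\Gamma(i,j)=\{F\in\Gamma:i\notin F\}\cup\{(F\setminus\{i\})\cup\{j\}: i\in F\in\Gamma\}$, a complex on $[n]\setminus\{i\}$. $\Gamma$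 satisfies the Link condition w.r.t. $\{i,j\}$ if $\mathrm{lk}_\Gamma(i)\cap\mathrm{lk}_\Gamma(j)=\mathrm{lk}_\Gamma(\{i,j\})$. Strongly edge decomposable (recursive definition): boundary complexes of simplices and $\{\emptyset\}$ are strongly edge decomposable; a pure simplicial complex $\Gamma$ is strongly edge decomposable if there is $\{i,j\}\in\Gamma$ such that $\Gamma$ satisfies the Link condition w.r.t. $\{i,j\}$ and both $\mathcal C_\Gamma(i,j)$ and $\mathrm{lk}_\Gamma(\{i,j\})$ are strongly edge decomposable. Exterior algebraic shifting: $K$ infinite field, $E=\bigwedge\langle e_1,\dots,e_n\rangle$ over $K$ with $\deg e_i=1$; for $F=\{i_1<\dots<i_k\}$, $e_F=e_{i_1}\wedge\dots\wedge e_{i_k}$. The exterior face ideal $J_\Gamma$ is generated by all $e_F$ with $F\notin\Gamma$. $GL_n(K)$ acts on $E$ by graded $K$-algebra automorphisms; $\mathrm{in}(J)$ is the initial ideal w.r.t. the reverse lexicographic order induced by $1>2>\dots>n$, and $\mathrm{Gin}(J)=\mathrm{in}(\varphi(J))$ for generic $\varphi\in GL_n(K)$. $\Delta^e(\Gamma)$ is the simplicial complex on $[n]$ with $J_{\Delta^e(\Gamma)}=\mathrm{Gin}(J_\Gamma)$. Symmetric algebraic shifting: $\mathrm{char}K=0$, $S=K[x_1,\dots,x_n]$, $I_\Gamma$ the Stanley–Reisner ideal generated by $x_F=\prod_{i\in F}x_i$, $F\notin\Gamma$; $\mathrm{Gin}(I_\Gamma)$ is the generic initial ideal w.r.t. degree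 reverse lexicographic order with $x_1>\dots>x_n$. Let $\Phi(x_{i_1}x_{i_2}\cdots x_{i_k})=x_{i_1}x_{i_2+1}\cdots x_{i_k+k-1}$ for $i_1\le\dots\le i_k$; $\Delta^s(\Gamma)$ is the simplicial complex on $[n]$ whose Stanley–Reisner ideal is generated by $\{\Phi(u): u$ a minimal monomial generator of $\mathrm{Gin}(I_\Gamma)\}$. (Known, Kalai: for $n>d>0$, $\Delta^s(C(n,d))$ is the complex generated by all $d$-subsets $F\subset[n]$ such that for every integer $k\ge0$, $n-k\notin F$ implies $\{n-d+k,\dots,n-k-1\}\subset F$.) *)

(* Defs.v *)
From HB Require Import structures.
From mathcomp Require Import boolp classical_sets cardinality.
(* Loaded after classical_sets so that set0, setT, subsetP, [set x | P], ...
   refer to {set T}; classical sets are written with the scope %classic. *)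
From mathcomp Require Import all_boot all_order all_algebra.
From mathcomp Require Import mpoly.

Set Implicit Arguments.
Unset Strict Implicit.
Unset Printing Implicit Defensive.

Import GRing.Theory.
Local Open Scope ring_scope.

(* A complex is the family of its faces, over an ambient vertex type; its
   vertex set V may be smaller, as happens for links and contractions. *)
Section Complexes.
Variable T : finType.
Implicit Types (G : {set {set T}}) (F H V : {set T}).

Definition complex_on V G : Prop :=
  [/\ set0 \in G, forall v, v \in V -> [set v] \in G,
      forall F, F \in G -> F \subset V
    & forall F H, F \in G -> H \subset F -> H \in G].

Definition facet G F : Prop := maxset (fun H => H \in G) F.

Definition pure G : Prop :=
  forall F H, facet G F -> facet G H -> #|F| = #|H|.

(* This is dim G + 1, so that the complex {set0} of dimension -1 has
   dimS G = 0. *)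
Definition dimS G : nat := \max_(F in G) #|F|.

(* The number of faces of cardinality k, i.e. f_(k-1). *)
Definition fnum G (k : nat) : nat := #|[set F in G | #|F| == k]|.

Definition hnum G (i : nat) : int :=
  \sum_(j < i.+1)
    (-1) ^+ (i - j) * ('C(dimS G - j, dimS G - i) * fnum G j)%N%:R.

Definition link G F : {set {set T}} :=
  [set H : {set T} | [disjoint H & F] && (H :|: F \in G)].

Definition contraction G (i j : T) : {set {set T}} :=
  [set F in G | i \notin F] :|: [set j |: F :\ i | F in G & i \in F].

Definition link_condition G (i j : T) : Prop :=
  link G [set i] :&: link G [set j] = link G [set i; j].

End Complexes.

Inductive strongly_edge_decomposable n : {set {set 'I_n}} -> Prop :=
| sed_boundary (V : {set 'I_n}) :
    V != set0 -> strongly_edge_decomposable [set F : {set 'I_n} | F \proper V]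
| sed_empty : strongly_edge_decomposable [set set0]
| sed_edge (V : {set 'I_n}) (G : {set {set 'I_n}}) (i j : 'I_n) :
    complex_on V G -> pure G -> (i < j)%N -> [set i; j] \in G ->
    link_condition G i j ->
    strongly_edge_decomposable (contraction G i j) ->
    strongly_edge_decomposable (link G [set i; j]) ->
    strongly_edge_decomposable G.

Section Exterior.
Variables (K : fieldType) (n : nat).

(* An element is the family of its coordinates on the basis e_F, where
   e_F = e_i1 /\ ... /\ e_ik for F = {i1 < ... < ik} (see ext_basisE). *)
Definition exterior := {ffun {set 'I_n} -> K^o}.

HB.instance Definition _ := GRing.Lmodule.on exterior.

Implicit Types (A B C F : {set 'I_n}) (f g h : exterior).

Definition inversions A B : nat :=
  #|[set p : 'I_n * 'I_n | [&& p.1 \in A, p.2 \in B & (p.2 < p.1)%N]]|.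

Definition ext_basis F : exterior := [ffun G => (G == F)%:R].

(* e_A /\ e_B is (-1) ^+ inversions A B *: e_(A :|: B) if A and B are disjoint
   and 0 otherwise. *)
Definition wedge f g : exterior :=
  [ffun F : {set 'I_n} => \sum_(A : {set 'I_n} | A \subset F)
     (-1) ^+ inversions A (F :\: A) * (f A * g (F :\: A))].

Lemma inversionsUl A B C : [disjoint A & B] ->
  inversions (A :|: B) C = (inversions A C + inversions B C)%N.
Proof.
move=> dAB; rewrite /inversions -cardsUI; set X := (X in (_ + X)%N).
have -> : X = 0%N.
  apply/eqP; rewrite cards_eq0 -subset0; apply/subsetP=> p.
  rewrite !inE => /andP[/and3P[pA _ _] /and3P[pB _ _]].
  by rewrite (disjointFr dAB pA) in pB.
by rewrite addn0; apply: eq_card => p; rewrite !inE andb_orl.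
Qed.

Lemma inversionsUr A B C : [disjoint B & C] ->
  inversions A (B :|: C) = (inversions A B + inversions A C)%N.
Proof.
move=> dBC; rewrite /inversions -cardsUI; set X := (X in (_ + X)%N).
have -> : X = 0%N.
  apply/eqP; rewrite cards_eq0 -subset0; apply/subsetP=> p.
  rewrite !inE => /andP[/and3P[_ pB _] /and3P[_ pC _]].
  by rewrite (disjointFr dBC pB) in pC.
by rewrite addn0; apply: eq_card => p; rewrite !inE andb_orl andb_orr.
Qed.

Lemma inversions0l A : inversions set0 A = 0%N.
Proof. by apply: eq_card0 => p; rewrite !inE. Qed.

Lemma inversions0r A : inversions A set0 = 0%N.
Proof. by apply: eq_card0 => p; rewrite !inE andbF. Qed.

Lemma wedgeA : associative wedge.
Proof.
move=> f g h; apply/ffunP=> F; rewrite !ffunE.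
pose G A B := (-1) ^+ (inversions A B + inversions A (F :\: A :\: B)
   + inversions B (F :\: A :\: B)) * (f A * g B * h (F :\: A :\: B)) : K.
transitivity (\sum_(A : {set 'I_n} | A \subset F)
   \sum_(B : {set 'I_n} | B \subset F :\: A) G A B).
  apply: eq_bigr => A sAF; rewrite !ffunE !mulr_sumr.
  apply: eq_bigr => B sBFA; rewrite /G -inversionsUr.
    rewrite (_ : B :|: _ = F :\: A).
      by rewrite exprD; rewrite -!mulrA; congr (_ * _); rewrite mulrCA.
    by rewrite -{1}(setIidPr sBFA) setID.
  by rewrite -setI_eq0 setIDA setIC -setIDA setDv setI0.
transitivity (\sum_(C : {set 'I_n} | C \subset F)
   \sum_(A : {set 'I_n} | A \subset C) G A (C :\: A)); last first.
  apply: eq_bigr => C sCF; rewrite !ffunE mulr_suml mulr_sumr.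
  apply: eq_bigr => A sAC; rewrite /G.
  have -> : F :\: A :\: (C :\: A) = F :\: C.
    apply/setP=> x; rewrite !inE; case xC: (x \in C) => /=.
      by case: (x \in A).
    by case xA: (x \in A) => //=; rewrite (subsetP sAC) in xC.
  rewrite -addnA -inversionsUl.
    rewrite (_ : A :|: _ = C).
      by rewrite addnC exprD -!mulrA.
    by rewrite -{1}(setIidPr sAC) setID.
  by rewrite -setI_eq0 setIDA setIC -setIDA setDv setI0.
rewrite [RHS](exchange_big_dep (fun A => A \subset F)) /=; last first.
  by move=> C A sCF sAC; exact: (subset_trans sAC sCF).
apply: eq_bigr => A sAF.
rewrite (reindex_onto (fun C => C :\: A) (fun B => A :|: B)) /=; last first.
  move=> B; rewrite subsetD => /andP[_ dBA].
  by rewrite setDUl setDv set0U; apply/setDidPl.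
apply: eq_bigl => C; apply/andP/andP.
  case=> sCFA /eqP defC; split; last by rewrite -defC subsetUl.
  by rewrite -defC subUset sAF (subset_trans sCFA) ?subsetDl.
by case=> sCF sAC; rewrite setSD // -{1}(setIidPr sAC) setID.
Qed.

Lemma wedge1l : left_id (ext_basis set0) wedge.
Proof.
move=> f; apply/ffunP=> F; rewrite !ffunE (bigD1 set0) ?sub0set //= big1.
  by rewrite !ffunE eqxx inversions0l setD0 !mul1r addr0.
by move=> A /andP[_ /negbTE A0]; rewrite !ffunE A0 mul0r mulr0.
Qed.

Lemma wedge1r : right_id (ext_basis set0) wedge.
Proof.
move=> f; apply/ffunP=> F; rewrite !ffunE (bigD1 F) //= big1.
  by rewrite !ffunE setDv eqxx inversions0r mul1r mulr1 addr0.
move=> A /andP[sAF nAF]; rewrite !ffunE setD_eq0.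
case: (boolP (F \subset A)) => [sFA|_]; last by rewrite !mulr0.
by case/eqP: nAF; apply/eqP; rewrite eqEsubset sAF.
Qed.

Lemma wedgeDl : left_distributive wedge +%R.
Proof.
move=> f g h; apply/ffunP=> F; rewrite !ffunE -big_split /=.
by apply: eq_bigr => A _; rewrite !ffunE mulrDl mulrDr.
Qed.

Lemma wedgeDr : right_distributive wedge +%R.
Proof.
move=> f g h; apply/ffunP=> F; rewrite !ffunE -big_split /=.
by apply: eq_bigr => A _; rewrite !ffunE !mulrDr.
Qed.

Lemma ext_basis0_neq0 : ext_basis set0 != 0.
Proof. by apply/eqP=> /ffunP/(_ set0)/eqP; rewrite !ffunE eqxx oner_eq0. Qed.

HB.instance Definition _ := GRing.Zmodule_isNzRing.Build exterior
  wedgeA wedge1l wedge1r wedgeDl wedgeDr ext_basis0_neq0.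

Lemma wedgeZl (a : K) f g : a *: (f * g) = (a *: f) * g.
Proof.
apply/ffunP=> F; rewrite !ffunE scaler_sumr.
apply: eq_bigr => A _; rewrite !ffunE /=.
by rewrite /GRing.scale /= -mulrA mulrCA.
Qed.

Lemma wedgeZr (a : K) f g : a *: (f * g) = f * (a *: g).
Proof.
apply/ffunP=> F; rewrite !ffunE scaler_sumr.
apply: eq_bigr => A _; rewrite !ffunE /=.
by rewrite /GRing.scale /= mulrCA (mulrCA (f A)).
Qed.

HB.instance Definition _ := GRing.Lmodule_isLalgebra.Build K exterior wedgeZl.
HB.instance Definition _ := GRing.Lalgebra_isAlgebra.Build K exterior wedgeZr.

Lemma wedge_basis A B : ext_basis A * ext_basis B =
  if [disjoint A & B]
  then (-1) ^+ inversions A B *: ext_basis (A :|: B) else 0.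
Proof.
have mulE F : (ext_basis A * ext_basis B) F =
    \sum_(C : {set 'I_n} | C \subset F) (-1) ^+ inversions C (F :\: C)
      * ((C == A)%:R * (F :\: C == B)%:R).
  by rewrite [LHS]ffunE; apply: eq_bigr => C _; rewrite !ffunE.
apply/ffunP=> F; rewrite mulE; have [dAB|dAB] := boolP [disjoint A & B].
  rewrite !ffunE; have [-> |nF] := eqVneq F (A :|: B).
    rewrite (bigD1 A) ?subsetUl //= big1 => [|C /andP[_ /negbTE->]].
      have /setDidPl defB : [disjoint B & A] by rewrite disjoint_sym.
      by rewrite setDUl setDv set0U defB !eqxx !mulr1 addr0 [RHS]mulr1.
    by rewrite mul0r mulr0.
  rewrite big1 => [|C sCF]; first by rewrite [RHS]mulr0.
  case: eqP => [defA|_]; last by rewrite mul0r mulr0.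
  case: eqP => [defB|_]; last by rewrite !mulr0.
  by case/eqP: nF; rewrite -defA -defB -{1}(setID F C) (setIidPr sCF).
rewrite !ffunE big1 // => C sCF.
case: eqP => [defA|_]; last by rewrite mul0r mulr0.
case: eqP => [defB|_]; last by rewrite !mulr0.
by case/negP: dAB; rewrite -defA -defB -setI_eq0 setIDA setIC -setIDA setDv setI0.
Qed.

Definition ext_gen (i : 'I_n) : exterior := ext_basis [set i].

Lemma ext_basisE F : ext_basis F = \prod_(i <- enum F) ext_gen i.
Proof.
suff basis_sorted s : sorted (fun i j : 'I_n => i < j)%N s ->
    ext_basis [set i in s] = \prod_(i <- s) ext_gen i.
  rewrite -basis_sorted.
    by congr ext_basis; apply/setP=> i; rewrite inE mem_enum.
  rewrite /enum_mem; apply: sorted_filter.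
    by move=> i j k; apply: ltn_trans.
  have : sorted ltn (map val (enum 'I_n)).
    by rewrite val_enum_ord iota_ltn_sorted.
  by rewrite sorted_map enumT.
elim: s => [_|i s IHs /= ps].
  by rewrite big_nil; congr ext_basis; apply/setP=> i; rewrite !inE.
rewrite big_cons -IHs ?(path_sorted ps) // wedge_basis.
have lt_is j : j \in s -> (i < j)%N.
  by move: j; apply/allP; apply: order_path_min ps => ? ? ?; apply: ltn_trans.
rewrite ifT; last first.
  rewrite disjoints1 inE; apply/negP=> /lt_is; by rewrite ltnn.
rewrite (_ : inversions _ _ = 0%N) ?scale1r.
  by congr ext_basis; apply/setP=> j; rewrite !inE.
apply: eq_card0 => p; rewrite !inE; apply/negP=> /and3P[/eqP-> /lt_is lt_ip].
by rewrite ltnNge ltnW.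
Qed.

End Exterior.

Definition is_ideal (R : nzRingType) (I : set R) : Prop :=
  [/\ I 0, forall f g, I f -> I g -> I (f + g)
    & forall a f, I f -> I (a * f) /\ I (f * a)].

Definition ideal_gen (R : nzRingType) (X : set R) : set R :=
  smallest (@is_ideal R) X.

(* The strict degree reverse lexicographic order with x_0 > x_1 > ..., on
   exponent vectors. The order that mpoly provides on monomials is instead the
   degree lexicographic one. *)
Definition degrevlex_lt n (a b : 'I_n -> nat) : Prop :=
  (\sum_i a i < \sum_i b i)%N \/
  (\sum_i a i = \sum_i b i)%N /\
  exists i : 'I_n, (b i < a i)%N /\ forall j : 'I_n, (i < j)%N -> a j = b j.

(* P holds for all matrices of some nonempty Zariski open subset of GL_n; it is
   enough to consider principal open subsets. *)
Definition generically (K : fieldType) n (P : 'M[K]_n -> Prop) : Prop :=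
  exists p : {mpoly K[n * n]},
    let nonvanishing A := A \in unitmx /\ p.@[fun k => mxvec A 0 k] != 0 in
    (exists A, nonvanishing A) /\ (forall A, nonvanishing A -> P A).

Section ExteriorShifting.
Variables (K : fieldType) (n : nat).
Implicit Types (F : {set 'I_n}) (f : exterior K n) (J : set (exterior K n)).

Definition ext_face_ideal (G : {set {set 'I_n}}) : set (exterior K n) :=
  ideal_gen [set f | exists2 F, F \notin G & f = ext_basis K F]%classic.

(* The graded algebra automorphism with e_i |-> \sum_j A j i *: e_j. *)
Definition ext_act (A : 'M[K]_n) f : exterior K n :=
  \sum_(F : {set 'I_n})
    f F *: \prod_(i <- enum F) \sum_j A j i *: ext_gen K j.

Definition ext_initial f F : Prop :=
  f F != 0 /\ forall H : {set 'I_n}, f H != 0 -> H != F ->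
    degrevlex_lt (fun i => i \in H : nat) (fun i => i \in F : nat).

Definition ext_in J : set (exterior K n) :=
  ideal_gen [set g | exists F, g = ext_basis K F /\
                     exists2 f, J f & ext_initial f F]%classic.

Definition ext_gin J : set (exterior K n) :=
  [set g | generically (fun A : 'M[K]_n =>
             ext_in [set ext_act A f | f in J] g)]%classic.

(* A complex D is determined by its face ideal: F is in D if and only if e_F is
   not in ext_face_ideal D. *)
Definition ext_shift (G : {set {set 'I_n}}) : {set {set 'I_n}} :=
  [set F | `[< ~ ext_gin (ext_face_ideal G) (ext_basis K F) >]].

End ExteriorShifting.

Section SymmetricShifting.
Variables (K : fieldType) (n : nat).
Implicit Types (F : {set 'I_n}) (p : {mpoly K[n]}) (I : set {mpoly K[n]}).

Definition mono F : {mpoly K[n]} := \prod_(i in F) 'X_i.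

Definition stanley_reisner (G : {set {set 'I_n}}) : set {mpoly K[n]} :=
  ideal_gen [set p | exists2 F, F \notin G & p = mono F]%classic.

Definition sym_act (A : 'M[K]_n) p : {mpoly K[n]} :=
  p \mPo [tuple \sum_j A j i *: 'X_j | i < n].

Definition sym_initial p (m : 'X_{1..n}) : Prop :=
  p@_m != 0 /\ forall m' : 'X_{1..n}, p@_m' != 0 -> m' != m ->
    degrevlex_lt m' m.

Definition sym_in I : set {mpoly K[n]} :=
  ideal_gen [set q | exists m : 'X_{1..n}, q = 'X_[m] /\
                     exists2 p, I p & sym_initial p m]%classic.

Definition sym_gin I : set {mpoly K[n]} :=
  [set q | generically (fun A : 'M[K]_n =>
             sym_in [set sym_act A p | p in I] q)]%classic.

Definition min_generator I (m : 'X_{1..n}) : Prop :=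
  I 'X_[m] /\ forall m' : 'X_{1..n}, (m' <= m)%MM -> I 'X_[m'] -> m' = m.

(* The indices i_1 <= ... <= i_k such that 'X_[m] = x_(i_1) ... x_(i_k). *)
Definition mindices (m : 'X_{1..n}) : seq nat :=
  flatten [seq nseq (m i) (val i) | i <- enum 'I_n].

(* The increasing sequence of indices of the squarefree monomial Phi('X_[m]). *)
Definition Phi (m : 'X_{1..n}) : seq nat :=
  mkseq (fun j => nth 0%N (mindices m) j + j)%N (size (mindices m)).

(* A sequence Phi m that leaves 'I_n is not of the form map val (enum F), and
   contributes no generator; this does not happen for the minimal generators of
   a generic initial ideal Gin(I_G), and such a generator could in any case not
   divide a monomial mono F. *)
Definition sym_shift_ideal (G : {set {set 'I_n}}) : set {mpoly K[n]} :=
  ideal_gen [set p | exists F, p = mono F /\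
    exists2 m, min_generator (sym_gin (stanley_reisner G)) m
             & map val (enum F) = Phi m]%classic.

(* The complex with Stanley-Reisner ideal sym_shift_ideal G. *)
Definition sym_shift (G : {set {set 'I_n}}) : {set {set 'I_n}} :=
  [set F | `[< ~ sym_shift_ideal G (mono F) >]].

End SymmetricShifting.

Inductive algebraic_shifting n :
    ({set {set 'I_n}} -> {set {set 'I_n}}) -> Prop :=
| exterior_shifting (K : fieldType) :
    infinite_set [set: K]%classic -> algebraic_shifting (@ext_shift K n)
| symmetric_shifting (K : fieldType) :
    [pchar K] =i pred0 -> algebraic_shifting (@sym_shift K n).

Definition moment_curve (R : nzRingType) (d : nat) (s : R) : 'rV[R]_d :=
  \row_k s ^+ k.+1.

(* The boundary complex of the polytope with vertices moment_curve d (t i),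
   t_0 < ... < t_(n-1): the vertex sets of its proper faces. A face is the
   locus where a valid inequality c x <= b is an equality; it suffices to test
   validity on the vertices. As n > d, the polytope is full-dimensional, and
   the face is proper exactly when (c, b) != 0; the empty face is given by
   c = 0 and b = 1. The latter also makes {set0} the boundary complex for
   n = d = 0. *)
Definition cyclic_boundary (R : realFieldType) (n d : nat) (t : 'I_n -> R) :
    {set {set 'I_n}} :=
  [set F | `[< exists (c : 'rV[R]_d) (b : R),
     let value i := \sum_k c 0 k * moment_curve d (t i) 0 k in
     [/\ (c, b) != 0, forall i, value i <= b & F = [set i | value i == b]] >]].

(* Main.v *)
From HB Require Import structures.
Require Import Defs.
From mathcomp Require Import boolp classical_sets cardinality.
From mathcomp Require Import all_boot all_order all_algebra.
From mathcomp Require Import mpoly ring lra zify.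

Set Implicit Arguments.
Unset Strict Implicit.
Unset Printing Implicit Defensive.

Import GRing.Theory.
Local Open Scope ring_scope.

(** For an edge satisfying the Link condition, with contraction C and edge link L, the face numbers
    give h(Gamma) = h(C) + x h(L) ([sum_faces_edge], [sum_faces_h]). Boundaries of simplices have h
    = (1, ..., 1), so h is symmetric by induction ([sedh_sym]).

    The heart is a Lefschetz property proved along the same recursion: up to a change of variables
    or a deformation, the face ring of Gamma is built from that of C and from that of a join over L,
    shifted by one degree. In the exterior case ([ext_span_sedh]), modulo d - p + 1 suitable linear
    forms the degree p is spanned by h_p elements; and modulo p + 1 forms, the product of d - 2p
    further forms maps a space of at most h_p dimensions in degree p onto degree d - p. In the
    symmetric case ([sym_span_sedh]), one divides by d forms and multiplies by the power d - 2p of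
    one more form.

    Spanning is an open condition on the forms, so in generic coordinates the forms may be taken to
    be the last variables. In the reverse lexicographic order the monomials involving the last
    variables are the smallest of their degree, so a spanning statement bounds the number of
    standard monomials outside an initial segment ([card_std_lower]). The bounds by h_p are then
    compared with the true number of faces ([card_top_faces]) or with the Hilbert function
    ([card_face_monos]). All of them must be equalities, and this yields purity ([pure_of_counts],
    and [sym_cm] with [sym_shift_extend]).

    The surjectivity in degree d - p says that each face of the shifted complex satisfies [Kgood], a
    condition on subsets of the vertex set in which no field occurs. Conversely, the complex [gale]
    given by Gale's evenness condition is itself strongly edge decomposable ([gale_sed]) and
    contains all sets of at most d/2 vertices. For it the standard monomials are known exactly in
    the relevant degrees, so every [Kgood] set belongs to its symmetric shifting ([good_sym_shift]).
    As [gale] lies in the boundary of the cyclic polytope ([gale_cyclic]) and symmetric shifting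
    preserves inclusions ([sym_shift_mono]), the inclusion follows. *)

Definition subspace (K : fieldType) (V : lmodType K) (S : V -> Prop) : Prop :=
  S 0 /\ forall a u v, S u -> S v -> S (a *: u + v).

(** * Subspaces as predicates, and vectors depending polynomially on a parameter *)

Section Subspace.
Variables (K : fieldType) (V : lmodType K) (S : V -> Prop).
Hypothesis subS : subspace S.

Lemma subspaceD u v : S u -> S v -> S (u + v).
Proof. by case: subS => _ SD Su Sv; rewrite -[u]scale1r; apply: SD. Qed.

Lemma subspaceZ a u : S u -> S (a *: u).
Proof. by case: subS => S0 SD Su; rewrite -[_ *: _]addr0; apply: SD. Qed.

Lemma subspaceB u v : S u -> S v -> S (u - v).
Proof. by move=> Su Sv; apply: subspaceD => //; rewrite -scaleN1r; apply: subspaceZ. Qed.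

Lemma subspace_sum (I : Type) (r : seq I) (P : pred I) (F : I -> V) :
  (forall i, P i -> S (F i)) -> S (\sum_(i <- r | P i) F i).
Proof.
move=> SF; apply: (big_ind S) => //; first by case: subS.
exact: subspaceD.
Qed.

End Subspace.

Section PolyClass.
Variables (K : fieldType) (X : Type) (P : (X -> K) -> Prop).

(** Abstracts over the two kinds of parameter: a point of a line ([polyline]) and the entries of a
    matrix ([polymx]). The openness lemmas serve both. *)
Record poly_class : Prop := PolyClass {
  pc_ext : forall f g, f =1 g -> P f -> P g;
  pc_const : forall c, P (fun=> c);
  pc_add : forall f g, P f -> P g -> P (fun x => f x + g x);
  pc_mul : forall f g, P f -> P g -> P (fun x => f x * g x) }.

Hypothesis PC : poly_class.

Lemma pc_sum (I : Type) (r : seq I) (Q : pred I) (F : I -> X -> K) :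
  (forall i, Q i -> P (F i)) -> P (fun x => \sum_(i <- r | Q i) F i x).
Proof.
move=> PF; elim: r => [|i r IHr].
  by apply: pc_ext (pc_const PC 0) => // x; rewrite big_nil.
case Qi: (Q i); last by apply: pc_ext IHr => // x; rewrite big_cons Qi.
apply: pc_ext (pc_add PC (PF i Qi) IHr) => // x.
by rewrite big_cons Qi.
Qed.

Lemma pc_prod (I : Type) (r : seq I) (Q : pred I) (F : I -> X -> K) :
  (forall i, Q i -> P (F i)) -> P (fun x => \prod_(i <- r | Q i) F i x).
Proof.
move=> PF; elim: r => [|i r IHr].
  by apply: pc_ext (pc_const PC 1) => // x; rewrite big_nil.
case Qi: (Q i); last by apply: pc_ext IHr => // x; rewrite big_cons Qi.
apply: pc_ext (pc_mul PC (PF i Qi) IHr) => // x.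
by rewrite big_cons Qi.
Qed.

Lemma pc_det m (A : X -> 'M[K]_m) :
  (forall i j, P (fun x => A x i j)) -> P (fun x => \det (A x)).
Proof.
move=> PA; apply: pc_sum => s _; apply: pc_mul => //; first exact: pc_const.
by apply: pc_prod => i _.
Qed.

(* If the vectors [v x i] of [U x] depend polynomially on [x] and form a basis
   at [x0], then they form a basis wherever their determinant does not vanish. *)
Lemma open_span (V : lmodType K) (I : finType) (b : I -> V)
    (U : X -> V -> Prop) (c : I -> I -> X -> K) (x0 : X) :
  (forall x, subspace (U x)) -> (forall i j, P (c i j)) ->
  (forall x i, U x (\sum_j c i j x *: b j)) ->
  (forall i j, c i j x0 = (i == j)%:R) ->
  exists2 q, P q & q x0 != 0 /\ forall x, q x != 0 -> forall i, U x (b i).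
Proof.
move=> subU Pc Uc c0; pose A x := \matrix_(i, j < #|I|) c (enum_val i) (enum_val j) x.
exists (fun x => \det (A x)).
  by apply: pc_det => i j; apply: pc_ext (Pc (enum_val i) (enum_val j)) => // x; rewrite mxE.
split=> [|x qx i].
  suff -> : A x0 = 1%:M by rewrite det1 oner_eq0.
  by apply/matrixP=> i j; rewrite !mxE c0 (inj_eq enum_val_inj).
have Au : A x \in unitmx by rewrite unitmxE unitfE.
have -> : b i = \sum_(k < #|I|) (invmx (A x)) (enum_rank i) k *:
                  \sum_j c (enum_val k) j x *: b j.
  under eq_bigr => k _ do rewrite scaler_sumr.
  have inv_row j : \sum_(k < #|I|) invmx (A x) (enum_rank i) k * c (enum_val k) j x
      = (i == j)%:R.
    have := congr1 (fun M : 'M_#|I| => M (enum_rank i) (enum_rank j)) (mulVmx Au).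
    rewrite !mxE (inj_eq enum_rank_inj) => <-.
    by apply: eq_bigr => k _; rewrite mxE enum_rankK.
  rewrite exchange_big /=.
  under eq_bigr => j _ do
    (under eq_bigr => k _ do rewrite scalerA; rewrite -scaler_suml inv_row).
  rewrite (bigD1 i) //= eqxx scale1r big1 ?addr0 // => j.
  by rewrite eq_sym => /negbTE->; rewrite scale0r.
apply: subspace_sum => // k _; apply: subspaceZ => //.
Qed.

End PolyClass.

(** The consequence of infinitude by which two nonempty open conditions meet. It is derived from the
    two hypotheses on the field in [infinite_field_char0] and [infinite_field_set]. *)
Definition infinite_field (K : fieldType) : Prop :=
  forall q : {poly K}, q != 0 -> exists t, q.[t] != 0.

Definition polyline (K : fieldType) (f : K -> K) : Prop :=
  exists q : {poly K}, forall t, f t = q.[t].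

Lemma polyline_class (K : fieldType) : poly_class (@polyline K).
Proof.
split.
- by move=> f g fg [q fq]; exists q => t; rewrite -fg.
- by move=> c; exists c%:P => t; rewrite hornerC.
- by move=> f g [p fp] [q gq]; exists (p + q) => t; rewrite hornerD fp gq.
- by move=> f g [p fp] [q gq]; exists (p * q) => t; rewrite hornerM fp gq.
Qed.

Lemma polyline_id (K : fieldType) : polyline (fun t : K => t).
Proof. by exists 'X => t; rewrite hornerX. Qed.

Lemma polyline_common (K : fieldType) (f g : K -> K) t0 t1 : infinite_field K ->
  polyline f -> polyline g -> f t0 != 0 -> g t1 != 0 ->
  exists t, f t != 0 /\ g t != 0.
Proof.
move=> Kinf [p fp] [q gq]; rewrite fp gq => p0 q0.
have pq0 : p * q != 0.
  rewrite mulf_neq0 //.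
    by apply: contraNneq p0 => ->; rewrite horner0.
  by apply: contraNneq q0 => ->; rewrite horner0.
have [t] := Kinf _ pq0; rewrite hornerM mulf_eq0 negb_or => /andP[pt qt].
by exists t; rewrite fp gq.
Qed.

Definition polymx (K : fieldType) n (f : 'M[K]_n -> K) : Prop :=
  exists p : {mpoly K[n * n]}, forall A, f A = p.@[fun k => mxvec A 0 k].

Lemma polymx_class (K : fieldType) n : poly_class (@polymx K n).
Proof.
split.
- by move=> f g fg [q fq]; exists q => t; rewrite -fg.
- by move=> c; exists c%:MP => t; rewrite mevalC.
- by move=> f g [p fp] [q gq]; exists (p + q) => t; rewrite mevalD fp gq.
- by move=> f g [p fp] [q gq]; exists (p * q) => t; rewrite mevalM fp gq.
Qed.

Lemma polymx_entry (K : fieldType) n i j : polymx (fun A : 'M[K]_n => A i j).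
Proof. by exists 'X_(mxvec_index i j) => A; rewrite mevalXU mxvecE. Qed.

Lemma polymx_det (K : fieldType) n : polymx (fun A : 'M[K]_n => \det A).
Proof. by apply: (pc_det (@polymx_class K n)) => i j; exact: polymx_entry. Qed.

Lemma polymx_line (K : fieldType) n (f : 'M[K]_n -> K) (A B : 'M[K]_n) :
  polymx f -> polyline (fun t => f (A + t *: (B - A))).
Proof.
case=> p fp.
have PC := polyline_class K.
apply: (pc_ext PC (f := fun t => \sum_(m <- msupp p) p@_m *
    \prod_i (mxvec A 0 i + t * mxvec (B - A) 0 i) ^+ m i)) => [t|].
  rewrite fp mevalE; apply: eq_bigr => m _; congr (_ * _).
  apply: eq_bigr => i _; congr (_ ^+ _).
  by case/mxvec_indexP: i => i j; rewrite !mxvecE !mxE.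
apply: (pc_sum PC) => m _; apply: (pc_mul PC); first exact: (pc_const PC).
apply: (pc_prod PC) => i _; elim: (m i) => [|k IHk].
  by apply: (pc_ext PC (f := fun=> 1)) (pc_const PC 1) => t; rewrite expr0.
apply: (pc_ext PC (f := fun t => (mxvec A 0 i + t * mxvec (B - A) 0 i) *
   (mxvec A 0 i + t * mxvec (B - A) 0 i) ^+ k)) => [t|]; first by rewrite exprS.
apply: (pc_mul PC) => //; apply: (pc_add PC); first exact: (pc_const PC).
apply: (pc_mul PC); [exact: polyline_id | exact: (pc_const PC)].
Qed.

(** On the line joining [A] to [B] both functions become nonzero polynomials in one variable. *)
Lemma polymx_common (K : fieldType) n (f g : 'M[K]_n -> K) A B : infinite_field K ->
  polymx f -> polymx g -> f A != 0 -> g B != 0 ->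
  exists C, f C != 0 /\ g C != 0.
Proof.
move=> Kinf Pf Pg fA gB.
have fA' : f (A + 0 *: (B - A)) != 0 by rewrite scale0r addr0.
have gB' : g (A + 1 *: (B - A)) != 0 by rewrite scale1r subrKC.
have [t [ft gt]] := polyline_common Kinf (polymx_line A B Pf) (polymx_line A B Pg) fA' gB'.
by exists (A + t *: (B - A)).
Qed.

(** * Spans, standard indices and their behaviour for generic matrices *)

Section Lines.
Variables (K : fieldType) (vT : vectType K) (J : finType).

Definition lspan (P : pred J) (f : J -> vT) : {vspace vT} := (\sum_(a | P a) <[f a]>)%VS.

Lemma lspanP (P : pred J) (f : J -> vT) v :
  reflect (exists c : J -> K, v = \sum_(a | P a) c a *: f a) (v \in lspan P f).
Proof.
apply: (iffP memv_sumP) => [[vs vsP ->]|[c ->]].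
  have /fin_all_exists[c cP] a : exists k, P a -> vs a = k *: f a.
    case Pa: (P a); last by exists 0.
    by have /vlineP[k] := vsP a Pa; exists k.
  by exists c; apply: eq_bigr => a; exact: cP.
by exists (fun a => c a *: f a) => // a _; rewrite memvZ ?memv_line.
Qed.

Lemma mem_lspan (P : pred J) (f : J -> vT) a : P a -> f a \in lspan P f.
Proof.
move=> Pa; apply/lspanP; exists (fun b => (b == a)%:R).
rewrite (bigD1 a) //= eqxx scale1r big1 ?addr0 // => b /andP[_ /negbTE->].
by rewrite scale0r.
Qed.

Lemma dim_lspan (P : pred J) (f : J -> vT) : (\dim (lspan P f) <= #|P|)%N.
Proof.
apply: leq_trans (dimv_leq_sum _ _ _) _; rewrite -sum1_card.
by apply: leq_sum => a _; rewrite dim_vline; case: (_ != 0).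
Qed.

End Lines.

Lemma dimv_add_line (K : fieldType) (vT : vectType K) (V : {vspace vT}) v :
  \dim (V + <[v]>) = ((v \notin V) + \dim V)%N.
Proof.
have [vV|nV] := boolP (v \in V).
  by rewrite (addv_idPl _).
have dis : (V :&: <[v]> = 0)%VS.
  apply/eqP; rewrite -subv0; apply/subvP=> u /memv_capP[uV /vlineP[k defu]].
  rewrite memv0; apply: contraR nV => u0; have k0 : k != 0.
    by apply: contra u0 => /eqP k0; rewrite defu k0 scale0r.
  by rewrite -[v]scale1r -(mulVf k0) -scalerA -defu memvZ.
rewrite dimv_disjoint_sum // dim_vline addnC.
by case: eqP nV => // ->; rewrite mem0v.
Qed.

Section GenericInitial.
Variables (K : fieldType) (I : finType).
Local Notation W := {ffun I -> K^o}.

Definition delta (i : I) : W := [ffun j => (j == i)%:R].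

Lemma sum_delta (v : W) : v = \sum_i v i *: delta i.
Proof.
apply/ffunP=> j; rewrite sum_ffunE (bigD1 j) //= big1 ?addr0.
  by rewrite !ffunE eqxx; rewrite /GRing.scale /= mulr1.
by move=> i ij; rewrite !ffunE eq_sym (negbTE ij) /GRing.scale /= mulr0.
Qed.

Lemma delta_fullv (V : {vspace W}) : (forall i, delta i \in V) -> (V = fullv)%VS.
Proof.
move=> dV; apply/vspaceP=> v; rewrite memvf [v]sum_delta.
by apply: memv_suml => i _; rewrite memvZ.
Qed.

Lemma dim_W : \dim {: W} = #|I|.
Proof. by rewrite dimvf /dim /= muln1. Qed.

(** Lower semicontinuity of the dimension of a span. *)
Lemma open_dim (X : Type) (P : (X -> K) -> Prop) (J : finType) (w : J -> X -> W) x0 :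
  poly_class P -> (forall a i, P (fun x => w a x i)) ->
  exists2 q, P q & q x0 != 0 /\ forall x, q x != 0 ->
    (\dim (lspan predT (w^~ x0)) <= \dim (lspan predT (w^~ x)))%N.
Proof.
move=> PC Pw; set D := lspan predT (w^~ x0).
(* A fixed complement of the span at [x0] is added, so that the claim becomes the persistence of a
   basis of the whole space. *)
have /fin_all_exists[c cP] i : exists c : (J -> K) * W, c.2 \in (D^C)%VS /\
    delta i = \sum_a c.1 a *: w a x0 + c.2.
  have : delta i \in (D + D^C)%VS by rewrite addv_complf memvf.
  case/memv_addP=> u uD [u' u'D ->]; have /lspanP[c ->] := uD.
  by exists (c, u').
pose u i x : W := \sum_a (c i).1 a *: w a x + (c i).2.
have [|i j|x i||q Pq [q0 qP]] := @open_span K X P PC W I delta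
   (fun x v => v \in (lspan predT (w^~ x) + D^C)%VS) (fun i j x => u i x j) x0.
- by move=> x; split=> [|a v v' vU v'U]; rewrite ?mem0v // memvD // memvZ.
- apply: (pc_ext PC (f := fun x => \sum_a (c i).1 a * w a x j + (c i).2 j)).
    move=> x; rewrite !ffunE sum_ffunE; congr (_ + _).
    by apply: eq_bigr => a _; rewrite ffunE.
  apply: (pc_add PC); last exact: (pc_const PC).
  apply: (pc_sum PC) => a _; apply: (pc_mul PC) => //; exact: (pc_const PC).
- rewrite -[\sum_j _]sum_delta memv_add //; last by have [] := cP i.
  by apply/lspanP; exists (c i).1.
- by move=> i j; rewrite /u -(proj2 (cP i)) ffunE eq_sym.
exists q => //; split=> // x /qP/delta_fullv full.
have := dimv_add_leqif (lspan predT (w^~ x)) D^C; rewrite full => /leqifP.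
rewrite dim_W => le; have : (#|I| <= \dim (lspan predT (w^~ x)) + \dim D^C)%N.
  by case: ifP le => _ => [/eqP->|/ltnW].
rewrite dimv_compl dim_W; have : (\dim D <= #|I|)%N by rewrite -dim_W dimvS ?subvf.
by lia.
Qed.

Definition seg (Q : {set I}) : {vspace W} := lspan (mem Q) delta.

Lemma delta_seg (Q : {set I}) i : i \in Q -> delta i \in seg Q.
Proof. exact: mem_lspan. Qed.

Lemma seg_sub (Q : {set I}) (V : {vspace W}) :
  (forall i, i \in Q -> delta i \in V) -> (seg Q <= V)%VS.
Proof. by move=> QV; apply/subv_sumP => i iQ; apply: QV. Qed.

Lemma seg_setU1 (Q : {set I}) i : seg (i |: Q) = (seg Q + <[delta i]>)%VS.
Proof.
apply/eqP; rewrite eqEsubv; apply/andP; split.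
  apply: seg_sub => j; rewrite !inE => /orP[/eqP->|jQ].
    by apply: (subvP (addvSr _ _)); exact: memv_line.
  by apply: (subvP (addvSl _ _)); exact: delta_seg.
rewrite subv_add; apply/andP; split.
  by apply: seg_sub => j jQ; rewrite delta_seg // !inE jQ orbT.
by rewrite -memvE delta_seg // !inE eqxx.
Qed.

Variable lt : rel I.
Hypotheses (lt_irr : irreflexive lt) (lt_trans : transitive lt)
  (lt_total : forall i j, i != j -> lt i j || lt j i).

Definition lower (i : I) : {set I} := [set j | lt j i].

Definition down_closed (Q : {set I}) : Prop := forall i j, lt i j -> j \in Q -> i \in Q.

(** [~~ std U i] means that [i] is the largest index in the support of some vector of [U], that is,
    an initial monomial of [U]. *)
Definition std (U : {vspace W}) i : bool := delta i \notin (U + seg (lower i))%VS.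

Lemma min_notin (Q : {set I}) : Q != [set: I] ->
  exists2 i, i \notin Q & forall j, lt j i -> j \in Q.
Proof.
move=> QT; have [i0 i0Q] : exists i, i \notin Q.
  apply/existsP; apply: contraNT QT; rewrite negb_exists => /forallP h.
  by apply/eqP/setP=> i; rewrite inE; apply: negbNE; apply: h.
case: (@arg_minnP _ i0 (fun i => i \notin Q) (fun i => #|lower i|) i0Q) => i iQ imin.
exists i => // j ji; apply: contraT => /imin; rewrite leqNgt proper_card //.
apply/properP; split; first by apply/subsetP=> k; rewrite !inE => /lt_trans; apply.
by exists j; rewrite !inE ?lt_irr.
Qed.

(* Each standard monomial raises by one the dimension of [U] plus the segment
   of the monomials below it. *)
Lemma card_std (U : {vspace W}) (Q : {set I}) : down_closed Q ->
  (#|[set i | (i \notin Q) && std U i]| + \dim (U + seg Q))%N = #|I|.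
Proof.
move: {2}_.+1 (ltnSn #|~: Q|) => N; elim: N Q => // N IHN Q le_QN downQ.
have [->|QT] := eqVneq Q [set: I].
  rewrite (_ : [set _ | _] = set0) ?cards0; last by apply/setP=> i; rewrite !inE.
  by rewrite (@delta_fullv (U + _)%VS) ?dim_W // => i; apply: (subvP (addvSr _ _)); rewrite delta_seg ?inE.
have [i iQ ltiQ] := min_notin QT.
have lowQ : lower i = Q.
  apply/setP=> j; rewrite inE; apply/idP/idP => [/ltiQ//|jQ].
  have /lt_total/orP[ij|//] : i != j by apply: contraNneq iQ => ->.
  by rewrite (downQ _ _ ij jQ) in iQ.
have downQ1 : down_closed (i |: Q).
  move=> j k jk; rewrite !inE => /orP[/eqP ki|/(downQ _ _ jk)->]; last by rewrite orbT.
  by rewrite ltiQ ?orbT // -ki.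
have ltN : (#|~: (i |: Q)| < N)%N.
  rewrite -ltnS; apply: leq_trans le_QN; rewrite ltnS; apply: proper_card.
  apply/properP; split; first by rewrite setCS subsetUr.
  by exists i; rewrite !inE ?eqxx.
rewrite -(IHN _ ltN downQ1) seg_setU1 addvA dimv_add_line addnA; congr (_ + _)%N.
rewrite -lowQ -/(std U i) lowQ (cardsD1 i) inE iQ /= addnC; congr (_ + _)%N.
by apply: eq_card => j; rewrite !inE negb_or andbA.
Qed.

(** The passage from spanning to counting: if [V] completes [U] and the monomials of an initial
    segment to the whole space, it has room for every standard monomial outside the segment. *)
Lemma card_std_lower (U : {vspace W}) (Q : {set I}) (V : {vspace W}) h :
  down_closed Q -> (U + seg Q + V = fullv)%VS -> (\dim V <= h)%N ->
  (#|[set i | (i \notin Q) && std U i]| <= h)%N.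
Proof.
move=> downQ full leV; have := card_std U downQ.
have := dimv_add_leqif (U + seg Q) V; rewrite full => /leqifP.
rewrite dim_W => le; have : (#|I| <= \dim (U + seg Q) + \dim V)%N.
  by case: ifP le => _ => [/eqP->|/ltnW].
by lia.
Qed.

(** Stability of a generic initial space under a one-parameter group whose action on monomials is
    [w]. If [m'] were standard, the line of [delta m'] could be split off from [U] and all smaller
    monomials; stretching the vectors [w i t] along it then gives at [t = 0] a space containing [U],
    all [delta i] with [i] up to [m], and [delta m']. By semicontinuity this dimension would persist
    for some [t != 0], against the bound on dimensions. *)
Lemma std_shift (U : {vspace W}) (m m' : I) (w w1 : I -> K -> W) (c : K) :
    infinite_field K ->
    (forall i j, polyline (fun t => w1 i t j)) ->
    (forall i t, w i t = delta i + t *: w1 i t) ->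
    (forall i, lt i m -> w1 i 0 \in seg (lower m')) ->
    w1 m 0 - c *: delta m' \in seg (lower m') -> c != 0 -> lt m m' ->
    (forall t, (\dim (U + lspan (mem (m |: lower m)) (w^~ t)) <=
                \dim (U + seg (m |: lower m)))%N) ->
  ~~ std U m -> ~~ std U m'.
Proof.
move=> Kinf Pw1 wE w1lt w1m c0 mm' led; rewrite /std !negbK => mU.
set Q := m |: lower m in led; set Y := (U + seg (lower m'))%VS.
apply: contraT => m'Y.
pose pi := daddv_pi <[delta m']>%VS Y.
have dis : (<[delta m']> :&: Y = 0)%VS.
  apply/eqP; rewrite -subv0; apply/subvP=> u /memv_capP[/vlineP[k ->] uY].
  rewrite memv0; have [->|k0] := eqVneq k 0; first by rewrite scale0r.
  case/negP: m'Y; rewrite -[delta m']scale1r -(mulVf k0) -scalerA memvZ //.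
have pi_id : pi (delta m') = delta m' by rewrite daddv_pi_id ?memv_line.
have pi_Y y : y \in Y -> pi y = 0.
  move=> yY; have := @daddv_pi_add _ _ _ _ y dis (subvP (addvSr _ _) _ yY).
  rewrite (daddv_pi_id (U := Y)) //; last by rewrite capvC.
  by move/(canRL (addrK _)); rewrite subrr.
have segY y : y \in seg (lower m') -> y \in Y by apply: (subvP (addvSr _ _)).
have QY i : i \in Q -> delta i \in Y.
  move=> iQ; apply/segY/delta_seg; move: iQ; rewrite !inE => /orP[/eqP->//|].
  by move/lt_trans; apply.
(* At [t = 0] this is [delta i + pi (w1 i 0)], which equals [delta i] below [m] and
   [delta m + c *: delta m'] at [m]. For [t != 0] it is the image of [w i t] under the map [T]
   below. *)
pose g i t : W := w i t + (1 - t) *: pi (w1 i t).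
pose f (a : I + 'I_(\dim U)) t : W :=
  match a with inl i => if i \in Q then g i t else 0 | inr k => (vbasis U)`_k end.
have fE t : lspan predT (f^~ t) = (lspan (mem Q) (g^~ t) + U)%VS.
  rewrite /lspan big_sumType /=; congr (_ + _)%VS.
    rewrite [RHS]big_mkcond /=; apply: eq_bigr => i _.
    by rewrite (fun_if (fun v : W => <[v]>%VS)).
  rewrite -[RHS](span_basis (vbasisP U)) span_def [RHS](big_nth 0) big_mkord.
  by rewrite size_tuple.
have Pg i j : polyline (fun t => g i t j).
  have PC := polyline_class K.
  apply: (pc_ext PC (f := fun t => (delta i j + t * w1 i t j) +
      (1 + (-1) * t) * \sum_k w1 i t k * pi (delta k) j)).
    move=> t; have -> : \sum_k w1 i t k * pi (delta k) j = pi (w1 i t) j.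
      rewrite {2}[w1 i t]sum_delta linear_sum sum_ffunE.
      by apply: eq_bigr => k _; rewrite linearZ ffunE.
    by rewrite /g wE mulN1r !ffunE.
  apply: (pc_add PC).
    apply: (pc_add PC); first exact: (pc_const PC).
    by apply: (pc_mul PC) => //; exact: polyline_id.
  apply: (pc_mul PC).
    apply: (pc_add PC); first exact: (pc_const PC).
    by apply: (pc_mul PC); [exact: (pc_const PC) | exact: polyline_id].
  by apply: (pc_sum PC) => k _; apply: (pc_mul PC) => //; exact: (pc_const PC).
have Pf a j : polyline (fun t => f a t j).
  have PC := polyline_class K.
  case: a => [i|k] /=; last exact: (pc_const PC).
  by case: (i \in Q) => //; exact: (pc_const PC).
have [q Pq [q0 qP]] := @open_dim K (@polyline K) _ f 0 (polyline_class K) Pf.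
have [t [qt t0]] := polyline_common Kinf Pq (polyline_id K) q0 (oner_neq0 K).
have := qP t qt; rewrite !fE => le0t.
have le0 : (\dim (U + seg Q + <[delta m']>) <= \dim (lspan (mem Q) (g^~ 0%R) + U))%N.
  have gE i : g i 0 = delta i + pi (w1 i 0) by rewrite /g wE scale0r addr0 subr0 scale1r.
  have inG i : i \in Q -> g i 0 \in (lspan (mem Q) (g^~ 0%R) + U)%VS.
    by move=> iQ; apply: (subvP (addvSl _ _)); apply: (@mem_lspan _ _ _ _ (g^~ 0%R)).
  have low : (U + seg (lower m) <= lspan (mem Q) (g^~ 0%R) + U)%VS.
    rewrite subv_add addvSr; apply: seg_sub => i; rewrite inE => im.
    rewrite (_ : delta i = g i 0); first by rewrite inG // !inE im orbT.
    by rewrite gE pi_Y ?addr0 // segY // w1lt.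
  have mG : delta m \in (lspan (mem Q) (g^~ 0%R) + U)%VS by apply: (subvP low).
  apply: dimvS; rewrite !subv_add addvSr /=; apply/andP; split.
    apply: seg_sub => i; rewrite !inE => /orP[/eqP->//|im].
    by apply: (subvP low); apply: (subvP (addvSr _ _)); rewrite delta_seg ?inE.
  rewrite -memvE -[delta m']scale1r -(mulVf c0) -scalerA memvZ //.
  have -> : c *: delta m' = g m 0 - delta m.
    rewrite gE addrC addKr; apply/esym.
    have : pi (w1 m 0 - c *: delta m') = 0 by rewrite pi_Y ?segY.
    by rewrite linearB linearZ => /subr0_eq->; congr (_ *: _).
  by rewrite memvB // inG // !inE eqxx.
have let0 : (\dim (lspan (mem Q) (g^~ t) + U) <= \dim (U + seg Q))%N.
  pose T := (\1 + ((1 - t) / t) *: pi)%VF.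
  have TE v : T v = v + ((1 - t) / t) *: pi v.
    by rewrite add_lfunE scale_lfunE id_lfunE.
  apply: leq_trans (led t).
  apply: (@leq_trans (\dim (T @: (U + lspan (mem Q) (w^~ t))))); last first.
    by rewrite -(limg_ker_dim T (U + _)) leq_addl.
  apply: dimvS; rewrite subv_add; apply/andP; split.
    apply/subv_sumP=> i iQ; rewrite -memvE.
    rewrite (_ : g i t = T (w i t)).
      by apply: memv_img; apply: (subvP (addvSr _ _)); apply: (@mem_lspan _ _ _ _ (w^~ t)).
    rewrite TE /g; congr (_ + _).
    by rewrite wE linearD linearZ /= (pi_Y _ (QY _ iQ)) add0r scalerA divfK.
  apply/subvP=> u uU; rewrite (_ : u = T u).
    by apply: memv_img; apply: (subvP (addvSl _ _)).
  by rewrite TE pi_Y ?scaler0 ?addr0 //; apply: (subvP (addvSl _ _)).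
have : (\dim (U + seg Q + <[delta m']>) <= \dim (U + seg Q))%N.
  by apply: leq_trans le0 (leq_trans le0t let0).
rewrite dimv_add_line (_ : delta m' \notin _) ?ltnn //.
apply: contra m'Y; apply/subvP; rewrite subv_add addvSl /=.
by apply: seg_sub.
Qed.

Section Generic.
Variables (n : nat) (J : finType) (g : J -> 'M[K]_n -> W).
Hypotheses (Kinf : infinite_field K) (Pg : forall a i, polymx (fun A => g a A i)).

Definition gspan A : {vspace W} := lspan predT (g^~ A).

Lemma open_dim_seg A0 (Q : {set I}) : exists2 q, polymx q &
  q A0 != 0 /\ forall A, q A != 0 ->
    (\dim (gspan A0 + seg Q) <= \dim (gspan A + seg Q))%N.
Proof.
pose w (a : J + I) (A : 'M[K]_n) : W :=
  match a with inl a => g a A | inr i => if i \in Q then delta i else 0 end.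
have defU A : (gspan A + seg Q)%VS = lspan predT (w^~ A).
  rewrite /lspan big_sumType /=; congr (_ + _)%VS.
  rewrite /seg /lspan big_mkcond /=; apply: eq_bigr => i _.
  by rewrite (fun_if (fun v : W => <[v]>%VS)).
have [||q Pq [q0 qP]] := @open_dim 'M[K]_n (@polymx K n) _ w A0.
- exact: polymx_class.
- case=> [a|j] i; [exact: Pg | exact: (pc_const (@polymx_class K n))].
by exists q => //; split=> // A /qP; rewrite !defU.
Qed.

(* [A0] maximises the sum of the dimensions of all [gspan A + seg Q]. *)
Lemma generic_initial : exists A0 : 'M[K]_n, [/\ A0 \in unitmx,
    forall A (Q : {set I}), A \in unitmx ->
      (\dim (gspan A + seg Q) <= \dim (gspan A0 + seg Q))%N
  & exists2 q, polymx q & q A0 != 0 /\ forall A, A \in unitmx -> q A != 0 ->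
      forall i, std (gspan A) i = std (gspan A0) i].
Proof.
pose D A := (\sum_(Q : {set I}) \dim (gspan A + seg Q))%N.
have Dbound A : (D A <= \sum_(Q : {set I}) #|I|)%N.
  by apply: leq_sum => Q _; rewrite -dim_W dimvS ?subvf.
have [A0 A0u A0max] : exists2 A0, A0 \in unitmx &
    forall A, A \in unitmx -> (D A <= D A0)%N.
  pose R k := `[< exists2 A, A \in unitmx & D A = k >].
  have exR : exists k, R k.
    by exists (D 1%:M); apply/asboolP; exists 1%:M => //; exact: unitmx1.
  have ubR k : R k -> (k <= \sum_(Q : {set I}) #|I|)%N.
    by move/asboolP=> [A _ <-].
  case: (ex_maxnP exR ubR) => k /asboolP[A0 A0u <-] kmax; exists A0 => // A Au.
  by apply: kmax; apply/asboolP; exists A.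
have /fin_all_exists[q qP] Q : exists q, polymx q /\ (q A0 != 0 /\ forall A, q A != 0 ->
    (\dim (gspan A0 + seg Q) <= \dim (gspan A + seg Q))%N).
  by have [q Pq qP] := open_dim_seg A0 Q; exists q.
pose p A := \prod_Q q Q A.
have Pp : polymx p by apply: (pc_prod (@polymx_class K n)) => Q _; case: (qP Q).
have p0 : p A0 != 0 by apply/prodf_neq0 => Q _; case: (qP Q) => _ [].
have pP A : A \in unitmx -> p A != 0 -> forall Q,
    \dim (gspan A + seg Q) = \dim (gspan A0 + seg Q).
  move=> Au /prodf_neq0 pA Q; have leQ Q' : (\dim (gspan A0 + seg Q') <= \dim (gspan A + seg Q'))%N.
    by have [_ [_]] := qP Q'; apply; apply: pA.
  (* Termwise inequalities against a maximal sum are equalities. *)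
  have := leqif_sum (fun Q' (_ : true) => leqif_eq (leQ Q')).
  case=> le0; rewrite eqn_leq le0 (A0max A Au) => /esym/forall_inP/(_ Q isT)/eqP.
  by [].
exists A0; split=> //.
  move=> A Q Au; have [q1 Pq1 [q1A q1P]] := open_dim_seg A Q.
  have PC := @polymx_class K n.
  (* At [B] the dimensions agree with those at [A0], and the one for [Q] is at least its value at
     [A]. *)
  have [|B] := polymx_common Kinf (pc_mul PC Pp (@polymx_det K n)) Pq1 _ q1A (A := A0).
    by rewrite mulf_neq0 // -unitfE -unitmxE.
  case; rewrite mulf_eq0 negb_or => /andP[pB detB] /q1P.
  by rewrite (pP B) // unitmxE unitfE.
exists p => //; split=> // A Au pA i; rewrite /std.
have /eqP := pP A Au pA (i |: lower i).
rewrite seg_setU1 !addvA !dimv_add_line pP // eqn_add2r.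
by case: (_ \notin _); case: (_ \notin _).
Qed.

(** Two nonempty open sets of matrices meet, so a property equivalent to non-standardness at each
    invertible matrix holds generically exactly when it holds at the single matrix [A0]. This
    removes the quantification over open sets from the generic initial ideals. *)
Lemma generic_std : exists A0 : 'M[K]_n, [/\ A0 \in unitmx,
    forall A (Q : {set I}), A \in unitmx ->
      (\dim (gspan A + seg Q) <= \dim (gspan A0 + seg Q))%N
  & forall i (P : 'M[K]_n -> Prop),
      (forall A, A \in unitmx -> P A <-> ~~ std (gspan A) i) ->
      generically P <-> ~~ std (gspan A0) i].
Proof.
have [A0 [A0u A0max [q [qp qE] [q0 qP]]]] := generic_initial.
have Pq : polymx q by exists qp.
exists A0; split=> // i P Pstd; split=> [[p [[A1 [A1u p1]] Pgen]]|nstd].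
  have Pp : polymx (fun A : 'M[K]_n => p.@[fun k => mxvec A 0 k]) by exists p.
  have PC := @polymx_class K n.
  have [||C] := polymx_common Kinf (pc_mul PC Pq (@polymx_det K n))
      (pc_mul PC Pp (@polymx_det K n)) _ _ (A := A0) (B := A1).
  - by apply: mulf_neq0 => //; rewrite -unitfE -unitmxE.
  - by apply: mulf_neq0 => //; rewrite -unitfE -unitmxE.
  rewrite !mulf_eq0 !negb_or => -[/andP[qC dC] /andP[pC _]].
  have Cu : C \in unitmx by rewrite unitmxE unitfE.
  by rewrite -(qP C) // -Pstd //; apply: Pgen.
exists qp; split; first by exists A0; rewrite -qE.
move=> A [Au]; rewrite -qE => qA.
by apply/Pstd => //; rewrite qP.
Qed.

End Generic.
End GenericInitial.

(** * Exterior algebra: sorted bases and algebra maps *)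

Lemma enum_sorted n (G : {set 'I_n}) : sorted (fun i j : 'I_n => i < j)%N (enum G).
Proof.
rewrite /enum_mem; apply: sorted_filter; first by move=> i j k; exact: ltn_trans.
have : sorted ltn (map val (enum 'I_n)) by rewrite val_enum_ord iota_ltn_sorted.
by rewrite sorted_map enumT.
Qed.

Lemma sorted_ord_eq n (s1 s2 : seq 'I_n) :
  sorted (fun i j : 'I_n => i < j)%N s1 -> sorted (fun i j : 'I_n => i < j)%N s2 ->
  s1 =i s2 -> s1 = s2.
Proof. by apply: irr_sorted_eq => [i j k|i]; [exact: ltn_trans | exact: ltnn]. Qed.

Lemma enum_split n (G : {set 'I_n}) (i : 'I_n) :
  enum G = enum [set j in G | (j < i)%N] ++ enum [set j in G | (i <= j)%N].
Proof.
apply: sorted_ord_eq; first exact: enum_sorted.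
  rewrite (sorted_pairwise (leT := fun i j : 'I_n => (i < j)%N)); last by move=> x y z; exact: ltn_trans.
  rewrite pairwise_cat -!(sorted_pairwise (leT := fun i j : 'I_n => (i < j)%N)) ?enum_sorted ?andbT;
    try by move=> x y z; exact: ltn_trans.
  apply/allrelP=> x y; rewrite !mem_enum !inE => /andP[_ xi] /andP[_].
  exact: leq_trans.
move=> j; rewrite mem_cat !mem_enum !inE.
by case: (j \in G) => //=; case: ltnP.
Qed.

Lemma enum_cons n (G : {set 'I_n}) (i : 'I_n) : (forall j, j \in G -> (i < j)%N) ->
  enum (i |: G) = i :: enum G.
Proof.
move=> ltG; apply: sorted_ord_eq; first exact: enum_sorted.
  rewrite /= path_min_sorted ?enum_sorted //.
  by apply/allP=> j; rewrite mem_enum => /ltG.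
by move=> j; rewrite !inE !mem_enum !inE.
Qed.

Section ExteriorAlgebra.
Variables (K : fieldType) (n : nat).
Local Notation E := (exterior K n).
Local Notation eb := (ext_basis K).
Implicit Types (F G H : {set 'I_n}) (f g : E).

Lemma ext_sumE f : f = \sum_F f F *: eb F.
Proof.
apply/ffunP=> F; rewrite sum_ffunE (bigD1 F) //= big1 ?addr0.
  by rewrite !ffunE eqxx /GRing.scale /= mulr1.
by move=> G GF; rewrite !ffunE eq_sym (negbTE GF) /GRing.scale /= mulr0.
Qed.

Lemma ext_mulE f g F : (f * g) F =
  \sum_(A : {set 'I_n} | A \subset F) (-1) ^+ inversions A (F :\: A) * (f A * g (F :\: A)).
Proof. by rewrite [LHS]ffunE. Qed.

Lemma ext_scaleE (a : K) f F : (a *: f) F = a * f F.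
Proof. by rewrite ffunE. Qed.

Lemma ext_addE f g F : (f + g) F = f F + g F.
Proof. by rewrite ffunE. Qed.

Lemma ext_oppE f F : (- f) F = - f F.
Proof. by rewrite ffunE. Qed.

Lemma ext_sum_apply (I : Type) (r : seq I) (P : pred I) (f : I -> E) F :
  (\sum_(i <- r | P i) f i) F = \sum_(i <- r | P i) f i F.
Proof. by rewrite sum_ffunE. Qed.

Definition ext_lin (v : 'I_n -> K) : E := \sum_j v j *: ext_gen K j.

Lemma ext_gen_lin i : ext_gen K i = ext_lin (fun j => (j == i)%:R).
Proof.
rewrite /ext_lin (bigD1 i) //= eqxx scale1r big1 ?addr0 // => j /negbTE->.
by rewrite scale0r.
Qed.

Lemma ext_genC (i j : 'I_n) : ext_gen K i * ext_gen K j = - (ext_gen K j * ext_gen K i).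
Proof.
rewrite /ext_gen !wedge_basis !disjoints1 !inE eq_sym.
have [->|ij] := eqVneq i j; first by rewrite /= oppr0.
rewrite /= setUC -scaleNr; congr (_ *: _).
have inv1 (x y : 'I_n) : inversions [set x] [set y] = (y < x)%N.
  rewrite /inversions; case: ltnP => [xy|yx] /=.
    rewrite (_ : [set _ | _] = [set (x, y)]) ?cards1 //.
    apply/setP=> -[a b]; rewrite !inE /= xpair_eqE.
    by case: (eqVneq a x) => [->|] //; case: (eqVneq b y) => [->|]; rewrite ?andbF ?xy.
  apply: eq_card0 => -[a b]; rewrite !inE /=.
  by apply/negP=> /and3P[/eqP-> /eqP->]; rewrite ltnNge yx.
by rewrite !inv1; case: ltngtP (ij) => [||/val_inj->]; rewrite ?eqxx // expr1 expr0 ?opprK.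
Qed.

Lemma ext_gen_sqr (i : 'I_n) : ext_gen K i * ext_gen K i = 0.
Proof. by rewrite /ext_gen wedge_basis disjoints1 inE eqxx. Qed.

Lemma ext_linC v w : ext_lin v * ext_lin w = - (ext_lin w * ext_lin v).
Proof.
rewrite /ext_lin !mulr_suml -sumrN.
under eq_bigr => i _ do rewrite mulr_sumr.
rewrite exchange_big /=; apply: eq_bigr => j _.
rewrite mulr_sumr -sumrN; apply: eq_bigr => i _.
rewrite -!scalerAl -!scalerAr !scalerA mulrC -scalerN; congr (_ *: _).
by rewrite ext_genC.
Qed.

Lemma ext_lin_sqr v : ext_lin v * ext_lin v = 0.
Proof.
rewrite /ext_lin; elim: (index_enum _) => [|i r IHr]; first by rewrite big_nil mul0r.
rewrite big_cons mulrDl !mulrDr IHr addr0 -scalerAl -scalerAr ext_gen_sqr !scaler0 add0r.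
apply/eqP; rewrite addr_eq0; apply/eqP.
rewrite -scalerAl mulr_sumr scaler_sumr mulr_suml -sumrN; apply: eq_bigr => j _.
rewrite -!scalerAl -!scalerAr !scalerA -scalerN mulrC; congr (_ *: _).
by rewrite ext_genC.
Qed.

Section Substitution.
Variable v : 'I_n -> E.
Hypotheses (vC : forall i j, v i * v j = - (v j * v i)) (v2 : forall i, v i * v i = 0).

(** The algebra map given by the universal property of the exterior algebra. Multiplicativity takes
    both [vC] and [v2], since in characteristic two anticommutation does not make squares vanish. *)
Definition ext_map f : E := \sum_F f F *: \prod_(i <- enum F) v i.

Lemma ext_map_is_linear : linear ext_map.
Proof.
move=> a f g; rewrite /ext_map scaler_sumr -big_split /=; apply: eq_bigr => F _.
by rewrite ext_addE ext_scaleE scalerDl scalerA.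
Qed.

HB.instance Definition _ := GRing.isLinear.Build K E E _ ext_map ext_map_is_linear.

Lemma ext_map_basis F : ext_map (eb F) = \prod_(i <- enum F) v i.
Proof.
rewrite /ext_map (bigD1 F) //= ffunE eqxx scale1r [X in _ + X]big1 ?addr0 // => G GF.
by rewrite ffunE (negbTE GF) scale0r.
Qed.

Lemma ext_map_gen i : ext_map (ext_gen K i) = v i.
Proof. by rewrite ext_map_basis enum_set1 big_seq1. Qed.

Lemma ext_map1 : ext_map 1 = 1.
Proof. by rewrite (ext_map_basis set0) enum_set0 big_nil. Qed.

Lemma anticomm_prod i (s : seq 'I_n) :
  v i * \prod_(j <- s) v j = (-1) ^+ size s *: (\prod_(j <- s) v j * v i).
Proof.
elim: s => [|j s IHs]; first by rewrite big_nil mulr1 mul1r expr0 scale1r.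
rewrite big_cons mulrA vC mulNr -!mulrA IHs /= exprS mulN1r scaleNr.
by rewrite -scalerAr.
Qed.

Lemma gen_mul_basis i G : ext_gen K i * eb G =
  if i \in G then 0 else (-1) ^+ #|[set j in G | (j < i)%N]| *: eb (i |: G).
Proof.
rewrite /ext_gen wedge_basis disjoints1; case: (i \in G) => //=.
congr ((-1) ^+ _ *: _); rewrite /inversions.
rewrite -[RHS](card_imset _ (f := fun j => (i, j))); last by move=> j k [].
apply: eq_card => -[a b]; rewrite !inE /=; apply/and3P/imsetP.
  by case=> /eqP-> bG bi; exists b => //; rewrite inE bG.
by case=> j; rewrite inE => /andP[jG ji] [-> ->].
Qed.

(** Moving [v i] past the elements of [G] smaller than [i] produces the same sign as in
    [gen_mul_basis]; if [i] belongs to [G], then [v i] meets itself and the product vanishes. *)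
Lemma ext_map_genM i f : ext_map (ext_gen K i * f) = v i * ext_map f.
Proof.
rewrite {1}[f]ext_sumE {2}[f]ext_sumE mulr_sumr !linear_sum mulr_sumr /=.
apply: eq_bigr => G _; rewrite -scalerAr !linearZ -scalerAr /=; congr (_ *: _).
rewrite ext_map_basis gen_mul_basis (enum_split G i) big_cat /= mulrA anticomm_prod.
rewrite -cardE -scalerAl.
have gt_enum : enum [set j in G | (i <= j)%N] =
    if i \in G then i :: enum [set j in G | (i < j)%N] else enum [set j in G | (i < j)%N].
  case: ifP => iG.
    rewrite -enum_cons => [|j]; last by rewrite inE => /andP[].
    apply: eq_enum => j; rewrite !inE leq_eqVlt -(inj_eq val_inj) [val j == _]eq_sym.
    by case: eqP => [/val_inj<-|]; rewrite ?iG.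
  apply: eq_enum => j; rewrite !inE leq_eqVlt.
  by case: eqP => // /val_inj<-; rewrite iG.
rewrite gt_enum; case: ifP => iG.
  rewrite linear0 big_cons -(mulrA _ (v i)) (mulrA (v i)) v2 mul0r mulr0 scaler0 //.
rewrite linearZ /= ext_map_basis; congr (_ *: _); rewrite (enum_split _ i) big_cat /=.
rewrite -mulrA; congr (_ * _).
  congr (\prod_(j <- _) _); apply: eq_enum => j; rewrite !inE.
  by case: eqP => [->|]; rewrite ?ltnn ?andbF.
have -> : v i * \prod_(j <- enum [set j in G | (i < j)%N]) v j =
    \prod_(j <- i :: enum [set j in G | (i < j)%N]) v j by rewrite big_cons.
rewrite -enum_cons => [|j]; last by rewrite inE => /andP[].
congr (\prod_(j <- _) _); apply: eq_enum => j; rewrite !inE.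
case: eqP => [->|/eqP ji]; rewrite ?ltnn ?leqnn ?iG //= ltn_neqAle.
by rewrite (_ : (i != j :> nat) = true) // eq_sym; apply/eqP => /val_inj/eqP; apply/negP.
Qed.

Lemma ext_mapM f g : ext_map (f * g) = ext_map f * ext_map g.
Proof.
rewrite [f]ext_sumE mulr_suml !linear_sum mulr_suml /=; apply: eq_bigr => F _.
rewrite -scalerAl !linearZ -scalerAl /=; congr (_ *: _).
rewrite ext_map_basis ext_basisE; elim: (enum F) => [|i s IHs].
  by rewrite !big_nil !mul1r.
by rewrite !big_cons -!mulrA ext_map_genM IHs.
Qed.

HB.instance Definition _ := GRing.isMonoidMorphism.Build E E ext_map
  (conj ext_map1 ext_mapM).

End Substitution.
End ExteriorAlgebra.

(** * Spanning one degree of the exterior face ring modulo linear forms *)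

Section ExteriorSpan.
Variables (K : fieldType) (n : nat).
Local Notation E := (exterior K n).
Local Notation eb := (ext_basis K).
Local Notation gen := (ext_gen K).
Local Notation lin := (@ext_lin K n).
Implicit Types (F H : {set 'I_n}) (G : {set {set 'I_n}}) (f g : E).

Definition ext_homog k f : Prop := forall F, #|F| != k -> f F = 0.
Arguments ext_homog k%_N f.

(* Degree [k - 1], with only the zero vector for [k = 0]. *)
Definition ext_prehomog k f : Prop := forall F, #|F|.+1 != k -> f F = 0.
Arguments ext_prehomog k%_N f.

Lemma ext_homog_subspace k : subspace (ext_homog k).
Proof.
split=> [F _|a f g hf hg F kF]; first by rewrite ffunE.
by rewrite ext_addE ext_scaleE hf // hg // mulr0 addr0.
Qed.

Lemma ext_prehomog_subspace k : subspace (ext_prehomog k).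
Proof.
split=> [F _|a f g hf hg F kF]; first by rewrite ffunE.
by rewrite ext_addE ext_scaleE hf // hg // mulr0 addr0.
Qed.

Lemma ext_prehomogS k f : ext_prehomog k.+1 f <-> ext_homog k f.
Proof. by split=> h F kF; apply: h; rewrite // eqSS in kF *. Qed.

Lemma ext_prehomog0 f : ext_prehomog 0 f -> f = 0.
Proof. by move=> h; apply/ffunP=> F; rewrite h // ffunE. Qed.

Lemma ext_homog_basis F : ext_homog #|F| (eb F).
Proof. by move=> H; rewrite ffunE; have [->|//] := eqVneq H F; rewrite eqxx. Qed.

Lemma ext_homog_mul p q f g : ext_homog p f -> ext_homog q g -> ext_homog (p + q)%N (f * g).
Proof.
move=> hf hg F; rewrite ext_mulE => pqF; apply: big1 => A AF.
have [pA|/hf->] := eqVneq #|A| p; last by rewrite mul0r mulr0.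
rewrite hg ?mulr0 //; apply: contra pqF => /eqP qA.
by rewrite -qA -pA cardsD (setIidPr AF) subnKC ?subset_leq_card.
Qed.

Lemma ext_homog_gen i : ext_homog 1 (gen i).
Proof. by rewrite -(cards1 i); exact: ext_homog_basis. Qed.

Lemma ext_homog_lin v : ext_homog 1 (lin v).
Proof.
apply: (subspace_sum (ext_homog_subspace 1)) => i _.
by apply: (subspaceZ (ext_homog_subspace 1)); exact: ext_homog_gen.
Qed.

Lemma ext_homog1 : ext_homog 0 (1 : E).
Proof. by rewrite -(cards0 'I_n); exact: ext_homog_basis. Qed.

Lemma ext_homog_prod (I : Type) (r : seq I) (f : I -> E) :
  (forall i, ext_homog 1 (f i)) -> ext_homog (size r) (\prod_(i <- r) f i).
Proof.
move=> hf; elim: r => [|i r IHr]; first by rewrite big_nil; exact: ext_homog1.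
by rewrite big_cons; apply: (ext_homog_mul (p := 1%N)).
Qed.

Lemma ext_prehomog_mul k f g : ext_homog 1 f -> ext_prehomog k g -> ext_homog k (f * g).
Proof.
case: k => [hf /ext_prehomog0->|k hf /ext_prehomogS hg].
  by rewrite mulr0; case: (ext_homog_subspace 0).
exact: (ext_homog_mul (p := 1%N)).
Qed.

Lemma ext_homog_sum k (S : E -> Prop) f : subspace S -> ext_homog k f ->
  (forall F, #|F| = k -> S (eb F)) -> S f.
Proof.
move=> subS hf Sb; rewrite [f]ext_sumE; apply: (subspace_sum subS) => F _.
have [kF|/hf->] := eqVneq #|F| k; first by apply: subspaceZ => //; exact: Sb.
by rewrite scale0r; case: subS.
Qed.

(** The exterior face ideal, described by coordinates; see [ext_face_idealE]. *)
Definition ext_nonface G f : Prop := forall F, F \in G -> f F = 0.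

Lemma ext_nonface_subspace G : subspace (ext_nonface G).
Proof.
split=> [F _|a f g hf hg F kF]; first by rewrite ffunE.
by rewrite ext_addE ext_scaleE hf // hg // mulr0 addr0.
Qed.

Lemma ext_nonface_mul G f g : (forall F H, F \in G -> H \subset F -> H \in G) ->
  ext_nonface G f -> ext_nonface G (f * g).
Proof.
move=> clG hf F FG; rewrite ext_mulE; apply: big1 => A AF.
by rewrite hf ?mul0r ?mulr0 // (clG F).
Qed.

Lemma ext_nonface_mull G f g : (forall F H, F \in G -> H \subset F -> H \in G) ->
  ext_nonface G f -> ext_nonface G (g * f).
Proof.
move=> clG hf F FG; rewrite ext_mulE; apply: big1 => A AF.
by rewrite hf ?mulr0 // (clG F) // subsetDl.
Qed.

Lemma ext_nonface_basis G F : F \notin G -> ext_nonface G (eb F).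
Proof.
by move=> FG H HG; rewrite ffunE; case: eqP => // HF; rewrite -HF HG in FG.
Qed.

Section Span.
Variables (G : {set {set 'I_n}}) (k r : nat) (tau : E) (Theta : nat -> 'I_n -> K)
  (D : E -> Prop).

(** Membership of [f] in the sum of the face ideal, of the ideal of the first [r] forms, and of
    [tau * D]. Required of all forms of degree [k], it says that [tau * D] spans the quotient in
    degree [k]. *)
Definition ext_decomp f : Prop := exists (j : E) (u : nat -> E) (w : E),
  [/\ ext_homog k j /\ ext_nonface G j, forall l, ext_prehomog k (u l), D w
    & f = j + \sum_(l < r) lin (Theta l) * u l + tau * w].

Definition ext_span : Prop := forall f, ext_homog k f -> ext_decomp f.

Lemma ext_decomp_subspace : subspace D -> subspace ext_decomp.
Proof.
move=> subD; split.
  exists 0, (fun=> 0), 0; split; last 1 first.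
  - by rewrite mulr0 addr0 add0r big1 // => l _; rewrite mulr0.
  - split; [by case: (ext_homog_subspace k) | by case: (ext_nonface_subspace G)].
  - by move=> _; case: (ext_prehomog_subspace k).
  - by case: subD.
move=> a f g [j [u [w [[hj nj] hu Dw ->]]]] [j' [u' [w' [[hj' nj'] hu' Dw' ->]]]].
exists (a *: j + j'), (fun l => a *: u l + u' l), (a *: w + w'); split.
- by split; [apply: (proj2 (ext_homog_subspace k)) | apply: (proj2 (ext_nonface_subspace G))].
- by move=> l; apply: (proj2 (ext_prehomog_subspace k)).
- exact: (proj2 subD).
rewrite !scalerDr mulrDr -scalerAr scaler_sumr addrACA; congr (_ + _).
rewrite addrACA; congr (_ + _); rewrite -big_split; apply: eq_bigr => l _ /=.
by rewrite mulrDr -scalerAr.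
Qed.

Lemma ext_span_basis : subspace D -> (forall F, #|F| = k -> ext_decomp (eb F)) -> ext_span.
Proof.
by move=> subD dF f hf; apply: (ext_homog_sum (ext_decomp_subspace subD) hf).
Qed.

End Span.

Section Open.
Variables (X : Type) (P : (X -> K) -> Prop).
Hypothesis PC : poly_class P.

Definition ext_poly (f : X -> E) : Prop := forall F, P (fun x => f x F).

Lemma ext_poly_const f : ext_poly (fun=> f).
Proof. by move=> F; exact: (pc_const PC). Qed.

Lemma ext_poly_add (f g : X -> E) : ext_poly f -> ext_poly g -> ext_poly (fun x => f x + g x).
Proof.
move=> Pf Pg F; apply: (pc_ext PC) (pc_add PC (Pf F) (Pg F)) => x.
by rewrite ext_addE.
Qed.

Lemma ext_poly_sum (I : Type) (r : seq I) (f : I -> X -> E) :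
  (forall i, ext_poly (f i)) -> ext_poly (fun x => \sum_(i <- r) f i x).
Proof.
move=> Pf F; have Ps := @pc_sum _ _ _ PC _ r xpredT (fun i x => f i x F).
by apply: (pc_ext PC) (Ps _) => [x|i _]; [rewrite ext_sum_apply | exact: Pf].
Qed.

Lemma ext_poly_scale (a : X -> K) (f : X -> E) : P a -> ext_poly f -> ext_poly (fun x => a x *: f x).
Proof.
move=> Pa Pf F; apply: (pc_ext PC) (pc_mul PC Pa (Pf F)) => x.
by rewrite ext_scaleE.
Qed.

Lemma ext_poly_mul (f g : X -> E) : ext_poly f -> ext_poly g -> ext_poly (fun x => f x * g x).
Proof.
move=> Pf Pg F.
have Ps := @pc_sum _ _ _ PC _ (index_enum _) (fun A : {set 'I_n} => A \subset F)
  (fun A x => (-1) ^+ inversions A (F :\: A) * (f x A * g x (F :\: A))).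
apply: (pc_ext PC) (Ps _) => [x|A _]; first by rewrite ext_mulE.
by apply: (pc_mul PC); [exact: (pc_const PC) | exact: (pc_mul PC)].
Qed.

Lemma ext_poly_prod (I : Type) (r : seq I) (f : I -> X -> E) :
  (forall i, ext_poly (f i)) -> ext_poly (fun x => \prod_(i <- r) f i x).
Proof.
move=> Pf; elim: r => [|i r IHr] F.
  by apply: (pc_ext PC) (ext_poly_const 1 F) => x; rewrite big_nil.
by apply: (pc_ext PC) (ext_poly_mul (Pf i) IHr F) => x; rewrite big_cons.
Qed.

Lemma ext_poly_lin (v : X -> 'I_n -> K) : (forall i, P (v^~ i)) ->
  ext_poly (fun x => lin (v x)).
Proof.
by move=> Pv; apply: ext_poly_sum => i; apply: ext_poly_scale => //; exact: ext_poly_const.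
Qed.

(** The decompositions found at [x0] are kept, with the same [j], [u], [w], while the forms and
    [tau] move; [open_span] then applies. *)
Lemma ext_span_open G k r (tau : X -> E) (Theta : X -> nat -> 'I_n -> K) D x0 :
  subspace D -> ext_poly tau -> (forall l i, P (fun x => Theta x l i)) ->
  (forall x w, D w -> ext_homog k (tau x * w)) ->
  ext_span G k r (tau x0) (Theta x0) D ->
  exists2 q, P q & q x0 != 0 /\
    forall x, q x != 0 -> ext_span G k r (tau x) (Theta x) D.
Proof.
move=> subD Ptau PT hD span0; pose I := {F : {set 'I_n} | #|F| == k}.
have /fin_all_exists[c cP] (i : I) : exists c : E * (nat -> E) * E,
    [/\ ext_homog k c.1.1 /\ ext_nonface G c.1.1, forall l, ext_prehomog k (c.1.2 l), D c.2
      & eb (val i) = c.1.1 + \sum_(l < r) lin (Theta x0 l) * c.1.2 l + tau x0 * c.2].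
  have [|j [u [w dF]]] := span0 (eb (val i)); last by exists (j, u, w).
  by have := @ext_homog_basis (val i); rewrite (eqP (valP i)).
(* At [x0] this is the basis vector [eb (val i)]. *)
pose u i x := (c i).1.1 + \sum_(l < r) lin (Theta x l) * (c i).1.2 l + tau x * (c i).2.
have hu i x : ext_homog k (u i x).
  have subk := ext_homog_subspace k; have [[hj _] hl Dw _] := cP i.
  apply: (subspaceD subk); last exact: hD.
  apply: (subspaceD subk) => //; apply: (subspace_sum subk) => l _.
  by apply: ext_prehomog_mul => //; exact: ext_homog_lin.
have uE i x : \sum_(H : I) u i x (val H) *: eb (val H) = u i x.
  rewrite [RHS]ext_sumE (bigID (fun H => #|H| == k)) /= [X in _ + X]big1 ?addr0; last first.
    by move=> H kH; rewrite hu ?scale0r.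
  apply/esym; rewrite (reindex_omap (fun H : I => val H) insub) /=; last first.
    by move=> H kH; rewrite insubT.
  by apply: eq_bigl => H; rewrite valK eqxx andbT (valP H).
have [||x i||q Pq [q0 qP]] := @open_span K X P PC E I (fun H : I => eb (val H))
  (fun x => ext_decomp G k r (tau x) (Theta x) D) (fun (i H : I) x => u i x (val H)) x0.
- by move=> x; exact: ext_decomp_subspace.
- move=> i H.
  apply: (@ext_poly_add (fun x => (c i).1.1 + _) (fun x => tau x * _)); last first.
    by apply: ext_poly_mul => //; exact: ext_poly_const.
  apply: ext_poly_add; first exact: ext_poly_const.
  by apply: ext_poly_sum => l; apply: ext_poly_mul;
    [apply: ext_poly_lin | exact: ext_poly_const].
- rewrite uE; have [hj hl Dw _] := cP i.
  by exists (c i).1.1, (c i).1.2, (c i).2.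
- move=> i H; rewrite /u; have [_ _ _ <-] := cP i; rewrite ffunE (inj_eq val_inj).
  by rewrite eq_sym.
exists q => //; split=> // x /qP dx; apply: ext_span_basis => // F kF.
have kF' : #|F| == k by apply/eqP.
exact: (dx (exist _ F kF')).
Qed.

End Open.

(** The factors are the [a] forms that follow the [r] forms divided out, so that they later become
    the [a] variables preceding the last [r] ones. *)
Definition ext_tau (Theta : nat -> 'I_n -> K) r a : E :=
  \prod_(l <- iota r a) lin (Theta l).

Lemma ext_homog_tau Theta r a : ext_homog a (ext_tau Theta r a).
Proof.
rewrite -{1}(size_iota r a); apply: ext_homog_prod => l; exact: ext_homog_lin.
Qed.

Definition line (Theta Theta' : nat -> 'I_n -> K) (t : K) l i : K :=
  Theta l i + t * (Theta' l i - Theta l i).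

Lemma line_poly Theta Theta' l i : polyline (fun t => line Theta Theta' t l i).
Proof.
have PC := polyline_class K.
apply: (pc_add PC); first exact: (pc_const PC).
by apply: (pc_mul PC); [exact: polyline_id | exact: (pc_const PC)].
Qed.

(* Two conditions satisfied by some linear forms each have a common solution. *)
Lemma ext_span_common G G' k k' r a Theta Theta' D D' : infinite_field K ->
  subspace D -> subspace D' ->
  (forall Th w, D w -> ext_homog k (ext_tau Th r a * w)) ->
  (forall Th w, D' w -> ext_homog k' (ext_tau Th r a * w)) ->
  ext_span G k r (ext_tau Theta r a) Theta D ->
  ext_span G' k' r (ext_tau Theta' r a) Theta' D' ->
  exists Theta2, ext_span G k r (ext_tau Theta2 r a) Theta2 D /\
                 ext_span G' k' r (ext_tau Theta2 r a) Theta2 D'.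
Proof.
move=> Kinf subD subD' hD hD' sp sp'; have PC := polyline_class K.
pose L := line Theta Theta'; pose tau t := ext_tau (L t) r a.
have Ptau : ext_poly (@polyline K) tau.
  apply: ext_poly_prod => // l; apply: ext_poly_lin => // i; exact: line_poly.
have LP l i : polyline (fun t => L t l i) by exact: line_poly.
have L0 : L 0 = Theta by apply/funext=> l; apply/funext=> i; rewrite /L /line mul0r addr0.
have L1 : L 1 = Theta' by apply/funext=> l; apply/funext=> i; rewrite /L /line mul1r subrKC.
have [||q Pq [q0 qP]] := @ext_span_open K (@polyline K) PC G k r tau L D 0 subD Ptau LP.
- by move=> t w /hD; apply.
- by rewrite /tau L0.
have [||q' Pq' [q0' qP']] := @ext_span_open K (@polyline K) PC G' k' r tau L D' 1 subD' Ptau LP.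
- by move=> t w /hD'; apply.
- by rewrite /tau L1.
have [t [qt q't]] := polyline_common Kinf Pq Pq' q0 q0'.
by exists (L t); split; [exact: qP | exact: qP'].
Qed.

End ExteriorSpan.

Arguments ext_homog [K n] k%_N f.
Arguments ext_prehomog [K n] k%_N f.
Arguments ext_span [K n] G k%_N r%_N tau Theta D.
Arguments ext_tau [K n] Theta r%_N a%_N.

(** Strongly edge decomposable complexes together with [d], one more than the dimension, and the
    h-vector produced by the recursion. The shape of [sedh_edge] records that contraction keeps the
    dimension and that the edge link loses two; [sed_sedh] derives this from purity. *)
Inductive sedh n : nat -> {set {set 'I_n}} -> (nat -> nat) -> Prop :=
| sedh_empty : sedh 0 [set set0] (fun k => k == 0%N)
| sedh_boundary (V : {set 'I_n}) d : #|V| = d.+1 ->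
    sedh d [set F : {set 'I_n} | F \proper V] (fun k => k <= d)%N
| sedh_edge (V : {set 'I_n}) (G : {set {set 'I_n}}) (i j : 'I_n) d h1 h2 :
    complex_on V G -> (i < j)%N -> [set i; j] \in G -> link_condition G i j ->
    (forall F, F \in G -> (#|F| <= d.+2)%N) ->
    sedh d.+2 (contraction G i j) h1 -> sedh d (link G [set i; j]) h2 ->
    sedh d.+2 G (fun k => h1 k + (if k is k'.+1 then h2 k' else 0))%N.

(** * Face numbers under edge contraction and the h-vector *)

Section Edge.
Variables (T : finType) (V : {set T}) (G : {set {set T}}) (i j : T).
Hypotheses (cG : complex_on V G) (ij : i != j).
Implicit Types F H : {set T}.

Lemma complex_sub F H : F \in G -> H \subset F -> H \in G.
Proof. by case: cG => _ _ _; apply. Qed.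

Lemma mem_contraction F : (F \in contraction G i j) =
  (i \notin F) && ((F \in G) || (j \in F) && (i |: F :\ j \in G)).
Proof.
apply/idP/idP; rewrite /contraction !inE.
  case/orP=> [/andP[-> ->] //|/imsetP[F0]]; rewrite inE => /andP[F0G iF0 ->].
  rewrite !inE !eqxx (negbTE ij) /=; apply/orP; right; apply: (complex_sub F0G).
  rewrite subUset sub1set iF0 /=; apply/subsetP=> x; rewrite !inE.
  by case: eqP => //= _ /andP[].
case/andP=> iF; rewrite iF; case: (F \in G) => //= /andP[jF iFG].
apply/imsetP; exists (i |: F :\ j); first by rewrite inE iFG setU11.
apply/setP=> x; rewrite !inE; have [->//|xj] /= := eqVneq x j.
by have [->|] := eqVneq x i; rewrite ?(negbTE iF).
Qed.

Lemma mem_link2 H : (H \in link G [set i; j]) =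
  [&& i \notin H, j \notin H & i |: (j |: H) \in G].
Proof.
rewrite inE disjoints_subset setCU subsetI ![H \subset _]subsetC !sub1set !inE -andbA; do 2!congr (_ && _).
by rewrite setUC setUA.
Qed.

Hypothesis lc : link_condition G i j.

Lemma link_edge H : i \notin H -> j \notin H ->
  (i |: (j |: H) \in G) = (i |: H \in G) && (j |: H \in G).
Proof.
move=> iH jH; apply/idP/andP => [h|[hi hj]].
  by split; apply: (complex_sub h); rewrite ?setUS ?subsetUr.
have : H \in link G [set i] :&: link G [set j].
  rewrite inE !inE ![_ :|: [set _]]setUC hi hj !andbT.
  by rewrite !disjoints_subset ![H \subset _]subsetC !sub1set !inE iH jH.
by rewrite lc mem_link2 => /and3P[].
Qed.

Lemma sum_setU1 (R : nmodType) (psi : {set T} -> R) (P : pred {set T}) :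
  (forall F, P (i |: F) = P F) ->
  \sum_(F | P F) psi F = \sum_(F | P F && (i \notin F)) (psi F + psi (i |: F)).
Proof.
move=> PU; rewrite big_split /= (bigID (fun F => i \in F)) /= addrC; congr (_ + _).
rewrite (reindex_onto (fun F => i |: F) (fun F => F :\ i)) /=; last first.
  by move=> F /andP[_ iF]; rewrite setD1K.
apply: eq_bigl => F; rewrite PU setU11 andbT; congr (_ && _).
by apply/eqP/idP => [<-|iF]; [rewrite !inE eqxx | rewrite setU1K].
Qed.

End Edge.

Section EdgeSum.
Variables (T : finType) (V : {set T}) (G : {set {set T}}) (i j : T).
Hypotheses (cG : complex_on V G) (ij : i != j) (lc : link_condition G i j).

(** For [F] avoiding [i] and [j], contraction identifies [i |: F] and [j |: F], and loses a face
    only when both are in [G]. By the Link condition this happens exactly when [F] is in the link of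
    the edge, in which case the face containing both [i] and [j] is lost as well. *)
Lemma sum_faces_edge (R : nmodType) (phi : nat -> R) :
  \sum_(F in G) phi #|F| = \sum_(F in contraction G i j) phi #|F| +
    \sum_(F in link G [set i; j]) (phi #|F|.+1 + phi #|F|.+2).
Proof.
have split4 (A : {set {set T}}) (f : nat -> R) : \sum_(F in A) f #|F| =
    \sum_(F : {set T} | (j \notin F) && (i \notin F))
     ((if F \in A then f #|F| else 0) + (if i |: F \in A then f #|F|.+1 else 0) +
      ((if j |: F \in A then f #|F|.+1 else 0) +
       (if i |: (j |: F) \in A then f #|F|.+2 else 0))).
  rewrite big_mkcond /= (sum_setU1 (i := i) _ (P := predT)) //=.
  rewrite (sum_setU1 (i := j)) => [|F]; last by rewrite !inE (negbTE ij).
  under eq_bigl => F do rewrite andbC.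
  apply: eq_bigr => F /andP[jF iF].
  by rewrite !cardsU1 !inE negb_or iF jF ij /= !add1n.
rewrite (split4 G) (split4 (contraction G i j)).
have -> : \sum_(F in link G [set i; j]) (phi #|F|.+1 + phi #|F|.+2) =
    \sum_(F : {set T} | (j \notin F) && (i \notin F))
      (if i |: (j |: F) \in G then phi #|F|.+1 + phi #|F|.+2 else 0).
  rewrite [LHS]big_mkcond [RHS]big_mkcond /=; apply: eq_bigr => F _.
  by rewrite (mem_link2 G); case: (i \in F); case: (j \in F).
rewrite -big_split /=; apply: eq_bigr => F /andP[jF iF].
rewrite !(mem_contraction cG ij) !inE !eqxx (negbTE ij) iF (negbTE jF) (negbTE iF) /=.
rewrite orbF setU1K // (link_edge cG lc) //.
by case: (i |: F \in G); case: (j |: F \in G); rewrite /= ?addr0 ?add0r ?addr0.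
Qed.

End EdgeSum.

Lemma sedh_h0 n d (G : {set {set 'I_n}}) hh k : sedh d G hh -> (d < k)%N -> hh k = 0%N.
Proof.
move=> sG; elim: sG k => {d G hh} [|V d _|V G i j d h1 h2 _ _ _ _ _ _ IH1 _ IH2] k.
- by case: k.
- by rewrite ltnNge => /negbTE->.
by case: k => // k dk; rewrite IH1 // IH2 // -ltnS ltnW.
Qed.

(** The homogeneous polynomial identity relating f-vector and h-vector. Different values of [x] and
    [y] give the h-numbers, the number of top faces and the Hilbert function. *)
Lemma sum_faces_h n d (G : {set {set 'I_n}}) hh : sedh d G hh ->
  forall (R : idomainType) (x y : R), y != 0 ->
  \sum_(F in G) x ^+ #|F| * y ^+ (d - #|F|) =
  \sum_(k < d.+1) (hh k)%:R * (x ^+ k * (x + y) ^+ (d - k)).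
Proof.
move=> sG R x y y0; elim: sG => {d G hh} [|V d cV|V G i j d h1 h2 cG lij ijG lc leG _ IH1 s2 IH2].
- by rewrite big_set1 cards0 big_ord1 eqxx !expr0 !mul1r.
- have -> : \sum_(k < d.+1) ((k <= d)%N : nat)%:R * (x ^+ k * (x + y) ^+ (d - k)) =
      \sum_(k < d.+1) (x + y) ^+ (d.+1.-1 - k) * x ^+ k.
    by apply: eq_bigr => k _; rewrite -ltnS ltn_ord mul1r mulrC.
  have defB : [set F : {set 'I_n} | F \proper V] = powerset V :\ V.
    by apply/setP=> F; rewrite !inE properEneq.
  rewrite defB.
  (* Binomial theorem over all subsets of [V]. Removing the term of [V] leaves [y] times the desired
     sum, whence the cancellation of [y] below. *)
  have pw : \sum_(F in powerset V) (fun F : {set 'I_n} => x ^+ #|F| * y ^+ (d.+1 - #|F|)) F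
      = (x + y) ^+ d.+1.
    under eq_bigl => F do rewrite powersetE.
    rewrite -cV addrC exprDn (partition_big (fun F : {set 'I_n} => inord #|F| : 'I_(#|V|.+1)) predT) //=.
    apply: eq_bigr => k _.
    rewrite (eq_bigr (fun=> x ^+ k * y ^+ (#|V| - k))); last first.
      move=> F /andP[FV /eqP<-]; rewrite inordK //.
      by rewrite ltnS subset_leq_card.
    rewrite sumr_const mulrC; congr (_ *+ _); rewrite -cards_draws -cardsE.
    apply: eq_card => F; rewrite !inE; apply/andP/andP=> -[FV /eqP h]; split=> //.
      by rewrite -h inordK // ltnS subset_leq_card.
    by rewrite h; apply/eqP/inord_val.
  have Vp : V \in powerset V by rewrite powersetE.
  move: pw; rewrite (big_setD1 V) //= cV subnn expr0 mulr1.
  move/(canRL (addKr _)); rewrite addrC subrXX addrAC subrr add0r => pw.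
  apply: (mulfI y0); rewrite -pw mulr_sumr.
  apply: eq_bigr => F; rewrite !inE => /andP[FV sFV].
  have ltF : (#|F| < d.+1)%N by rewrite -cV proper_card // properEneq FV sFV.
  by rewrite mulrCA -exprS subSn.
have ij : i != j by rewrite -(inj_eq val_inj) neq_ltn lij.
rewrite (sum_faces_edge cG ij lc (fun k => x ^+ k * y ^+ (d.+2 - k))) IH1.
(* The factor [x] shifts the h-vector of the link by one, and [x + y] restores the total degree
   [d.+2]. *)
have -> : \sum_(F in link G [set i; j]) (x ^+ #|F|.+1 * y ^+ (d.+2 - #|F|.+1) +
    x ^+ #|F|.+2 * y ^+ (d.+2 - #|F|.+2)) =
    x * (x + y) * \sum_(F in link G [set i; j]) x ^+ #|F| * y ^+ (d - #|F|).
  rewrite mulr_sumr; apply: eq_bigr => F; rewrite (mem_link2 G) => /and3P[iF jF /leG].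
  rewrite !cardsU1 !inE negb_or ij iF jF /= !add1n !ltnS => leF.
  by rewrite subSS subSn // subSS !exprS; ring.
under [RHS]eq_bigr => k _ do rewrite natrD mulrDl.
rewrite big_split /= IH2; congr (_ + _).
rewrite [RHS]big_ord_recl /= mul0r add0r [RHS]big_ord_recr /=.
rewrite (sedh_h0 s2) ?mul0r ?addr0 //.
rewrite mulr_sumr; apply: eq_bigr => k _; rewrite /bump /= add1n.
have lek : (k <= d)%N by rewrite -ltnS.
by rewrite (_ : d.+2 - k.+1 = (d - k).+1)%N ?exprS; [ring | rewrite subSS subSn].
Qed.

Lemma coef_exp1subX m k : ((1 - 'X : {poly int}) ^+ m)`_k = (-1) ^+ k * 'C(m, k)%:R.
Proof.
have -> : (1 - 'X : {poly int}) ^+ m = \poly_(l < m.+1) ((-1) ^+ l * 'C(m, l)%:R).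
  rewrite poly_def exprBn; apply: eq_bigr => l _.
  rewrite expr1n mulr1 -mul_polyC rmorphM rmorphXn rmorphN1 rmorph_nat /=.
  by rewrite -mulr_natr mulrAC.
rewrite coef_poly ltnS; case: leqP => // /bin_small->.
by rewrite mulr0.
Qed.

Lemma leq_dimS (T : finType) (G : {set {set T}}) F : F \in G -> (#|F| <= dimS G)%N.
Proof. by move=> FG; rewrite /dimS (bigmax_sup F). Qed.

(** Taking x = X and y = 1 - X makes x + y = 1, so the coefficient of X^i isolates [hh i]. *)
Lemma hnum_sedh n (G : {set {set 'I_n}}) hh i : sedh (dimS G) G hh ->
  (i <= dimS G)%N -> hnum G i = (hh i)%:R.
Proof.
move=> sG le_id; set d := dimS G in le_id sG *.
have y0 : (1 - 'X : {poly int}) != 0.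
  by rewrite subr_eq0 eq_sym; apply/eqP => /(congr1 (fun p : {poly int} => p`_0)); rewrite coefX coef1.
have := sum_faces_h sG 'X y0 => /(congr1 (fun p : {poly int} => p`_i)).
rewrite subrKC !coef_sum.
rewrite [X in _ = X](bigD1 (Ordinal (le_id : (i < d.+1)%N))) //= [X in _ = _ + X]big1 => [|k ki]; last first.
  rewrite expr1n mulr1 mulr_natl coefMn coefXn.
  by rewrite (_ : (i == k :> nat) = false) ?mul0rn //; apply: contraNF ki => /eqP ik; apply/eqP/val_inj.
rewrite expr1n mulr1 mulr_natl coefMn coefXn eqxx addr0 => <-.
rewrite /hnum -/d.
transitivity (\sum_(F in G | (#|F| <= i)%N) (-1) ^+ (i - #|F|) * ('C(d - #|F|, d - i))%:R : int); last first.
  rewrite big_mkcondr /=; apply: eq_bigr => F /leq_dimS leFd; rewrite coefXnM ltnNge.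
  case: leqP => //= leFi; rewrite coef_exp1subX; congr (_ * _%:R).
  have -> : (d - i = (d - #|F|) - (i - #|F|))%N.
    by rewrite subnBA // subnK.
  by rewrite bin_sub // leq_sub2r.
rewrite (partition_big (fun F : {set 'I_n} => inord #|F| : 'I_i.+1) predT) //=.
apply: eq_bigr => j _.
rewrite (eq_bigr (fun=> (-1) ^+ (i - j) * ('C(d - j, d - i))%:R)); last first.
  by move=> F /andP[/andP[_ leFi] /eqP<-]; rewrite inordK.
rewrite sumr_const -[RHS]mulr_natr natrM mulrA; congr (_ * _%:R).
rewrite /fnum; apply: eq_card => F; rewrite !inE [RHS]/in_mem /= -andbA; congr (_ && _).
apply/eqP/andP => [Fj|[leFi /eqP<-]]; last by rewrite inordK.
by rewrite Fj -ltnS ltn_ord inord_val eqxx.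
Qed.

(** Taking x = 1 and y = X, then evaluating at X = 0: only faces of size [d] survive, and x + y
    becomes 1. *)
Lemma card_top_faces n d (G : {set {set 'I_n}}) hh : sedh d G hh ->
  (forall F, F \in G -> (#|F| <= d)%N) ->
  #|[set F in G | #|F| == d]| = (\sum_(k < d.+1) hh k)%N.
Proof.
move=> sG leG; have X0 : ('X : {poly int}) != 0 by rewrite polyX_eq0.
have := sum_faces_h sG 1 X0 => /(congr1 (fun p : {poly int} => p.[0])).
rewrite !horner_sum.
have h0 k : ((hh k)%:R * (1 ^+ k * (1 + 'X) ^+ (d - k)) : {poly int}).[0] = (hh k)%:R.
  rewrite expr1n mul1r hornerM horner_exp hornerD hornerC hornerX addr0 expr1n mulr1.
  by rewrite -[LHS]/((hh k)%:R.[0]) -(rmorph_nat polyC) hornerC.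
under [X in _ = X]eq_bigr => k _ do rewrite h0.
rewrite -natr_sum => h; apply/eqP; rewrite -(Num.Theory.eqr_nat int) -h -sum1_card natr_sum.
rewrite [X in _ == X](bigID (fun F : {set 'I_n} => #|F| == d)) /= [X in _ == _ + X]big1 ?addr0.
  apply/eqP; apply: eq_big => [F|F]; first by rewrite !inE.
  by rewrite !inE => /andP[_ /eqP->]; rewrite expr1n mul1r subnn expr0 hornerC.
move=> F /andP[/leG leF Fd]; rewrite expr1n mul1r horner_exp hornerX expr0n.
by rewrite subn_eq0 leqNgt ltn_neqAle Fd leF.
Qed.

(** A simplex boundary is no cone, and contracting an edge of a cone gives a cone. This keeps the
    dimension under contraction and later forces d < n. *)
Lemma sed_not_cone n (G : {set {set 'I_n}}) v : strongly_edge_decomposable G ->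
  exists2 F, F \in G & v |: F \notin G.
Proof.
move=> sG; elim: sG v => {G} [V V0 v||V G i j cG _ lij _ _ _ IHC _ _ v].
- have [vV|vV] := boolP (v \in V).
    by exists (V :\ v); rewrite !inE ?properD1 // setD1K ?properxx.
  exists set0; first by rewrite inE proper0.
  by rewrite inE setU0 properE sub1set (negbTE vV).
- by move=> v; exists set0; rewrite inE // -subset0 subUset sub1set inE.
have ij : i != j by rewrite -(inj_eq val_inj) neq_ltn lij.
(* If [i] is the apex of [G], then [j] is the apex of the contraction. *)
pose w := if v == i then j else v.
have [F FC wF] := IHC w; have := FC.
rewrite (mem_contraction cG ij) => /andP[iF /orP FG].
case: (boolP [exists F in G, v |: F \notin G]) => [/exists_inP[H]|]; first by exists H.
rewrite negb_exists_in => /forall_inP cone; case/negP: wF.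
have vG H : H \in G -> v |: H \in G by move/cone; rewrite negbK.
rewrite /w (mem_contraction cG ij).
case: FG => [FG|/andP[jF FG]].
  case: (eqVneq v i) => vi; rewrite !inE.
    rewrite (negbTE ij) iF eqxx /=; apply/orP; right.
    by apply: (complex_sub cG (vG F FG)); rewrite vi setUS // setDUl subUset subsetDl setDv sub0set.
  by rewrite eq_sym (negbTE vi) iF vG.
case: (eqVneq v i) => vi; rewrite !inE.
  rewrite (negbTE ij) iF eqxx /=; apply/orP; right.
  by rewrite (_ : j |: F = F) //; apply/setUidPr; rewrite sub1set.
rewrite eq_sym (negbTE vi) iF jF orbT /=; apply/orP; right.
apply: (complex_sub cG (vG _ FG)); rewrite subUset sub1set !inE eqxx orbT /=.
by apply/subsetP=> x; rewrite !inE => /andP[->] /orP[->//|->]; rewrite !orbT.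
Qed.

Lemma dimS_eq (T : finType) (G : {set {set T}}) d F :
  (forall H, H \in G -> (#|H| <= d)%N) -> F \in G -> #|F| = d -> dimS G = d.
Proof.
move=> le FG Fd; apply/eqP; rewrite eqn_leq -{2}Fd leq_dimS // andbT.
by apply/bigmax_leqP => H /le.
Qed.

Lemma pure_extend (T : finType) (G : {set {set T}}) F : pure G -> F \in G ->
  exists2 H, H \in G & (F \subset H) && (#|H| == dimS G).
Proof.
move=> pG FG; have [H mH FH] := maxset_exists (P := fun H => H \in G) FG.
have [HG _] := maxsetP mH; exists H => //; rewrite FH /=.
have Gpos : (0 < #|G|)%N by apply/card_gt0P; exists F.
have [F1 F1G F1d] := eq_bigmax_cond (fun F : {set T} => #|F|) Gpos.
rewrite /dimS F1d; apply/eqP/pG => //; apply/maxsetP; split=> // H1 H1G F1H1.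
by apply/eqP; rewrite eq_sym eqEcard F1H1 -F1d leq_dimS.
Qed.

(** Only the dimensions need an argument: the link of the edge has dimension two less by purity, and
    the contraction keeps the dimension because it is not a cone. *)
Lemma sed_sedh n (G : {set {set 'I_n}}) : strongly_edge_decomposable G ->
  exists hh, sedh (dimS G) G hh.
Proof.
elim=> {G} [V V0||V G i j cG pG lij ijG lc sC [h1 IH1] sL [h2 IH2]].
- have [V00|[v vV]] := set_0Vmem V; first by rewrite V00 eqxx in V0.
  exists (fun k => k <= #|V|.-1)%N.
  have Vd : #|V| = #|V|.-1.+1 by rewrite (cardsD1 v) vV.
  rewrite (@dimS_eq _ _ #|V|.-1 (V :\ v)); first exact: sedh_boundary.
  + by move=> H; rewrite inE => /proper_card; rewrite {1}Vd ltnS.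
  + by rewrite inE properD1.
  by rewrite (cardsD1 v V) vV.
- exists (fun k => k == 0)%N; rewrite (@dimS_eq _ _ 0 set0) ?inE ?cards0 //.
    exact: sedh_empty.
  by move=> H; rewrite inE => /eqP->; rewrite cards0.
have ij : i != j by rewrite -(inj_eq val_inj) neq_ltn lij.
have [F0 F0G /andP[ijF0 /eqP F0d]] := pure_extend pG ijG.
have d2 : dimS G = (dimS G).-2.+2.
  by have := subset_leq_card ijF0; rewrite cards2 ij F0d; case: dimS => [|[|]].
have iF0 : i \in F0 by apply: (subsetP ijF0); rewrite !inE eqxx.
have jF0 : j \in F0 by apply: (subsetP ijF0); rewrite !inE eqxx orbT.
have dL : dimS (link G [set i; j]) = (dimS G).-2.
  apply: (@dimS_eq _ _ _ (F0 :\ j :\ i)).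
  - move=> H; rewrite (mem_link2 G) => /and3P[iH jH /leq_dimS].
    by rewrite {1}d2 !cardsU1 !inE negb_or ij iH jH.
  - by rewrite (mem_link2 G) !inE !eqxx andbF /= setUCA setD1K ?setD1K // !inE ij.
  rewrite -F0d (cardsD1 j F0) jF0 (cardsD1 i (F0 :\ j)) !inE ij iF0 //.
have leC H : H \in contraction G i j -> (#|H| <= dimS G)%N.
  rewrite (mem_contraction cG ij) => /andP[iH /orP[|/andP[jH]] /leq_dimS //].
  by rewrite cardsU1 !inE negb_and iH orbT (cardsD1 j H) jH.
(* Otherwise every top face of [G] contains both [i] and [j]; by purity every face of the
   contraction could then be enlarged by [j], making it a cone with apex [j]. *)
have dC : dimS (contraction G i j) = dimS G.
  case: (boolP [exists F in contraction G i j, #|F| == dimS G]) => [/exists_inP[F FC /eqP Fd]|].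
    exact: (@dimS_eq _ _ _ F).
  rewrite negb_exists_in => /forall_inP noF.
  have top F : F \in G -> #|F| = dimS G -> (i \in F) && (j \in F).
    move=> FG Fd; have := noF F; rewrite (mem_contraction cG ij) FG Fd eqxx /=.
    case iF: (i \in F) => //=; last by move=> /(_ isT).
    move=> _; have := noF (j |: F :\ i); rewrite (mem_contraction cG ij).
    case jF: (j \in F) => //.
    rewrite !inE !eqxx !(negbTE ij) /= setU1K; last by rewrite !inE jF andbF.
    rewrite setD1K // FG orbT => /(_ isT).
    by rewrite cardsU1 !inE jF andbF -Fd (cardsD1 i F) iF eqxx.
  have [F FC] := sed_not_cone j sC; have := FC.
  rewrite !(mem_contraction cG ij) !inE (negbTE ij) eqxx /= => /andP[iF /orP[FG|/andP[jF FG]]].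
    have [H HG /andP[FH /eqP Hd]] := pure_extend pG FG.
    have /andP[iH jH] := top H HG Hd; rewrite iF /=.
    rewrite (complex_sub cG HG) //; last by rewrite subUset sub1set jH.
  by rewrite iF /= (_ : j |: F = F) ?FG ?orbT //; apply/setUidPr; rewrite sub1set.
rewrite d2; rewrite dC d2 in IH1; rewrite dL in IH2.
exists (fun k => h1 k + (if k is k'.+1 then h2 k' else 0))%N.
apply: (sedh_edge cG lij ijG lc _ IH1 IH2) => F /leq_dimS.
by rewrite {1}d2.
Qed.

(** * Exterior case: the inductive step for an edge *)

Section ExteriorInduction.
Variables (K : fieldType) (n : nat).
Local Notation E := (exterior K n).
Local Notation eb := (ext_basis K).
Local Notation gen := (ext_gen K).
Local Notation lin := (@ext_lin K n).
Implicit Types (F H : {set 'I_n}) (G L : {set {set 'I_n}}) (f g : E).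

Lemma basis_gen (i : 'I_n) F : i \in F -> exists c : K, eb F = c *: (gen i * eb (F :\ i)).
Proof.
move=> iF; exists ((-1) ^+ #|[set j in F :\ i | (j < i)%N]|).
rewrite gen_mul_basis !inE eqxx /= setD1K // scalerA -exprD addnn -mul2n exprM.
by rewrite sqrrN !expr1n scale1r.
Qed.

Lemma ext_nonface_gen G i F : i |: F \notin G -> ext_nonface G (gen i * eb F).
Proof.
move=> iFG; rewrite gen_mul_basis; case: ifP => _.
  by case: (ext_nonface_subspace K G).
by apply: (subspaceZ (ext_nonface_subspace K G)); exact: ext_nonface_basis.
Qed.

Lemma ext_homog_gen_basis i F : ext_homog #|F|.+1 (gen i * eb F).
Proof. by apply: (ext_homog_mul (p := 1%N)); [exact: ext_homog_gen | exact: ext_homog_basis]. Qed.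

Lemma ext_nonface_sum G k (S : E -> Prop) f : subspace S -> ext_homog k f ->
  ext_nonface G f -> (forall F, #|F| = k -> F \notin G -> S (eb F)) -> S f.
Proof.
move=> subS hf nf Sb; rewrite [f]ext_sumE; apply: (subspace_sum subS) => F _.
have [FG|FG] := boolP (F \in G); first by rewrite nf // scale0r; case: subS.
have [kF|/hf->] := eqVneq #|F| k; first by apply: subspaceZ => //; exact: Sb.
by rewrite scale0r; case: subS.
Qed.

Lemma ext_homog_premul a p f w : ext_homog a f -> ext_prehomog p w ->
  ext_prehomog (a + p) (f * w).
Proof.
case: p => [|p] hf; first by move/ext_prehomog0->; rewrite mulr0; case: (ext_prehomog_subspace K n (a + 0)).
by move/ext_prehomogS => hw; rewrite addnS; apply/ext_prehomogS; exact: ext_homog_mul.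
Qed.

Section LinearMap.
Variable S : 'I_n -> 'I_n -> K.

Definition ext_submap : E -> E := ext_map (fun m => lin (S m)).

HB.instance Definition _ := GRing.isLinear.Build K E E _ ext_submap
  (ext_map_is_linear _).
HB.instance Definition _ := GRing.isMonoidMorphism.Build E E ext_submap
  (conj (ext_map1 (fun m => lin (S m)))
    (ext_mapM (fun i j => ext_linC (S i) (S j)) (fun i => ext_lin_sqr (S i)))).

Lemma ext_submap_gen i : ext_submap (gen i) = lin (S i).
Proof. exact: ext_map_gen. Qed.

Lemma ext_submap_lin v : ext_submap (lin v) = lin (fun x => \sum_m v m * S m x).
Proof.
rewrite /ext_lin linear_sum /=.
under eq_bigr => m _ do rewrite linearZ /= ext_submap_gen scaler_sumr.
rewrite exchange_big /=; apply: eq_bigr => x _; rewrite scaler_suml.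
by apply: eq_bigr => m _; rewrite scalerA.
Qed.

Lemma ext_submap_homog k f : ext_homog k f -> ext_homog k (ext_submap f).
Proof.
have subk := ext_homog_subspace K n k.
move=> hf; rewrite [f]ext_sumE linear_sum; apply: (subspace_sum subk) => F _.
rewrite linearZ /=; have [kF|/hf->] := eqVneq #|F| k; last by rewrite scale0r; case: subk.
apply: (subspaceZ subk); rewrite /ext_submap ext_map_basis -kF cardE.
by apply: ext_homog_prod => m; exact: ext_homog_lin.
Qed.

Lemma ext_submap_prehomog k f : ext_prehomog k f -> ext_prehomog k (ext_submap f).
Proof.
case: k => [/ext_prehomog0->|k /ext_prehomogS hf].
  by rewrite linear0; case: (ext_prehomog_subspace K n 0).
by apply/ext_prehomogS/ext_submap_homog.
Qed.

Lemma ext_submap_tau Theta r a : ext_submap (ext_tau Theta r a) =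
  ext_tau (fun l x => \sum_m Theta l m * S m x) r a.
Proof.
by rewrite /ext_tau rmorph_prod /=; apply: eq_bigr => l _; rewrite ext_submap_lin.
Qed.

End LinearMap.

Lemma ext_gen_linC (i : 'I_n) v : gen i * lin v = - (lin v * gen i).
Proof. by rewrite ext_gen_lin ext_linC. Qed.

Lemma ext_tau_anticomm (i : 'I_n) (Theta : nat -> 'I_n -> K) r a :
  gen i * ext_tau Theta r a = (-1) ^+ a *: (ext_tau Theta r a * gen i).
Proof.
have -> : (-1 : K) ^+ a = (-1) ^+ size (iota r a) by rewrite size_iota.
rewrite /ext_tau; elim: (iota r a) => [|l s IHs].
  by rewrite big_nil mulr1 mul1r scale1r.
rewrite big_cons mulrA ext_gen_linC mulNr -(mulrA (lin (Theta l)) (gen i)) IHs /=.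
by rewrite exprS mulN1r scaleNr -scalerAr mulrA.
Qed.

(** The cone with apex [j] over [L], [i] not being a vertex; for [L] the link of the edge it arises
    as a cokernel in [ext_span_edge]. *)
Definition join_faces L (i j : 'I_n) : {set {set 'I_n}} :=
  [set F : {set 'I_n} | (i \notin F) && (F :\ j \in L)].

Definition join_forms (Theta : nat -> 'I_n -> K) (j : 'I_n) (l : nat) : 'I_n -> K :=
  if l is l'.+1 then Theta l' else fun x => (x == j)%:R.

(** Dividing by the apex, taken as the new form number 0, leads back from the cone to [L]. The other
    forms move up by one index. *)
Lemma ext_span_join L i j k r a Theta D : subspace D ->
  ext_span L k r (ext_tau Theta r a) Theta D ->
  ext_span (join_faces L i j) k r.+1 (ext_tau (join_forms Theta j) r.+1 a)
    (join_forms Theta j) D.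
Proof.
move=> subD sp f /sp[j0 [u [w [[hj nj] hu Dw ->]]]].
have -> : ext_tau (join_forms Theta j) r.+1 a = ext_tau Theta r a.
  by rewrite /ext_tau (iotaDl 1) big_map.
set dec := ext_decomp _ _ _ _ _ _; have subdec : subspace dec by exact: ext_decomp_subspace.
rewrite -addrA; apply: (subspaceD subdec); last first.
  exists 0, (fun l => if l is l'.+1 then u l' else 0), w; split=> //.
  - by split; [case: (ext_homog_subspace K n k) | case: (ext_nonface_subspace K (join_faces L i j))].
  - by case=> [|l] //; case: (ext_prehomog_subspace K n k).
  by rewrite big_ord_recl mulr0 !add0r.
apply: (ext_nonface_sum subdec hj nj) => F kF FL.
have [FJ|FJ] := boolP (F \in join_faces L i j); last first.
  exists (eb F), (fun=> 0), 0; split; first by split; [rewrite -kF; exact: ext_homog_basis | exact: ext_nonface_basis].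
  - by move=> _; case: (ext_prehomog_subspace K n k).
  - by case: subD.
  by rewrite mulr0 addr0 big1 ?addr0 // => l _; rewrite mulr0.
have jF : j \in F.
  apply: contraNT FL => jF; move: FJ; rewrite inE => /andP[_].
  by rewrite (setDidPl _) // disjoint_sym disjoints1.
have [c defF] := basis_gen jF.
exists 0, (fun l => if l is 0%N then c *: eb (F :\ j) else 0), 0; split.
- by split; [case: (ext_homog_subspace K n k) | case: (ext_nonface_subspace K (join_faces L i j))].
- have subp := ext_prehomog_subspace K n k.
  case=> [|l]; last by case: subp.
  apply: (subspaceZ subp); rewrite -kF (cardsD1 j) jF add1n.
  by apply/ext_prehomogS; exact: ext_homog_basis.
- by case: subD.
rewrite big_ord_recl /= big1 => [|l _]; last by rewrite mulr0.
by rewrite mulr0 !addr0 add0r -ext_gen_lin -scalerAr.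
Qed.

Section Edge.
Variables (V : {set 'I_n}) (G : {set {set 'I_n}}) (i j : 'I_n).
Hypotheses (cG : complex_on V G) (ij : i != j) (lc : link_condition G i j).
Local Notation C := (contraction G i j).
Local Notation JL := (join_faces (link G [set i; j]) i j).

(* e_i |-> 0 and e_j |-> e_i + e_j: a section of the contraction. *)
Definition split_edge (m x : 'I_n) : K :=
  if m == i then 0 else (x == m)%:R + ((m == j) && (x == i))%:R.
Local Notation sg := (ext_submap split_edge).

Lemma sg_i : sg (gen i) = 0.
Proof.
rewrite ext_submap_gen /ext_lin big1 // => x _.
by rewrite /split_edge eqxx scale0r.
Qed.

Lemma sg_j : sg (gen j) = gen i + gen j.
Proof.
rewrite ext_submap_gen addrC !ext_gen_lin /ext_lin -big_split /=; apply: eq_bigr => x _.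
by rewrite /split_edge eq_sym (negbTE ij) eqxx -scalerDl.
Qed.

Lemma sg_gen m : m != i -> m != j -> sg (gen m) = gen m.
Proof.
move=> mi mj; rewrite ext_submap_gen ext_gen_lin /ext_lin; apply: eq_bigr => x _.
by rewrite /split_edge (negbTE mi) (negbTE mj) addr0.
Qed.

Lemma sg_basis F : i \notin F -> j \notin F -> sg (eb F) = eb F.
Proof.
move=> iF jF; rewrite ext_basisE rmorph_prod /=; apply: eq_big_seq => m.
by rewrite mem_enum => mF; rewrite sg_gen //; apply: contraTneq mF => ->.
Qed.

Lemma sg_basis_i F : i \in F -> sg (eb F) = 0.
Proof. by case/basis_gen=> c ->; rewrite linearZ /= rmorphM /= sg_i mul0r scaler0. Qed.

Lemma sg_basis_j F : i \notin F -> j \in F -> exists c : K,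
  sg (eb F) = c *: (gen i * eb (F :\ j) + gen j * eb (F :\ j)).
Proof.
move=> iF /basis_gen[c ->]; exists c; rewrite linearZ /= rmorphM /= sg_j.
by rewrite (sg_basis (F := F :\ j)) ?mulrDl // !inE ?eqxx ?negb_and ?iF ?orbT.
Qed.

Lemma gen_sg_basis F : i \notin F -> gen i * sg (eb F) = gen i * eb F.
Proof.
move=> iF; have [jF|jF] := boolP (j \in F); last by rewrite sg_basis.
have [c ->] := basis_gen jF; rewrite linearZ /= rmorphM /= sg_j.
rewrite (sg_basis (F := F :\ j)) ?inE ?eqxx ?negb_and ?iF ?orbT // -!scalerAr.
by rewrite !mulrA mulrDr ext_gen_sqr add0r.
Qed.

(** The image of [sg] together with e_i generates the algebra, since e_j is [sg (gen j)] minus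
    e_i. *)
Lemma sg_decomp k f : ext_homog k f -> exists g1 g2,
  [/\ ext_homog k g1, ext_prehomog k g2 & f = sg g1 + gen i * sg g2].
Proof.
have [h0 hL] := ext_homog_subspace K n k; have [p0 pL] := ext_prehomog_subspace K n k.
pose S f := exists g1 g2,
  [/\ ext_homog k g1, ext_prehomog k g2 & f = sg g1 + gen i * sg g2].
move=> hf; apply: (ext_homog_sum (S := S) _ hf); first split.
- by exists 0, 0; rewrite linear0 mulr0 addr0.
- move=> a f1 f2 [g1 [g2 [h1 h2 ->]]] [g3 [g4 [h3 h4 ->]]].
  exists (a *: g1 + g3), (a *: g2 + g4); split; [exact: hL | exact: pL |].
  by rewrite !linearP /= mulrDr -scalerAr scalerDr addrACA.
move=> F kF; have [iF|iF] := boolP (i \in F).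
  have [c ->] := basis_gen iF; exists 0, (c *: eb (F :\ i)); split=> //.
    apply: (subspaceZ (ext_prehomog_subspace K n k)); rewrite -kF (cardsD1 i) iF.
    by apply/ext_prehomogS; exact: ext_homog_basis.
  by rewrite linear0 add0r linearZ /= -scalerAr gen_sg_basis // !inE eqxx.
have [jF|jF] := boolP (j \in F); last first.
  by exists (eb F), 0; split; rewrite -?kF ?linear0 ?mulr0 ?addr0 ?sg_basis //;
    [exact: ext_homog_basis | rewrite kF].
have [c defF] := basis_gen jF; exists (eb F), (- c *: eb (F :\ j)); split.
- by rewrite -kF; exact: ext_homog_basis.
- apply: (subspaceZ (ext_prehomog_subspace K n k)); rewrite -kF (cardsD1 j) jF.
  by apply/ext_prehomogS; exact: ext_homog_basis.
have jFj : sg (eb (F :\ j)) = eb (F :\ j).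
  by rewrite sg_basis // !inE ?eqxx ?negb_and ?iF ?orbT.
rewrite linearZ /= jFj {2}defF linearZ /= rmorphM /= sg_j jFj -scalerAr scaleNr.
by rewrite mulrDl scalerDr addrAC subrr add0r.
Qed.

(** If [F] contains [j] and is a nonface of the contraction, then neither [F] nor its copy with [i]
    in place of [j] is a face of [G]; these are the two terms of [sg (eb F)]. *)
Lemma sg_nonface k f : ext_homog k f -> ext_nonface C f -> ext_nonface G (sg f).
Proof.
have subN := ext_nonface_subspace K G.
move=> hf nf; apply: (ext_nonface_sum (S := fun f => ext_nonface G (sg f)) _ hf nf).
  by split=> [|a f1 f2 h1 h2]; rewrite ?linear0 ?linearP; [case: subN | exact: (proj2 subN)].
move=> F _; rewrite (mem_contraction cG ij); have [iF|iF] := boolP (i \in F).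
  by rewrite sg_basis_i // => _; case: subN.
rewrite /= negb_or => /andP[FG]; have [jF /=|jF _] := boolP (j \in F); last first.
  by rewrite sg_basis //; exact: ext_nonface_basis.
move=> iFG; have [c ->] := sg_basis_j iF jF; apply: (subspaceZ subN).
by apply: (subspaceD subN); apply: ext_nonface_gen => //; rewrite setD1K.
Qed.

(** The Link condition enters here. If [F] avoids [i] and [j] and is not in the link of the edge,
    then [i |: F] or [j |: F] is a nonface. In the first case e_i e_F is in the ideal; in the second
    e_i e_F is [sg (gen j * eb F)] minus an element of the ideal. *)
Lemma gen_sg_nonface k f : ext_homog k f -> ext_nonface JL f -> exists g f',
  [/\ ext_homog k.+1 g, ext_homog k.+1 f', ext_nonface G f' & gen i * sg f = sg g + f'].
Proof.
have [h0 hL] := ext_homog_subspace K n k.+1; have [n0 nL] := ext_nonface_subspace K G.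
pose S f := exists g f',
  [/\ ext_homog k.+1 g, ext_homog k.+1 f', ext_nonface G f' & gen i * sg f = sg g + f'].
move=> hf nf; apply: (ext_nonface_sum (S := S) _ hf nf); first split.
- by exists 0, 0; split; rewrite ?linear0 ?mulr0 ?addr0.
- move=> a f1 f2 [g1 [g2 [h1 h2 m2 e1]]] [g3 [g4 [h3 h4 m4 e2]]].
  exists (a *: g1 + g3), (a *: g2 + g4); split; [exact: hL | exact: hL | exact: nL |].
  by rewrite !linearP /= mulrDr -scalerAr e1 e2 scalerDr addrACA.
move=> F kF FJ; have [iF|iF] := boolP (i \in F).
  by exists 0, 0; split; rewrite // sg_basis_i // linear0 mulr0 addr0.
have hF : ext_homog k.+1 (gen i * eb F) by rewrite -kF; exact: ext_homog_gen_basis.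
have iFj : i \notin F :\ j by rewrite !inE negb_and iF orbT.
have jFj : j \notin F :\ j by rewrite !inE eqxx.
rewrite /S gen_sg_basis //; move: FJ; rewrite inE iF (mem_link2 G) iFj jFj /=.
have [jF|jF] := boolP (j \in F).
  rewrite setD1K // => FG; exists 0, (gen i * eb F).
  by split; rewrite // ?linear0 ?add0r //; exact: ext_nonface_gen.
have -> : F :\ j = F by apply/setDidPl; rewrite disjoint_sym disjoints1.
rewrite (link_edge cG lc) // negb_and.
have [iFG /=|iFG _] := boolP (i |: F \in G); last first.
  exists 0, (gen i * eb F).
  by split; rewrite // ?linear0 ?add0r //; exact: ext_nonface_gen.
move=> jFG; exists (gen j * eb F), (- (gen j * eb F)); split.
- by rewrite -kF; exact: ext_homog_gen_basis.
- rewrite -scaleN1r; apply: (subspaceZ (ext_homog_subspace K n k.+1)).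
  by rewrite -kF; exact: ext_homog_gen_basis.
- rewrite -scaleN1r; apply: (subspaceZ (ext_nonface_subspace K G)).
  exact: ext_nonface_gen.
by rewrite rmorphM /= sg_j sg_basis // mulrDl addrK.
Qed.

Definition edge_forms (Theta : nat -> 'I_n -> K) l x := \sum_m Theta l m * split_edge m x.

Definition edge_space (D1 D2 : E -> Prop) w : Prop :=
  exists w1 w2, [/\ D1 w1, D2 w2 & w = sg w1 + gen i * sg w2].

(* [K[C] -> K[G], x_j |-> x_i + x_j] has cokernel [K[j * lk(ij)]] shifted by one,
   and it is linear over the subalgebra generated by its image. *)
Lemma ext_span_edge k r a Theta D1 D2 : subspace D2 ->
  ext_span C k r (ext_tau Theta r a) Theta D1 ->
  (forall k', k = k'.+1 -> ext_span JL k' r (ext_tau Theta r a) Theta D2) ->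
  ext_span G k r (ext_tau (edge_forms Theta) r a) (edge_forms Theta) (edge_space D1 D2).
Proof.
move=> subD2 spC spL f /sg_decomp[g1 [g2 [hg1 hg2 ->]]].
(* The part involving e_i is reduced first, through the link. What remains, [sg g], is then added to
   [sg g1] and treated in the contraction. *)
have [g [f' [u2 [w2 [hg [hf' nf' hu2] Dw2 def2]]]]] : exists g f' (u2 : nat -> E) w2,
    [/\ ext_homog k g, [/\ ext_homog k f', ext_nonface G f' & forall l, ext_prehomog k (u2 l)], D2 w2
      & gen i * sg g2 = sg g + f' + \sum_(l < r) lin (edge_forms Theta l) * u2 l +
         ext_tau (edge_forms Theta) r a * (gen i * sg w2)].
  case: k hg2 {spC g1 hg1} spL => [/ext_prehomog0-> _|k /ext_prehomogS hg2 spL].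
    have [h0 _] := ext_homog_subspace K n 0; have [n0 _] := ext_nonface_subspace K G.
    exists 0, 0, (fun=> 0), 0; split=> //; first by split=> // _; case: (ext_prehomog_subspace K n 0).
      by case: subD2.
    rewrite linear0 !mulr0 !addr0 add0r big1 // => l _; by rewrite mulr0.
  have [l0 [u [w [[hl nl] hu Dw ->]]]] := spL k erefl g2 hg2.
  have [g [f' [hg hf' nf' e]]] := gen_sg_nonface hl nl.
  (* The signs come from moving e_i past one linear form, respectively past the [a] factors of
     [tau]. *)
  exists g, f', (fun l => - (gen i * sg (u l))), ((-1) ^+ a *: w); split=> //.
  - split=> // l; rewrite -scaleN1r; apply: (subspaceZ (ext_prehomog_subspace K n _)).
    apply/ext_prehomogS; apply: ext_prehomog_mul; first exact: ext_homog_gen.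
    exact: ext_submap_prehomog.
  - exact: subspaceZ.
  rewrite !linearD /= linear_sum !mulrDr /= e; congr (_ + _ + _).
    rewrite mulr_sumr; apply: eq_bigr => l _; rewrite rmorphM /= ext_submap_lin.
    by rewrite mulrA ext_gen_linC mulNr mulrN -mulrA.
  rewrite rmorphM /= ext_submap_tau linearZ /= mulrA ext_tau_anticomm.
  by rewrite -scalerAl -scalerAr -scalerAr mulrA.
have [|c [u1 [w1 [[hc nc] hu1 Dw1 def1]]]] := spC (g1 + g).
  by apply: (subspaceD (ext_homog_subspace K n k)).
exists (sg c + f'), (fun l => sg (u1 l) + u2 l), (sg w1 + gen i * sg w2); split.
- split; first by apply: (subspaceD (ext_homog_subspace K n k)) => //; exact: ext_submap_homog.
  by apply: (subspaceD (ext_nonface_subspace K G)) => //; exact: (sg_nonface hc).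
- move=> l; apply: (subspaceD (ext_prehomog_subspace K n k)) => //.
  exact: ext_submap_prehomog.
- by exists w1, w2.
rewrite def2 -!addrA (addrA (sg g1)) -linearD def1 !linearD /= linear_sum /= rmorphM /=.
rewrite ext_submap_tau.
under [X in _ = _ + (_ + (X + _))]eq_bigr => l _ do rewrite mulrDr.
rewrite big_split /= mulrDr.
rewrite (eq_bigr (fun l : 'I_r => lin (edge_forms Theta l) * sg (u1 l))); last first.
  by move=> l _; rewrite rmorphM /= ext_submap_lin.
rewrite -/(edge_forms Theta).
set A := sg c; set B := \sum_(l < r) _; set B2 := \sum_(l < r) _.
by rewrite -!addrA; congr (_ + _); rewrite [RHS]addrCA; congr (_ + _); rewrite [LHS]addrCA; congr (_ + _); rewrite [LHS]addrCA.
Qed.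

End Edge.
End ExteriorInduction.

(** Stands for dimension at most [h], for a subspace given as a predicate. *)
Definition spanned (K : fieldType) (V : lmodType K) h (D : V -> Prop) : Prop :=
  exists M : nat -> V, forall w, D w -> exists c : nat -> K, w = \sum_(l < h) c l *: M l.
Arguments spanned [K V] h%_N D.

Lemma spanned0 (K : fieldType) (V : lmodType K) (h : nat) (D : V -> Prop) :
  (forall w, D w -> w = 0) -> spanned h D.
Proof.
move=> D0; exists (fun=> 0) => w /D0->; exists (fun=> 0).
by rewrite big1 // => l _; rewrite scaler0.
Qed.

Lemma spanned_add (K : fieldType) (V : lmodType K) h1 h2 (D1 D2 D : V -> Prop)
    (f1 : {linear V -> V}) (f2 : V -> V) :
  (forall m c (M : nat -> V), f2 (\sum_(l < m) c l *: M l) = \sum_(l < m) c l *: f2 (M l)) ->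
  spanned h1 D1 -> spanned h2 D2 ->
  (forall w, D w -> exists w1 w2, [/\ D1 w1, D2 w2 & w = f1 w1 + f2 w2]) ->
  spanned (h1 + h2) D.
Proof.
move=> f2S [M1 s1] [M2 s2] sD.
exists (fun l => if (l < h1)%N then f1 (M1 l) else f2 (M2 (l - h1)%N)) => w.
case/sD=> w1 [w2 [/s1[c1 ->] /s2[c2 ->] ->]].
exists (fun l => if (l < h1)%N then c1 l else c2 (l - h1)%N).
rewrite big_split_ord /= linear_sum f2S; congr (_ + _); apply: eq_bigr => l _ /=.
  by rewrite ltn_ord linearZ.
by rewrite ltnNge leq_addr /= addKn.
Qed.

(** * Exterior case: the Lefschetz property along a decomposition *)

Section ExteriorInduction.
Variables (K : fieldType) (n : nat).
Hypothesis Kinf : infinite_field K.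
Local Notation E := (exterior K n).
Local Notation eb := (ext_basis K).
Local Notation gen := (ext_gen K).
Local Notation lin := (@ext_lin K n).
Implicit Types (F H : {set 'I_n}) (G L : {set {set 'I_n}}) (f g : E).

Lemma ext_oneE F : (1 : E) F = (F == set0)%:R.
Proof. by rewrite -[1]/(eb set0) ffunE. Qed.

Lemma gens_mul_basis (s : seq 'I_n) H : uniq s -> (forall x, x \in s -> x \notin H) ->
  exists2 c : K, c != 0 & (\prod_(x <- s) gen x) * eb H = c *: eb ([set x in s] :|: H).
Proof.
elim: s => [|x s IHs] /=.
  exists 1; rewrite ?oner_eq0 // big_nil mul1r scale1r; congr eb.
  by apply/setP=> y; rewrite !inE.
case/andP=> xs us sH; have [//|y ys|c c0 e] := IHs.
  by apply: sH; rewrite inE ys orbT.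
rewrite big_cons -mulrA e -scalerAr gen_mul_basis !inE (negbTE xs).
rewrite (negbTE (sH x _)) ?mem_head //= scalerA.
eexists; last by congr (_ *: eb _); apply/setP=> y; rewrite !inE orbA.
by rewrite mulf_neq0 // signr_eq0.
Qed.

(** The forms are the vertices of [V] in order. With [k = a + p], the first d + 1 - k of them are
    killed, and the only monomial of degree [k] left on [V] is the product of the last [k] vertices:
    [a] of them make up [tau], and the other [p] span [D]. *)
Lemma ext_span_boundary (V : {set 'I_n}) d p a : #|V| = d.+1 -> (a + p <= d)%N ->
  exists (Theta : nat -> 'I_n -> K) (D : E -> Prop),
    [/\ subspace D, forall w, D w -> ext_homog p w, spanned 1 D &
    ext_span [set F : {set 'I_n} | F \proper V] (a + p) (d - p + 1 - a)
      (ext_tau Theta (d - p + 1 - a) a) Theta D].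
Proof.
move=> Vd le_apd; set G := [set F | _]; set r := (d - p + 1 - a)%N; set k := (a + p)%N.
have rk : (r + k = d.+1)%N by rewrite /r /k; lia.
have [x0 x0V] : exists x0, x0 \in V by apply/card_gt0P; rewrite Vd.
pose s := enum V; pose v l := nth x0 s l.
have sz : size s = d.+1 by rewrite -cardE.
have us : uniq s by exact: enum_uniq.
pose Theta (l : nat) (x : 'I_n) : K := (x == v l)%:R.
have linT l : lin (Theta l) = gen (v l) by rewrite ext_gen_lin.
pose V3 := [set x in drop (r + a) s].
have cV3 : #|V3| = p.
  by rewrite cardsE (card_uniqP _) ?drop_uniq // size_drop sz -rk /k; lia.
pose D (w : E) := exists c : K, w = c *: eb V3.
have subD : subspace D.
  split=> [|b w w' [c ->] [c' ->]]; first by exists 0; rewrite scale0r.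
  by exists (b * c + c'); rewrite scalerDl scalerA.
exists Theta, D; split=> //.
- by move=> w [c ->]; rewrite -cV3; apply: (subspaceZ (ext_homog_subspace K n _)); exact: ext_homog_basis.
- by exists (fun=> eb V3) => w [c ->]; exists (fun=> c); rewrite big_ord1.
apply: ext_span_basis => // F kF.
have [h0 _] := ext_homog_subspace K n k; have [p0 _] := ext_prehomog_subspace K n k.
have [n0 _] := ext_nonface_subspace K G; have [D0 _] := subD.
have [FG|FG] := boolP (F \in G); last first.
  exists (eb F), (fun=> 0), 0; split=> //.
    by split; [rewrite -kF; exact: ext_homog_basis | exact: ext_nonface_basis].
  by rewrite mulr0 addr0 big1 ?addr0 // => l _; rewrite mulr0.
have sFV : F \subset V by move: FG; rewrite inE => /proper_sub.
have [/existsP[l lF]|] := boolP [exists l : 'I_r, v l \in F].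
  have [c defF] := basis_gen K lF.
  exists 0, (fun l' => if l' == l :> nat then c *: eb (F :\ v l) else 0), 0; split=> //.
    move=> l'; case: eqP => // _; apply: (subspaceZ (ext_prehomog_subspace K n _)).
    by rewrite -kF (cardsD1 (v l)) lF; apply/ext_prehomogS; exact: ext_homog_basis.
  rewrite mulr0 addr0 add0r (bigD1 l) //= eqxx big1 ?addr0.
    by rewrite linT -scalerAr.
  by move=> l' /negbTE l'l; rewrite (inj_eq val_inj) l'l mulr0.
rewrite negb_exists => /forallP noF.
have tau_eq : ext_tau Theta r a = \prod_(x <- take a (drop r s)) gen x.
  have -> : take a (drop r s) = map v (iota r a).
    apply: (@eq_from_nth _ x0) => [|l].
      by rewrite size_map size_iota size_take size_drop sz; case: ifP => //; lia.
    rewrite size_take size_drop sz => lla; have la : (l < a)%N by case: ifP lla => //; lia.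
    by rewrite nth_take // nth_drop (nth_map 0%N) ?size_iota // nth_iota.
  by rewrite big_map /ext_tau; apply: eq_bigr => l _; rewrite linT.
have [||c c0 e] := @gens_mul_basis (take a (drop r s)) V3.
- by rewrite take_uniq // drop_uniq.
- move=> x xt; rewrite inE; apply/negP => xd.
  have : uniq (drop r s) by rewrite drop_uniq.
  rewrite -(cat_take_drop a (drop r s)) cat_uniq => /and3P[_ /hasPn + _].
  by move=> /(_ x); rewrite drop_drop addnC => /(_ xd); rewrite /= xt.
exists 0, (fun=> 0), (c^-1 *: eb V3); split=> //; first by exists c^-1.
rewrite add0r big1 ?add0r => [|l _]; last by rewrite mulr0.
rewrite -scalerAr tau_eq e scalerA mulVf // scale1r; congr eb.
have -> : [set x in take a (drop r s)] :|: V3 = [set x in drop r s].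
  by apply/setP=> x; rewrite !inE -mem_cat [(r + a)%N]addnC -drop_drop cat_take_drop.
apply/eqP; rewrite eqEcard; apply/andP; split.
  apply/subsetP=> x xF; rewrite inE.
  have xs : x \in s by rewrite mem_enum (subsetP sFV).
  have := xs; rewrite -{1}(cat_take_drop r s) mem_cat => /orP[|//] /(nthP x0)[l].
  rewrite size_take sz => llt xl; have lr : (l < r)%N by case: ifP llt => //; lia.
  have := noF (Ordinal lr); rewrite /v /= -(nth_take _ lr) xl xF //.
by rewrite cardsE (card_uniqP _) ?drop_uniq // size_drop sz kF -rk addKn.
Qed.

Lemma sedh_bound d G hh F : sedh d G hh -> F \in G -> (#|F| <= d)%N.
Proof.
case=> {d G hh} [|V d Vd|V G i j d h1 h2 _ _ _ _ le _ _]; last exact: le.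
  by rewrite inE => /eqP->; rewrite cards0.
by rewrite inE => /proper_card; rewrite Vd.
Qed.

(** For [a = 0] this is spanning by [hh p] elements modulo d - p + 1 forms; for [a = d - 2p] it is
    surjectivity from degree [p] modulo p + 1 forms. Passing to the link of an edge replaces [d],
    [p] by [d - 2], [p - 1], which preserves both conditions and lowers the number of forms by one,
    the one that the join adds again. *)
Theorem ext_span_sedh d G hh p a : sedh d G hh -> (p <= d)%N ->
  (a == 0%N) || (a + p.*2 == d)%N ->
  exists (Theta : nat -> 'I_n -> K) (D : E -> Prop),
    [/\ subspace D, forall w, D w -> ext_homog p w, spanned (hh p) D &
    ext_span G (a + p) (d - p + 1 - a) (ext_tau Theta (d - p + 1 - a) a) Theta D].
Proof.
move=> sG; elim: sG p a => {d G hh} [|V d Vd|V G i j d h1 h2 cG lij ijG lc leG sC IH1 sL IH2] p a le_pd ap.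
- have [-> ->] : p = 0%N /\ a = 0%N by move: le_pd ap; case: p => // _; case: a.
  pose D (w : E) := exists c : K, w = c *: 1.
  exists (fun _ _ => 0), D; split.
  + split=> [|b w w' [c ->] [c' ->]]; first by exists 0; rewrite scale0r.
    by exists (b * c + c'); rewrite scalerDl scalerA.
  + by move=> w [c ->]; apply: (subspaceZ (ext_homog_subspace K n _)); exact: ext_homog1.
  + by exists (fun=> 1) => w [c ->]; exists (fun=> c); rewrite big_ord1.
  move=> f hf; exists 0, (fun=> 0), f; split.
  + by split; [case: (ext_homog_subspace K n 0) | case: (ext_nonface_subspace K [set set0 : {set 'I_n}])].
  + by move=> _; case: (ext_prehomog_subspace K n 0).
  + exists (f set0); apply/ffunP=> F; rewrite ext_scaleE.
    have [F0|F0] := eqVneq F set0; first by rewrite F0 ext_oneE eqxx mulr1.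
    by rewrite ext_oneE (negbTE F0) mulr0 hf ?cards_eq0.
  rewrite /ext_tau big_nil mul1r big1 ?addr0 ?add0r // => l _; by rewrite mulr0.
- have [|Theta [D [? ? ? ?]]] := @ext_span_boundary V d p a Vd.
    by case/orP: ap => /eqP; lia.
  by exists Theta, D; rewrite le_pd.
have ij : i != j by rewrite -(inj_eq val_inj) neq_ltn lij.
set r := (d.+2 - p + 1 - a)%N; set k := (a + p)%N.
have [Th1 [D1 [subD1 hD1 sD1 sp1]]] := IH1 p a le_pd ap.
have [Th2 [D2 [subD2 hD2 sD2 sp2]]] : exists (Th2 : nat -> 'I_n -> K) (D2 : E -> Prop), [/\ subspace D2,
    forall w, D2 w -> ext_prehomog p w, spanned (if p is p'.+1 then h2 p' else 0) D2 &
    forall k', k = k'.+1 -> ext_span (join_faces (link G [set i; j]) i j) k' r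
      (ext_tau Th2 r a) Th2 D2].
  (* Above its dimension the link has no faces, so every form lies in its ideal and [D] may be
     zero. *)
  have large k' : (d < k')%N -> ext_span (link G [set i; j]) k' r.-1
      (ext_tau (fun _ _ => 0 : K) r.-1 a) (fun _ _ => 0) (fun w => w = 0).
    move=> lt_dk' f hf; exists f, (fun=> 0), 0; split=> //.
    - by split=> // F FL; apply: hf; have := sedh_bound sL FL; rewrite neq_ltn; lia.
    - by move=> _; case: (ext_prehomog_subspace K n k').
    by rewrite big1 => [|l _]; rewrite mulr0 ?addr0.
  have sub0 : subspace (fun w : E => w = 0).
    by split=> // b u v -> ->; rewrite scaler0 addr0.
  have r1 : r = r.-1.+1 by rewrite /r; case/orP: ap => /eqP; lia.
  case defp: p => [|p'].
    exists (join_forms (fun _ _ => 0) j), (fun w => w = 0); split=> //.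
    - by move=> w ->; case: (ext_prehomog_subspace K n 0).
    - exact: spanned0.
    move=> k' kk'; rewrite r1; apply: ext_span_join => //; apply: large.
    by move: kk'; rewrite /k; case/orP: ap => /eqP; lia.
  have [le_p'd|lt_dp'] := leqP p' d; last first.
    exists (join_forms (fun _ _ => 0) j), (fun w => w = 0); split=> //.
    - by move=> w ->; case: (ext_prehomog_subspace K n p'.+1).
    - exact: spanned0.
    by move=> k' kk'; rewrite r1; apply: ext_span_join => //; apply: large; move: kk'; rewrite /k; lia.
  have [|Th [D [subD hD sD sp]]] := IH2 p' a le_p'd.
    by case/orP: ap => /eqP; rewrite ?defp; lia.
  exists (join_forms Th j), D; split=> //.
  move=> k' kk'; have -> : r = (d - p' + 1 - a).+1 by rewrite /r defp; case/orP: ap => /eqP; lia.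
  have -> : k' = (a + p')%N by move: kk'; rewrite /k; lia.
  exact: ext_span_join.
(* The contraction and the link come with different forms; both conditions are open and nonempty, so
   they have a common solution. *)
have [Th [spC spL]] : exists Th, ext_span (contraction G i j) k r (ext_tau Th r a) Th D1 /\
    forall k', k = k'.+1 -> ext_span (join_faces (link G [set i; j]) i j) k' r
      (ext_tau Th r a) Th D2.
  case defk: k => [|k']; first by exists Th1; split=> //; rewrite -defk.
  have [||Th [s1 s2]] := ext_span_common (k' := k') Kinf subD1 subD2 _ _ sp1 (sp2 k' defk).
  - by move=> Th w Dw; apply: (@ext_homog_mul K n a p); [exact: ext_homog_tau | exact: (hD1 w Dw)].
  - move=> Th w Dw; have : ext_prehomog k'.+1 (ext_tau Th r a * w); last by move/ext_prehomogS.
    by rewrite -defk; apply: (@ext_homog_premul K n a p); [exact: ext_homog_tau | exact: (hD2 w Dw)].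
  by exists Th; rewrite -defk; split=> // k'' ; rewrite defk => -[<-].
exists (edge_forms i j Th), (edge_space i j D1 D2); split.
- have [D10 D1L] := subD1; have [D20 D2L] := subD2; split.
    by exists 0, 0; rewrite !linear0 mulr0 addr0.
  move=> b u v [u1 [u2 [Du1 Du2 ->]]] [v1 [v2 [Dv1 Dv2 ->]]].
  exists (b *: u1 + v1), (b *: u2 + v2); split; [exact: D1L | exact: D2L |].
  by rewrite !linearP /= mulrDr -scalerAr scalerDr addrACA.
- move=> w [w1 [w2 [Dw1 Dw2 ->]]]; have h1w := hD1 _ Dw1; have h2w := hD2 _ Dw2; apply: (subspaceD (ext_homog_subspace K n p)).
    exact: ext_submap_homog.
  by apply: ext_prehomog_mul; [exact: ext_homog_gen | exact: ext_submap_prehomog].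
- apply: (spanned_add (f1 := ext_submap (split_edge K i j))
    (f2 := fun w => gen i * ext_submap (split_edge K i j) w) _ sD1 sD2) => // m c M.
  rewrite linear_sum mulr_sumr; apply: eq_bigr => l _.
  by rewrite linearZ /= scalerAr.
by apply: (ext_span_edge cG ij lc subD2 spC).
Qed.

End ExteriorInduction.

(** * The reverse lexicographic order *)

Section Revlex.
Variable n : nat.
Implicit Types a b c : 'I_n -> nat.

Definition revlex_lt a b : bool :=
  [exists i : 'I_n, (b i < a i)%N && [forall j : 'I_n, (i < j)%N ==> (a j == b j)]].

Lemma revlex_ltP a b : reflect
  (exists i : 'I_n, (b i < a i)%N /\ forall j : 'I_n, (i < j)%N -> a j = b j) (revlex_lt a b).
Proof.
apply: (iffP existsP) => [[i /andP[ba /forallP eqab]]|[i [ba eqab]]]; exists i.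
  by split=> // j ij; have /implyP/(_ ij)/eqP := eqab j.
by rewrite ba; apply/forallP => j; apply/implyP=> /eqab->.
Qed.

Lemma degrevlexE a b : (\sum_i a i = \sum_i b i)%N -> degrevlex_lt a b <-> revlex_lt a b.
Proof.
move=> eqab; split=> [|/revlex_ltP h]; last by right.
by case=> [|[_ h]]; [rewrite eqab ltnn | apply/revlex_ltP].
Qed.

Lemma revlex_irr a : revlex_lt a a = false.
Proof. by apply/revlex_ltP => -[i []]; rewrite ltnn. Qed.

Lemma revlex_trans b a c : revlex_lt a b -> revlex_lt b c -> revlex_lt a c.
Proof.
move=> /revlex_ltP[i [ba eqab]] /revlex_ltP[j [cb eqbc]]; apply/revlex_ltP.
have [ij|ji|/val_inj ij] := ltngtP i j.
- exists j; split=> [|k jk]; first by rewrite eqab.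
  by rewrite eqab ?eqbc // (ltn_trans ij).
- exists i; split=> [|k ik]; first by rewrite -eqbc.
  by rewrite eqab ?eqbc // (ltn_trans ji).
exists j; split=> [|k jk]; first by rewrite (ltn_trans cb) // -ij.
by rewrite eqab ?eqbc // ij.
Qed.

Lemma revlex_total a b : ~ (a =1 b) -> revlex_lt a b || revlex_lt b a.
Proof.
move=> neab; have [i0 nei0] : exists i, a i != b i.
  apply/existsP; apply: contra_notT neab; rewrite negb_exists => /forallP h i.
  by apply/eqP; have := h i; rewrite negbK.
case: (@arg_maxnP _ i0 (fun i => a i != b i) val nei0) => i nei imax.
have eqab (j : 'I_n) : (i < j)%N -> a j = b j.
  by move=> ij; apply/eqP/negPn/negP => /imax; rewrite /= leqNgt ij.
move: nei; rewrite neq_ltn => /orP[ab|ba]; apply/orP; [right|left]; apply/revlex_ltP.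
  by exists i; split=> // j /eqab.
by exists i.
Qed.

Lemma revlex_addr a b c : revlex_lt (fun i => a i + c i)%N (fun i => b i + c i)%N = revlex_lt a b.
Proof.
apply: eq_existsb => i; rewrite ltn_add2r; congr (_ && _).
by apply: eq_forallb => j; rewrite eqn_add2r.
Qed.

Lemma degrevlex_addr a b c : degrevlex_lt a b ->
  degrevlex_lt (fun i => a i + c i)%N (fun i => b i + c i)%N.
Proof.
rewrite /degrevlex_lt !big_split /= ltn_add2r.
case=> [|[-> [i [ba eqab]]]]; [by left | right; split=> //].
by exists i; rewrite ltn_add2r; split=> // j /eqab->.
Qed.

(* The monomials divisible by a variable of index at least [s], or by the
   [e]-th power of the variable [s - 1], are an initial segment. *)
Lemma revlex_down a b (s e : nat) : revlex_lt a b ->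
  (exists2 i : 'I_n, (s <= i)%N & (0 < b i)%N) \/ (exists2 i : 'I_n, i.+1 = s & (e <= b i)%N) ->
  (exists2 i : 'I_n, (s <= i)%N & (0 < a i)%N) \/ (exists2 i : 'I_n, i.+1 = s & (e <= a i)%N).
Proof.
move=> /revlex_ltP[j [ba eqab]].
have [sj|js] := leqP s j; first by left; exists j; rewrite // (leq_ltn_trans _ ba).
case=> [[i si bi]|[i si bi]].
  by left; exists i; rewrite // eqab // (leq_trans js).
right; exists i => //; have [ji|] := ltnP j i; first by rewrite eqab.
rewrite -ltnS si leq_eqVlt ltnNge js orbF => /eqP sj.
suff -> : i = j by rewrite (leq_trans _ (ltnW ba)) // (_ : j = i) //; apply/val_inj/eqP; rewrite -eqSS si sj.
by apply/val_inj/eqP; rewrite -eqSS si sj.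
Qed.

End Revlex.

Definition ind n (F : {set 'I_n}) (i : 'I_n) : nat := i \in F.

Lemma sum_ind n (F : {set 'I_n}) : (\sum_i ind F i)%N = #|F|.
Proof. by rewrite -sum1_card [RHS]big_mkcond; apply: eq_bigr => i _; rewrite /ind; case: (_ \in _). Qed.

Lemma revlex_set_total n (F H : {set 'I_n}) : F != H ->
  revlex_lt (ind F) (ind H) || revlex_lt (ind H) (ind F).
Proof.
move=> FH; apply: revlex_total => eqFH; case/eqP: FH; apply/setP=> i.
by have := eqFH i; rewrite /ind; case: (i \in F); case: (i \in H).
Qed.

Section IdealGen.
Variable R : nzRingType.

Lemma ideal_gen_min (X I : set R) : is_ideal I -> (forall x, X x -> I x) ->
  forall x, ideal_gen X x -> I x.
Proof. by move=> idI XI x; apply; split. Qed.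

Lemma sub_ideal_gen (X : set R) x : X x -> ideal_gen X x.
Proof. by move=> Xx I [_]; apply. Qed.

Lemma ideal_gen_ideal (X : set R) : is_ideal (ideal_gen X).
Proof.
split=> [I [[]]//|f g fI gI I hI|a f fI].
  by have [[_ ID _] _] := hI; apply: ID; [exact: fI | exact: gI].
by split=> I hI; have [[_ _ IM] _] := hI; have [] := IM a f (fI I hI).
Qed.

End IdealGen.

(** * Exterior generic initial ideals and standard sets *)

Section ExteriorGin.
Variables (K : fieldType) (n : nat).
Local Notation E := (exterior K n).
Local Notation eb := (ext_basis K).
Local Notation gen := (ext_gen K).
Local Notation lin := (@ext_lin K n).
Implicit Types (F H : {set 'I_n}) (G : {set {set 'I_n}}) (f g : E).

Lemma ext_face_idealE G f : (forall F H, F \in G -> H \subset F -> H \in G) ->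
  ext_face_ideal G f <-> ext_nonface G f.
Proof.
move=> clG; split.
  apply: ideal_gen_min => [|g [F FG ->]]; last exact: ext_nonface_basis.
  have [n0 nL] := ext_nonface_subspace K G; split=> //.
    by move=> g h ng nh; apply: (subspaceD (ext_nonface_subspace K G)).
  by move=> a g ng; split; [exact: ext_nonface_mull | exact: ext_nonface_mul].
move=> nf; have [I0 ID IM] := ideal_gen_ideal [set f | exists2 F, F \notin G & f = eb F]%classic.
rewrite [f]ext_sumE; apply: (big_ind (fun g => ideal_gen _ g)) => // F _.
have [FG|FG] := boolP (F \in G); first by rewrite nf // scale0r.
have -> : f F *: eb F = eb F * (f F *: (1 : E)) by rewrite -[RHS]scalerAr mulr1.
by apply: (proj2 (IM _ _ _)); apply: sub_ideal_gen; exists F.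
Qed.

Definition mx_forms (A : 'M[K]_n) (m x : 'I_n) : K := A x m.

Lemma ext_actE (A : 'M[K]_n) f : ext_act A f = ext_submap (mx_forms A) f.
Proof. by []. Qed.

Lemma ext_act_gen (A : 'M[K]_n) i : ext_act A (gen i) = lin (mx_forms A i).
Proof. by rewrite ext_actE ext_submap_gen. Qed.

Lemma eq_ext_linear (h1 h2 : {linear E -> E}) :
  (forall F, h1 (eb F) = h2 (eb F)) -> forall f, h1 f = h2 f.
Proof.
move=> eqh f; rewrite [f]ext_sumE !linear_sum; apply: eq_bigr => F _.
by rewrite !linearZ eqh.
Qed.

Lemma ext_act_comp (A B : 'M[K]_n) f : ext_act A (ext_act B f) = ext_act (A *m B) f.
Proof.
apply: (eq_ext_linear (h1 := ext_submap (mx_forms A) \o ext_submap (mx_forms B))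
  (h2 := ext_submap (mx_forms (A *m B)))) => F /=.
rewrite ext_basisE !rmorph_prod /=; apply: eq_bigr => i _.
rewrite !ext_submap_gen ext_submap_lin /ext_lin; apply: eq_bigr => x _; congr (_ *: _).
by rewrite /mx_forms mxE; apply: eq_bigr => m _; rewrite mulrC.
Qed.

Lemma ext_act1 f : ext_act 1%:M f = f.
Proof.
apply: (eq_ext_linear (h1 := ext_submap (mx_forms 1%:M)) (h2 := idfun)) => F /=.
rewrite ext_basisE rmorph_prod /=; apply: eq_bigr => i _.
rewrite ext_submap_gen ext_gen_lin /ext_lin; apply: eq_bigr => x _; congr (_ *: _).
by rewrite /mx_forms mxE.
Qed.

End ExteriorGin.

Lemma generically_mono (K : fieldType) n (P Q : 'M[K]_n -> Prop) :
  (forall A, A \in unitmx -> P A -> Q A) -> generically P -> generically Q.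
Proof.
move=> PQ [p [ex Pp]]; exists p; split=> // A pA.
by apply: PQ; [case: pA | exact: Pp].
Qed.

Section ExteriorStd.
Variables (K : fieldType) (n : nat) (G : {set {set 'I_n}}).
Local Notation E := (exterior K n).
Local Notation eb := (ext_basis K).
Implicit Types (F H : {set 'I_n}) (f : E) (A : 'M[K]_n).
Hypothesis clG : forall F H, F \in G -> H \subset F -> H \in G.

Definition ext_image A : classical_sets.set E := [set ext_act A f | f in ext_face_ideal G]%classic.

Lemma ext_imageP A g : ext_image A g <-> exists2 f, ext_nonface G f & g = ext_act A f.
Proof.
split=> [[f /(ext_face_idealE _ clG) nf <-]|[f nf ->]]; first by exists f.
by exists f => //; apply/ext_face_idealE.
Qed.

Lemma ext_image_mul A f g : A \in unitmx -> ext_image A f -> ext_image A (f * g).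
Proof.
move=> Au /ext_imageP[f0 nf ->]; apply/ext_imageP; exists (f0 * ext_act (invmx A) g).
  exact: ext_nonface_mul.
rewrite [RHS]ext_actE rmorphM /= -!ext_actE ext_act_comp mulmxV // ext_act1 //.
Qed.

Definition ext_initial_set A F : Prop := exists2 f, ext_image A f & ext_initial f F.

(** Multiplication by [eb (F :\: H)] kills the monomials meeting [F :\: H] and translates the others
    by one exponent vector, which preserves the order. *)
Lemma ext_initial_set_up A F H : A \in unitmx -> ext_initial_set A H -> H \subset F ->
  ext_initial_set A F.
Proof.
move=> Au [f Jf [fH ltH]] HF; exists (f * eb (F :\: H)); first exact: ext_image_mul.
have DD (A1 B1 : {set 'I_n}) : B1 \subset A1 -> A1 :\: (A1 :\: B1) = B1.
  by move/setIidPr=> e; rewrite setDDr setDv set0U.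
have mulE F1 : (f * eb (F :\: H)) F1 = if F :\: H \subset F1
    then (-1) ^+ inversions (F1 :\: (F :\: H)) (F :\: H) * f (F1 :\: (F :\: H)) else 0.
  rewrite ext_mulE; case: ifP => sub.
    rewrite (bigD1 (F1 :\: (F :\: H))) ?subsetDl //= big1 => [|A1 /andP[A1F neq]].
      by rewrite DD // ffunE eqxx mulr1 addr0.
    rewrite ffunE; case: eqP => [e|]; last by rewrite !mulr0.
    by case/eqP: neq; rewrite -e DD.
  rewrite big1 // => A1 A1F; rewrite ffunE; case: eqP => [e|]; last by rewrite !mulr0.
  by rewrite -e subsetDl in sub.
have FH : F :\: (F :\: H) = H by rewrite setDDr setDv set0U; apply/setIidPr.
split; first by rewrite mulE subsetDl FH mulf_neq0 // signr_eq0.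
move=> F1; rewrite mulE; case: ifP; last by rewrite eqxx.
set H1 := F1 :\: (F :\: H) => sub; rewrite mulf_eq0 negb_or => /andP[_ fH1] F1F.
have dis : [disjoint H1 & F :\: H] by rewrite -setI_eq0 /H1 setIDAC -setIDA setDv setI0.
have dis' : [disjoint H & F :\: H] by rewrite -setI_eq0 setIDA setIC -setIDA setDv setI0.
have F1E : F1 = H1 :|: (F :\: H).
  by rewrite /H1 -{1}(setID F1 (F :\: H)) (setIidPr sub) setUC.
have FE : F = H :|: (F :\: H) by rewrite -{1}(setID F H) (setIidPr HF).
have H1H : H1 != H by apply: contraNneq F1F => e; rewrite F1E e -FE.
have indU F2 (i : 'I_n) : [disjoint F2 & F :\: H] ->
    (i \in F2 :|: F :\: H : nat) = ((i \in F2) + (i \in F :\: H))%N.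
  move=> d; rewrite in_setU; case: (boolP (i \in F2)) => // iF2.
  by rewrite (disjointFr d iF2).
have -> : (fun i => i \in F1 : nat) = (fun i => (i \in H1) + (i \in F :\: H))%N.
  by apply/funext=> i; rewrite F1E indU.
have -> : (fun i => i \in F : nat) = (fun i => (i \in H) + (i \in F :\: H))%N.
  by apply/funext=> i; rewrite {1}FE indU.
by apply: degrevlex_addr; exact: ltH.
Qed.

Lemma ext_in_basis A F : A \in unitmx ->
  ext_in (ext_image A) (eb F) <-> ext_initial_set A F.
Proof.
move=> Au; split=> [|iF]; last by apply: sub_ideal_gen; exists F.
(* The elements supported on initial monomials form an ideal containing the generators of the
   initial ideal. *)
pose I0 : E -> Prop := fun g => forall H, g H != 0 -> ext_initial_set A H.
have idI : is_ideal (I0 : classical_sets.set (exterior K n)).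
  split=> [H|f g If Ig H|a f If].
  - by rewrite ffunE eqxx.
  - rewrite ext_addE => nz; have [f0|] := eqVneq (f H) 0; last exact: If.
    by apply: Ig; rewrite f0 add0r in nz.
  split=> H; rewrite ext_mulE => /eqP nz; apply: contrapT => nH; apply: nz; apply: big1 => H1 H1H.
    have [->|fz] := eqVneq (f (H :\: H1)) 0; first by rewrite !mulr0.
    by case: nH; apply: (ext_initial_set_up Au (If _ fz)); exact: subsetDl.
  have [->|fz] := eqVneq (f H1) 0; first by rewrite mul0r mulr0.
  by case: nH; apply: (ext_initial_set_up Au (If _ fz)).
move/(ideal_gen_min idI) => h; apply: h; last by rewrite ffunE eqxx oner_eq0.
move=> g [H [-> iH]] H1; rewrite ffunE; have [->//|] := eqVneq H1 H.
by rewrite eqxx.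
Qed.

Lemma ext_shift_sub F H : F \in ext_shift K G -> H \subset F -> H \in ext_shift K G.
Proof.
rewrite !inE => /asboolP nF HF; apply/asboolP => gH; apply: nF.
apply: generically_mono gH => A Au; rewrite -/(ext_image A) !ext_in_basis // => iH.
exact: ext_initial_set_up iH HF.
Qed.

Section Degree.
Variable k : nat.
Local Notation I := {F : {set 'I_n} | #|F| == k}.
Local Notation W := {ffun I -> K^o}.

Definition ext_coords f : W := [ffun H => f (val H)].

Lemma ext_coords_is_linear : linear ext_coords.
Proof. by move=> a f g; apply/ffunP=> H; rewrite !ffunE. Qed.

HB.instance Definition _ := GRing.isLinear.Build K E W _ ext_coords ext_coords_is_linear.

Definition ext_gens (a : I) (A : 'M[K]_n) : W :=
  if val a \in G then 0 else ext_coords (ext_act A (eb (val a))).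

Definition ext_lt (a b : I) : bool := revlex_lt (ind (val a)) (ind (val b)).

Lemma ext_lt_irr : irreflexive ext_lt.
Proof. by move=> a; exact: revlex_irr. Qed.

Lemma ext_lt_trans : transitive ext_lt.
Proof. by move=> a b c; exact: revlex_trans. Qed.

Lemma ext_lt_total a b : a != b -> ext_lt a b || ext_lt b a.
Proof. by rewrite -(inj_eq val_inj); exact: revlex_set_total. Qed.

Lemma ext_act_basis_poly F : ext_poly (@polymx K n) (fun A => ext_act A (eb F)).
Proof.
have PC := @polymx_class K n => H.
apply: (pc_ext PC (f := fun A => (\prod_(i <- enum F) ext_lin (mx_forms A i)) H)) => [A|].
  by rewrite ext_actE /ext_submap ext_map_basis.
apply: ext_poly_prod => // i; apply: ext_poly_lin => // x; exact: polymx_entry.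
Qed.

Lemma ext_gens_poly a i : polymx (fun A => ext_gens a A i).
Proof.
have PC := @polymx_class K n; rewrite /ext_gens.
case: (val a \in G).
  by apply: (pc_ext PC) (pc_const PC 0) => A; rewrite ffunE.
by apply: (pc_ext PC) (ext_act_basis_poly (val a) (val i)) => A; rewrite ffunE.
Qed.

Lemma mem_ext_gspan A v : v \in gspan ext_gens A <->
  exists j, [/\ ext_homog k j, ext_nonface G j & v = ext_coords (ext_act A j)].
Proof.
split=> [/lspanP[c ->]|[j [hj nj ->]]].
  exists (\sum_(a : I | val a \notin G) c a *: eb (val a)); split.
  - apply: (subspace_sum (ext_homog_subspace K n k)) => a _.
    apply: (subspaceZ (ext_homog_subspace K n k)).
    by have := @ext_homog_basis K n (val a); rewrite (eqP (valP a)).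
  - apply: (subspace_sum (ext_nonface_subspace K G)) => a aG.
    by apply: (subspaceZ (ext_nonface_subspace K G)); exact: ext_nonface_basis.
  rewrite ext_actE (linear_sum (ext_submap (mx_forms A))) linear_sum [RHS]big_mkcond /=.
  apply: eq_bigr => a _.
  by rewrite /ext_gens; case: ifP => _ /=; rewrite ?scaler0 // !linearZ.
apply: (ext_nonface_sum (S := fun j => ext_coords (ext_act A j) \in gspan ext_gens A) _ hj nj).
  split=> [|a u w uS wS]; first by rewrite ext_actE !linear0 mem0v.
  by rewrite ext_actE !linearP memvD ?memvZ.
move=> F kF FG; have kF' : #|F| == k by apply/eqP.
have -> : ext_coords (ext_act A (eb F)) = ext_gens (exist _ F kF') A.
  by rewrite /ext_gens /= (negbTE FG).
exact: (@mem_lspan _ _ _ predT (ext_gens^~ A)).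
Qed.

Definition ext_part f : E := [ffun F : {set 'I_n} => if #|F| == k then f F else 0].

Lemma ext_part_is_linear : linear ext_part.
Proof.
move=> a f g; apply/ffunP=> H; rewrite !ffunE; case: ifP => _ //=.
by rewrite scaler0 addr0.
Qed.

HB.instance Definition _ := GRing.isLinear.Build K E E _ ext_part ext_part_is_linear.

Lemma ext_act_part A f : ext_act A (ext_part f) = ext_part (ext_act A f).
Proof.
apply: (eq_ext_linear (h1 := ext_submap (mx_forms A) \o ext_part)
  (h2 := ext_part \o ext_submap (mx_forms A))) => F /=.
have hF := ext_submap_homog (mx_forms A) (@ext_homog_basis K n F).
have [kF|kF] := eqVneq #|F| k.
  have -> : ext_part (eb F) = eb F.
    apply/ffunP=> H; rewrite !ffunE; case: ifP => // kH.
    by case: eqP => // HF; rewrite HF kF eqxx in kH.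
  apply/ffunP=> H; rewrite [RHS]ffunE; case: ifP => // kH.
  by rewrite hF // kF kH.
have -> : ext_part (eb F) = 0.
  apply/ffunP=> H; rewrite !ffunE; case: ifP => // kH.
  by case: eqP => // HF; rewrite HF (negbTE kF) in kH.
rewrite linear0; apply/ffunP=> H; rewrite !ffunE; case: ifP => // /eqP kH.
by rewrite hF // kH eq_sym.
Qed.

(** The image of the face ideal is graded, so an element with initial monomial [F] may be replaced
    by its part of degree [k]; being initial is then linear algebra in that degree. *)
Lemma ext_initial_std A (F : I) : ext_initial_set A (val F) <-> ~~ std ext_lt (gspan ext_gens A) F.
Proof.
have sumF (H : I) : (\sum_(i < n) (i \in val H : nat))%N = k.
  by rewrite (sum_ind (val H)) (eqP (valP H)).
rewrite /std negbK; split=> [[f /ext_imageP[f0 nf0 deff] [fF ltF]]|].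
  have fU : ext_coords f \in gspan ext_gens A.
    apply/mem_ext_gspan; exists (ext_part f0); split.
    - by move=> H kH; rewrite ffunE (negbTE kH).
    - by move=> H HG; rewrite ffunE nf0 //; case: ifP.
    by rewrite ext_act_part -deff; apply/ffunP=> H; rewrite !ffunE (valP H).
  rewrite -[delta _ F]scale1r -(mulVf fF) -scalerA memvZ //.
  have -> : f (val F) *: delta K F =
      ext_coords f - \sum_(H : I | H != F) ext_coords f H *: delta K H.
    by rewrite {1}[ext_coords f]sum_delta (bigD1 F) //= addrK ffunE.
  apply: memv_add => //; rewrite memvN; apply: memv_suml => H HF.
  have [->|fH] := eqVneq (ext_coords f H) 0; first by rewrite scale0r mem0v.
  rewrite memvZ //; apply: delta_seg; rewrite inE /ext_lt -degrevlexE; last first.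
    by rewrite !sum_ind (eqP (valP H)) (eqP (valP F)).
  by apply: ltF; [move: fH; rewrite ffunE | rewrite (inj_eq val_inj)].
case/memv_addP=> u /mem_ext_gspan[j [hj nj ->]] [s sl e].
have [c defs] := lspanP _ _ _ sl.
have sE (H : I) : s H = if H \in lower ext_lt F then c H else 0.
  rewrite defs sum_ffunE; case: ifP => HF.
    rewrite (bigD1 H) //= big1 ?addr0 => [|H1 /andP[_ H1H]].
      by rewrite !ffunE eqxx /GRing.scale /= mulr1.
    by rewrite !ffunE eq_sym (negbTE H1H) /GRing.scale /= mulr0.
  rewrite big1 // => H1 H1F; rewrite !ffunE; case: eqP => [HH|]; last by rewrite /GRing.scale /= mulr0.
  by rewrite HH (H1F : H1 \in lower ext_lt F) in HF.
have fE (H : I) : ext_act A j (val H) = (H == F)%:R - s H.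
  have := congr1 (fun v : W => v H) e; rewrite !ffunE => ->.
  by rewrite addrK.
exists (ext_act A j); first by apply/ext_imageP; exists j.
split; first by rewrite fE eqxx sE inE ext_lt_irr subr0 oner_eq0.
move=> H fH HF; have kH : #|H| == k.
  by apply: contraNT fH => kH; rewrite (ext_submap_homog (mx_forms A) hj).
have := fE (exist _ H kH) => /= fHE; move: fH; rewrite fHE.
have -> : (exist _ H kH == F :> I) = false.
  by apply: contraNF HF => /eqP<-.
rewrite sub0r oppr_eq0 sE inE; case: ifP => [lt _|]; last by rewrite eqxx.
by apply/degrevlexE => //; rewrite (sumF (exist _ H kH)) sumF.
Qed.

(** The faces of size [k] of the shifted complex are the standard sets of one matrix, at which the
    dimensions used in the counting arguments are moreover maximal. *)
Lemma ext_shift_std : infinite_field K -> exists A0 : 'M[K]_n,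
  (forall A (Q : {set I}), A \in unitmx ->
    (\dim (gspan ext_gens A + seg K Q) <= \dim (gspan ext_gens A0 + seg K Q))%N) /\
  forall F : I, (val F \in ext_shift K G) = std ext_lt (gspan ext_gens A0) F.
Proof.
move=> Kinf; have [A0 [A0u A0max A0gen]] :=
  generic_std ext_lt Kinf ext_gens_poly.
exists A0; split=> // F; rewrite inE.
have /A0gen gF : forall A, A \in unitmx ->
    ext_in (ext_image A) (eb (val F)) <-> ~~ std ext_lt (gspan ext_gens A) F.
  by move=> A Au; rewrite ext_in_basis //; exact: ext_initial_std.
apply/asboolP/idP => [h|sF /gF /negP]; last by apply.
by case: (boolP (std ext_lt (gspan ext_gens A0) F)) => // /gF /h.
Qed.

End Degree.
End ExteriorStd.

(** Numbers the vertices from the top, so that form number [l] is moved to the [l]-th smallest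
    variable. The default [x0] only witnesses that [n] is positive. *)
Definition vtx n (x0 : 'I_n) (l : nat) : 'I_n := insubd x0 (n.-1 - l)%N.

Lemma val_vtx n (x0 : 'I_n) l : vtx x0 l = (n.-1 - l)%N :> nat.
Proof.
rewrite val_insubd; case: ifP => // /negbT; rewrite -leqNgt => h.
by have := ltn_ord x0; lia.
Qed.

Lemma vtxK n (x0 : 'I_n) l : (l < n)%N -> (n.-1 - vtx x0 l)%N = l.
Proof. by rewrite val_vtx; lia. Qed.

(** * From suitable forms to the last variables in generic coordinates *)

Section ExteriorTransport.
Variables (K : fieldType) (n : nat) (G : {set {set 'I_n}}) (x0 : 'I_n).
Local Notation E := (exterior K n).
Local Notation eb := (ext_basis K).
Local Notation gen := (ext_gen K).
Local Notation lin := (@ext_lin K n).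
Implicit Types (F H : {set 'I_n}) (f : E) (A B : 'M[K]_n).
Hypothesis Kinf : infinite_field K.

Lemma ext_span_eq k r a (Theta Theta' : nat -> 'I_n -> K) (D : E -> Prop) :
  (forall l, (l < r + a)%N -> Theta l = Theta' l) ->
  ext_span G k r (ext_tau Theta r a) Theta D -> ext_span G k r (ext_tau Theta' r a) Theta' D.
Proof.
move=> eqT sp f /sp[j [u [w [hj hu Dw ->]]]]; exists j, u, w; split=> //.
congr (_ + _ + _ * _).
  by apply: eq_bigr => l _; rewrite eqT // ltn_addr.
by apply: eq_big_seq => l; rewrite mem_iota => /andP[_ lra]; rewrite eqT.
Qed.

(** An invertible matrix whose last columns are the forms carries the last variables to them;
    applying its inverse turns the spanning statement into one about variables. *)
Lemma ext_transport k r a p h (Theta : nat -> 'I_n -> K) (D : E -> Prop) : k = (a + p)%N -> (r + a <= n)%N ->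
  subspace D -> (forall w, D w -> ext_homog p w) -> spanned h D ->
  ext_span G k r (ext_tau Theta r a) Theta D ->
  exists A (D' : E -> Prop), [/\ A \in unitmx, forall w, D' w -> ext_homog p w, spanned h D' &
    forall f, ext_homog k f -> exists (j : E) (u : nat -> E) (w : E),
      [/\ ext_homog k j /\ ext_nonface G j, forall l, ext_prehomog k (u l), D' w &
       f = ext_act A j + \sum_(l < r) gen (vtx x0 l) * u l +
           (\prod_(l <- iota r a) gen (vtx x0 l)) * w]].
Proof.
move=> defk le_ra subD hD sD sp; have PC := polyline_class K.
pose B0 : 'M[K]_n := \matrix_(x, y) Theta (n.-1 - y)%N x.
(* [B0] has the forms as columns but may be singular. On the line towards the identity,
   invertibility and spanning are both open and nonempty. *)
pose B t := B0 + t *: (1%:M - B0); pose Th t l x := B t x (vtx x0 l).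
have PTh l x : polyline (fun t => Th t l x).
  apply: (pc_ext PC (f := fun t => B0 x (vtx x0 l) + t * (1%:M - B0) x (vtx x0 l))).
    by move=> t; rewrite /Th /B !mxE.
  apply: (pc_add PC); first exact: (pc_const PC).
  by apply: (pc_mul PC); [exact: polyline_id | exact: (pc_const PC)].
have Th0 l : (l < r + a)%N -> Theta l = Th 0 l.
  move=> lra; apply/funext=> x.
  by rewrite /Th /B scale0r addr0 mxE vtxK // (leq_trans lra).
have Ptau : ext_poly (@polyline K) (fun t => ext_tau (Th t) r a).
  by apply: ext_poly_prod => // l; apply: ext_poly_lin => // i; exact: PTh.
have [||q Pq [q0 qP]] := @ext_span_open K n _ (@polyline K) PC G k r
  (fun t => ext_tau (Th t) r a) Th D 0 subD Ptau PTh.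
- by move=> t w Dw; rewrite defk; apply: (@ext_homog_mul K n a p); [exact: ext_homog_tau | exact: (hD w Dw)].
- exact: ext_span_eq Th0 sp.
have Pdet : polyline (fun t => \det (B t)).
  apply: (pc_det PC) => i j; apply: (pc_ext PC (f := fun t => B0 i j + t * (1%:M - B0) i j)).
    by move=> t; rewrite /B !mxE.
  apply: (pc_add PC); first exact: (pc_const PC).
  by apply: (pc_mul PC); [exact: polyline_id | exact: (pc_const PC)].
have [t [qt dett]] : exists t, q t != 0 /\ \det (B t) != 0.
  apply: (polyline_common (t0 := 0) (t1 := 1)) => //.
  by rewrite /B scale1r subrKC det1 oner_eq0.
have Bu : B t \in unitmx by rewrite unitmxE unitfE.
pose A := invmx (B t); pose D' w := exists2 w0, D w0 & w = ext_act A w0.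
have actA l : ext_act A (lin (Th t l)) = gen (vtx x0 l).
  rewrite (_ : lin (Th t l) = ext_act (B t) (gen (vtx x0 l))); last by rewrite ext_act_gen.
  by rewrite ext_act_comp mulVmx // ext_act1.
exists A, D'; split.
- by rewrite unitmx_inv.
- by move=> w [w0 Dw0 ->]; apply: (ext_submap_homog (mx_forms A)); exact: hD.
- have [M sM] := sD; exists (fun l => ext_act A (M l)) => w [w0 /sM[c ->] ->].
  exists c; rewrite ext_actE (linear_sum (ext_submap (mx_forms A))); apply: eq_bigr => l _.
  by rewrite linearZ.
move=> f hf; have [|j [u [w [hj hu Dw e]]]] := qP t qt (ext_act (B t) f).
  exact: (ext_submap_homog (mx_forms (B t))).
exists j, (fun l => ext_act A (u l)), (ext_act A w); split=> //.
- by move=> l; exact: (ext_submap_prehomog (mx_forms A) (hu l)).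
- by exists w.
have -> : f = ext_act A (ext_act (B t) f) by rewrite ext_act_comp mulVmx // ext_act1.
rewrite e {1}ext_actE !linearD /= (linear_sum (ext_submap (mx_forms A))) !rmorphM rmorph_prod /=.
congr (_ + _ + _ * _); apply: eq_bigr => l _; rewrite ?rmorphM /= -!ext_actE actA //.
Qed.

Section Supp.
Variable v : 'I_n.

Lemma supp_gen_mul u H : (gen v * u) H != 0 -> v \in H.
Proof.
apply: contraNT => vH; rewrite ext_mulE; apply/eqP/big1 => A AH.
rewrite ffunE; case: eqP => [e|]; last by rewrite mul0r mulr0.
by case/negP: vH; apply: (subsetP AH); rewrite e inE.
Qed.

Lemma supp_mul_r f u H : (forall H', f H' != 0 -> v \in H') -> (f * u) H != 0 -> v \in H.
Proof.
move=> sf; apply: contraNT => vH; rewrite ext_mulE; apply/eqP/big1 => A AH.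
have [->|/sf vA] := eqVneq (f A) 0; first by rewrite mul0r mulr0.
by case/negP: vH; apply: (subsetP AH).
Qed.

Lemma supp_mul_l f u H : (forall H', f H' != 0 -> v \in H') -> (u * f) H != 0 -> v \in H.
Proof.
move=> sf; apply: contraNT => vH; rewrite ext_mulE; apply/eqP/big1 => A AH.
have [->|/sf vA] := eqVneq (f (H :\: A)) 0; first by rewrite !mulr0.
by case/negP: vH; apply: (subsetP _ _ vA); exact: subsetDl.
Qed.

Lemma supp_prod (s : seq nat) u l H : l \in s -> v = vtx x0 l ->
  ((\prod_(l <- s) gen (vtx x0 l)) * u) H != 0 -> v \in H.
Proof.
move=> ls vl; apply: supp_mul_r => H'; elim: s ls H' => // m s IHs.
rewrite inE big_cons => /orP[/eqP <-|ls] H'; first by rewrite -vl; exact: supp_gen_mul.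
by apply: supp_mul_l => H2; exact: IHs.
Qed.

End Supp.

Section Bound.
Variables (k : nat) (A0 : 'M[K]_n).
Local Notation I := {F : {set 'I_n} | #|F| == k}.
Hypothesis A0max : forall A (Q : {set I}), A \in unitmx ->
    (\dim (gspan (ext_gens G (k := k)) A + seg K Q) <=
     \dim (gspan (ext_gens G (k := k)) A0 + seg K Q))%N.
Hypothesis clG : forall F H, F \in G -> H \subset F -> H \in G.

(** By [card_std] the number of standard sets outside [Q] is a codimension, which is smallest at
    [A0]. *)
Lemma ext_std_bound A (Q : {set I}) V h : A \in unitmx -> down_closed (@ext_lt n k) Q ->
  (gspan (ext_gens G (k := k)) A + seg K Q + V = fullv)%VS -> (\dim V <= h)%N ->
  (#|[set F : I | (F \notin Q) && std (@ext_lt n k) (gspan (ext_gens G (k := k)) A0) F]| <= h)%N.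
Proof.
move=> Au dQ full leV.
have cs (U : {vspace {ffun I -> K^o}}) := card_std (@ext_lt_irr n k) (@ext_lt_trans n k) (@ext_lt_total n k) U dQ.
apply: leq_trans (card_std_lower (@ext_lt_irr n k) (@ext_lt_trans n k) (@ext_lt_total n k) dQ full leV).
rewrite -(leq_add2r (\dim (gspan (ext_gens G (k := k)) A + seg K Q))) cs.
by rewrite -(cs (gspan (ext_gens G (k := k)) A0)) leq_add2l A0max.
Qed.

(** The monomials in the ideal generated by the last [r] variables and by the product of the [a]
    variables before them. For [a = 0] the empty product is excluded, since it would give every
    set. *)
Definition tail_sets r a : {set I} := [set F : I |
  [exists i in val F, (n - r <= i)%N] ||
  (a != 0)%N && [forall i : 'I_n, (n - r - a <= i < n - r)%N ==> (i \in val F)]].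

Lemma tail_sets_down r a : (r + a <= n)%N -> down_closed (@ext_lt n k) (tail_sets r a).
Proof.
move=> le_ra F H /revlex_ltP[m [FHm eqFH]].
have mF : m \in val F by move: FHm; rewrite /ind; case: (m \in val F) => //; case: (_ \in _).
have mH : m \notin val H by move: FHm; rewrite /ind; case: (m \in val H) => //; case: (_ \in _).
have eqm (i : 'I_n) : (m < i)%N -> (i \in val F) = (i \in val H).
  by move/eqFH; rewrite /ind; case: (i \in val F); case: (i \in val H).
rewrite !inE => /orP[/exists_inP[i iH ri]|/andP[a0 /forallP all]].
  apply/orP; left; apply/exists_inP.
  have [mi|im] := ltnP m i; first by exists i; rewrite // eqm.
  by exists m; rewrite // (leq_trans ri).
have [rm|mr] := leqP (n - r) m.
  by apply/orP; left; apply/exists_inP; exists m.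
have [ram|mra] := leqP (n - r - a) m.
  by have := all m; rewrite ram mr /= (negbTE mH).
apply/orP; right; rewrite a0 /=; apply/forallP=> i; apply/implyP=> /andP[rai ir].
by rewrite eqm ?(leq_trans mra) //; have := all i; rewrite rai ir.
Qed.

Lemma ext_coords_seg (Q : {set I}) f : (forall H : I, f (val H) != 0 -> H \in Q) ->
  ext_coords k f \in seg K Q.
Proof.
move=> fQ; rewrite [ext_coords k f]sum_delta; apply: memv_suml => H _.
have [->|nz] := eqVneq (ext_coords k f H) 0; first by rewrite scale0r mem0v.
by rewrite memvZ //; apply: delta_seg; apply: fQ; move: nz; rewrite ffunE.
Qed.

(** Once the forms are the last variables, the terms that they divide lie in the segment of tail
    sets, so only [D] contributes; when [a] is positive even [tau * D] lies in the segment and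
    nothing is left. *)
Lemma ext_card_std r a p h (Theta : nat -> 'I_n -> K) (D : E -> Prop) : k = (a + p)%N -> (r + a <= n)%N ->
  subspace D -> (forall w, D w -> ext_homog p w) -> spanned h D ->
  ext_span G k r (ext_tau Theta r a) Theta D ->
  (#|[set F : I | (F \notin tail_sets r a) && std (@ext_lt n k) (gspan (ext_gens G (k := k)) A0) F]|
    <= if a == 0%N then h else 0)%N.
Proof.
move=> defk le_ra subD hD sD sp.
have [A [D' [Au hD' [M sM] dec]]] := ext_transport defk le_ra subD hD sD sp.
pose V := if a == 0%N then lspan predT (fun l : 'I_h => ext_coords k (M l)) else 0%VS.
apply: (ext_std_bound (V := V) Au (tail_sets_down le_ra)); last first.
  rewrite /V; case: ifP => _; last by rewrite dimv0.
  by apply: leq_trans (dim_lspan _ _) _; rewrite card_ord.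
apply: delta_fullv => F; have [|j [u [w [[hj nj] hu D'w e]]]] := dec (eb (val F)).
  by have := @ext_homog_basis K n (val F); rewrite (eqP (valP F)).
have -> : delta K F = ext_coords k (eb (val F)).
  by apply/ffunP=> H; rewrite !ffunE (inj_eq val_inj).
have jU : ext_coords k (ext_act A j) \in gspan (ext_gens G (k := k)) A.
  by apply/mem_ext_gspan; exists j.
rewrite e !linearD /=; move: (ext_act A j) jU => j' jU; rewrite linear_sum.
have Qgen (l : 'I_r) : ext_coords k (gen (vtx x0 l) * u l) \in seg K (tail_sets r a).
  apply: ext_coords_seg => H nz; rewrite inE; apply/orP; left.
  apply/exists_inP; exists (vtx x0 l); first exact: supp_gen_mul nz.
  by rewrite val_vtx; have := ltn_ord l; have := ltn_ord x0; lia.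
set cw := ext_coords k (_ * w).
(* For [a = 0] the remainder is in the span of [h] vectors; otherwise it is divisible by the [a]
   variables of [tau]. *)
have [cwQ|cwV] : cw \in seg K (tail_sets r a) \/ cw \in V.
  have [a0|a0] := eqVneq a 0%N.
    right; rewrite /V /cw a0 eqxx /= big_nil mul1r; have [c ->] := sM w D'w.
    rewrite linear_sum; apply: memv_suml => l _; rewrite linearZ memvZ //.
    exact: (@mem_lspan _ _ _ predT (fun l : 'I_h => ext_coords k (M l))).
  left; apply: ext_coords_seg => H nz; rewrite inE; apply/orP; right; rewrite a0 /=.
  apply/forallP=> i; apply/implyP=> /andP[rai ir].
  have iE : i = vtx x0 (n.-1 - i)%N.
    by apply/val_inj; rewrite /= val_vtx; have := ltn_ord i; lia.
  apply: (supp_prod _ iE nz); rewrite mem_iota; have := ltn_ord i; lia.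
- apply: (subvP (addvSl _ _)); rewrite -addrA; apply: memv_add => //.
  by apply: memvD => //; apply: memv_suml => l _; exact: Qgen.
apply: memv_add => //; apply: memv_add => //.
by apply: memv_suml => l _; exact: Qgen.
Qed.

(** The degree [k] part of the transformed ideal is spanned by the images of the nonfaces, so its
    codimension is at least the number of faces. *)
Lemma ext_card_std0 : (#|[set F in G | #|F| == k]| <=
  #|[set F : I | std (@ext_lt n k) (gspan (ext_gens G (k := k)) A0) F]|)%N.
Proof.
have d0 : down_closed (@ext_lt n k) set0 by move=> F H _; rewrite inE.
have := card_std (@ext_lt_irr n k) (@ext_lt_trans n k) (@ext_lt_total n k)
  (gspan (ext_gens G (k := k)) A0) d0.
have -> : (gspan (ext_gens G (k := k)) A0 + seg K set0)%VS = gspan (ext_gens G (k := k)) A0.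
  by apply/addv_idPl/seg_sub => i; rewrite inE.
have -> : [set i | (i \notin set0) && std (@ext_lt n k) (gspan (ext_gens G (k := k)) A0) i] =
    [set F : I | std (@ext_lt n k) (gspan (ext_gens G (k := k)) A0) F].
  by apply/setP=> i; rewrite !inE.
have : (\dim (gspan (ext_gens G (k := k)) A0) <= #|[pred a : I | val a \notin G]|)%N.
  apply: leq_trans (dim_lspan _ (ext_gens G (k := k) ^~ A0)); apply: dimvS.
  apply/subv_sumP=> a _; rewrite -memvE.
  have [aG|aG] := boolP (val a \in G); first by rewrite /ext_gens aG mem0v.
  exact: (@mem_lspan _ _ _ [pred a : I | val a \notin G] (ext_gens G (k := k) ^~ A0)).
have : #|[set F in G | #|F| == k]| = #|[pred a : I | val a \in G]|.
  rewrite -(card_imset _ (@val_inj _ _ I)); apply: eq_card => F; rewrite !inE.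
  apply/andP/imsetP => [[FG kF]|[a]]; last by rewrite inE => aG ->; split=> //; exact: (valP a).
  by exists (exist _ F kF).
move=> -> le_dim cs; rewrite -(leq_add2r #|[pred a : I | val a \notin G]|).
have -> : #|[pred a : I | val a \notin G]| = #|[predC [pred a : I | val a \in G]]|.
  by apply: eq_card => a; rewrite !inE.
rewrite cardC -cs leq_add2l; apply: leq_trans le_dim _.
by apply: eq_leq; apply: eq_card => a; rewrite !inE.
Qed.

End Bound.
End ExteriorTransport.

(** * Purity from counting facets by their heads *)

Section PureCount.
Variables (n d : nat) (D : {set {set 'I_n}}) (hh : nat -> nat).
Implicit Types F H : {set 'I_n}.
Hypotheses (ltdn : (d < n)%N) (clD : forall F H, F \in D -> H \subset F -> H \in D)
  (leD : forall F, F \in D -> (#|F| <= d)%N).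

(** The part of [F] below its largest missing vertex. It determines [F] once the size of [F] is
    known. *)
Definition head_set F : {set 'I_n} := [set i in F | [exists j, (j \notin F) && (i < j)%N]].

Lemma card_above (a : 'I_n) : #|[set i : 'I_n | (a < i)%N]| = (n - a.+1)%N.
Proof.
have -> : [set i : 'I_n | (a < i)%N] = ~: [set i : 'I_n | (i < a.+1)%N].
  by apply/setP=> i; rewrite !inE -leqNgt.
rewrite cardsCs setCK card_ord; congr (_ - _)%N.
rewrite -sum1dep_card -(big_ord_widen n (fun=> 1%N) (ltn_ord a)).
by rewrite sum1_card card_ord.
Qed.

Lemma head_setP F : #|F| = d -> exists a : 'I_n,
  [/\ F = head_set F :|: [set i : 'I_n | (a < i)%N], a = (n - (d - #|head_set F|).+1)%N :> nat,
      (#|head_set F| <= d)%N & forall i, i \in head_set F -> (i < a)%N].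
Proof.
move=> Fd; have [a0 a0F] : exists a, a \notin F.
  apply/existsP; rewrite -negb_forall; apply: contraL ltdn => /forallP all.
  rewrite -leqNgt -Fd; have : (#|[set: 'I_n]| <= #|F|)%N; last by rewrite cardsT card_ord.
  by apply: subset_leq_card; apply/subsetP=> i _; exact: all.
case: (@arg_maxnP _ a0 (fun i => i \notin F) val a0F) => a aF amax.
have gtF (i : 'I_n) : (a < i)%N -> i \in F.
  by move=> ai; apply: contraT => /amax; rewrite /= leqNgt ai.
have headE i : (i \in head_set F) = (i \in F) && (i < a)%N.
  rewrite inE; case iF: (i \in F) => //=; apply/existsP/idP => [[j /andP[jF ij]]|ia].
    by apply: leq_trans ij _; exact: amax.
  by exists a; rewrite aF.
have FE : F = head_set F :|: [set i : 'I_n | (a < i)%N].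
  apply/setP=> i; rewrite in_setU headE inE.
  case: ltngtP => [ia|/gtF->|/val_inj->]; rewrite ?orbF ?andbT ?andbF //.
  by rewrite (negbTE aF).
have dE : (#|head_set F| + (n - a.+1) = d)%N.
  rewrite -card_above -cardsUI -FE Fd [X in (_ + #|pred_of_set X|)%N](_ : _ = set0) ?cards0 ?addn0 //.
  by apply/setP=> i; rewrite in_setI headE !inE; case: ltngtP; rewrite ?andbF.
exists a; split=> //; first by have := ltn_ord a; lia.
  by rewrite -dE leq_addr.
by move=> i; rewrite headE => /andP[].
Qed.

(** Every head of size [k] of a set of size [d] that belongs to [D] is among these, its largest
    missing vertex being [n - (d - k).+1]. *)
Definition low_faces k : {set {set 'I_n}} :=
  [set F in D | (#|F| == k) && [forall i in F, (i < n - (d - k).+1)%N]].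

Hypotheses (leB : forall k, (k <= d)%N -> (#|low_faces k| <= hh k)%N)
  (geD : (\sum_(k < d.+1) hh k <= #|[set F in D | #|F| == d]|)%N).

(** Sets of size [d] with head in [D] inject into the low faces, so there are at most as many of
    them as faces of size [d]; hence all of them are faces. Each face extends to such a set. *)
Lemma pure_of_counts F : F \in D -> exists2 H, H \in D & (F \subset H) && (#|H| == d).
Proof.
pose S := [set H : {set 'I_n} | (#|H| == d) && (head_set H \in D)].
have DS : [set H in D | #|H| == d] = S.
  apply/eqP; rewrite eqEcard; apply/andP; split.
    apply/subsetP=> H; rewrite !inE => /andP[HD ->] /=; apply: clD HD _.
    by apply/subsetP=> i; rewrite inE => /andP[].
  apply: leq_trans geD.
  have injS : {in S &, injective head_set}.
    move=> H H'; rewrite !inE => /andP[/eqP Hd _] /andP[/eqP H'd _] e.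
    have [a [HE aE _ _]] := head_setP Hd; have [a' [H'E a'E _ _]] := head_setP H'd.
    have aa : a = a' by apply: val_inj; rewrite /= aE a'E e.
    by rewrite HE H'E e aa.
  rewrite -(card_in_imset injS).
  apply: (@leq_trans (\sum_(k < d.+1) #|low_faces k|)%N); last first.
    by apply: leq_sum => k _; apply: leB; rewrite -ltnS.
  apply: (@leq_trans #|\bigcup_(k < d.+1) low_faces k|).
    apply: subset_leq_card; apply/subsetP=> H' /imsetP[H].
    rewrite inE => /andP[/eqP Hd hHD] ->.
    have [a [_ aE le_kd lta]] := head_setP Hd.
    apply/bigcupP; exists (inord #|head_set H|) => //.
    rewrite inE hHD inordK // eqxx /=.
    by apply/forall_inP=> i /lta; rewrite aE.
  elim/big_rec2: _ => [|k m A _ le_mA]; first by rewrite cards0.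
  by apply: leq_trans (leq_card_setU _ _) _; rewrite leq_add2l.
(* [phi a] is the size of the set made of the elements of [F] below [a] and of all vertices above
   [a]. The largest [a] with [d <= phi a] gives a set of size [d] containing [F] whose head lies in
   [F]. *)
move=> FD; pose phi (a : 'I_n) := (#|[set i in F | (i < a)%N]| + (n - a.+1))%N.
have n0 : (0 < n)%N by apply: leq_ltn_trans ltdn.
have phi0 : (d <= phi (Ordinal n0))%N by rewrite /phi /=; lia.
case: (@arg_maxnP _ _ (fun a => d <= phi a)%N val phi0) => a dphi amax.
have [aF phia] : a \notin F /\ phi a = d.
  have [ltan|] := boolP (a.+1 < n)%N; last first.
    rewrite -leqNgt => leSa; have aE : a.+1 = n by apply/eqP; rewrite eqn_leq leSa ltn_ord.
    have sF : [set i in F | (i < a)%N] \subset F by apply/subsetP=> i; rewrite inE => /andP[].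
    have phiE : phi a = #|[set i in F | (i < a)%N]| by rewrite /phi aE subnn addn0.
    have dF : #|F| = d /\ #|[set i in F | (i < a)%N]| = d.
      have := subset_leq_card sF; have := leD FD; rewrite -phiE; lia.
    split; last by rewrite phiE; case: dF.
    apply/negP=> aF; have : [set i in F | (i < a)%N] \proper F.
      by apply/properP; split=> //; exists a; rewrite // inE ltnn andbF.
    by move/proper_card; case: dF => -> ->; rewrite ltnn.
  have ltd : (phi (Ordinal ltan) < d)%N.
    by rewrite ltnNge; apply/negP => /amax /=; rewrite ltnn.
  have setE : [set i in F | (i < a.+1)%N] = if a \in F then a |: [set i in F | (i < a)%N]
      else [set i in F | (i < a)%N].
    apply/setP=> i; rewrite inE; case: ifP => aF; rewrite !inE ltnS leq_eqVlt (inj_eq val_inj).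
      by case: eqP => [->|] /=; rewrite ?aF.
    by case: eqP => [->|] /=; rewrite ?aF.
  move: ltd; rewrite /phi /= setE; case: ifP => aF.
    rewrite cardsU1 inE ltnn andbF /=; move: dphi; rewrite -/(phi a) /phi.
    by move: #|[set i in F | (i < a)%N]| ltan => c; lia.
  split=> //; apply/eqP; move: dphi ltd; rewrite -/(phi a) /phi.
  by move: #|[set i in F | (i < a)%N]| => c; lia.
pose H := [set i in F | (i < a)%N] :|: [set i : 'I_n | (a < i)%N].
have Hd : #|H| = d.
  rewrite -phia /phi -card_above -cardsUI [X in (_ + #|pred_of_set X|)%N](_ : _ = set0) ?cards0 ?addn0 //.
  by apply/setP=> i; rewrite !inE; case: ltngtP; rewrite ?andbF.
have HS : H \in S.
  rewrite inE Hd eqxx /=; apply: clD FD _; apply/subsetP=> i.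
  rewrite inE => /andP[iH /existsP[j /andP[jH ij]]].
  move: jH iH; rewrite !inE negb_or -leqNgt => /andP[_ ja] /orP[/andP[] //|ai].
  by have := leq_trans ij ja; rewrite ltnNge ltnW.
exists H; first by move: HS; rewrite -DS inE => /andP[].
rewrite Hd eqxx andbT; apply/subsetP=> i iF; rewrite !inE iF /=.
by case: ltngtP => // /val_inj e; rewrite -e iF in aF.
Qed.

Lemma pure_counts : pure D.
Proof.
have facet_d F : facet D F -> #|F| = d.
  move=> /maxsetP[FD Fmax]; have [H HD /andP[FH /eqP Hd]] := pure_of_counts FD.
  by rewrite -(Fmax H HD FH).
by move=> F H /facet_d-> /facet_d->.
Qed.

End PureCount.

(** The bridge between the shifted complex and the cyclic polytope, independent of the field.
    Surjectivity onto degree [d - p] forces a face of that size avoiding the last [p.+1] vertices to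
    contain the [d - p.*2] vertices just before them. For [d = p.*2] the interval is empty. *)
Definition Kgood n d (F : {set 'I_n}) : Prop := (#|F| <= d)%N /\
  forall p, (p.*2 <= d)%N -> forall F' : {set 'I_n}, F' \subset F -> #|F'| = (d - p)%N ->
  (forall i, i \in F' -> (i < n - p.+1)%N) ->
  forall i : 'I_n, (n - p.+1 - (d - p.*2) <= i < n - p.+1)%N -> i \in F'.

(** * The exterior shifting is pure and its faces are good *)

Section ExteriorShift.
Variables (K : fieldType) (n d : nat) (V : {set 'I_n}) (G : {set {set 'I_n}}) (hh : nat -> nat).
Hypotheses (Kinf : infinite_field K) (cG : complex_on V G) (sG : sedh d G hh) (ltdn : (d < n)%N).
Local Notation Delta := (ext_shift K G).
Implicit Types F H : {set 'I_n}.

Let clG F H : F \in G -> H \subset F -> H \in G.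
Proof. exact: (complex_sub cG). Qed.

Let x0 : 'I_n := Ordinal (leq_ltn_trans (leq0n d) ltdn).

Lemma ext_shift_card k r a p h (Theta : nat -> 'I_n -> K) (D : exterior K n -> Prop) :
  k = (a + p)%N -> (r + a <= n)%N ->
  subspace D -> (forall w, D w -> ext_homog p w) -> spanned h D ->
  ext_span G k r (ext_tau Theta r a) Theta D ->
  (#|[set F in Delta | (#|F| == k) && ~~ ([exists i in F, (n - r <= i)%N] ||
     (a != 0)%N && [forall i : 'I_n, (n - r - a <= i < n - r)%N ==> (i \in F)])]| <=
   if a == 0%N then h else 0)%N.
Proof.
move=> defk le_ra subD hD sD sp.
have [A0 [A0max A0std]] := ext_shift_std clG k Kinf.
have := ext_card_std x0 Kinf A0max defk le_ra subD hD sD sp; apply: leq_trans.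
rewrite -(card_imset _ (@val_inj _ _ {F : {set 'I_n} | #|F| == k})); apply: subset_leq_card.
apply/subsetP=> F; rewrite inE => /and3P[FD kF nF]; apply/imsetP; exists (exist _ F kF) => //.
by rewrite inE -A0std FD andbT inE.
Qed.

(** In degree [d.+1] the whole exterior algebra lies in the face ideal: the counting bound with no
    forms and [h = 0] leaves no face of that size. *)
Lemma ext_shift_dim F : F \in Delta -> (#|F| <= d)%N.
Proof.
move=> FD; rewrite leqNgt; apply/negP => ltdF.
have [H HF Hd] : exists2 H : {set 'I_n}, H \subset F & #|H| = d.+1.
  pose s := take d.+1 (enum F); exists [set x in s].
    by apply/subsetP=> x; rewrite inE => /mem_take; rewrite mem_enum.
  by rewrite cardsE (card_uniqP _) ?take_uniq ?enum_uniq // size_takel // -cardE.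
have HD := ext_shift_sub clG FD HF.
have sub0 : subspace (fun w : exterior K n => w = 0).
  by split=> // b u v -> ->; rewrite scaler0 addr0.
have sp : ext_span G (0 + d.+1) 0 (ext_tau (fun _ _ => 0 : K) 0 0) (fun _ _ => 0) (fun w => w = 0).
  move=> f hf; exists f, (fun=> 0), 0; split=> //.
  - by split=> // F0 F0G; apply: hf; rewrite add0n neq_ltn ltnS (sedh_bound sG F0G).
  - by move=> _; case: (ext_prehomog_subspace K n (0 + d.+1)).
  by rewrite big_ord0 mulr0 !addr0.
have := @ext_shift_card (0 + d.+1) 0 0 d.+1 0 (fun _ _ => 0) (fun w => w = 0) (erefl _) (leq0n _) sub0 _ _ sp.
rewrite eqxx leqn0 cards_eq0 => h; have /h : forall w : exterior K n, w = 0 -> ext_homog d.+1 w.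
  by move=> w ->; case: (ext_homog_subspace K n d.+1).
move=> {}h; have /h/eqP/setP/(_ H) : spanned 0 (fun w : exterior K n => w = 0) by exact: spanned0.
rewrite !inE; have := HD; rewrite inE => -> /=.
rewrite Hd add0n eqxx /=; move/negbT; rewrite negbK orbF => /exists_inP[i _].
by rewrite subn0 leqNgt ltn_ord.
Qed.

Lemma ext_low_faces k : (k <= d)%N -> (#|low_faces d Delta k| <= hh k)%N.
Proof.
move=> le_kd; have [//|Theta [D [subD hD sD sp]]] := ext_span_sedh Kinf sG le_kd (a := 0).
rewrite subn0 in sp; have le_rn : (d - k + 1 + 0 <= n)%N by lia.
apply: leq_trans (ext_shift_card (erefl _) le_rn subD hD sD sp).
apply: subset_leq_card; apply/subsetP=> F; rewrite !inE => /and3P[-> -> /forall_inP h].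
rewrite eqxx /= orbF; apply/exists_inP=> -[i /h]; lia.
Qed.

Lemma ext_shift_pure : pure Delta.
Proof.
apply: (pure_counts (d := d) (hh := hh)) => //.
- by move=> F H; exact: ext_shift_sub.
- exact: ext_shift_dim.
- exact: ext_low_faces.
rewrite -(card_top_faces sG); last by move=> F FG; exact: (sedh_bound sG FG).
have [A0 [A0max A0std]] := ext_shift_std clG d Kinf.
apply: leq_trans (ext_card_std0 G d A0) _.
rewrite -(card_imset _ (@val_inj _ _ {F : {set 'I_n} | #|F| == d})); apply: subset_leq_card.
by apply/subsetP=> F' /imsetP[F]; rewrite inE -A0std => FD ->; rewrite in_set (valP F) andbT.
Qed.

(** The case [a = d - p.*2] of the Lefschetz property, where [r = p.+1]: a face of size [d - p] must
    be a tail set. *)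
Lemma ext_shift_good F : F \in Delta -> Kgood d F.
Proof.
move=> FD; split; first exact: ext_shift_dim.
move=> p le_p F' F'F cF' ltF' i /andP[li ui].
have [d2p|d2p] := eqVneq (d - p.*2)%N 0%N; first by rewrite d2p in li; lia.
have le_pd : (p <= d)%N by lia.
have [|Theta [D [subD hD sD sp]]] := ext_span_sedh Kinf sG le_pd (a := (d - p.*2)%N).
  by rewrite subnK // eqxx orbT.
have defk : (d - p.*2 + p = d - p)%N by lia.
rewrite (_ : d - p + 1 - (d - p.*2) = p.+1)%N in sp; last by lia.
have le_rn : (p.+1 + (d - p.*2) <= n)%N by lia.
have := ext_shift_card (erefl _) le_rn subD hD sD sp; rewrite (negbTE d2p) leqn0 cards_eq0.
move=> /eqP/setP/(_ F'); rewrite in_set0 inE (ext_shift_sub clG FD F'F) defk cF' eqxx /=.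
move/negbT; rewrite negbK => /orP[/exists_inP[x /ltF']|]; first by lia.
by move=> /forallP/(_ i); rewrite li ui.
Qed.

End ExteriorShift.

(** * Polynomial ring: graded pieces, linear substitutions, Stanley-Reisner ideals *)

Section SymBasics.
Variables (K : fieldType) (n : nat).
Local Notation S := {mpoly K[n]}.
Implicit Types (F H : {set 'I_n}) (G : {set {set 'I_n}}) (f g : S) (m : 'X_{1..n}) (A B : 'M[K]_n).

Definition slin (v : 'I_n -> K) : S := \sum_x v x *: 'X_x.

Definition carrier m : {set 'I_n} := [set i | (0 < m i)%N].

Definition sym_homog k f : Prop := forall m, mdeg m != k -> f@_m = 0.
Arguments sym_homog k%_N f.

Definition sym_prehomog k f : Prop := forall m, (mdeg m).+1 != k -> f@_m = 0.
Arguments sym_prehomog k%_N f.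

Definition sym_nonface G f : Prop := forall m, carrier m \in G -> f@_m = 0.

Lemma coef_subspace (P : 'X_{1..n} -> Prop) : subspace (fun f : S => forall m, P m -> f@_m = 0).
Proof.
split=> [m _|a f g hf hg m Pm]; first by rewrite mcoeff0.
by rewrite mcoeffD mcoeffZ hf // hg // mulr0 addr0.
Qed.

Lemma sym_homog_subspace k : subspace (sym_homog k).
Proof. exact: coef_subspace. Qed.

Lemma sym_prehomog_subspace k : subspace (sym_prehomog k).
Proof. exact: coef_subspace. Qed.

Lemma sym_nonface_subspace G : subspace (sym_nonface G).
Proof. exact: coef_subspace. Qed.

Lemma sym_prehomogS k f : sym_prehomog k.+1 f <-> sym_homog k f.
Proof. by split=> h m km; apply: h; rewrite // eqSS in km *. Qed.

Lemma sym_prehomog0 f : sym_prehomog 0 f -> f = 0.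
Proof. by move=> h; apply/mpolyP=> m; rewrite h // mcoeff0. Qed.

Lemma sym_homogX m : sym_homog (mdeg m) 'X_[m].
Proof. by move=> m'; rewrite mcoeffX; case: (eqVneq m m') => [->|//]; rewrite eqxx. Qed.

Lemma sym_homog_mul p q f g : sym_homog p f -> sym_homog q g -> sym_homog (p + q)%N (f * g).
Proof.
move=> hf hg m pqm; rewrite mcoeffM; apply: big1 => -[m1 m2] /= /eqP e.
have [p1|/hf->] := eqVneq (mdeg m1) p; last by rewrite mul0r.
rewrite hg ?mulr0 //; apply: contra pqm => /eqP q2.
by rewrite e mdegD p1 q2.
Qed.

Lemma sym_homogXU i : sym_homog 1 ('X_i : S).
Proof. by have := @sym_homogX U_(i)%MM; rewrite mdeg1. Qed.

Lemma sym_homog_lin v : sym_homog 1 (slin v).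
Proof.
apply: (subspace_sum (sym_homog_subspace 1)) => i _.
by apply: (subspaceZ (sym_homog_subspace 1)); exact: sym_homogXU.
Qed.

Lemma sym_homog1 : sym_homog 0 (1 : S).
Proof. by have := @sym_homogX 0%MM; rewrite mdeg0 mpolyX0. Qed.

Lemma sym_homog_exp k f : sym_homog 1 f -> sym_homog k (f ^+ k).
Proof.
move=> hf; elim: k => [|k IHk]; first by rewrite expr0; exact: sym_homog1.
by rewrite exprS; apply: (sym_homog_mul (p := 1%N)).
Qed.

Lemma sym_prehomog_mul k f g : sym_homog 1 f -> sym_prehomog k g -> sym_homog k (f * g).
Proof.
case: k => [hf /sym_prehomog0->|k hf /sym_prehomogS hg].
  by rewrite mulr0; case: (sym_homog_subspace 0).
exact: (sym_homog_mul (p := 1%N)).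
Qed.

Lemma sym_homog_premul a p f g : sym_homog a f -> sym_prehomog p g -> sym_prehomog (a + p) (f * g).
Proof.
case: p => [|p] hf; first by move/sym_prehomog0->; rewrite mulr0; case: (sym_prehomog_subspace (a + 0)).
by move/sym_prehomogS => hw; rewrite addnS; apply/sym_prehomogS; exact: sym_homog_mul.
Qed.

Lemma sym_sumP (T : S -> Prop) f : subspace T -> (forall m, f@_m != 0 -> T 'X_[m]) -> T f.
Proof.
move=> subT Tm; rewrite [f]mpolyE big_seq; apply: (subspace_sum subT) => m.
by rewrite mcoeff_msupp => /Tm; exact: subspaceZ.
Qed.

Lemma sym_homog_sum k (T : S -> Prop) f : subspace T -> sym_homog k f ->
  (forall m, mdeg m = k -> T 'X_[m]) -> T f.
Proof.
move=> subT hf Tm; apply: (sym_sumP subT) => m fm; apply: Tm.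
by apply: contraNeq fm => /hf->.
Qed.

Lemma sym_nonface_sum G k (T : S -> Prop) f : subspace T -> sym_homog k f -> sym_nonface G f ->
  (forall m, mdeg m = k -> carrier m \notin G -> T 'X_[m]) -> T f.
Proof.
move=> subT hf nf Tm; apply: (sym_sumP subT) => m fm; apply: Tm.
  by apply: contraNeq fm => /hf->.
by apply: contraNN fm => /nf->.
Qed.

Lemma carrierD m m' : carrier (m + m') = carrier m :|: carrier m'.
Proof. by apply/setP=> i; rewrite !inE mnmDE addn_gt0. Qed.

Lemma carrier_sub m m' : (m <= m')%MM -> carrier m \subset carrier m'.
Proof.
by move/mnm_lepP=> le; apply/subsetP=> i; rewrite !inE => mi; exact: leq_trans (le i).
Qed.

Lemma sym_nonfaceX G m : carrier m \notin G -> sym_nonface G 'X_[m].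
Proof. by move=> mG m' m'G; rewrite mcoeffX; case: eqP => // mm; rewrite mm m'G in mG. Qed.

Lemma sym_nonface_mul G f g : (forall F H, F \in G -> H \subset F -> H \in G) ->
  sym_nonface G f -> sym_nonface G (f * g).
Proof.
move=> clG hf m mG; rewrite mcoeffM; apply: big1 => -[m1 m2] /= /eqP e.
rewrite hf ?mul0r // (clG _ _ mG) //; have -> : carrier m = carrier (m1 + m2)%MM by rewrite -e.
by rewrite carrierD subsetUl.
Qed.

Lemma sym_act_is_linear A : linear (@sym_act K n A).
Proof. by move=> a f g; rewrite /sym_act comp_mpolyD comp_mpolyZ. Qed.

HB.instance Definition _ A := GRing.isLinear.Build K S S _ (@sym_act K n A) (sym_act_is_linear A).

Lemma sym_act_is_monoid_morphism A : monoid_morphism (@sym_act K n A).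
Proof.
split=> [|f g]; first by rewrite /sym_act comp_mpoly1.
by rewrite /sym_act [LHS]rmorphM.
Qed.

HB.instance Definition _ A := GRing.isMonoidMorphism.Build S S (@sym_act K n A)
  (sym_act_is_monoid_morphism A).

Lemma sym_actXU A i : sym_act A 'X_i = slin (fun j => A j i).
Proof. by rewrite /sym_act comp_mpolyXU (nth_map i) -?enumT ?size_enum_ord // nth_ord_enum. Qed.

Lemma sym_actX A m : sym_act A 'X_[m] = \prod_i slin (fun j => A j i) ^+ m i.
Proof. by rewrite mpolyXE_id rmorph_prod; apply: eq_bigr => i _; rewrite rmorphXn /= sym_actXU. Qed.

Lemma sym_act_lin A v : sym_act A (slin v) = slin (fun x => \sum_i v i * A x i).
Proof.
rewrite /slin linear_sum /=.
under eq_bigr => i _ do rewrite linearZ /= sym_actXU scaler_sumr.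
rewrite exchange_big /=; apply: eq_bigr => x _; rewrite scaler_suml.
by apply: eq_bigr => i _; rewrite scalerA.
Qed.

Lemma eq_sym_act A B f : (forall i, sym_act A (sym_act B 'X_i) = sym_act (A *m B) 'X_i) ->
  sym_act A (sym_act B f) = sym_act (A *m B) f.
Proof.
move=> e; apply: (sym_sumP (T := fun f => sym_act A (sym_act B f) = sym_act (A *m B) f)).
  split=> [|a g h eg eh]; first by rewrite !linear0.
  by rewrite !linearP /= eg eh.
move=> m _; rewrite mpolyXE_id !rmorph_prod /=; apply: eq_bigr => i _.
by rewrite !rmorphXn /= e.
Qed.

Lemma sym_act_comp A B f : sym_act A (sym_act B f) = sym_act (A *m B) f.
Proof.
apply: eq_sym_act => i; rewrite !sym_actXU sym_act_lin; apply: eq_bigr => x _; congr (_ *: _).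
by rewrite mxE; apply: eq_bigr => y _; rewrite mulrC.
Qed.

Lemma slin_delta i : slin (fun j => (j == i)%:R) = 'X_i.
Proof.
rewrite /slin (bigD1 i) //= eqxx scale1r big1 ?addr0 // => j /negbTE->.
by rewrite scale0r.
Qed.

Lemma sym_act1 f : sym_act 1%:M f = f.
Proof.
apply: (sym_sumP (T := fun f => sym_act 1%:M f = f)) => [|m _].
  by split=> [|a g h eg eh]; [rewrite linear0 | rewrite linearP /= eg eh].
rewrite mpolyXE_id !rmorph_prod /=; apply: eq_bigr => i _; rewrite rmorphXn /= sym_actXU.
rewrite -[in RHS]slin_delta; congr (_ ^+ _); apply: eq_bigr => j _.
by rewrite mxE eq_sym.
Qed.

Lemma sym_act_homog A k f : sym_homog k f -> sym_homog k (sym_act A f).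
Proof.
have subk := sym_homog_subspace k => hf.
apply: (sym_homog_sum (T := fun f => sym_homog k (sym_act A f)) _ hf) => [|m <-].
  split=> [|a g h eg eh]; first by rewrite linear0; case: subk.
  by rewrite linearP; exact: (proj2 subk).
rewrite sym_actX mdegE.
elim: (index_enum _) => [|i s IHs]; first by rewrite !big_nil; exact: sym_homog1.
rewrite !big_cons; apply: sym_homog_mul => //; apply: sym_homog_exp; exact: sym_homog_lin.
Qed.

Lemma sym_act_prehomog A k f : sym_prehomog k f -> sym_prehomog k (sym_act A f).
Proof.
case: k => [/sym_prehomog0->|k /sym_prehomogS hf].
  by rewrite linear0; case: (sym_prehomog_subspace 0).
by apply/sym_prehomogS/sym_act_homog.
Qed.

(* Setting to zero the variables outside of [F]. *)
Definition restr_mx F : 'M[K]_n := \matrix_(j, i) ((j == i) && (i \in F))%:R.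

Lemma sym_act_restrU F i : sym_act (restr_mx F) 'X_i = if i \in F then 'X_i else 0.
Proof.
rewrite sym_actXU; case: ifP => iF.
  by rewrite -[RHS]slin_delta; apply: eq_bigr => j _; rewrite mxE iF andbT.
by rewrite /slin big1 // => j _; rewrite mxE iF andbF scale0r.
Qed.

Lemma sym_act_restrX F m : sym_act (restr_mx F) 'X_[m] = if carrier m \subset F then 'X_[m] else 0.
Proof.
rewrite mpolyXE_id rmorph_prod /=; case: ifP => [/subsetP mF|/negbT/subsetPn[i im iF]].
  apply: eq_bigr => i _; rewrite rmorphXn /= sym_act_restrU; case: ifP => // iF.
  by case: (posnP (m i)) => [->//|mi]; rewrite mF // inE in iF.
rewrite (bigD1 i) //= rmorphXn /= sym_act_restrU (negbTE iF) expr0n; move: im; rewrite inE lt0n.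
by move/negbTE->; rewrite mul0r.
Qed.

(** The Stanley-Reisner ideal consists of the polynomials vanishing identically on each coordinate
    subspace spanned by a face. *)
Lemma sym_nonfaceP G f : (forall F, F \in G -> sym_act (restr_mx F) f = 0) -> sym_nonface G f.
Proof.
move=> h m mG; have := congr1 (fun p : S => p@_m) (h _ mG).
rewrite {1}[f]mpolyE (linear_sum (sym_act (restr_mx (carrier m)))) (linear_sum (mcoeff m)) mcoeff0 /=.
under eq_bigr => m' _ do rewrite linearZ /= mcoeffZ sym_act_restrX.
have [fm|] := boolP (m \in msupp f); last by rewrite mcoeff_msupp negbK => /eqP.
rewrite (bigD1_seq m) ?msupp_uniq //= subxx mcoeffX eqxx mulr1 big1 ?addr0 // => m' m'm.
by case: ifP; rewrite ?mcoeff0 ?mcoeffX ?(negbTE m'm) ?mulr0.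
Qed.

End SymBasics.

Arguments sym_homog [K n] k%_N f.
Arguments sym_prehomog [K n] k%_N f.

Section MonoDegree.
Variables (n k : nat).

(** Monomials of degree [k] as a finite type, so that the linear algebra on [{ffun I -> K^o}]
    applies. *)
Definition mono_deg := {m : 'X_{1..n < k.+1} | mdeg m == k}.

HB.instance Definition _ := Finite.on mono_deg.

Definition mval (a : mono_deg) : 'X_{1..n} := bmnm (val a).

Lemma mdeg_mval a : mdeg (mval a) = k.
Proof. exact/eqP/(valP a). Qed.

Lemma mval_inj : injective mval.
Proof. by move=> a b e; apply/val_inj/val_inj. Qed.

Lemma mval_exists m : mdeg m = k -> exists a, mval a = m.
Proof.
move=> km; have lt : (mdeg m < k.+1)%N by rewrite km.
have kb : mdeg (BMultinom lt) == k by rewrite /= km.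
by exists (exist _ (BMultinom lt) kb).
Qed.

Lemma sym_homogE (K : fieldType) (f : {mpoly K[n]}) : sym_homog k f ->
  f = \sum_(a : mono_deg) f@_(mval a) *: 'X_[mval a].
Proof.
move=> hf; apply/mpolyP=> m; rewrite (linear_sum (mcoeff m)) /=.
have [/mval_exists[a <-]|km] := eqVneq (mdeg m) k.
  rewrite (bigD1 a) //= mcoeffZ mcoeffX eqxx mulr1 big1 ?addr0 // => b ba.
  by rewrite mcoeffZ mcoeffX (inj_eq mval_inj) (negbTE ba) mulr0.
rewrite hf // big1 // => b _; rewrite mcoeffZ mcoeffX; case: eqP => [e|]; last by rewrite mulr0.
by rewrite -e mdeg_mval eqxx in km.
Qed.

End MonoDegree.

(** * Spanning one degree of the face ring modulo linear forms *)

Section SymSpan.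
Variables (K : fieldType) (n : nat).
Local Notation S := {mpoly K[n]}.
Implicit Types (F H : {set 'I_n}) (G : {set {set 'I_n}}) (f g : S) (m : 'X_{1..n}) (A B : 'M[K]_n).

Definition sym_part G k f : Prop := sym_homog k f /\ sym_nonface G f.

Lemma sym_part_subspace G k : subspace (sym_part G k).
Proof.
have [h0 hL] := sym_homog_subspace K n k; have [n0 nL] := sym_nonface_subspace K G.
by split=> // a u v [hu nu] [hv nv]; split; [exact: hL | exact: nL].
Qed.

Section Decomp.
Variables (J : S -> Prop) (k r : nat) (tau : S) (Theta : nat -> 'I_n -> K) (D : S -> Prop).

(** Unlike in [ext_decomp], the ideal part [J] is a parameter, because it moves during the
    deformation used for an edge. *)
Definition sym_decomp f : Prop := exists (j : S) (u : nat -> S) (w : S),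
  [/\ J j, forall l, sym_prehomog k (u l), D w
    & f = j + \sum_(l < r) slin (Theta l) * u l + tau * w].

Definition sym_span : Prop := forall f, sym_homog k f -> sym_decomp f.

Hypotheses (subJ : subspace J) (subD : subspace D).

Lemma sym_decomp_subspace : subspace sym_decomp.
Proof.
split.
  exists 0, (fun=> 0), 0; split; last 1 first.
  - by rewrite mulr0 addr0 add0r big1 // => l _; rewrite mulr0.
  - by case: subJ.
  - by move=> _; case: (sym_prehomog_subspace K n k).
  - by case: subD.
move=> a f g [j [u [w [hj hu Dw ->]]]] [j' [u' [w' [hj' hu' Dw' ->]]]].
exists (a *: j + j'), (fun l => a *: u l + u' l), (a *: w + w'); split.
- exact: (proj2 subJ).
- by move=> l; apply: (proj2 (sym_prehomog_subspace K n k)).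
- exact: (proj2 subD).
rewrite !scalerDr mulrDr -scalerAr scaler_sumr addrACA; congr (_ + _).
rewrite addrACA; congr (_ + _); rewrite -big_split; apply: eq_bigr => l _ /=.
by rewrite mulrDr -scalerAr.
Qed.

Lemma sym_decompJ f : J f -> sym_decomp f.
Proof.
move=> Jf; exists f, (fun=> 0), 0; split=> //.
- by move=> _; case: (sym_prehomog_subspace K n k).
- by case: subD.
by rewrite mulr0 addr0 big1 ?addr0 // => l _; rewrite mulr0.
Qed.

Lemma sym_decompD w : D w -> sym_decomp (tau * w).
Proof.
move=> Dw; exists 0, (fun=> 0), w; split=> //.
- by case: subJ.
- by move=> _; case: (sym_prehomog_subspace K n k).
by rewrite add0r big1 ?add0r // => l _; rewrite mulr0.
Qed.

Lemma sym_decomp_lin l u : (l < r)%N -> sym_prehomog k u -> sym_decomp (slin (Theta l) * u).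
Proof.
move=> lr hu; exists 0, (fun l' => if l' == l then u else 0), 0; split.
- by case: subJ.
- by move=> l'; case: eqP => // _; case: (sym_prehomog_subspace K n k).
- by case: subD.
rewrite mulr0 addr0 add0r (bigD1 (Ordinal lr)) //= eqxx big1 ?addr0 // => l'.
by rewrite -(inj_eq val_inj) /= => /negbTE->; rewrite mulr0.
Qed.

Lemma sym_span_mono : (forall m, mdeg m = k -> sym_decomp 'X_[m]) -> sym_span.
Proof. by move=> dm f hf; apply: (sym_homog_sum sym_decomp_subspace hf). Qed.

End Decomp.

Section Open.
Variables (X : Type) (P : (X -> K) -> Prop).
Hypothesis PC : poly_class P.

Definition sym_poly (f : X -> S) : Prop := forall m, P (fun x => (f x)@_m).

Lemma sym_poly_const f : sym_poly (fun=> f).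
Proof. by move=> m; exact: (pc_const PC). Qed.

Lemma sym_poly_add (f g : X -> S) : sym_poly f -> sym_poly g -> sym_poly (fun x => f x + g x).
Proof. by move=> Pf Pg m; apply: (pc_ext PC) (pc_add PC (Pf m) (Pg m)) => x; rewrite mcoeffD. Qed.

Lemma sym_poly_sum (I : Type) (r : seq I) (f : I -> X -> S) :
  (forall i, sym_poly (f i)) -> sym_poly (fun x => \sum_(i <- r) f i x).
Proof.
move=> Pf m; have Ps := @pc_sum _ _ _ PC _ r xpredT (fun i x => (f i x)@_m).
by apply: (pc_ext PC) (Ps _) => [x|i _]; [rewrite (linear_sum (mcoeff m)) | exact: Pf].
Qed.

Lemma sym_poly_scale (a : X -> K) (f : X -> S) : P a -> sym_poly f -> sym_poly (fun x => a x *: f x).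
Proof. by move=> Pa Pf m; apply: (pc_ext PC) (pc_mul PC Pa (Pf m)) => x; rewrite mcoeffZ. Qed.

Lemma sym_poly_mul (f g : X -> S) : sym_poly f -> sym_poly g -> sym_poly (fun x => f x * g x).
Proof.
move=> Pf Pg m; pose I := ('X_{1..n < (mdeg m).+1} * 'X_{1..n < (mdeg m).+1})%type.
have Ps := @pc_sum _ _ _ PC I (index_enum _) (fun q => m == (q.1 + q.2)%MM)
  (fun q x => (f x)@_q.1 * (g x)@_q.2).
by apply: (pc_ext PC) (Ps _) => [x|q _]; [rewrite mcoeffM | exact: (pc_mul PC)].
Qed.

Lemma sym_poly_prod (I : Type) (r : seq I) (f : I -> X -> S) :
  (forall i, sym_poly (f i)) -> sym_poly (fun x => \prod_(i <- r) f i x).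
Proof.
move=> Pf; elim: r => [|i r IHr] F.
  by apply: (pc_ext PC) (sym_poly_const 1 F) => x; rewrite big_nil.
by apply: (pc_ext PC) (sym_poly_mul (Pf i) IHr F) => x; rewrite big_cons.
Qed.

Lemma sym_poly_exp e (f : X -> S) : sym_poly f -> sym_poly (fun x => f x ^+ e).
Proof.
move=> Pf; elim: e => [|e IHe] m.
  by apply: (pc_ext PC) (sym_poly_const 1 m) => x; rewrite expr0.
by apply: (pc_ext PC) (sym_poly_mul Pf IHe m) => x; rewrite exprS.
Qed.

Lemma sym_poly_lin (v : X -> 'I_n -> K) : (forall i, P (v^~ i)) ->
  sym_poly (fun x => slin (v x)).
Proof.
by move=> Pv; apply: sym_poly_sum => i; apply: sym_poly_scale => //; exact: sym_poly_const.
Qed.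

Definition sym_lin_span k (v : mono_deg n k -> S) f : Prop :=
  exists c, f = \sum_a c a *: v a.

Lemma sym_lin_span_subspace k (v : mono_deg n k -> S) : subspace (sym_lin_span v).
Proof.
split; first by exists (fun=> 0); rewrite big1 // => a _; rewrite scale0r.
move=> a f g [c ->] [c' ->]; exists (fun b => a * c b + c' b).
rewrite scaler_sumr -big_split; apply: eq_bigr => b _ /=.
by rewrite scalerDl scalerA.
Qed.

(** Openness also when the ideal part is spanned by vectors [v a x] that move with the parameter. *)
Lemma sym_span_open k r (v : mono_deg n k -> X -> S) (tau : X -> S)
    (Theta : X -> nat -> 'I_n -> K) D x0 :
  subspace D -> (forall a, sym_poly (v a)) -> sym_poly tau -> (forall l i, P (fun x => Theta x l i)) ->
  (forall a x, sym_homog k (v a x)) -> (forall x w, D w -> sym_homog k (tau x * w)) ->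
  sym_span (sym_lin_span (v^~ x0)) k r (tau x0) (Theta x0) D ->
  exists2 q, P q & q x0 != 0 /\
    forall x, q x != 0 -> sym_span (sym_lin_span (v^~ x)) k r (tau x) (Theta x) D.
Proof.
move=> subD Pv Ptau PT hv hD span0; pose I := mono_deg n k.
have /fin_all_exists[c cP] (i : I) : exists c : (I -> K) * (nat -> S) * S,
    [/\ forall l, sym_prehomog k (c.1.2 l), D c.2
      & 'X_[mval i] = \sum_a c.1.1 a *: v a x0 +
          \sum_(l < r) slin (Theta x0 l) * c.1.2 l + tau x0 * c.2].
  have [|j [u [w [[c ->] hu Dw e]]]] := span0 'X_[mval i].
    by have := @sym_homogX K n (mval i); rewrite mdeg_mval.
  by exists (c, u, w).
pose u (i : I) x : S := \sum_a (c i).1.1 a *: v a x +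
  \sum_(l < r) slin (Theta x l) * (c i).1.2 l + tau x * (c i).2.
have subk := sym_homog_subspace K n k.
have hu i x : sym_homog k (u i x).
  have [hl Dw _] := cP i; apply: (subspaceD subk); last exact: hD.
  apply: (subspaceD subk); apply: (subspace_sum subk) => a _.
    by apply: (subspaceZ subk); exact: hv.
  by apply: sym_prehomog_mul => //; exact: sym_homog_lin.
have [||x i||q Pq [q0 qP]] := @open_span K X P PC S I (fun a : I => 'X_[mval a])
  (fun x => sym_decomp (sym_lin_span (v^~ x)) k r (tau x) (Theta x) D)
  (fun (i a : I) x => (u i x)@_(mval a)) x0.
- by move=> x; apply: sym_decomp_subspace => //; exact: sym_lin_span_subspace.
- move=> i a.
  apply: (@sym_poly_add (fun x => _ + _) (fun x => tau x * _)); last first.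
    by apply: sym_poly_mul => //; exact: sym_poly_const.
  apply: sym_poly_add; apply: sym_poly_sum => l.
    by apply: sym_poly_scale => //; exact: (pc_const PC).
  by apply: sym_poly_mul; [apply: sym_poly_lin | exact: sym_poly_const].
- rewrite -sym_homogE //; have [hl Dw _] := cP i.
  exists (\sum_a (c i).1.1 a *: v a x), (c i).1.2, (c i).2; split=> //.
  by exists (c i).1.1.
- move=> i a; rewrite /u; have [_ _ <-] := cP i; rewrite mcoeffX (inj_eq (@mval_inj n k)).
  by [].
exists q => //; split=> // x /qP dx; apply: sym_span_mono => //.
  exact: sym_lin_span_subspace.
by move=> m /mval_exists[a <-]; exact: dx.
Qed.

End Open.

Definition nf_mono G k (a : mono_deg n k) : S := if carrier (mval a) \in G then 0 else 'X_[mval a].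

Lemma nf_mono_homog G k (a : mono_deg n k) : sym_homog k (nf_mono G a).
Proof.
rewrite /nf_mono; case: ifP => _; first by case: (sym_homog_subspace K n k).
by have := @sym_homogX K n (mval a); rewrite mdeg_mval.
Qed.

Lemma sym_partE G k f : sym_part G k f <-> sym_lin_span (nf_mono G (k := k)) f.
Proof.
split=> [[hf nf]|[c ->]].
  exists (fun a => f@_(mval a)); rewrite {1}(sym_homogE hf); apply: eq_bigr => a _.
  by rewrite /nf_mono; case: ifP => // aG; rewrite nf // scale0r scaler0.
apply: (subspace_sum (sym_part_subspace G k)) => a _; apply: (subspaceZ (sym_part_subspace G k)).
split; first exact: nf_mono_homog.
rewrite /nf_mono; case: ifP => [_|/negbT]; last exact: sym_nonfaceX.
by case: (sym_nonface_subspace K G).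
Qed.

Lemma sym_span_sub (J J' : S -> Prop) k r tau Theta (D : S -> Prop) :
  (forall f, J f -> J' f) -> sym_span J k r tau Theta D -> sym_span J' k r tau Theta D.
Proof.
by move=> JJ' sp f /sp[j [u [w [Jj hu Dw ->]]]]; exists j, u, w; split=> //; exact: JJ'.
Qed.

(** After the first [r] forms are divided out, form number [r] plays the role of a strong Lefschetz
    element. *)
Definition sym_tau (Theta : nat -> 'I_n -> K) r a : S := slin (Theta r) ^+ a.

Lemma sym_homog_tau Theta r a : sym_homog a (sym_tau Theta r a).
Proof. by apply: sym_homog_exp; exact: sym_homog_lin. Qed.

Lemma sym_tau_poly (X : Type) (P : (X -> K) -> Prop) (Theta : X -> nat -> 'I_n -> K) r a :
  poly_class P -> (forall l i, P (fun x => Theta x l i)) -> sym_poly P (fun x => sym_tau (Theta x) r a).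
Proof. by move=> PC PT; apply: sym_poly_exp => //; apply: sym_poly_lin. Qed.

Lemma sym_span_common G G' k k' r a Theta Theta' D D' : infinite_field K ->
  subspace D -> subspace D' ->
  (forall Th w, D w -> sym_homog k (sym_tau Th r a * w)) ->
  (forall Th w, D' w -> sym_homog k' (sym_tau Th r a * w)) ->
  sym_span (sym_part G k) k r (sym_tau Theta r a) Theta D ->
  sym_span (sym_part G' k') k' r (sym_tau Theta' r a) Theta' D' ->
  exists Theta2, sym_span (sym_part G k) k r (sym_tau Theta2 r a) Theta2 D /\
                 sym_span (sym_part G' k') k' r (sym_tau Theta2 r a) Theta2 D'.
Proof.
move=> Kinf subD subD' hD hD' sp sp'; have PC := polyline_class K.
pose L := line Theta Theta'; pose tau t := sym_tau (L t) r a.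
have LP l i : polyline (fun t => L t l i) by exact: line_poly.
have Ptau : sym_poly (@polyline K) tau by exact: sym_tau_poly.
have L0 : L 0 = Theta by apply/funext=> l; apply/funext=> i; rewrite /L /line mul0r addr0.
have L1 : L 1 = Theta' by apply/funext=> l; apply/funext=> i; rewrite /L /line mul1r subrKC.
have open G1 k1 D1 t0 : subspace D1 -> (forall Th w, D1 w -> sym_homog k1 (sym_tau Th r a * w)) ->
  sym_span (sym_part G1 k1) k1 r (tau t0) (L t0) D1 -> exists2 q, polyline q & q t0 != 0 /\
    forall t, q t != 0 -> sym_span (sym_part G1 k1) k1 r (tau t) (L t) D1.
  move=> subD1 hD1 sp1; have [||||q Pq [q0 qP]] := @sym_span_open K _ PC k1 r (fun b _ => nf_mono G1 b) tau L D1 t0 subD1 _ Ptau LP.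
  - by move=> b; exact: sym_poly_const.
  - by move=> b _; exact: nf_mono_homog.
  - by move=> t w /hD1; apply.
  - by apply: sym_span_sub sp1 => f /sym_partE.
  by exists q => //; split=> // t /qP; apply: sym_span_sub => f /sym_partE.
have [|q Pq [q0 qP]] := open G k D 0 subD hD; first by rewrite /tau L0.
have [|q' Pq' [q0' qP']] := open G' k' D' 1 subD' hD'; first by rewrite /tau L1.
have [t [qt q't]] := polyline_common Kinf Pq Pq' q0 q0'.
by exists (L t); split; [exact: qP | exact: qP'].
Qed.

End SymSpan.
Arguments sym_part [K n] G k%_N f.
Arguments sym_span [K n] J k%_N r%_N tau Theta D.
Arguments sym_tau [K n] Theta r%_N a%_N.
Arguments nf_mono K [n] G [k] a.

(** * Symmetric case: joins and boundaries of simplices *)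

Section SymInduction.
Variables (K : fieldType) (n : nat).
Local Notation S := {mpoly K[n]}.
Implicit Types (F H : {set 'I_n}) (G L : {set {set 'I_n}}) (f g : S) (m : 'X_{1..n}) (A B : 'M[K]_n).

Lemma mpolyX_pick m i : i \in carrier m -> 'X_[m] = 'X_i * 'X_[(m - U_(i))%MM] :> S.
Proof.
rewrite inE -mpolyXD addmC => mi; rewrite submK //; apply/mnm_lepP=> j.
by rewrite mnm1E; case: eqP => // <-.
Qed.

Lemma mdeg_pick m i : i \in carrier m -> (mdeg (m - U_(i))%MM).+1 = mdeg m.
Proof.
rewrite inE => mi; rewrite -[in RHS](submK (m := U_(i)%MM) (m' := m)).
  by rewrite mdegD mdeg1 addn1.
by apply/mnm_lepP=> j; rewrite mnm1E; case: eqP => // <-.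
Qed.

Lemma sym_prehomog_pick m i : i \in carrier m -> sym_prehomog (mdeg m) ('X_[(m - U_(i))%MM] : S).
Proof. by move=> im; rewrite -(mdeg_pick im); apply/sym_prehomogS; exact: sym_homogX. Qed.

Lemma sym_decomp_pick (J D : S -> Prop) k r tau Theta l m i : (l < r)%N ->
  slin (Theta l) = 'X_i -> i \in carrier m -> mdeg m = k -> subspace J -> subspace D -> sym_decomp J k r tau Theta D 'X_[m].
Proof.
move=> lr Ti im mk subJ subD; rewrite (mpolyX_pick im) -Ti.
by apply: sym_decomp_lin => //; rewrite -mk; exact: sym_prehomog_pick.
Qed.

Lemma spanned_image h (D : S -> Prop) A : spanned h D ->
  spanned h (fun w => exists2 w0, D w0 & w = sym_act A w0).
Proof.
move=> [M sM]; exists (fun l => sym_act A (M l)) => w [w0 /sM[c ->] ->]; exists c.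
by rewrite (linear_sum (sym_act A)); apply: eq_bigr => l _; rewrite linearZ.
Qed.

Lemma spanned0_eq0 (D : S -> Prop) w : spanned 0 D -> D w -> w = 0.
Proof. by move=> [M sM] /sM[c ->]; rewrite big_ord0. Qed.

(** Both [i] and [j] are cone points here. Dividing by x_i and x_j leads back to [L], and matches
    the two dimensions lost in the link of an edge. *)
Definition sym_join L (i j : 'I_n) : {set {set 'I_n}} := [set F : {set 'I_n} | F :\ i :\ j \in L].

Definition sym_join_forms (Theta : nat -> 'I_n -> K) (i j : 'I_n) (l : nat) : 'I_n -> K :=
  match l with 0%N => fun x => (x == i)%:R | 1%N => fun x => (x == j)%:R | l.+2 => Theta l end.

Lemma sym_span_join L i j k r a Theta D : subspace D ->
  sym_span (sym_part L k) k r (sym_tau Theta r a) Theta D ->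
  sym_span (sym_part (sym_join L i j) k) k r.+2 (sym_tau (sym_join_forms Theta i j) r.+2 a)
    (sym_join_forms Theta i j) D.
Proof.
move=> subD sp f /sp[j0 [u [w [[hj nj] hu Dw ->]]]].
have subJ := sym_part_subspace K (sym_join L i j) k.
have subdec := sym_decomp_subspace k r.+2 (sym_tau (sym_join_forms Theta i j) r.+2 a)
   (sym_join_forms Theta i j) subJ subD.
apply: (subspaceD subdec); last exact: sym_decompD.
apply: (subspaceD subdec); last first.
  apply: (subspace_sum subdec) => l _; rewrite -[Theta l]/(sym_join_forms Theta i j l.+2).
  by apply: sym_decomp_lin => //; rewrite !ltnS.
apply: (sym_nonface_sum subdec hj nj) => m mk mL.
have [im|im] := boolP (i \in carrier m).
  by apply: (@sym_decomp_pick _ _ k r.+2 _ _ 0 m i) => //; exact: slin_delta.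
have [jm|jm] := boolP (j \in carrier m).
  by apply: (@sym_decomp_pick _ _ k r.+2 _ _ 1 m j) => //; exact: slin_delta.
apply: sym_decompJ => //; split; first by rewrite -mk; exact: sym_homogX.
apply: sym_nonfaceX; rewrite inE; suff -> : carrier m :\ i :\ j = carrier m by [].
have -> : carrier m :\ i = carrier m by apply/setDidPl; rewrite disjoint_sym disjoints1.
by apply/setDidPl; rewrite disjoint_sym disjoints1.
Qed.

Section Boundary.
Variables (V : {set 'I_n}) (d : nat) (x0 : 'I_n).
Hypotheses (Vd : #|V| = d.+1) (x0V : x0 \in V).
Let v l := nth x0 (enum (V :\ x0)) l.
Let Theta (l : nat) (x : 'I_n) : K := if (l < d)%N then (x == v l)%:R - (x == x0)%:R else (x == x0)%:R.
Local Notation G := [set F : {set 'I_n} | F \proper V].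

Let linT l : (l < d)%N -> slin (Theta l) = 'X_(v l) - 'X_x0.
Proof.
move=> ld; rewrite -!slin_delta -sumrB /slin; apply: eq_bigr => x _.
by rewrite /Theta ld scalerBl.
Qed.

Let linTd : slin (Theta d) = 'X_x0.
Proof. by rewrite -slin_delta; apply: eq_bigr => x _; rewrite /Theta ltnn. Qed.

Let T k := sym_decomp (fun j => j = 0) k d 0 Theta (fun w => w = 0).

Let sub0 : subspace (fun w : S => w = 0).
Proof. by split=> // b u w -> ->; rewrite scaler0 addr0. Qed.

Let Tmul k f : T k f -> T k.+1 ('X_x0 * f).
Proof.
move=> [_ [u [_ [-> hu -> ->]]]]; exists 0, (fun l => 'X_x0 * u l), 0; split=> //.
  by move=> l; apply: (@sym_homog_premul K n 1 k) => //; exact: sym_homogXU.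
rewrite mulr0 !addr0 !add0r mulr_sumr; apply: eq_bigr => l _.
by rewrite mulrCA.
Qed.

(** A variable x_i of the carrier is exchanged for the variable of [x0] at the cost of a multiple of
    their difference, which is one of the first [d] forms. *)
Let Tmono k m : mdeg m = k -> carrier m \subset V -> T k ('X_[m] - 'X_x0 ^+ k).
Proof.
have subT k' := sym_decomp_subspace k' d 0 Theta sub0 sub0.
elim: k m => [|k IHk] m mk mV.
  have -> : m = 0%MM by apply/eqP; rewrite -mdeg_eq0 mk.
  by rewrite mpolyX0 expr0 subrr; case: (subT 0%N).
have [i im] : exists i, i \in carrier m.
  apply/set0Pn; apply/eqP=> m0; have : mdeg m = 0%N; last by rewrite mk.
  rewrite mdegE big1 // => i _; have : i \notin carrier m by rewrite m0 inE.
  by rewrite inE lt0n negbK => /eqP.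
have km : mdeg (m - U_(i))%MM = k by apply/eqP; rewrite -eqSS (mdeg_pick im) mk.
rewrite (mpolyX_pick im) exprS.
set f := 'X_[_ - _]; have -> : 'X_i * f - 'X_x0 * 'X_x0 ^+ k =
    'X_x0 * (f - 'X_x0 ^+ k) + ('X_i - 'X_x0) * f by ring.
apply: (subspaceD (subT k.+1)).
  apply/Tmul/IHk => //; apply: subset_trans mV; apply: carrier_sub.
  by apply/mnm_lepP=> j; rewrite mnmBE leq_subr.
have [->|ix0] := eqVneq i x0; first by rewrite subrr mul0r; case: (subT k.+1).
have iV : i \in enum (V :\ x0) by rewrite mem_enum !inE ix0 (subsetP mV).
have ld : (index i (enum (V :\ x0)) < d)%N.
  by rewrite -index_mem -cardE in iV; move: iV; rewrite (_ : #|_| = d) //; move: Vd; rewrite (cardsD1 x0) x0V => -[].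
have -> : 'X_i - 'X_x0 = slin (Theta (index i (enum (V :\ x0)))) by rewrite linT // /v nth_index.
by apply: sym_decomp_lin => //; apply/sym_prehomogS; rewrite -km; exact: sym_homogX.
Qed.

Let Tdec (J D : S -> Prop) k tau f : subspace J -> subspace D -> T k f -> sym_decomp J k d tau Theta D f.
Proof.
move=> [J0 _] [D0 _] [_ [u [_ [-> hu -> ->]]]]; exists 0, u, 0; split=> //.
by rewrite !mulr0.
Qed.

(** Modulo the differences of variables, all variables of [V] agree and the face ring becomes that
    of one variable truncated above degree [d], with the variable of [x0] as Lefschetz element. *)
Lemma sym_span_boundary p a : (a == 0%N) || (a + p.*2 == d)%N ->
  exists (Th : nat -> 'I_n -> K) (D : S -> Prop),
    [/\ subspace D, forall w, D w -> sym_homog p w, spanned (p <= d)%N D &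
    sym_span (sym_part G (a + p)%N) (a + p)%N d (sym_tau Th d a) Th D].
Proof.
(* The factor [(p <= d)%:R] makes [D] zero above degree [d]. *)
move=> ap; pose D (w : S) := exists c : K, w = (c * (p <= d)%:R) *: 'X_x0 ^+ p.
have subD : subspace D.
  split=> [|b w w' [c ->] [c' ->]]; first by exists 0; rewrite mul0r scale0r.
  by exists (b * c + c'); rewrite mulrDl scalerDl scalerA mulrA.
have subJ := sym_part_subspace K G (a + p)%N.
exists Theta, D; split=> //.
- move=> w [c ->]; apply: (subspaceZ (sym_homog_subspace K n p)); apply: sym_homog_exp.
  exact: sym_homogXU.
- case: leqP => pd; last first.
    by apply: spanned0 => w [c ->]; rewrite leqNgt pd mulr0 scale0r.
  exists (fun=> 'X_x0 ^+ p) => w [c ->]; exists (fun=> c); rewrite big_ord1 pd mulr1 //.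
have subdec := sym_decomp_subspace (a + p)%N d (sym_tau Theta d a) Theta subJ subD.
have dec_x0 : sym_decomp (sym_part G (a + p)%N) (a + p)%N d (sym_tau Theta d a) Theta D ('X_x0 ^+ (a + p)%N).
  have [le_pd|lt_dp] := leqP p d.
    rewrite exprD -linTd; apply: sym_decompD => //; rewrite linTd.
    by exists 1; rewrite le_pd mulr1 scale1r.
  have a0 : a = 0%N by case/orP: ap => /eqP //; lia.
  (* A monomial of degree [p] with carrier [V], a nonface, congruent to the power of the variable of
     [x0]. *)
  pose m0 : 'X_{1..n} := [multinom ((i \in V) + (i == x0) * (p - d.+1))%N | i < n].
  have m0p : mdeg m0 = (a + p)%N.
    rewrite mdegE (eq_bigr (fun i => (i \in V) + (i == x0) * (p - d.+1))%N); last by move=> i _; rewrite mnmE.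
    rewrite big_split /= -big_mkcond sum1_card Vd (bigD1 x0) //= eqxx mul1n big1 ?addn0.
      by rewrite a0 subnKC.
    by move=> i /negbTE->.
  have m0V : carrier m0 = V.
    apply/setP=> i; rewrite inE mnmE; case: (boolP (i \in V)) => // iV.
    by case: eqP => // ix0; rewrite ix0 x0V in iV.
  have -> : 'X_x0 ^+ (a + p)%N = 'X_[m0] - ('X_[m0] - 'X_x0 ^+ (a + p)%N) :> S by rewrite opprB addrCA subrr addr0.
  apply: (subspaceB subdec); last by apply: Tdec => //; apply: Tmono => //; rewrite m0V.
  apply: sym_decompJ => //; split; first by rewrite -m0p; exact: sym_homogX.
  by apply: sym_nonfaceX; rewrite inE m0V properxx.
apply: sym_span_mono => // m mk; have [mV|mV] := boolP (carrier m \subset V).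
  rewrite -['X_[m]](subrK ('X_x0 ^+ (a + p)%N)); apply: (subspaceD subdec) => //.
  by apply: Tdec => //; exact: Tmono.
apply: sym_decompJ => //; split; first by rewrite -mk; exact: sym_homogX.
by apply: sym_nonfaceX; rewrite inE properE (negbTE mV).
Qed.

End Boundary.
End SymInduction.

(** * Symmetric case: the inductive step for an edge, by deformation *)

Section SymEdge.
Variables (K : fieldType) (n : nat) (V : {set 'I_n}) (G : {set {set 'I_n}}) (i j : 'I_n).
Local Notation S := {mpoly K[n]}.
Implicit Types (F H : {set 'I_n}) (f g : S) (m : 'X_{1..n}) (A B : 'M[K]_n).
Hypotheses (cG : complex_on V G) (ij : i != j) (lc : link_condition G i j).
Local Notation C := (contraction G i j).
Local Notation JL := (sym_join (link G [set i; j]) i j).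

(** Setting x_i to zero in the ring of this complex leaves the ring of the contraction, and the
    multiples of x_i form the ring of [JL] shifted by one. The ring of [G] is reached from it by the
    deformation below. *)
Definition polar : {set {set 'I_n}} :=
  [set F : {set 'I_n} | if i \in F then F :\ i :\ j \in link G [set i; j] else F \in C].

Definition polar_space (D1 D2 : S -> Prop) w : Prop :=
  exists w1 w2, [/\ D1 w1, D2 w2 & w = w1 + 'X_i * w2].

Lemma polar_space_subspace D1 D2 : subspace D1 -> subspace D2 -> subspace (polar_space D1 D2).
Proof.
move=> [D10 D1L] [D20 D2L]; split; first by exists 0, 0; rewrite mulr0 addr0.
move=> b u v [u1 [u2 [Du1 Du2 ->]]] [v1 [v2 [Dv1 Dv2 ->]]].
exists (b *: u1 + v1), (b *: u2 + v2); split; [exact: D1L | exact: D2L |].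
by rewrite mulrDr -scalerAr scalerDr addrACA.
Qed.

Lemma carrier_add_i m : carrier (m + U_(i))%MM :\ i :\ j = carrier m :\ i :\ j.
Proof. by apply/setP=> x; rewrite !inE mnmDE mnm1E; case: (eqVneq x i) => [_|_] /=; rewrite ?andbF ?addn0. Qed.

(** After a decomposition in the contraction, the only monomials not already in the ideal of [polar]
    are multiples of x_i; the cofactor is then decomposed in [JL]. *)
Lemma sym_span_polar k r a Theta D1 D2 : subspace D1 -> subspace D2 ->
  sym_span (sym_part C k) k r (sym_tau Theta r a) Theta D1 ->
  (forall k', k = k'.+1 -> sym_span (sym_part JL k') k' r (sym_tau Theta r a) Theta D2) ->
  sym_span (sym_part polar k) k r (sym_tau Theta r a) Theta (polar_space D1 D2).
Proof.
move=> subD1 subD2 spC spL.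
have subP := sym_part_subspace K polar k.
have subD := polar_space_subspace subD1 subD2; have [D10 _] := subD1; have [D20 _] := subD2.
have subdec := sym_decomp_subspace k r (sym_tau Theta r a) Theta subP subD.
move=> f /spC[c [u1 [w1 [[hc nc] hu1 Dw1 ->]]]].
apply: (subspaceD subdec); last first.
  by apply: sym_decompD => //; exists w1, 0; rewrite mulr0 addr0.
apply: (subspaceD subdec); last first.
  by apply: (subspace_sum subdec) => l _; exact: sym_decomp_lin.
apply: (sym_nonface_sum subdec hc nc) => m mk mC.
have [im|im] := boolP (i \in carrier m); last first.
  apply: sym_decompJ => //; split; first by rewrite -mk; exact: sym_homogX.
  by apply: sym_nonfaceX; rewrite inE (negbTE im).
have kS : k = (mdeg (m - U_(i))%MM).+1 by rewrite mdeg_pick.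
have [|l0 [u2 [w2 [[hl nl] hu2 Dw2 e]]]] := spL _ kS 'X_[(m - U_(i))%MM].
  exact: sym_homogX.
rewrite (mpolyX_pick K im) e !mulrDr; apply: (subspaceD subdec); last first.
  rewrite mulrCA; apply: sym_decompD => //.
  by exists 0, w2; rewrite add0r.
apply: (subspaceD subdec); last first.
  rewrite mulr_sumr; apply: (subspace_sum subdec) => l _; rewrite mulrCA; apply: sym_decomp_lin => //.
  rewrite kS -add1n; apply: sym_homog_premul => //; exact: sym_homogXU.
apply: sym_decompJ => //; rewrite /sym_part kS.
apply: (sym_nonface_sum (T := fun f => sym_part polar _ ('X_i * f)) _ hl nl).
  have [P0 PL] := sym_part_subspace K polar (mdeg (m - U_(i))%MM).+1.
  by split=> [|b g h hg hh]; rewrite ?mulr0 // mulrDr -scalerAr; exact: PL.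
move=> m2 m2k m2L; rewrite -mpolyXD addmC; split.
  by have := @sym_homogX K n (m2 + U_(i))%MM; rewrite mdegD mdeg1 addn1 m2k.
apply: sym_nonfaceX; rewrite inE inE mnmDE mnm1E eqxx addn1 /= carrier_add_i.
by move: m2L; rewrite inE.
Qed.

(** Sends x_j to (x_i + x_j) / t and fixes the other variables, so that x_i - t x_j goes to - x_j
    when [t] is nonzero. *)
Definition merge_mx (t : K) : 'M[K]_n := \matrix_(x, y)
  if y == j then t^-1 * ((x == i)%:R + (x == j)%:R) else (x == y)%:R.
Definition unmerge_mx (t : K) : 'M[K]_n := \matrix_(x, y)
  if y == j then t * (x == j)%:R - (x == i)%:R else (x == y)%:R.

Lemma merge_neq t y : y != j -> sym_act (merge_mx t) 'X_y = 'X_y.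
Proof.
move=> yj; rewrite sym_actXU -[RHS]slin_delta; apply: eq_bigr => x _.
by rewrite mxE (negbTE yj).
Qed.

Lemma merge_j t : sym_act (merge_mx t) 'X_j = t^-1 *: ('X_i + 'X_j).
Proof.
rewrite sym_actXU -!slin_delta /slin -big_split scaler_sumr /=; apply: eq_bigr => x _.
by rewrite mxE eqxx -scalerDl scalerA.
Qed.

Lemma unmergeK t f : t != 0 -> sym_act (merge_mx t) (sym_act (unmerge_mx t) f) = f.
Proof.
move=> t0; apply: (sym_sumP (T := fun f => sym_act (merge_mx t) (sym_act (unmerge_mx t) f) = f)).
  split=> [|b g h eg eh]; first by rewrite !linear0.
  by rewrite !linearP /= eg eh.
move=> m _; rewrite mpolyXE_id !rmorph_prod /=; apply: eq_bigr => y _.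
rewrite !rmorphXn /=; congr (_ ^+ _); have [->|yj] := eqVneq y j.
  have -> : sym_act (unmerge_mx t) 'X_j = t *: 'X_j - 'X_i.
    rewrite sym_actXU -!slin_delta /slin scaler_sumr -sumrB; apply: eq_bigr => x _.
    by rewrite mxE eqxx scalerBl scalerA.
  by rewrite linearB linearZ /= merge_j merge_neq // scalerA mulfV // scale1r addrC addKr.
have -> : sym_act (unmerge_mx t) 'X_y = 'X_y.
  by rewrite sym_actXU -[RHS]slin_delta; apply: eq_bigr => x _; rewrite mxE (negbTE yj).
by rewrite merge_neq.
Qed.

(* The variable monomials [x^m] with [i] in the support and [i * x^(m - i - j)]
   supported on a face are deformed to [x^m - t x^(m - i + j)]. *)
Definition merge_case m : bool :=
  [&& i \in carrier m, carrier m \notin polar & i |: (carrier m :\ i :\ j) \in G].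

Definition merge_mono k (a : mono_deg n k) (t : K) : S :=
  nf_mono K polar a - (if merge_case (mval a) then t else 0) *: 'X_[(mval a - U_(i) + U_(j))%MM].

Lemma merge_mono_homog k (a : mono_deg n k) t : sym_homog k (merge_mono a t).
Proof.
have subk := sym_homog_subspace K n k; apply: (subspaceB subk); first exact: nf_mono_homog.
case: ifP => [/and3P[im _ _]|_]; last by rewrite scale0r; case: subk.
apply: (subspaceZ subk); have := @sym_homogX K n (mval a - U_(i) + U_(j))%MM.
by rewrite mdegD mdeg1 addn1 mdeg_pick // mdeg_mval.
Qed.

Lemma restr_merge_X F t m x : x \in carrier m ->
  sym_act (restr_mx K F) (sym_act (merge_mx t) 'X_x) = 0 ->
  sym_act (restr_mx K F) (sym_act (merge_mx t) 'X_[m]) = 0.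
Proof. by move=> xm e; rewrite (mpolyX_pick K xm) !rmorphM /= e mul0r. Qed.

Lemma restr_merge_neq F t x : x != j -> x \notin F ->
  sym_act (restr_mx K F) (sym_act (merge_mx t) 'X_x) = 0.
Proof. by move=> xj xF; rewrite merge_neq // sym_act_restrU (negbTE xF). Qed.

Lemma restr_merge_j F t : i \notin F -> j \notin F ->
  sym_act (restr_mx K F) (sym_act (merge_mx t) 'X_j) = 0.
Proof.
by move=> iF jF; rewrite merge_j linearZ linearD /= !sym_act_restrU (negbTE iF) (negbTE jF) addr0 scaler0.
Qed.

(** Restricting to a face of [G], some factor always vanishes. The delicate monomials are those
    divisible by x_i for which [i] with the carrier outside {i, j} is a face: by the Link condition
    the same set with [j] instead is a nonface, and the deformed monomial is mapped to a multiple of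
    that nonface. *)
Lemma merge_mono_nonface k (a : mono_deg n k) t : t != 0 ->
  sym_nonface G (sym_act (merge_mx t) (merge_mono a t)).
Proof.
move=> t0; apply: sym_nonfaceP => F FG; rewrite /merge_mono /nf_mono; set m := mval a.
have sub H : H \notin G -> exists2 x, x \in H & x \notin F.
  move=> HG; apply/subsetPn; apply: contra HG; exact: (complex_sub cG).
have [mP|mP] := boolP (carrier m \in polar).
  by rewrite /merge_case mP andbF scale0r subr0 !linear0.
have [im|im] := boolP (i \in carrier m); last first.
  rewrite /merge_case (negbTE im) scale0r subr0.
  move: mP; rewrite inE (negbTE im) (mem_contraction cG ij) im /= negb_or => /andP[mG].
  have [jm /= imG|jm _] := boolP (j \in carrier m); last first.
    have [x xm xF] := sub _ mG; apply: (restr_merge_X xm); apply: restr_merge_neq => //.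
    by apply: contraNneq jm => <-.
  have [x] := sub _ imG; rewrite !inE.
  have [-> /= _ iF|xi /= /andP[xj xm] xF] := eqVneq x i; last first.
    by apply: (restr_merge_X (x := x)); rewrite ?inE //; exact: restr_merge_neq.
  have [y ym yF] := sub _ mG; have [yj|yj] := eqVneq y j.
    by apply: (restr_merge_X jm); apply: restr_merge_j => //; rewrite -yj.
  by apply: (restr_merge_X ym); exact: restr_merge_neq.
set H0 := carrier m :\ i :\ j.
have H0m x : x \in H0 -> [&& x != j, x != i & x \in carrier m] by rewrite !inE.
have /negbTE H0L : H0 \notin link G [set i; j] by move: mP; rewrite inE im.
rewrite /merge_case im mP /=; case: ifP => [iG|/negbT iG]; last first.
  rewrite scale0r subr0; have [x xH xF] := sub _ iG.
  have [xm xj] : x \in carrier m /\ x != j.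
    by move: xH; rewrite !inE => /orP[/eqP->|/and3P[]//]; rewrite ij; move: im; rewrite inE.
  by apply: (restr_merge_X xm); exact: restr_merge_neq.
have jG : j |: H0 \notin G.
  apply/negP=> jG; have iH : i \notin H0 by rewrite !inE eqxx andbF.
  have jH : j \notin H0 by rewrite !inE eqxx.
  by move: H0L; rewrite (mem_link2 G) (link_edge cG lc iH jH) iG jG iH jH.

(* The factor x_i - t x_j is sent to - x_j. *)
rewrite (mpolyX_pick K im) mpolyXD; set X := 'X_[_ - _].
have -> : 'X_i * X - t *: (X * 'X_j) = X * ('X_i - t *: 'X_j).
  by rewrite mulrBr mulrC scalerAr.
rewrite !rmorphM /= [sym_act (merge_mx t) (_ - _)]linearB linearZ /= merge_j merge_neq //.
rewrite scalerA mulfV // scale1r opprD addrA subrr add0r linearN /= sym_act_restrU.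
have [jF|jF] := boolP (j \in F); last by rewrite oppr0 mulr0.
have [x] := sub _ jG; rewrite in_setU1; case/predU1P => [->|xH xF]; first by rewrite jF.
have /and3P[xj xi xm] := H0m x xH.
rewrite (restr_merge_X (x := x)) ?mul0r //; last exact: restr_merge_neq.
by move: xm; rewrite !inE mnmBE mnm1E eq_sym (negbTE xi) subn0.
Qed.

(** At [t = 0] the vectors [merge_mono] are the monomials of the ideal of [polar]. Spanning persists
    for some [t != 0], where the substitution [merge_mx t] carries them into the ideal of [G]. *)
Lemma sym_span_merge k r a Theta D : infinite_field K -> subspace D ->
  (forall Th w, D w -> sym_homog k (sym_tau Th r a * w)) ->
  sym_span (sym_part polar k) k r (sym_tau Theta r a) Theta D ->
  exists t Theta', sym_span (sym_part G k) k r (sym_tau Theta' r a) Theta'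
     (fun w => exists2 w0, D w0 & w = sym_act (merge_mx t) w0).
Proof.
move=> Kinf subD hD sp; have PC := polyline_class K.
have [||||||q Pq [q0 qP]] := @sym_span_open K n _ _ PC k r (@merge_mono k)
  (fun=> sym_tau Theta r a) (fun=> Theta) D 0 subD.
- move=> b; apply: (sym_poly_add PC); first exact: sym_poly_const.
  move=> m; apply: (pc_ext PC (f := fun t => - ((if merge_case (mval b) then t else 0) *
     ('X_[(mval b - U_(i) + U_(j))%MM] : S)@_m))).
    by move=> t; rewrite mcoeffN mcoeffZ.
  apply: (pc_ext PC (f := fun t => (if merge_case (mval b) then t else 0) *
     (- ('X_[(mval b - U_(i) + U_(j))%MM] : S)@_m))); first by move=> t; rewrite mulrN.
  apply: (pc_mul PC); last exact: (pc_const PC).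
  by case: (merge_case _); [exact: polyline_id | exact: (pc_const PC)].
- exact: sym_poly_const.
- by move=> l x; exact: (pc_const PC).
- by move=> b t; exact: merge_mono_homog.
- by move=> t w /hD; apply.
- apply: sym_span_sub sp => f /sym_partE[c ->]; exists c; apply: eq_bigr => b _.
  by rewrite /merge_mono; case: ifP; rewrite scale0r subr0.
have [t [qt t0]] := polyline_common Kinf Pq (polyline_id K) q0 (oner_neq0 K).
exists t, (fun l x => \sum_y Theta l y * merge_mx t x y) => f hf.
have [|_ [u [w [[c ->] hu Dw e]]]] := qP t qt (sym_act (unmerge_mx t) f).
  exact: sym_act_homog.
exists (\sum_b c b *: sym_act (merge_mx t) (merge_mono b t)), (fun l => sym_act (merge_mx t) (u l)),
  (sym_act (merge_mx t) w); split.
- apply: (subspace_sum (sym_part_subspace K G k)) => b _.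
  apply: (subspaceZ (sym_part_subspace K G k)); split; last exact: merge_mono_nonface.
  by apply: sym_act_homog; exact: merge_mono_homog.
- by move=> l; exact: sym_act_prehomog.
- by exists w.
rewrite -[LHS](unmergeK f t0) e !linearD /= !(linear_sum (sym_act (merge_mx t))) rmorphM /= /sym_tau rmorphXn /= sym_act_lin.
congr (_ + _ + _); apply: eq_bigr => l _; first by rewrite linearZ.
by rewrite rmorphM /= sym_act_lin.
Qed.

End SymEdge.

(** Same induction as in the exterior case, but always with [d] forms. For [a = 0] the degree [p]
    may exceed [d], which yields the vanishing above degree [d]. *)
Theorem sym_span_sedh (K : fieldType) n d (G : {set {set 'I_n}}) hh p a : infinite_field K ->
  sedh d G hh -> (a == 0%N) || (a + p.*2 == d)%N ->
  exists (Theta : nat -> 'I_n -> K) (D : {mpoly K[n]} -> Prop),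
    [/\ subspace D, forall w, D w -> sym_homog p w, spanned (hh p) D &
    sym_span (sym_part G (a + p)) (a + p) d (sym_tau Theta d a) Theta D].
Proof.
move=> Kinf sG; elim: sG p a => {d G hh} [|V d Vd|V G i j d h1 h2 cG lij ijG lc leG sC IH1 sL IH2] p a ap.
- have a0 : a = 0%N by case/orP: ap => /eqP //; lia.
  pose D (w : {mpoly K[n]}) := exists c : K, w = (c * (p == 0%N)%:R) *: 1.
  have subD : subspace D.
    split=> [|b w w' [c ->] [c' ->]]; first by exists 0; rewrite mul0r scale0r.
    by exists (b * c + c'); rewrite mulrDl scalerDl scalerA mulrA.
  exists (fun _ _ => 0), D; split=> //.
  + move=> w [c ->]; have subp := sym_homog_subspace K n p; case: eqP => [->|_].
      by apply: (subspaceZ (sym_homog_subspace K n 0)); exact: sym_homog1.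
    by rewrite mulr0 scale0r; case: subp.
  + case: eqP => p0; last by apply: spanned0 => w [c ->]; rewrite (_ : (p == 0%N) = false) ?mulr0 ?scale0r //; apply/eqP.
    by exists (fun=> 1) => w [c ->]; exists (fun=> c); rewrite big_ord1 p0 mulr1.
  rewrite a0 add0n; apply: sym_span_mono => //; first exact: sym_part_subspace.
  move=> m mp; have [p0|p0] := eqVneq p 0%N.
    have -> : 'X_[m] = sym_tau (fun _ _ => 0 : K) 0 0 * 1 :> {mpoly K[n]}.
      rewrite /sym_tau expr0 mulr1; have -> : m = 0%MM by apply/eqP; rewrite -mdeg_eq0 mp p0.
      by rewrite mpolyX0.
    apply: sym_decompD; first exact: sym_part_subspace.
    by exists 1; rewrite p0 mulr1 scale1r.
  apply: sym_decompJ => //; split; first by rewrite -mp; exact: sym_homogX.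
  apply: sym_nonfaceX; rewrite inE; apply: contra p0 => /eqP m0.
  rewrite -mp mdegE big1 // => x _; have : x \notin carrier m by rewrite m0 inE.
  by rewrite inE lt0n negbK => /eqP.
- have [x0 x0V] : exists x0, x0 \in V by apply/card_gt0P; rewrite Vd.
  by have := sym_span_boundary K Vd x0V ap.
have ij : i != j by rewrite -(inj_eq val_inj) neq_ltn lij.
set k := (a + p)%N.
have [Th1 [D1 [subD1 hD1 sD1 sp1]]] := IH1 p a ap.
have [Th2 [D2 [subD2 hD2 sD2 sp2]]] : exists (Th2 : nat -> 'I_n -> K) (D2 : {mpoly K[n]} -> Prop), [/\ subspace D2,
    forall w, D2 w -> sym_prehomog p w, spanned (if p is p'.+1 then h2 p' else 0) D2 &
    forall k', k = k'.+1 -> sym_span (sym_part (sym_join (link G [set i; j]) i j) k') k' d.+2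
      (sym_tau Th2 d.+2 a) Th2 D2].
  case defp: p => [|p'].
    (* With [p = 0], a predecessor [k'] exists only for [a = d.+2], and then [k' = d.+1]. In that
       degree [h2] vanishes, so the case [a = 0] gives [D] zero and any [tau] will do. *)
    have [|Th [D [subD hD sD sp]]] := IH2 d.+1 0%N; first by rewrite eqxx.
    rewrite (sedh_h0 sL) // in sD.
    exists (sym_join_forms Th i j), D; split=> //.
      by move=> w /(spanned0_eq0 sD)->; case: (sym_prehomog_subspace K n 0).
    move=> k' kk'; apply: sym_span_join => //.
    have dk' : (0 + d.+1 = k')%N by move: kk'; rewrite /k defp; case/orP: ap => /eqP; lia.
    rewrite dk' in sp => f /sp[u0 [u [w [Ju hu Dw ->]]]]; exists u0, u, w; split=> //.
    by rewrite (spanned0_eq0 sD Dw) !mulr0.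
  have [|Th [D [subD hD sD sp]]] := IH2 p' a.
    by case/orP: ap => /eqP; rewrite ?defp; lia.
  exists (sym_join_forms Th i j), D; split=> //.
  move=> k' kk'; apply: sym_span_join => //.
  by have -> : k' = (a + p')%N by move: kk'; rewrite /k defp; lia.
have [Th [spC spL]] : exists Th, sym_span (sym_part (contraction G i j) k) k d.+2 (sym_tau Th d.+2 a) Th D1 /\
    forall k', k = k'.+1 -> sym_span (sym_part (sym_join (link G [set i; j]) i j) k') k' d.+2
      (sym_tau Th d.+2 a) Th D2.
  case defk: k => [|k']; first by exists Th1; split=> //; rewrite -defk.
  have [||Th [s1 s2]] := sym_span_common (k' := k') Kinf subD1 subD2 _ _ sp1 (sp2 k' defk).
  - by move=> Th w Dw; apply: (@sym_homog_mul K n a p); [exact: sym_homog_tau | exact: (hD1 w Dw)].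
  - move=> Th w Dw; have : sym_prehomog k'.+1 (sym_tau Th d.+2 a * w); last by move/sym_prehomogS.
    by rewrite -defk; apply: (@sym_homog_premul K n a p); [exact: sym_homog_tau | exact: (hD2 w Dw)].
  by exists Th; rewrite -defk; split=> // k'' ; rewrite defk => -[<-].
have sp := sym_span_polar subD1 subD2 spC spL.
have subD := polar_space_subspace i subD1 subD2; set D := polar_space i D1 D2 in subD sp.
have hD w : D w -> sym_homog p w.
  move=> [w1 [w2 [Dw1 Dw2 ->]]]; apply: (subspaceD (sym_homog_subspace K n p)); first exact: hD1.
  by apply: sym_prehomog_mul; [exact: sym_homogXU | exact: hD2].
have sD : spanned (h1 p + (if p is p'.+1 then h2 p' else 0))%N D.
  apply: (spanned_add (f1 := idfun) (f2 := fun w => 'X_i * w) _ sD1 sD2) => // m c M.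
  by rewrite mulr_sumr; apply: eq_bigr => l _; rewrite scalerAr.
have [|t [Th' sp']] := sym_span_merge cG ij lc Kinf subD _ sp.
  by move=> Th0 w Dw; apply: (@sym_homog_mul K n a p); [exact: sym_homog_tau | exact: (hD w Dw)].
exists Th', (fun w => exists2 w0, D w0 & w = sym_act (merge_mx i j t) w0); split=> //.
- split; first by exists 0; rewrite ?linear0 //; case: subD.
  move=> b u v [u0 Du ->] [v0 Dv ->]; exists (b *: u0 + v0); last by rewrite linearP.
  exact: (proj2 subD).
- by move=> w [w0 Dw ->]; apply: sym_act_homog; exact: hD.
exact: spanned_image.
Qed.

(** * Symmetric generic initial ideals and standard monomials *)

Section SymGin.
Variables (K : fieldType) (n : nat) (G : {set {set 'I_n}}).
Local Notation S := {mpoly K[n]}.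
Implicit Types (F H : {set 'I_n}) (f g : S) (m : 'X_{1..n}) (A : 'M[K]_n).
Hypothesis clG : forall F H, F \in G -> H \subset F -> H \in G.

Definition set_mnm F : 'X_{1..n} := [multinom (i \in F : nat) | i < n].

Lemma mono_mnm F : mono K F = 'X_[set_mnm F].
Proof.
rewrite mpolyXE_id /mono big_mkcond; apply: eq_bigr => i _.
by rewrite mnmE; case: (i \in F).
Qed.

Lemma carrier_set_mnm F : carrier (set_mnm F) = F.
Proof. by apply/setP=> i; rewrite inE mnmE; case: (i \in F). Qed.

Lemma set_mnm_le F m : F \subset carrier m -> (set_mnm F <= m)%MM.
Proof.
move/subsetP=> Fm; apply/mnm_lepP=> i; rewrite mnmE; case: (boolP (i \in F)) => // /Fm.
by rewrite inE.
Qed.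

Lemma stanley_reisnerP f : stanley_reisner G f <-> sym_nonface G f.
Proof.
split.
  apply: ideal_gen_min => [|g [F FG ->]]; last first.
    by rewrite mono_mnm; apply: sym_nonfaceX; rewrite carrier_set_mnm.
  have [n0 nL] := sym_nonface_subspace K G; split=> //.
    by move=> g h ng nh; apply: (subspaceD (sym_nonface_subspace K G)).
  by move=> a g ng; rewrite [a * g]mulrC; split; exact: sym_nonface_mul.
move=> nf; have [I0 ID IM] := ideal_gen_ideal [set p | exists2 F, F \notin G & p = mono K F]%classic.
rewrite [f]mpolyE; apply: (big_ind (fun g => ideal_gen _ g)) => // m _.
have [mG|mG] := boolP (carrier m \in G); first by rewrite nf // scale0r.
rewrite -[m in 'X_[m]](submK (set_mnm_le (subxx (carrier m)))) mpolyXD scalerAl -mono_mnm.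
by apply: (proj1 (IM _ _ _)); apply: sub_ideal_gen; exists (carrier m).
Qed.

Definition sym_image A : classical_sets.set S := [set sym_act A f | f in stanley_reisner G]%classic.

Lemma sym_imageP A g : sym_image A g <-> exists2 f, sym_nonface G f & g = sym_act A f.
Proof.
split=> [[f /stanley_reisnerP nf <-]|[f nf ->]]; first by exists f.
by exists f => //; apply/stanley_reisnerP.
Qed.

Lemma sym_image_mul A f g : A \in unitmx -> sym_image A f -> sym_image A (f * g).
Proof.
move=> Au /sym_imageP[f0 nf ->]; apply/sym_imageP; exists (f0 * sym_act (invmx A) g).
  exact: sym_nonface_mul.
by rewrite rmorphM /= sym_act_comp mulmxV // sym_act1.
Qed.

Definition sym_initial_set A m : Prop := exists2 f, sym_image A f & sym_initial f m.

Lemma sym_initial_set_up A m m' : A \in unitmx -> sym_initial_set A m -> (m <= m')%MM ->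
  sym_initial_set A m'.
Proof.
move=> Au [f Jf [fm ltm]] mm'; exists (f * 'X_[m' - m]); first exact: sym_image_mul.
have defm' : ((m' - m) + m)%MM = m' by exact: submK.
split; first by rewrite -[m' in X in _@_X]defm' mcoeffMX.
move=> m1 fm1 m1m'.
have le1 : (m' - m <= m1)%MM.
  apply: contraNT fm1 => le1; rewrite mcoeffM; apply/eqP/big1 => -[q1 q2] /= /eqP e.
  rewrite mcoeffX; case: eqP => [e2|]; last by rewrite mulr0.
  by case/negP: le1; rewrite e2; apply/mnm_lepP=> x; move/mnmP: e => /(_ x) ->; rewrite mnmDE leq_addl.
have defm1 := submK le1; rewrite -defm1 addmC in fm1 m1m' *; rewrite mcoeffMX in fm1.
have neq : (m1 - (m' - m))%MM != m by apply: contraNneq m1m' => ->; rewrite defm'.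
have := degrevlex_addr (m' - m)%MM (ltm _ fm1 neq).
have eqf (q : 'X_{1..n}) : (fun i => (q i + (m' - m)%MM i)%N) = ((m' - m) + q)%MM.
  by apply/funext=> i; rewrite mnmDE addnC.
by rewrite !eqf defm'.
Qed.

Lemma sym_in_mono A m : A \in unitmx -> sym_in (sym_image A) 'X_[m] <-> sym_initial_set A m.
Proof.
move=> Au; split=> [|im]; last by apply: sub_ideal_gen; exists m.
pose I0 : S -> Prop := fun g => forall q, g@_q != 0 -> sym_initial_set A q.
have I0M f g : I0 f -> I0 (g * f).
  move=> If q; rewrite mcoeffM => /eqP nz; apply: contrapT => nq; apply: nz; apply: big1 => -[q1 q2] /= /eqP e.
  have [->|fz] := eqVneq (f@_q2) 0; first by rewrite mulr0.
  case: nq; apply: (sym_initial_set_up Au (If _ fz)).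
  by apply/mnm_lepP=> x; move/mnmP: e => /(_ x) ->; rewrite mnmDE leq_addl.
have idI : is_ideal (I0 : classical_sets.set {mpoly K[n]}).
  split=> [q|f g If Ig q|a f If]; last by rewrite [f * a]mulrC; split; exact: I0M.
  - by rewrite mcoeff0 eqxx.
  rewrite mcoeffD => nz; have [f0|] := eqVneq (f@_q) 0; last exact: If.
  by apply: Ig; rewrite f0 add0r in nz.
move/(ideal_gen_min idI) => h; apply: h; last by rewrite mcoeffX eqxx oner_eq0.
move=> g [q [-> iq]] q1; rewrite mcoeffX; have [<-//|] := eqVneq q q1.
by rewrite eqxx.
Qed.

Definition sym_nonstd m : Prop := sym_gin (@stanley_reisner K n G) 'X_[m].

Lemma sym_nonstd_up m m' : sym_nonstd m -> (m <= m')%MM -> sym_nonstd m'.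
Proof.
move=> Nm mm'; apply: generically_mono Nm => A Au; rewrite -/(sym_image A) !sym_in_mono // => im.
exact: sym_initial_set_up mm'.
Qed.

Section Degree.
Variable k : nat.
Local Notation I := (mono_deg n k).
Local Notation W := {ffun I -> K^o}.

Definition sym_coords f : W := [ffun a => f@_(mval a)].

Lemma sym_coords_is_linear : linear sym_coords.
Proof. by move=> a f g; apply/ffunP=> q; rewrite !ffunE mcoeffD mcoeffZ. Qed.

HB.instance Definition _ := GRing.isLinear.Build K S W _ sym_coords sym_coords_is_linear.

Definition sym_gens (a : I) A : W := sym_coords (sym_act A (nf_mono K G a)).

Definition sym_lt (a b : I) : bool := revlex_lt (mval a) (mval b).

Lemma sym_lt_irr : irreflexive sym_lt.
Proof. by move=> a; exact: revlex_irr. Qed.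

Lemma sym_lt_trans : transitive sym_lt.
Proof. by move=> a b c; exact: revlex_trans. Qed.

Lemma sym_lt_total a b : a != b -> sym_lt a b || sym_lt b a.
Proof.
move=> ab; apply: revlex_total => e; case/eqP: ab; apply: (@mval_inj n k).
exact/mnmP.
Qed.

Lemma sym_coords_mono a : sym_coords 'X_[mval a] = delta K a.
Proof.
apply/ffunP=> b; rewrite !ffunE mcoeffX (inj_eq (@mval_inj n k)) eq_sym.
by [].
Qed.

Lemma sym_coords_inj f g : sym_homog k f -> sym_homog k g -> sym_coords f = sym_coords g -> f = g.
Proof.
move=> hf hg /ffunP e; rewrite (sym_homogE hf) (sym_homogE hg); apply: eq_bigr => a _.
by have := e a; rewrite !ffunE => ->.
Qed.

Lemma sym_gens_poly a i : polymx (fun A => sym_gens a A i).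
Proof.
have PC := @polymx_class K n; rewrite /sym_gens /nf_mono.
case: (carrier (mval a) \in G).
  by apply: (pc_ext PC) (pc_const PC 0) => A; rewrite linear0 ffunE mcoeff0.
have P : sym_poly (@polymx K n) (fun A => \prod_x slin (fun j => A j x) ^+ (mval a) x).
  apply: (sym_poly_prod PC) => x; apply: (sym_poly_exp PC).
  by apply: (sym_poly_lin PC) => j; exact: polymx_entry.
by apply: (pc_ext PC) (P (mval i)) => A; rewrite ffunE sym_actX.
Qed.

Lemma mem_sym_gspan A v : v \in gspan sym_gens A <->
  exists2 j, sym_part G k j & v = sym_coords (sym_act A j).
Proof.
have lin (c : I -> K) : sym_coords (sym_act A (\sum_a c a *: nf_mono K G a)) = \sum_a c a *: sym_gens a A.
  rewrite (linear_sum (sym_act A)) linear_sum; apply: eq_bigr => a _.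
  by rewrite linearZ /= linearZ.
split=> [/lspanP[c ->]|[j /sym_partE[c ->] ->]].
  by exists (\sum_a c a *: nf_mono K G a); [apply/sym_partE; exists c | rewrite lin].
by apply/lspanP; exists c.
Qed.

Definition sym_kpart f : S := \sum_(a : I) f@_(mval a) *: 'X_[mval a].

Lemma sym_kpart_is_linear : linear sym_kpart.
Proof.
move=> c f g; rewrite /sym_kpart scaler_sumr -big_split; apply: eq_bigr => a _ /=.
by rewrite mcoeffD mcoeffZ scalerDl scalerA.
Qed.

HB.instance Definition _ := GRing.isLinear.Build K S S _ sym_kpart sym_kpart_is_linear.

Lemma sym_kpart_homog f : sym_homog k (sym_kpart f).
Proof.
apply: (subspace_sum (sym_homog_subspace K n k)) => a _; apply: (subspaceZ (sym_homog_subspace K n k)).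
by have := @sym_homogX K n (mval a); rewrite mdeg_mval.
Qed.

Lemma sym_kpart_id f : sym_homog k f -> sym_kpart f = f.
Proof. by move=> hf; rewrite [RHS](sym_homogE hf). Qed.

Lemma sym_kpart_other k' f : k' != k -> sym_homog k' f -> sym_kpart f = 0.
Proof. by move=> kk' hf; rewrite /sym_kpart big1 // => a _; rewrite hf ?scale0r // mdeg_mval eq_sym. Qed.

Lemma mcoeff_kpart f m : mdeg m = k -> (sym_kpart f)@_m = f@_m.
Proof.
case/mval_exists=> b <-; rewrite (linear_sum (mcoeff (mval b))) (bigD1 b) //= mcoeffZ mcoeffX eqxx mulr1.
by rewrite big1 ?addr0 // => a ab; rewrite mcoeffZ mcoeffX (inj_eq (@mval_inj n k)) (negbTE ab) mulr0.
Qed.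

Lemma sym_act_kpart A f : sym_act A (sym_kpart f) = sym_kpart (sym_act A f).
Proof.
apply: (sym_sumP (T := fun f => sym_act A (sym_kpart f) = sym_kpart (sym_act A f))).
  split=> [|c g h eg eh]; first by rewrite !linear0.
  by rewrite !linearP /= eg eh.
move=> m _; have hA := sym_act_homog A (@sym_homogX K n m).
have [mk|mk] := eqVneq (mdeg m) k.
  by rewrite mk in hA; rewrite !sym_kpart_id // -mk; exact: sym_homogX.
by rewrite (sym_kpart_other mk (@sym_homogX K n m)) (sym_kpart_other mk hA) linear0.
Qed.

Lemma sym_initial_std A (a : I) : sym_initial_set A (mval a) <-> ~~ std sym_lt (gspan sym_gens A) a.
Proof.
have sumE (b : I) : (\sum_i mval b i)%N = k by rewrite -mdegE mdeg_mval.
rewrite negbK; split.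
  case=> f /sym_imageP[f0 nf0 deff] [fa ltf].
  have fU : sym_coords f \in gspan sym_gens A.
    apply/mem_sym_gspan; exists (sym_kpart f0).
      split; first exact: sym_kpart_homog.
      move=> m mG; have [mk|mk] := eqVneq (mdeg m) k; first by rewrite mcoeff_kpart // nf0.
      by rewrite sym_kpart_homog.
    by rewrite sym_act_kpart -deff; apply/ffunP=> b; rewrite !ffunE mcoeff_kpart // mdeg_mval.
  rewrite -[delta _ a]scale1r -(mulVf fa) -scalerA memvZ //.
  have -> : f@_(mval a) *: delta K a =
      sym_coords f - \sum_(b : I | b != a) sym_coords f b *: delta K b.
    have <- : sym_coords f a = f@_(mval a) by rewrite ffunE.
    move: (sym_coords f) => v; have e := sum_delta v; rewrite (bigD1 a isT) in e.
    apply: (canRL (addrK _)); symmetry; exact: e.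
  apply: memv_add; first exact: fU.
  rewrite memvN; apply: memv_suml => b ba.
  have [->|fb] := eqVneq (sym_coords f b) 0; first by rewrite scale0r mem0v.
  apply: memvZ; apply: delta_seg; rewrite inE; apply/degrevlexE; first by rewrite !sumE.
  by apply: ltf; [move: fb; rewrite ffunE | rewrite (inj_eq (@mval_inj n k))].
case/memv_addP=> u /mem_sym_gspan[j [hj nj] ->] [s sl e].
have [c defs] := lspanP _ _ _ sl.
have sE (b : I) : s b = if b \in lower sym_lt a then c b else 0.
  rewrite defs sum_ffunE; case: ifP => ba.
    rewrite (bigD1 b) //= big1 ?addr0 => [|b1 /andP[_ b1b]].
      by rewrite !ffunE eqxx /GRing.scale /= mulr1.
    by rewrite !ffunE eq_sym (negbTE b1b) /GRing.scale /= mulr0.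
  rewrite big1 // => b1 b1a; rewrite !ffunE; case: eqP => [bb|]; last by rewrite /GRing.scale /= mulr0.
  by rewrite bb (b1a : b1 \in lower sym_lt a) in ba.
have fE (b : I) : (sym_act A j)@_(mval b) = (b == a)%:R - s b.
  have := congr1 (fun v : W => v b) e; rewrite !ffunE => ->.
  by rewrite addrK.
exists (sym_act A j); first by apply/sym_imageP; exists j.
split; first by rewrite fE eqxx sE inE sym_lt_irr subr0 oner_eq0.
move=> m fm ma; have mk : mdeg m = k.
  by apply/eqP; apply: contraNT fm => mk; rewrite (sym_act_homog A hj).
have [b defm] := mval_exists mk; rewrite -defm in fm ma *.
move: fm; rewrite fE; have -> : (b == a) = false by apply: contraNF ma => /eqP->.
rewrite sub0r oppr_eq0 sE inE; case: ifP => [lt _|]; last by rewrite eqxx.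
by apply/degrevlexE => //; rewrite !sumE.
Qed.

Definition sym_generic A0 : Prop :=
  (forall A (Q : {set I}), A \in unitmx ->
    (\dim (gspan sym_gens A + seg K Q) <= \dim (gspan sym_gens A0 + seg K Q))%N) /\
  forall a : I, sym_nonstd (mval a) <-> ~~ std sym_lt (gspan sym_gens A0) a.

Lemma sym_gin_std : infinite_field K -> exists2 A0 : 'M[K]_n, A0 \in unitmx & sym_generic A0.
Proof.
move=> Kinf; have [A0 [A0u A0max A0gen]] := generic_std sym_lt Kinf sym_gens_poly.
exists A0 => //; split=> // a; apply: A0gen => A Au.
by rewrite -/(sym_image A) sym_in_mono //; exact: sym_initial_std.
Qed.

End Degree.
End SymGin.
Arguments sym_nonstd K [n] G m.

(** * Strong stability of the generic initial ideal in characteristic zero *)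

Section SymStable.
Variables (K : fieldType) (n : nat) (G : {set {set 'I_n}}).
Local Notation S := {mpoly K[n]}.
Implicit Types (F H : {set 'I_n}) (f g : S) (m : 'X_{1..n}) (A : 'M[K]_n).
Hypothesis clG : forall F H, F \in G -> H \subset F -> H \in G.
Hypothesis Kinf : infinite_field K.

Section Shift.
Variables (i j : 'I_n).
Hypothesis ji : (j < i)%N.

Definition shift_mx (t : K) : 'M[K]_n := 1%:M + t *: delta_mx j i.

Definition shift_mnm m (e : nat) : 'X_{1..n} := [multinom (m x - (x == i) * e + (x == j) * e)%N | x < n].

Let neq_ij : (i == j) = false.
Proof. by apply/negP=> /eqP ij; have := ji; rewrite ij ltnn. Qed.

Lemma shift_mxK t : shift_mx t *m shift_mx (- t) = 1%:M.
Proof.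
rewrite /shift_mx mulmxDl mul1mx mulmxDr mulmx1 -!scalemxAl -!scalemxAr mul_delta_mx_cond neq_ij.
by rewrite mulr0n !scaler0 addr0 scaleNr subrK.
Qed.

Lemma shift_mx_unit t : shift_mx t \in unitmx.
Proof. by have := mulmx1_unit (shift_mxK t); case. Qed.

Lemma sym_act_shiftX t m :
  sym_act (shift_mx t) 'X_[m] = \sum_(e < (m i).+1) ('C(m i, e)%:R * t ^+ e) *: 'X_[shift_mnm m e].
Proof.
pose r : 'X_{1..n} := [multinom (if x == i then 0 else m x)%N | x < n].
have Xr : sym_act (shift_mx t) 'X_[r] = 'X_[r].
  rewrite mpolyXE_id rmorph_prod /=; apply: eq_bigr => x _; rewrite rmorphXn /= mnmE.
  case: eqP => [_|xi]; first by rewrite !expr0.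
  congr (_ ^+ _); rewrite sym_actXU -[RHS]slin_delta; apply: eq_bigr => y _; congr (_ *: _).
  have /eqP/negbTE xi' := xi.
  by rewrite !mxE xi' andbF mulr0 addr0.
have Xi : sym_act (shift_mx t) 'X_i = 'X_i + t *: 'X_j.
  rewrite sym_actXU -!slin_delta /slin scaler_sumr -big_split; apply: eq_bigr => y _ /=.
  by rewrite !mxE eqxx andbT scalerA -scalerDl.
have -> : m = (r + U_(i) *+ m i)%MM.
  apply/mnmP=> x; rewrite mnmDE mulmnE mnm1E mnmE eq_sym; case: eqP => [->|_].
    by rewrite mul1n.
  by rewrite mul0n addn0.
have -> : (r + U_(i) *+ m i)%MM i = m i by rewrite mnmDE mulmnE mnm1E mnmE !eqxx mul1n.
rewrite mpolyXD -mpolyXn rmorphM rmorphXn /= Xr Xi exprDn mulr_sumr; apply: eq_bigr => -[e le] _ /=.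
rewrite exprZn -scalerAr -scaler_nat scalerA -scalerAr; congr (_ *: _).
rewrite !mpolyXn -!mpolyXD; congr 'X_[_]; apply/mnmP=> x.
rewrite /shift_mnm /r !(mnmDE, mulmnE, mnm1E, mnmE) ![_ == x]eq_sym.
by case: eqP => [->|_]; rewrite ?neq_ij ?mul0n ?mul1n ?subn0 ?addn0 ?add0n.
Qed.

Lemma shift_mnm_le m e : (e <= m i)%N -> mdeg (shift_mnm m e) = mdeg m.
Proof.
move=> le; rewrite !mdegE (bigD1 i) //= [in RHS](bigD1 i) //= (bigD1 j) /=; last by rewrite eq_sym neq_ij.
rewrite [in RHS](bigD1 j) /=; last by rewrite eq_sym neq_ij.
rewrite !mnmE eqxx neq_ij [j == i]eq_sym neq_ij eqxx !mul1n !mul0n subn0 addn0.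
rewrite (eq_bigr (fun x => m x)); last first.
  by move=> x /andP[/negbTE xi /negbTE xj]; rewrite mnmE xi xj subn0 addn0.
by rewrite !addnA; congr (_ + _)%N; lia.
Qed.

Lemma shift_mnm1 m : shift_mnm m 1 = (m - U_(i) + U_(j))%MM.
Proof.
by apply/mnmP=> x; rewrite mnmE mnmDE mnmBE !mnm1E !muln1 ![_ == x]eq_sym.
Qed.

Lemma shift_mnm0 m : shift_mnm m 0 = m.
Proof. by apply/mnmP=> x; rewrite mnmE !muln0 subn0 addn0. Qed.

Lemma revlex_shift m m' : (0 < m i)%N -> (0 < m' i)%N -> revlex_lt m m' ->
  revlex_lt (shift_mnm m 1) (shift_mnm m' 1).
Proof.
move=> mi m'i; rewrite -(revlex_addr _ _ (fun x => (x == j : nat))).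
rewrite -(revlex_addr (shift_mnm m 1) _ (fun x => (x == i : nat))).
suff eqf (q : 'X_{1..n}) : (0 < q i)%N -> (fun x => (q x + (x == j))%N) = (fun x => (shift_mnm q 1 x + (x == i))%N).
  by rewrite !eqf.
move=> qi; apply/funext=> x; rewrite mnmE !muln1; case: (eqVneq x i) => [->|_]; last by rewrite subn0 addn0.
by rewrite neq_ij !addn0 subnK.
Qed.

Lemma revlex_shift1 m : (0 < m i)%N -> revlex_lt m (shift_mnm m 1).
Proof.
move=> mi; apply/revlex_ltP; exists i; split.
  by rewrite mnmE eqxx neq_ij mul1n mul0n addn0; lia.
move=> x ix; rewrite mnmE; have -> : (x == i) = false by apply/negP=> /eqP e; rewrite e ltnn in ix.
have -> : (x == j) = false by apply/negP=> /eqP e; rewrite e in ix; have := ltn_trans ix ji; rewrite ltnn.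
by rewrite subn0 addn0.
Qed.

(** Apply [std_shift] to the substitution of x_i + t x_j for x_i. To first order in [t] it sends the
    monomial to the shifted one with coefficient the exponent of x_i, which is nonzero in
    characteristic zero. *)
Lemma sym_stable m : [pchar K] =i pred0 -> sym_nonstd K G m -> i \in carrier m ->
  sym_nonstd K G (m - U_(i) + U_(j))%MM.
Proof.
move=> K0 Nm; rewrite inE => mi; rewrite -shift_mnm1; have [k km] : exists k, mdeg m = k by exists (mdeg m).
have [A0 A0u [A0max A0std]] := sym_gin_std clG k Kinf.
have [a defm] := mval_exists km; have [a' defm'] := mval_exists (etrans (shift_mnm_le mi) km).
rewrite -defm' A0std; rewrite -defm in Nm mi defm'; move/A0std: Nm.
set U := gspan _ A0 => Na.
pose w1 (q : mono_deg n k) (t : K) := sym_coords k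
  (\sum_(e < mval q i) ('C(mval q i, e.+1)%:R * t ^+ e) *: ('X_[shift_mnm (mval q) e.+1] : S)).
pose w (q : mono_deg n k) (t : K) := sym_coords k (sym_act (shift_mx t) ('X_[mval q] : S)).
have w10 q : w1 q 0 = (mval q i)%:R *: sym_coords k ('X_[shift_mnm (mval q) 1] : S).
  rewrite /w1; case: (mval q i) => [|e]; first by rewrite big_ord0 linear0 scale0r.
  rewrite big_ord_recl bin1 expr0 mulr1 big1 ?addr0; first by rewrite linearZ.
  by move=> x _; rewrite expr0n mulr0 scale0r.
apply: (@std_shift K _ (@sym_lt n k) (@sym_lt_trans n k) U a a' w w1 (mval a i)%:R Kinf _ _ _ _ _ _ _ Na).
- move=> q b; have PC := polyline_class K.
  have P : sym_poly (@polyline K) (fun t => \sum_(e < mval q i) ('C(mval q i, e.+1)%:R * t ^+ e) *: ('X_[shift_mnm (mval q) e.+1] : S)).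
    apply: (sym_poly_sum PC) => e; apply: (sym_poly_scale PC); last exact: (sym_poly_const PC).
    apply: (pc_mul PC); first exact: (pc_const PC).
    by exists ('X ^+ e) => t; rewrite hornerXn.
  by apply: (pc_ext PC) (P (mval b)) => t; rewrite /w1 ffunE.
- move=> q t; rewrite /w sym_act_shiftX big_ord_recl bin0 expr0 mulr1 scale1r shift_mnm0 linearD /= sym_coords_mono.
  congr (_ + _); rewrite /w1 -linearZ scaler_sumr; congr (sym_coords k _); apply: eq_bigr => e _.
  by rewrite scalerA exprS mulrCA.
- move=> q qa; rewrite w10; case: (posnP (mval q i)) => [->|qi]; first by rewrite scale0r mem0v.
  have [b defb] := mval_exists (etrans (shift_mnm_le qi) (mdeg_mval q)).
  apply: memvZ; rewrite -defb sym_coords_mono; apply: delta_seg; rewrite inE /sym_lt defb defm'.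
  exact: revlex_shift.
- by rewrite w10 -defm' sym_coords_mono subrr mem0v.
- by rewrite (proj1 (pcharf0P K) K0) -lt0n.
- by rewrite /sym_lt defm'; exact: revlex_shift1.
(* The substitution carries the space at [shift_mx (- t) *m A0], plus the segment, to a space
   containing the one at [A0] plus the moved monomials; maximality at [A0] bounds its dimension. *)
move=> t; set Q := a |: _.
pose toS (v : {ffun mono_deg n k -> K^o}) : S := \sum_b v b *: 'X_[mval b].
have toS_lin : linear toS.
  move=> c u v; rewrite /toS scaler_sumr -big_split; apply: eq_bigr => b _ /=.
  by rewrite !ffunE scalerDl scalerA.
have toSK f : sym_homog k f -> toS (sym_coords k f) = f.
  move=> hf; rewrite [RHS](sym_homogE hf); apply: eq_bigr => b _.
  by rewrite ffunE.
pose h v := sym_coords k (sym_act (shift_mx t) (toS v)).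
have h_lin : linear h by move=> c u v; rewrite /h toS_lin !linearP.
pose hL := GRing.isLinear.Build K _ _ _ h h_lin.
pose hF : {linear _ -> _} := HB.pack h hL.
apply: (@leq_trans (\dim (linfun hF @: (gspan (sym_gens G (k := k)) (shift_mx (- t) *m A0) + seg K Q))%VS)); last first.
  have Au : shift_mx (- t) *m A0 \in unitmx by rewrite unitmx_mul shift_mx_unit.
  apply: leq_trans (A0max _ Q Au).
  by rewrite -(limg_ker_dim (linfun hF) (gspan _ _ + _)) leq_addl.
apply: dimvS; rewrite subv_add; apply/andP; split; apply/subvP => u.
  move=> /mem_sym_gspan[f [hf nf] ->].
  have -> : sym_coords k (sym_act A0 f) = linfun hF (sym_coords k (sym_act (shift_mx (- t) *m A0) f)).
    rewrite lfunE /= /h toSK; last exact: sym_act_homog.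
    by rewrite sym_act_comp mulmxA shift_mxK mul1mx.
  apply: memv_img; apply: (subvP (addvSl _ _)); apply/mem_sym_gspan.
  by exists f.
move=> /lspanP[c ->]; apply: memv_suml => q qQ; apply: memvZ.
have -> : w q t = linfun hF (sym_coords k ('X_[mval q] : S)).
  by rewrite lfunE /= /h toSK //; have := @sym_homogX K n (mval q); rewrite mdeg_mval.
apply: memv_img; apply: (subvP (addvSr _ _)); rewrite sym_coords_mono.
exact: delta_seg.
Qed.

End Shift.
End SymStable.

(** * Counting standard monomials *)

Section SymCount.
Variables (K : fieldType) (n : nat) (G : {set {set 'I_n}}) (x0 : 'I_n).
Local Notation S := {mpoly K[n]}.
Implicit Types (F H : {set 'I_n}) (f g : S) (m : 'X_{1..n}) (A : 'M[K]_n).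
Hypothesis clG : forall F H, F \in G -> H \subset F -> H \in G.
Hypothesis Kinf : infinite_field K.

(** As in [ext_transport]; the Lefschetz element becomes the variable just before the last [d],
    hence the requirement [d < n]. *)
Lemma sym_transport k d a p h (Theta : nat -> 'I_n -> K) (D : S -> Prop) : k = (a + p)%N -> (d < n)%N ->
  subspace D -> (forall w, D w -> sym_homog p w) -> spanned h D ->
  sym_span (sym_part G k) k d (sym_tau Theta d a) Theta D ->
  exists A (D' : S -> Prop), [/\ A \in unitmx, forall w, D' w -> sym_homog p w, spanned h D' &
    forall f, sym_homog k f -> exists (j : S) (u : nat -> S) (w : S),
      [/\ sym_part G k j, forall l, sym_prehomog k (u l), D' w &
       f = sym_act A j + \sum_(l < d) 'X_(vtx x0 l) * u l + 'X_(vtx x0 d) ^+ a * w]].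
Proof.
move=> defk lt_dn subD hD sD sp; have PC := polyline_class K.
pose B0 : 'M[K]_n := \matrix_(x, y) Theta (n.-1 - y)%N x.
pose B t := B0 + t *: (1%:M - B0); pose Th t l x := B t x (vtx x0 l).
have PTh l x : polyline (fun t => Th t l x).
  apply: (pc_ext PC (f := fun t => B0 x (vtx x0 l) + t * (1%:M - B0) x (vtx x0 l))).
    by move=> t; rewrite /Th /B !mxE.
  apply: (pc_add PC); first exact: (pc_const PC).
  by apply: (pc_mul PC); [exact: polyline_id | exact: (pc_const PC)].
have Th0 l : (l <= d)%N -> Theta l = Th 0 l.
  move=> ld; apply/funext=> x.
  by rewrite /Th /B scale0r addr0 mxE vtxK // (leq_ltn_trans ld).
have Ptau : sym_poly (@polyline K) (fun t => sym_tau (Th t) d a) by exact: sym_tau_poly.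
have [||||||q Pq [q0 qP]] := @sym_span_open K n _ (@polyline K) PC k d (fun b _ => nf_mono K G b)
  (fun t => sym_tau (Th t) d a) Th D 0 subD.
- by move=> b; exact: sym_poly_const.
- exact: Ptau.
- exact: PTh.
- by move=> b _; exact: nf_mono_homog.
- by move=> t w Dw; rewrite defk; apply: (@sym_homog_mul K n a p); [exact: sym_homog_tau | exact: (hD w Dw)].
- move=> f /sp[j [u [w [/sym_partE Jj hu Dw ->]]]]; exists j, u, w; split=> //.
  congr (_ + _ + _ * _); last by rewrite /sym_tau Th0.
  by apply: eq_bigr => l _; rewrite Th0 // ltnW.
have Pdet : polyline (fun t => \det (B t)).
  apply: (pc_det PC) => i j; apply: (pc_ext PC (f := fun t => B0 i j + t * (1%:M - B0) i j)).
    by move=> t; rewrite /B !mxE.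
  apply: (pc_add PC); first exact: (pc_const PC).
  by apply: (pc_mul PC); [exact: polyline_id | exact: (pc_const PC)].
have [t [qt dett]] : exists t, q t != 0 /\ \det (B t) != 0.
  apply: (polyline_common (t0 := 0) (t1 := 1)) => //.
  by rewrite /B scale1r subrKC det1 oner_eq0.
have Bu : B t \in unitmx by rewrite unitmxE unitfE.
pose A := invmx (B t); pose D' w := exists2 w0, D w0 & w = sym_act A w0.
have actA l : sym_act A (slin (Th t l)) = 'X_(vtx x0 l).
  by rewrite (_ : slin (Th t l) = sym_act (B t) 'X_(vtx x0 l)) ?sym_actXU // -sym_actXU sym_act_comp mulVmx // sym_act1.
exists A, D'; split.
- by rewrite unitmx_inv.
- by move=> w [w0 Dw0 ->]; apply: sym_act_homog; exact: hD.
- exact: spanned_image.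
move=> f hf; have [|j [u [w [Jj hu Dw e]]]] := qP t qt (sym_act (B t) f).
  exact: sym_act_homog.
exists j, (fun l => sym_act A (u l)), (sym_act A w); split=> //.
- exact/sym_partE.
- by move=> l; exact: sym_act_prehomog.
- by exists w.
have -> : f = sym_act A (sym_act (B t) f) by rewrite sym_act_comp mulVmx // sym_act1.
rewrite e !linearD /= (linear_sum (sym_act A)) !rmorphM /sym_tau rmorphXn /= actA.
congr (_ + _ + _); apply: eq_bigr => l _; by rewrite rmorphM /= actA.
Qed.

Section Degree.
Variables (k : nat) (A0 : 'M[K]_n).
Local Notation I := (mono_deg n k).
Local Notation gens := (sym_gens G (k := k)).
Hypothesis A0gen : sym_generic G k A0.

Lemma sym_nonstdE (a : I) : `[< ~ sym_nonstd K G (mval a) >] = std (@sym_lt n k) (gspan gens A0) a.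
Proof.
have [_ /(_ a) gE] := A0gen; apply/asboolP/idP => [nN|sa /gE /negP]; last by apply.
by apply: contrapT => /negP /gE.
Qed.

Lemma sym_std_bound A (Q : {set I}) V h : A \in unitmx -> down_closed (@sym_lt n k) Q ->
  (gspan gens A + seg K Q + V = fullv)%VS -> (\dim V <= h)%N ->
  (#|[set q : I | (q \notin Q) && std (@sym_lt n k) (gspan gens A0) q]| <= h)%N.
Proof.
move=> Au dQ full leV.
have cs (U : {vspace {ffun I -> K^o}}) := card_std (@sym_lt_irr n k) (@sym_lt_trans n k) (@sym_lt_total n k) U dQ.
apply: leq_trans (card_std_lower (@sym_lt_irr n k) (@sym_lt_trans n k) (@sym_lt_total n k) dQ full leV).
rewrite -(leq_add2r (\dim (gspan gens A + seg K Q))) cs.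
by rewrite -(cs (gspan gens A0)) leq_add2l; have [A0max _] := A0gen; exact: A0max.
Qed.

(** The monomials in the ideal of the last [d] variables and of the [a]-th power of the variable
    before them; [a = 0] is kept out of the second clause, where it would admit every monomial. *)
Definition tail_monos d a : {set I} := [set q : I |
  [exists x : 'I_n, (n - d <= x)%N && (0 < mval q x)%N] ||
  (a != 0)%N && [exists x : 'I_n, (x.+1 == n - d)%N && (a <= mval q x)%N]].

Lemma tail_monos_down d a : down_closed (@sym_lt n k) (tail_monos d a).
Proof.
move=> q q' qq'; rewrite !inE.
have [->|a0] /= := eqVneq a 0%N; rewrite ?orbF.
  case/existsP=> x /andP[sx qx]; have [|[y sy qy]|[y]] := @revlex_down n _ _ (n - d) (mdeg (mval q)).+1 qq'.
  - by left; exists x.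
  - by apply/existsP; exists y; rewrite sy.
  by rewrite mdegE (bigD1 y) //= => _; rewrite ltnNge leq_addr.
move=> h; have [|[y sy qy]|[y sy qy]] := @revlex_down n _ _ (n - d) a qq'.
- case/orP: h => /existsP[x /andP[sx qx]]; [left | right]; exists x => //.
  exact/eqP.
- by apply/orP; left; apply/existsP; exists y; rewrite sy.
by apply/orP; right; apply/existsP; exists y; rewrite sy eqxx.
Qed.

Lemma sym_coords_seg (Q : {set I}) f : (forall q : I, f@_(mval q) != 0 -> q \in Q) ->
  sym_coords k f \in seg K Q.
Proof.
move=> fQ; rewrite [sym_coords k f]sum_delta; apply: memv_suml => q _.
have [->|nz] := eqVneq (sym_coords k f q) 0; first by rewrite scale0r mem0v.
by apply: memvZ; apply: delta_seg; apply: fQ; move: nz; rewrite ffunE.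
Qed.

Lemma mcoeff_varX x e (u : S) m : ('X_x ^+ e * u)@_m != 0 -> (e <= m x)%N.
Proof.
rewrite mpolyXn; apply: contraNT; rewrite -ltnNge => lt; rewrite mcoeffM; apply/eqP/big1 => -[q1 q2] /= /eqP e1.
rewrite mcoeffX; case: eqP => [e2|_]; last by rewrite mul0r.
have : m x = ((q1 : 'X_{1..n}) x + (q2 : 'X_{1..n}) x)%N by rewrite -mnmDE -e1.
by rewrite -e2 mulmnE mnm1E eqxx mul1n => e3; move: lt; rewrite e3 ltnNge leq_addr.
Qed.

Lemma sym_card_std d a p h (Theta : nat -> 'I_n -> K) (D : S -> Prop) : k = (a + p)%N -> (d < n)%N ->
  subspace D -> (forall w, D w -> sym_homog p w) -> spanned h D ->
  sym_span (sym_part G k) k d (sym_tau Theta d a) Theta D ->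
  (#|[set q : I | (q \notin tail_monos d a) && std (@sym_lt n k) (gspan gens A0) q]|
    <= if a == 0%N then h else 0)%N.
Proof.
move=> defk lt_dn subD hD sD sp.
have [A [D' [Au hD' [M sM] dec]]] := sym_transport defk lt_dn subD hD sD sp.
pose V := if a == 0%N then lspan predT (fun l : 'I_h => sym_coords k (M l)) else 0%VS.
apply: (@sym_std_bound A (tail_monos d a) V _ Au (tail_monos_down (d := d) (a := a))); last first.
  rewrite /V; case: ifP => _; last by rewrite dimv0.
  by apply: leq_trans (dim_lspan _ _) _; rewrite card_ord.
apply: delta_fullv => q; have [|j [u [w [Jj hu D'w e]]]] := dec 'X_[mval q].
  by have := @sym_homogX K n (mval q); rewrite mdeg_mval.
have jU : sym_coords k (sym_act A j) \in gspan gens A.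
  by apply/mem_sym_gspan; exists j.
rewrite -sym_coords_mono e !linearD /=; move: (sym_act A j) jU => j' jU; rewrite linear_sum.
have Qgen (l : 'I_d) : sym_coords k ('X_(vtx x0 l) * u l) \in seg K (tail_monos d a).
  apply: sym_coords_seg => b nz; rewrite inE; apply/orP; left.
  apply/existsP; exists (vtx x0 l); rewrite -['X_(vtx x0 l)]expr1 in nz.
  rewrite (mcoeff_varX nz) andbT val_vtx; have := ltn_ord l; lia.
set cw := sym_coords k (_ * w).
have cwQ : cw \in (seg K (tail_monos d a) + V)%VS.
  have [a0|a0] := eqVneq a 0%N.
    apply: (subvP (addvSr _ _)).
    rewrite /V /cw a0 eqxx /= expr0 mul1r; have [c ->] := sM w D'w.
    rewrite linear_sum; apply: memv_suml => l _; rewrite linearZ; apply: memvZ.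
    exact: (@mem_lspan _ _ _ predT (fun l : 'I_h => sym_coords k (M l))).
  apply: (subvP (addvSl _ _)).
  apply: sym_coords_seg => b nz; rewrite inE; apply/orP; right; rewrite a0 /=.
  apply/existsP; exists (vtx x0 d); rewrite (mcoeff_varX nz) andbT val_vtx; lia.
rewrite -addvA -addrA; apply: memv_add; first exact: jU.
apply: memvD; last exact: cwQ.
apply: (subvP (addvSl _ _)); apply: memv_suml => l _; exact: Qgen.
Qed.

Lemma sym_card_std0 : (#|[set q : I | carrier (mval q) \in G]| <=
  #|[set q : I | std (@sym_lt n k) (gspan gens A0) q]|)%N.
Proof.
have d0 : down_closed (@sym_lt n k) set0 by move=> b q _; rewrite inE.
have := card_std (@sym_lt_irr n k) (@sym_lt_trans n k) (@sym_lt_total n k) (gspan gens A0) d0.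
have -> : (gspan gens A0 + seg K set0)%VS = gspan gens A0.
  by apply/addv_idPl/seg_sub => i; rewrite inE.
have -> : [set i | (i \notin set0) && std (@sym_lt n k) (gspan gens A0) i] =
    [set q : I | std (@sym_lt n k) (gspan gens A0) q].
  by apply/setP=> i; rewrite !inE.
have le_dim : (\dim (gspan gens A0) <= #|[pred a : I | carrier (mval a) \notin G]|)%N.
  apply: leq_trans (dim_lspan _ (gens ^~ A0)); apply: dimvS.
  apply/subv_sumP=> a _; rewrite -memvE.
  have [aG|aG] := boolP (carrier (mval a) \in G).
    by rewrite /sym_gens /nf_mono aG !linear0 mem0v.
  exact: (@mem_lspan _ _ _ [pred a : I | carrier (mval a) \notin G] (gens ^~ A0)).
move=> cs; rewrite -(leq_add2r #|[pred a : I | carrier (mval a) \notin G]|).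
have -> : #|[set q : I | carrier (mval q) \in G]| = #|[pred a : I | carrier (mval a) \in G]|.
  by apply: eq_card => a; rewrite !inE.
have -> : #|[pred a : I | carrier (mval a) \notin G]| = #|[predC [pred a : I | carrier (mval a) \in G]]|.
  by apply: eq_card => a; rewrite !inE.
rewrite cardC -cs leq_add2l; apply: leq_trans le_dim _.
by apply: eq_leq; apply: eq_card => a; rewrite !inE.
Qed.

End Degree.

Section Sedh.
Variables (d : nat) (hh : nat -> nat).
Hypotheses (sG : sedh d G hh) (lt_dn : (d < n)%N).

(** The case [a = 0]: modulo the last [d] variables, degree [k] is spanned by [hh k] elements. *)
Lemma sym_card_low k : (#|[set q : mono_deg n k | `[< ~ sym_nonstd K G (mval q) >] &&
   [forall x : 'I_n, (n - d <= x)%N ==> (mval q x == 0)%N]]| <= hh k)%N.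
Proof.
have [A0 A0u A0gen] := sym_gin_std clG k Kinf.
have [//|Theta [D [subD hD sD sp]]] := sym_span_sedh (p := k) (a := 0) Kinf sG.
rewrite add0n in sp; have := @sym_card_std k A0 A0gen d 0 k (hh k) Theta D (erefl k) lt_dn subD hD sD sp.
rewrite eqxx; apply: leq_trans.
apply: subset_leq_card; apply/subsetP=> q; rewrite in_set => /andP[sq /forallP lq].
rewrite in_set -(sym_nonstdE A0gen) sq andbT inE /= orbF; apply/existsP=> -[x /andP[sx]].
by have := lq x; rewrite sx /= => /eqP->.
Qed.

(** The Lefschetz case [a = d - p.*2]: in degree [d - p] there is no standard monomial outside the
    tail. *)
Lemma sym_nonstd_mid p m : (p.*2 < d)%N -> mdeg m = (d - p)%N ->
  (forall x : 'I_n, (n - d <= x)%N -> m x = 0%N) ->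
  (forall x : 'I_n, (x.+1 == n - d)%N -> (m x < d - p.*2)%N) -> sym_nonstd K G m.
Proof.
move=> lt_pd mk mlow mmid; have [A0 A0u A0gen] := sym_gin_std clG (d - p)%N Kinf.
have [|Theta [D [subD hD sD sp]]] := sym_span_sedh (p := p) (a := (d - p.*2)%N) Kinf sG.
  by rewrite subnK ?eqxx ?orbT // ltnW.
have defk : (d - p.*2 + p = d - p)%N by lia.
rewrite defk in sp.
have a0 : (d - p.*2 == 0)%N = false by apply/negbTE; lia.
have := sym_card_std A0gen (esym defk) lt_dn subD hD sD sp; rewrite a0 leqn0 cards_eq0.
have [q defm] := mval_exists mk; move=> /eqP/setP/(_ q).
rewrite in_set0 in_set -(sym_nonstdE A0gen) => /negbT; rewrite negb_and negbK => /orP[|]; last first.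
  by rewrite -defm; move/asboolPn => /contrapT.
rewrite inE a0 /= => /orP[|] /existsP[x /andP[sx]]; rewrite defm.
  by rewrite mlow.
by rewrite leqNgt mmid.
Qed.

End Sedh.

Lemma sym_card_faces k : (#|[set q : mono_deg n k | carrier (mval q) \in G]| <=
  #|[set q : mono_deg n k | `[< ~ sym_nonstd K G (mval q) >]]|)%N.
Proof.
have [A0 A0u A0gen] := sym_gin_std clG k Kinf.
apply: leq_trans (sym_card_std0 k A0) _; apply: eq_leq; apply: eq_card => q.
by rewrite !in_set (sym_nonstdE A0gen).
Qed.

Lemma card_carrier m : (#|carrier m| <= mdeg m)%N.
Proof.
rewrite mdegE -sum1_card big_mkcond; apply: leq_sum => x _; rewrite inE.
by case: posnP.
Qed.

(** Every monomial of this degree is supported on a face, so by the count all of them are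
    standard. *)
Lemma sym_std_all_faces m : (forall F, (#|F| <= mdeg m)%N -> F \in G) -> ~ sym_nonstd K G m.
Proof.
move=> allG; have [q defm] := mval_exists (erefl (mdeg m)).
have := sym_card_faces (mdeg m); set B := [set b | `[< _ >]].
have -> : [set b : mono_deg n (mdeg m) | carrier (mval b) \in G] = setT.
  by apply/setP=> b; rewrite !inE allG // (leq_trans (card_carrier _)) // mdeg_mval.
move=> le; have /eqP/setP/(_ q) : B == setT by rewrite eqEcard subsetT.
by rewrite !inE => /asboolP; rewrite defm.
Qed.

End SymCount.

(** * Index sequences, the map Phi, and minimal generators of stable ideals *)

Section Indices.
Variable n : nat.
Implicit Types (m : 'X_{1..n}) (t f : seq nat) (F H : {set 'I_n}).

Definition mnat t : 'X_{1..n} := [multinom count_mem (val x) t | x < n].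

(** The inverse of the shift in [Phi]. On a strictly increasing sequence the truncated subtraction
    is exact. *)
Definition unphi f : seq nat := mkseq (fun j => nth 0%N f j - j)%N (size f).

Lemma count_mindices m (x : 'I_n) : count_mem (val x) (mindices m) = m x.
Proof.
rewrite /mindices count_flatten -map_comp sumnE big_map big_enum /= (bigD1 x) //=.
rewrite count_nseq /= eqxx mul1n big1 ?addn0 // => i ix.
by rewrite count_nseq /= (inj_eq val_inj) (negbTE ix).
Qed.

Lemma mindices_lt m : all (gtn n) (mindices m).
Proof.
apply/allP=> v /flattenP[_ /mapP[i _ ->]] /nseqP[-> _].
exact: ltn_ord.
Qed.

Lemma mindicesK m : mnat (mindices m) = m.
Proof. by apply/mnmP=> x; rewrite mnmE count_mindices. Qed.

Lemma sorted_mindices m : sorted leq (mindices m).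
Proof.
rewrite (sorted_pairwise leq_trans) /mindices.
have : sorted ltn (map val (enum 'I_n)) by rewrite val_enum_ord iota_ltn_sorted.
elim: (enum 'I_n) => //= i s IHs si.
rewrite pairwise_cat IHs ?andbT; last exact: path_sorted si.
apply/andP; split.
  apply/allrelP=> x y /nseqP[-> _] /flattenP[_ /mapP[j js ->]] /nseqP[-> _].
  rewrite path_sortedE in si; last exact: ltn_trans.
  by case/andP: si => /allP/(_ (val j)) h _; apply: ltnW; apply: h; apply: map_f.
elim: (m i) => //= e ->; rewrite andbT; apply/allP=> x /nseqP[-> _].
by rewrite leqnn.
Qed.

Lemma mnatK t : sorted leq t -> all (gtn n) t -> mindices (mnat t) = t.
Proof.
move=> st /allP lt; apply: (sorted_eq leq_trans anti_leq (sorted_mindices _) st).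
apply/allP=> v; rewrite mem_cat => /orP vt; apply/eqP.
have vn : (v < n)%N by case: vt => [/(allP (mindices_lt _))|/lt].
by rewrite -[v]/(val (Ordinal vn)) count_mindices mnmE.
Qed.

Lemma size_mindices m : size (mindices m) = mdeg m.
Proof.
rewrite /mindices size_flatten /shape -map_comp sumnE big_map big_enum mdegE.
by apply: eq_bigr => i _; rewrite /= size_nseq.
Qed.

Lemma mdeg_mnat t : sorted leq t -> all (gtn n) t -> mdeg (mnat t) = size t.
Proof. by move=> st lt; rewrite -size_mindices mnatK. Qed.

Lemma mnat_rcons t (y : 'I_n) : mnat (rcons t (val y)) = (mnat t + U_(y))%MM.
Proof.
apply/mnmP=> x; rewrite mnmDE !mnmE -cats1 count_cat /= addn0; congr (_ + _)%N.
Qed.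

Lemma ltn_sorted_nth f j k : sorted ltn f -> (j <= k)%N -> (k < size f)%N ->
  (nth 0%N f j + (k - j) <= nth 0%N f k)%N.
Proof.
move=> sf; elim: k => [|k IHk]; first by rewrite leqn0 => /eqP->; rewrite addn0.
rewrite leq_eqVlt => /orP[/eqP->|]; first by rewrite subnn addn0.
rewrite ltnS => jk ks; rewrite subSn // addnS.
apply: leq_ltn_trans (IHk jk (ltnW ks)) _.
by have := sorted_ltn_nth ltn_trans 0%N sf; apply; rewrite // inE ltnW.
Qed.

Lemma size_unphi f : size (unphi f) = size f.
Proof. by rewrite size_mkseq. Qed.

Lemma nth_unphi f j : (j < size f)%N -> nth 0%N (unphi f) j = (nth 0%N f j - j)%N.
Proof. by move=> jf; rewrite nth_mkseq. Qed.

Lemma sorted_unphi f : sorted ltn f -> sorted leq (unphi f).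
Proof.
move=> sf; apply/(sortedP 0%N) => j; rewrite size_unphi => jf.
rewrite !nth_unphi //; last exact: ltnW.
have := ltn_sorted_nth sf (leqnSn j) jf; rewrite subSnn; lia.
Qed.

Lemma unphi_lt f : all (gtn n) f -> all (gtn n) (unphi f).
Proof.
move=> /allP lf; apply/(all_nthP 0%N) => j; rewrite size_unphi => jf; rewrite nth_unphi //=.
by apply: leq_ltn_trans (leq_subr _ _) _; apply: lf; rewrite mem_nth.
Qed.

Lemma Phi_take f r : sorted ltn f -> all (gtn n) f -> (r <= size f)%N ->
  Phi (mnat (take r (unphi f))) = take r f.
Proof.
move=> sf lf rf; have st := take_sorted r (sorted_unphi sf).
have lt : all (gtn n) (take r (unphi f)).
  by apply/allP=> x /mem_take; apply/allP/unphi_lt.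
have rs : (r <= size (unphi f))%N by rewrite size_unphi.
rewrite /Phi (mnatK st lt); apply: (@eq_from_nth _ 0%N); rewrite size_mkseq !size_takel // => j jr.
rewrite nth_mkseq // !nth_take // nth_unphi ?(leq_trans jr) // subnK //.
have := ltn_sorted_nth sf (leq0n j) (leq_trans jr rf); rewrite subn0; lia.
Qed.

Lemma nth_Phi m j : (j < mdeg m)%N -> nth 0%N (Phi m) j = (nth 0%N (mindices m) j + j)%N.
Proof. by move=> jm; rewrite nth_mkseq // size_mindices. Qed.

Lemma size_Phi m : size (Phi m) = mdeg m.
Proof. by rewrite size_mkseq size_mindices. Qed.

Lemma leq_mindices_nth m i j : (i <= j)%N -> (j < mdeg m)%N ->
  (nth 0%N (mindices m) i <= nth 0%N (mindices m) j)%N.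
Proof.
move=> ij jm; have := sorted_leq_nth leq_trans leqnn 0%N (sorted_mindices m).
by apply; rewrite // inE size_mindices // (leq_ltn_trans ij).
Qed.

Lemma unphi_Phi m : unphi (Phi m) = mindices m.
Proof.
apply: (@eq_from_nth _ 0%N); first by rewrite size_unphi size_Phi size_mindices.
move=> j; rewrite size_unphi size_Phi => jm; rewrite nth_unphi ?size_Phi // nth_Phi //.
by rewrite addnK.
Qed.

Lemma sorted_enum_ord H : sorted ltn (map val (enum H)).
Proof. by rewrite sorted_map; exact: enum_sorted. Qed.

Lemma enum_ord_lt H : all (gtn n) (map val (enum H)).
Proof. by apply/allP=> _ /mapP[i _ ->]; exact: ltn_ord. Qed.

Section Prefix.
Variable N : 'X_{1..n} -> Prop.
Hypotheses (N_up : forall m m', N m -> (m <= m')%MM -> N m')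
  (N_stable : forall m (i j : 'I_n), N m -> i \in carrier m -> (j < i)%N -> N (m - U_(i) + U_(j))%MM).

(** For a stable set of monomials, the shortest prefix of the index list that lies in it is a
    minimal element for divisibility. A smaller divisor would miss a factor x; stability trades the
    last factor for x and puts a shorter prefix in the set. *)
Lemma prefix_min t : sorted leq t -> all (gtn n) t -> N (mnat t) ->
  exists2 r, (r <= size t)%N & N (mnat (take r t)) /\
    forall m, (m <= mnat (take r t))%MM -> N m -> m = mnat (take r t).
Proof.
move=> st lt Nt; have ex : exists r, `[< N (mnat (take r t)) >].
  by exists (size t); apply/asboolP; rewrite take_size.
case: (ex_minnP ex) => r /asboolP Nr rmin.
have rt : (r <= size t)%N by apply: rmin; apply/asboolP; rewrite take_size.
exists r => //; split=> // m le_m Nm; apply: contrapT => neq_m.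
case: r Nr rmin rt le_m neq_m => [|r] Nr rmin rt.
  move=> /mnm_lepP le_m neq_m; case: neq_m; apply/mnmP=> x; have := le_m x.
  by rewrite take0 mnmE /= leqn0 => /eqP.
have [y ty] : exists y : 'I_n, nth 0%N t r = val y.
  by have yn := all_nthP 0%N lt r rt; exists (Ordinal yn).
rewrite (take_nth 0%N rt) ty mnat_rcons; set q := mnat (take r t) => /mnm_lepP le_m neq_m.
have nNq : ~ N q.
  move=> Nq; have /rmin : `[< N (mnat (take r t)) >] by apply/asboolP.
  by rewrite ltnn.
have [x lt_x] : exists x, (m x < (q + U_(y))%MM x)%N.
  apply: contrapT => nx; apply: neq_m; apply/mnmP=> x; apply/eqP; rewrite eqn_leq le_m leqNgt.
  by apply/negP=> lt_x; apply: nx; exists x.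
(* The divisor [m] misses a factor [x]. It is not the last factor [y], as [q] is not in [N]; so [x]
   occurs in [q] and precedes [y]. *)
have Nqx : N (q + U_(y) - U_(x))%MM.
  apply: N_up Nm _; apply/mnm_lepP=> z; rewrite mnmBE mnm1E; have := le_m z; have := lt_x.
  by case: (eqVneq x z) => [<-|_]; rewrite ?subn0 //; lia.
have [xy|xy] := eqVneq x y; first by apply: nNq; rewrite xy addmK in Nqx.
have qx : (0 < q x)%N.
  by move: lt_x; rewrite mnmDE mnm1E eq_sym (negbTE xy) addn0; apply: leq_ltn_trans.
have le_xy : (x < y)%N.
  have xt : val x \in take r t by rewrite -has_pred1 has_count; move: qx; rewrite mnmE.
  have [k kr xk] := nthP 0%N xt; rewrite size_takel in kr; last exact: ltnW.
  rewrite ltn_neqAle xy /= -[nat_of_ord x]/(val x) -xk nth_take // -[nat_of_ord y]/(val y) -ty.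
  by have := sorted_leq_nth leq_trans leqnn 0%N st; apply; rewrite ?inE ?(ltnW kr) // (ltn_trans kr).
apply: nNq; have := N_stable (i := y) (j := x) Nqx.
have -> : (q + U_(y) - U_(x) - U_(y) + U_(x))%MM = q.
  apply/mnmP=> z; rewrite !(mnmDE, mnmBE, mnm1E); move: qx.
  by case: (eqVneq x z) => [<-|_]; case: (eqVneq y z) => [_|_]; lia.
apply=> //; rewrite inE mnmBE mnmDE !mnm1E eqxx (negbTE xy) subn0 addn1.
by [].
Qed.

End Prefix.

Lemma set_of_take (H : {set 'I_n}) r :
  map val (enum [set x in take r (enum H)]) = take r (map val (enum H)).
Proof.
have -> : enum [set x in take r (enum H)] = take r (enum H).
  apply: (irr_sorted_eq (leT := fun i j : 'I_n => (i < j)%N)).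
  - by move=> a b c; exact: ltn_trans.
  - by move=> a; exact: ltnn.
  - exact: enum_sorted.
  - by apply: take_sorted; exact: enum_sorted.
  by move=> x; rewrite mem_enum inE.
by rewrite map_take.
Qed.

End Indices.

(** * Membership in the symmetric shifting *)

Section SymShift.
Variables (K : fieldType) (n : nat).
Local Notation S := {mpoly K[n]}.
Implicit Types (F H : {set 'I_n}) (G : {set {set 'I_n}}) (m : 'X_{1..n}).

Definition sym_bad G F : Prop := exists m H, [/\ min_generator (sym_gin (@stanley_reisner K n G)) m,
  map val (enum H) = Phi m & H \subset F].

Lemma sym_shiftP G F : F \in sym_shift K G <-> ~ sym_bad G F.
Proof.
suff idE : sym_shift_ideal G (mono K F) <-> sym_bad G F.
  by rewrite inE; split=> [/asboolP h /idE //|h]; apply/asboolP=> /idE.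
split; last first.
  move=> [m [H [mG Hm HF]]].
  have -> : mono K F = 'X_[set_mnm (F :\: H)] * mono K H.
    rewrite !mono_mnm -mpolyXD; congr 'X_[_]; apply/mnmP=> x; rewrite mnmDE !mnmE inE.
    by case: (boolP (x \in H)) => [/(subsetP HF)->|_]; rewrite ?addn0.
  have [_ _ IM] := ideal_gen_ideal [set p | exists F0, p = mono K F0 /\
    exists2 m, min_generator (sym_gin (@stanley_reisner K n G)) m & map val (enum F0) = Phi m]%classic.
  by apply: (proj1 (IM _ _ _)); apply: sub_ideal_gen; exists H; split=> //; exists m.
pose I0 : S -> Prop := fun g => forall q, g@_q != 0 -> sym_bad G (carrier q).
have up F1 F2 : sym_bad G F1 -> F1 \subset F2 -> sym_bad G F2.
  by move=> [m [H [mG Hm HF]]] F12; exists m, H; split=> //; exact: subset_trans F12.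
have I0M f g : I0 f -> I0 (g * f).
  move=> If q; rewrite mcoeffM => /eqP nz; apply: contrapT => nq; apply: nz; apply: big1 => -[q1 q2] /= /eqP e.
  have [->|fz] := eqVneq (f@_q2) 0; first by rewrite mulr0.
  case: nq; apply: (up _ _ (If _ fz)); apply: carrier_sub.
  by apply/mnm_lepP=> x; move/mnmP: e => /(_ x) ->; rewrite mnmDE leq_addl.
have idI : is_ideal (I0 : classical_sets.set {mpoly K[n]}).
  split=> [q|f g If Ig q|a f If]; last by rewrite [f * a]mulrC; split; exact: I0M.
  - by rewrite mcoeff0 eqxx.
  rewrite mcoeffD => nz; have [f0|] := eqVneq (f@_q) 0; last exact: If.
  by apply: Ig; rewrite f0 add0r in nz.
rewrite mono_mnm => h; rewrite -(carrier_set_mnm F); move: h.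
move/(ideal_gen_min idI) => h; apply: h; last by rewrite mcoeffX eqxx oner_eq0.
move=> g [H [-> [m mG Hm]]] q; rewrite mono_mnm mcoeffX; case: (eqVneq (set_mnm H) q) => [<- _|]; last by rewrite eqxx.
by rewrite carrier_set_mnm; exists m, H.
Qed.

(** The minimal prefix of the unshifted sequence is a minimal generator, and [Phi] sends it to a
    prefix of [H], hence to a subset of [H]. *)
Lemma sym_bad_of_nonstd G H : (forall m (i j : 'I_n), sym_nonstd K G m -> i \in carrier m -> (j < i)%N ->
    sym_nonstd K G (m - U_(i) + U_(j))%MM) ->
  (forall F H, F \in G -> H \subset F -> H \in G) ->
  sym_nonstd K G (mnat n (unphi (map val (enum H)))) -> sym_bad G H.
Proof.
move=> stable clG NH; have sH := sorted_enum_ord H; have lH := enum_ord_lt H.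
have [r rs [Nr rmin]] := prefix_min (fun m m' => sym_nonstd_up clG (m := m) (m' := m')) stable
  (sorted_unphi sH) (unphi_lt lH) NH.
rewrite size_unphi in rs.
exists (mnat n (take r (unphi (map val (enum H))))), [set x in take r (enum H)]; split=> //.
  by rewrite set_of_take Phi_take.
by apply/subsetP=> x; rewrite inE => /mem_take; rewrite mem_enum.
Qed.

End SymShift.

(** * Hilbert functions by truncated generating functions *)

Section MonoCount.
Variable n : nat.

Lemma mval_le k (q : mono_deg n k) x : (mval q x <= k)%N.
Proof.
by apply: (@leq_trans (mdeg (mval q))); [rewrite mdegE (bigD1 x) //= leq_addr | rewrite mdeg_mval].
Qed.

(** A monomial of degree [k] has all exponents at most [k], so each factor may be cut at any [N]
    above [k] and remains a polynomial. *)
Lemma card_mono_gen (P : 'I_n -> pred nat) N k : (k < N)%N ->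
  (#|[set q : mono_deg n k | [forall x, P x (mval q x)]]|)%:R =
  (\prod_(x < n) \sum_(e < N | P x e) 'X^e : {poly int})`_k.
Proof.
case: N => // N; rewrite ltnS => le_kN.
rewrite (eq_bigr (fun x => \sum_(e < N.+1) if P x e then 'X^e else 0 : {poly int})) => [|x _]; last by rewrite big_mkcond.
rewrite bigA_distr_bigA coef_sum -sum1_card natr_sum.
pose phi (q : mono_deg n k) : {ffun 'I_n -> 'I_N.+1} := [ffun x => inord (mval q x)].
have phiE q x : phi q x = mval q x :> nat.
  by rewrite ffunE inordK // ltnS (leq_trans _ le_kN) // mval_le.
have phi_inj : injective phi.
  by move=> q q' e; apply: (@mval_inj n k); apply/mnmP=> x; rewrite -!phiE e.
have prodE (f : {ffun 'I_n -> 'I_N.+1}) :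
    (\prod_i (if P i (f i) then 'X^(f i) else 0 : {poly int}))`_k =
    ([forall x, P x (f x)] && (\sum_x f x == k)%N)%:R.
  case: (boolP [forall x, P x (f x)]) => [/forallP Pf|/forallPn[x /negbTE Pfx]] /=; last first.
    by rewrite (bigD1 x) //= Pfx mul0r coef0.
  rewrite (eq_bigr (fun i => 'X^(f i))) => [|i _]; last by rewrite Pf.
  by rewrite -(big_morph (fun e => 'X^e : {poly int}) (fun a b => exprD _ a b) (expr0 _)) coefXn eq_sym.
under [RHS]eq_bigr => f _ do rewrite prodE.
rewrite [RHS](bigID (fun f => f \in [set phi q | q : mono_deg n k])) /= [X in _ + X]big1 ?addr0.
  rewrite big_imset /=; last by move=> q q' _ _; exact: phi_inj.
  rewrite [LHS]big_mkcond /=; apply: eq_bigr => q _.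
  rewrite inE; have -> : (\sum_x phi q x == k)%N.
    apply/eqP; rewrite (eq_bigr (fun x => mval q x)) => [|x _]; last exact: phiE.
    by rewrite -mdegE mdeg_mval.
  rewrite andbT; have -> : [forall x, P x (phi q x)] = [forall x, P x (mval q x)].
    by apply: eq_forallb => x; rewrite phiE.
  by case: ifP.
move=> f nf; case: (boolP (_ && _)) => // /andP[_ /eqP fk]; case/negP: nf.
have [q qf] : exists q : mono_deg n k, mval q = [multinom (f x : nat) | x < n].
  by apply: mval_exists; rewrite mdegE -fk; apply: eq_bigr => x _; rewrite mnmE.
by apply/imsetP; exists q => //; apply/ffunP=> x; apply: val_inj; rewrite /= phiE qf mnmE.
Qed.

Definition geom k : {poly int} := \sum_(e < k.+1) 'X^e.

Definition low_mnm d (m : 'X_{1..n}) : 'X_{1..n} := [multinom (if x < n - d then m x else 0)%N | x < n].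
Definition high_mnm d (m : 'X_{1..n}) : 'X_{1..n} := [multinom (if x < n - d then 0 else m x)%N | x < n].

Lemma low_high d m : m = (low_mnm d m + high_mnm d m)%MM.
Proof. by apply/mnmP=> x; rewrite mnmDE !mnmE; case: ifP; rewrite ?addn0. Qed.

Lemma low_mnm_le d m : (low_mnm d m <= m)%MM.
Proof. by apply/mnm_lepP=> x; rewrite mnmE; case: ifP. Qed.

Definition is_low d (m : 'X_{1..n}) : bool := [forall x : 'I_n, (n - d <= x)%N ==> (m x == 0)%N].

Lemma is_lowP d (m : 'X_{1..n}) : reflect (forall x : 'I_n, (n - d <= x)%N -> m x = 0%N) (is_low d m).
Proof.
apply: (iffP forallP) => h x; first by move=> dx; have := h x; rewrite dx => /eqP.
by apply/implyP=> /h->.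
Qed.

Lemma low_is_low d m : is_low d (low_mnm d m).
Proof. by apply/is_lowP=> x dx; rewrite mnmE ltnNge dx. Qed.

Lemma low_mnm_id d m : is_low d m -> low_mnm d m = m.
Proof.
by move/is_lowP=> h; apply/mnmP=> x; rewrite mnmE; case: ltnP => // /h->.
Qed.

Definition high_count d k : nat :=
  #|[set q : mono_deg n k | [forall x : 'I_n, (x < n - d)%N ==> (mval q x == 0)%N]]|.

Lemma high_countE d j k : (d <= n)%N -> (j <= k)%N -> (high_count d j)%:R = (geom k ^+ d)`_j.
Proof.
move=> le_dn jk; rewrite /high_count.
rewrite (@card_mono_gen (fun x e => (x < n - d)%N ==> (e == 0)%N) k.+1) //; congr (_`_j).
rewrite (eq_bigr (fun x : 'I_n => if (x < n - d)%N then 1 else geom k)); last first.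
  move=> x _; case: ifP => xd /=; last by apply: eq_bigl.
  by rewrite big_mkcond big_ord_recl /= big1 ?addr0 // expr0.
rewrite (bigID (fun x : 'I_n => x < n - d)%N) /=.
rewrite big1 ?mul1r => [|x ->] //.
rewrite (eq_bigr (fun=> geom k)) => [|x /negbTE->] //; rewrite prodr_const.
suff -> : #|[pred x : 'I_n | ~~ (x < n - d)%N]| = d by [].
have := cardC [pred x : 'I_n | (x < n - d)%N]; rewrite card_ord.
have -> : #|[pred x : 'I_n | (x < n - d)%N]| = (n - d)%N.
  rewrite -sum1_card -(big_ord_widen n (fun=> 1%N) (leq_subr d n)).
  by rewrite sum1_card card_ord.
have -> : #|[predC [pred x : 'I_n | (x < n - d)%N]]| = #|[pred x : 'I_n | ~~ (x < n - d)%N]| by apply: eq_card.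
by move: #|_| => c; lia.
Qed.

(** The Hilbert series, h-polynomial over (1 - X)^d, read modulo X^(k+1). In [sum_faces_h] take x =
    X g and y = 1 - X^(k+1), with g the truncated geometric series; then x + y = g. *)
Lemma card_face_monos (G : {set {set 'I_n}}) d hh k : sedh d G hh -> (d <= n)%N ->
  #|[set q : mono_deg n k | carrier (mval q) \in G]| = (\sum_(e < k.+1) hh e * high_count d (k - e))%N.
Proof.
move=> sG le_dn; apply/eqP; rewrite -(Num.Theory.eqr_nat int); apply/eqP.
have y1 : (1 - 'X^(k.+1) : {poly int}) != 0.
  apply/eqP=> /(congr1 (fun p : {poly int} => p`_0)); rewrite coefB coef1 coefXn coef0 /= subr0.
  by move/eqP; rewrite oner_eq0.
have gE : 'X * geom k + (1 - 'X^(k.+1)) = geom k.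
  have := subrX1 ('X : {poly int}) k.+1; rewrite -/(geom k) mulrBl mul1r => e.
  have -> : 1 - 'X^(k.+1) = geom k - 'X * geom k by rewrite -opprB e opprB.
  by rewrite subrKC.
(* The powers of [y] are invisible up to degree [k]. *)
have trunc (p : {poly int}) e : (p * (1 - 'X^(k.+1)) ^+ e)`_k = p`_k.
  elim: e => [|e IHe]; first by rewrite expr0 mulr1.
  by rewrite exprSr mulrA mulrBr mulr1 coefB coefMXn ltnSn subr0.
have := sum_faces_h sG ('X * geom k) y1; rewrite gE => /(congr1 (fun p : {poly int} => p`_k)).
rewrite !coef_sum.
have -> : \sum_(F in G) (('X * geom k) ^+ #|F| * (1 - 'X^(k.+1)) ^+ (d - #|F|))`_k =
    (#|[set q : mono_deg n k | carrier (mval q) \in G]|)%:R.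
  rewrite -sum1_card natr_sum (partition_big (fun q : mono_deg n k => carrier (mval q)) (fun F => F \in G)) /=; last first.
    by move=> q; rewrite inE.
  apply: eq_bigr => F FG; rewrite trunc.
  have -> : ('X * geom k) ^+ #|F| = \prod_(x < n) \sum_(e < k.+2 | (x \in F) == (0 < e)%N) 'X^e.
    rewrite -prodr_const big_mkcond; apply: eq_bigr => x _; rewrite [RHS]big_mkcond big_ord_recl /=.
    case: (x \in F) => /=; last by rewrite big1 ?addr0 ?expr0.
    by rewrite add0r mulr_sumr; apply: eq_bigr => e _; rewrite /bump /= -exprS.
  rewrite -(@card_mono_gen (fun x e => (x \in F) == (0 < e)%N)) // -sum1_card natr_sum.
  apply: eq_bigl => q; rewrite !inE; apply/forallP/andP => [h|[_ /eqP qF] x].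
    have -> : carrier (mval q) = F by apply/setP=> x; rewrite inE (eqP (h x)).
    by [].
  by rewrite -qF inE.
move=> ->; pose f e : int := (hh e)%:R * (if (k < e)%N then 0 else (high_count d (k - e))%:R).
have ext0 a b (g : nat -> int) : (forall e, (a <= e)%N -> g e = 0) -> \sum_(e < a) g e = \sum_(e < a + b) g e.
  by move=> g0; rewrite big_split_ord /= [X in _ = _ + X]big1 ?addr0 // => e _; rewrite g0 // leq_addr.
transitivity (\sum_(e < d.+1) f e).
  apply: eq_bigr => -[e /=]; rewrite ltnS => le_ed _.
  rewrite exprMn -mulrA -exprD subnKC // /f.
  rewrite -polyC_natr coefCM coefXnM; case: ltnP => // le_ek.
  by rewrite (@high_countE d _ k) // leq_subr.
rewrite (ext0 d.+1 k.+1) => [|e lt_de]; last by rewrite /f (sedh_h0 sG) // mul0r.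
rewrite addnC -(ext0 k.+1 d.+1) => [|e lt_ke]; last by rewrite /f lt_ke mulr0.
rewrite natr_sum; apply: eq_bigr => -[e /=]; rewrite ltnS => le_ek _.
by rewrite /f ltnNge le_ek /= natrM.
Qed.

End MonoCount.

(** * Cohen-Macaulay structure of the generic initial ideal; purity and goodness *)

Section SymCM.
Variables (K : fieldType) (n d : nat) (V : {set 'I_n}) (G : {set {set 'I_n}}) (hh : nat -> nat).
Hypotheses (Kinf : infinite_field K) (clG : forall F H : {set 'I_n}, F \in G -> H \subset F -> H \in G)
  (sG : sedh d G hh) (ltdn : (d < n)%N).
Implicit Types (F H : {set 'I_n}) (m : 'X_{1..n}).
Local Notation N := (sym_nonstd K G).

Let x0 : 'I_n := Ordinal (leq_ltn_trans (leq0n d) ltdn).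

Definition low_std k : {set mono_deg n k} :=
  [set q | `[< ~ N (mval q) >] && is_low d (mval q)].

Let mdeg_low k (q : mono_deg n k) : (mdeg (low_mnm d (mval q)) <= k)%N.
Proof.
apply: (@leq_trans (mdeg (mval q))); last by rewrite mdeg_mval.
by rewrite [X in (_ <= mdeg X)%N](low_high d) mdegD leq_addr.
Qed.

(** A monomial is determined by its part in the first n - d variables and its part in the last
    [d]. *)
Lemma card_low_part k : (#|[set q : mono_deg n k | `[< ~ N (low_mnm d (mval q)) >]]| <=
  \sum_(e < k.+1) #|low_std e| * high_count n d (k - e))%N.
Proof.
rewrite -sum1_card (partition_big (fun q : mono_deg n k => inord (mdeg (low_mnm d (mval q))) : 'I_k.+1) predT) //=.
apply: leq_sum => e _; rewrite sum1_card.
pose hs := [set q : mono_deg n (k - e) | [forall x : 'I_n, (x < n - d)%N ==> (mval q x == 0)%N]].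
pose f (uv : mono_deg n e * mono_deg n (k - e)) : option (mono_deg n k) :=
  [pick q | mval q == (mval uv.1 + mval uv.2)%MM].
rewrite -/(#|hs|) -cardsX.
apply: (@leq_trans #|f @: setX (low_std e) hs|); last exact: leq_imset_card.
rewrite -(card_imset _ (@Some_inj _)); apply: subset_leq_card.
apply/subsetP=> o /imsetP[q]; rewrite unfold_in => /andP[]; rewrite inE => /asboolP Nq /eqP qe ->.
have le_e : mdeg (low_mnm d (mval q)) = e by rewrite -qe inordK // ltnS.
have he : mdeg (high_mnm d (mval q)) = (k - e)%N.
  have := mdeg_mval q; move: (mval q) le_e => m0 <- <-.
  by rewrite [X in (mdeg X - _)%N](low_high d) mdegD addKn.
have [u defu] := mval_exists le_e; have [v defv] := mval_exists he.
apply/imsetP; exists (u, v).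
  rewrite inE /= !inE defu defv low_is_low andbT; apply/andP; split; first exact/asboolP.
  by apply/forallP=> x; apply/implyP=> xd; rewrite mnmE xd.
rewrite /f /= defu defv -low_high; case: pickP => [q' /eqP/(@mval_inj n k)->|/(_ q)] //.
by rewrite eqxx.
Qed.

(** The number of monomials supported on faces is at most that of standard monomials, which is at
    most that of monomials with standard low part, and this is at most the Hilbert function again by
    [sym_card_low]. All are equal: the generic initial ideal is generated in the first n - d
    variables, and the low standard monomials number exactly [hh k]. *)
Lemma sym_cm k : (forall q : mono_deg n k, ~ N (low_mnm d (mval q)) -> ~ N (mval q)) /\
  #|low_std k| = hh k.
Proof.
pose T := [set q : mono_deg n k | `[< ~ N (low_mnm d (mval q)) >]].
pose St := [set q : mono_deg n k | `[< ~ N (mval q) >]].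
have leB e : (#|low_std e| <= hh e)%N by exact: (sym_card_low x0 clG Kinf sG ltdn).
have ST : St \subset T.
  apply/subsetP=> q; rewrite !inE => /asboolP Nq; apply/asboolP=> Nl; apply: Nq.
  exact: sym_nonstd_up (low_mnm_le d _).
have c1 := card_low_part k; rewrite -/T in c1.
have c2 : (\sum_(e < k.+1) #|low_std e| * high_count n d (k - e) <=
           \sum_(e < k.+1) hh e * high_count n d (k - e))%N.
  by apply: leq_sum => e _; rewrite leq_mul2r leB orbT.
have c3 := sym_card_faces clG Kinf k; rewrite -/St (card_face_monos k sG (ltnW ltdn)) in c3.
have ST' : St = T.
  by apply/eqP; rewrite eqEcard ST (leq_trans c1) // (leq_trans c2).
split.
  by move=> q Nl; have : q \in T by [rewrite inE; apply/asboolP]; rewrite -ST' inE => /asboolP.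
(* The two sums agree and are compared termwise; in the last term the factor [high_count n d 0] is
   positive and may be cancelled. *)
have := leq_trans c3 (leq_trans (subset_leq_card ST) c1).
rewrite !big_ord_recr /= subnn => h.
have : (\sum_(e < k) #|low_std e| * high_count n d (k - e) <=
           \sum_(e < k) hh e * high_count n d (k - e))%N.
  by apply: leq_sum => e _; rewrite leq_mul2r leB orbT.
move: h (leB k); have hi0 : (0 < high_count n d 0)%N.
  have [q q0] := mval_exists (@mdeg0 n); apply/card_gt0P; exists q.
  by rewrite inE; apply/forallP=> x; rewrite q0 mnm0E eqxx implybT.
move: (\sum_(e < k) _)%N (\sum_(e < k) _)%N (high_count n d 0) hi0 => a b c c0 le1 le2 le3.
apply/eqP; rewrite eqn_leq le2 -(leq_pmul2r c0); apply: contraTT le1; rewrite -!ltnNge => lt.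
by rewrite -addnS leq_add.
Qed.

Lemma nonstd_low m : N m -> N (low_mnm d m).
Proof.
have [q <-] := mval_exists (erefl (mdeg m)) => Nq; apply: contrapT => Nl.
by have [h _] := sym_cm (mdeg m); apply: (h q Nl).
Qed.

Lemma min_generator_low m : min_generator (sym_gin (@stanley_reisner K n G)) m -> is_low d m.
Proof.
by move=> [Nm mmin]; rewrite -(mmin _ (low_mnm_le d m) (nonstd_low Nm)) low_is_low.
Qed.

(* A face misses some vertex; if adding the last missing vertex [a] created a
   forbidden monomial, all its indices being below [n - d], the face would have
   too many vertices below [a]. *)
Lemma sym_shift_extend F : F \in sym_shift K G -> (#|F| < d)%N ->
  exists2 a, a \notin F & a |: F \in sym_shift K G.
Proof.
move=> FD ltF; have [a0 a0F] : exists a, a \notin F.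
  apply/existsP; rewrite -negb_forall; apply/negP=> /forallP all.
  have : (#|[set: 'I_n]| <= #|F|)%N by apply: subset_leq_card; apply/subsetP=> i _; exact: all.
  rewrite cardsT card_ord leqNgt (ltn_trans ltF ltdn) //.
case: (@arg_maxnP _ a0 (fun i => i \notin F) val a0F) => a aF amax.
have gtF (i : 'I_n) : (a < i)%N -> i \in F.
  by move=> ai; apply: contraT => /amax; rewrite /= leqNgt ai.
exists a => //; apply/sym_shiftP=> -[m [H [mG HPhi HaF]]].
have /is_lowP mlow := min_generator_low mG.
have aH : a \in H.
  apply: contraT => aH; case: (proj1 (sym_shiftP K G F) FD); exists m, H; split=> //.
  apply/subsetP=> x xH; have := subsetP HaF x xH; rewrite in_setU1; case/predU1P => // xa.
  by rewrite -xa xH in aH.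
have szH : size (map val (enum H)) = mdeg m by rewrite HPhi size_Phi.
have [j jH aj] : exists2 j, (j < mdeg m)%N & nth 0%N (Phi m) j = a.
  rewrite -size_Phi -HPhi; have /(nthP 0%N)[j jH <-] : val a \in map val (enum H) by rewrite map_f // mem_enum.
  by exists j.
have sj : (nth 0%N (mindices m) j < n - d)%N.
  have jm : (j < size (mindices m))%N by rewrite size_mindices.
  have lt := all_nthP 0%N (mindices_lt m) j jm.
  rewrite ltnNge; apply/negP=> le; have := mlow (Ordinal lt) le.
  rewrite -count_mindices /= => /eqP; apply/negP; rewrite -lt0n -has_count has_pred1.
  exact: mem_nth.
rewrite nth_Phi // in aj.
have le_j : (j <= #|[set x in F | (x < a)%N]|)%N.
  have sub : {subset take j (enum H) <= [set x in F | (x < a)%N]}.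
    move=> x /(nthP a)[k]; rewrite size_take_min -cardE => kj <-.
    have kj' : (k < j)%N by apply: leq_trans kj (geq_minl _ _).
    have jE : (j < size (enum H))%N by rewrite size_map in szH; rewrite szH.
    have kE : (k < size (enum H))%N by exact: ltn_trans kj' jE.
    rewrite nth_take // inE; set y := nth a _ k.
    have yH : y \in H by rewrite -mem_enum mem_nth.
    have ya : (y < a)%N.
      have := sorted_ltn_nth ltn_trans 0%N (sorted_enum_ord H) k j.
      rewrite !inE size_map kE jE => /(_ isT isT kj').
      by rewrite (nth_map a) // HPhi nth_Phi ?aj // -szH size_map.
    rewrite ya andbT; have := subsetP HaF y yH; rewrite in_setU1; case/predU1P => // e.
    by rewrite e ltnn in ya.
  have := uniq_leq_size (take_uniq j (enum_uniq (mem H))) => /(_ (enum [set x in F | (x < a)%N])).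
  rewrite size_takel; last by rewrite size_map in szH; rewrite szH ltnW.
  by rewrite -cardE; apply=> x /sub; rewrite mem_enum.
have leF : (#|[set x in F | (x < a)%N]| + #|[set i : 'I_n | (a < i)%N]| <= #|F|)%N.
  rewrite -cardsUI [X in (_ + #|pred_of_set X|)%N](_ : _ = set0) ?cards0 ?addn0; last first.
    by apply/setP=> x; rewrite !inE; case: ltngtP; rewrite ?andbF.
  apply: subset_leq_card; apply/subsetP=> x; rewrite !inE => /orP[/andP[]//|].
  exact: gtF.
have arith (c1 c2 c3 s b : nat) : (j <= c2)%N -> (s < n - d)%N -> (s + j = b)%N -> (c1 < d)%N ->
  (b < n)%N -> (c2 + c3 <= c1)%N -> (c3 = n - b.+1)%N -> False by lia.
exact: (arith _ _ _ _ _ le_j sj aj ltF (ltn_ord a) leF (card_above a)).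
Qed.

Section CharZero.
Hypothesis K0 : [pchar K] =i pred0.

Let stable m (i j : 'I_n) : N m -> i \in carrier m -> (j < i)%N -> N (m - U_(i) + U_(j))%MM.
Proof. by move=> Nm im ji; exact: (sym_stable clG Kinf ji K0 Nm im). Qed.

Lemma sym_bad_sub F H : sym_bad K G H -> H \subset F -> sym_bad K G F.
Proof. by move=> [m [H0 [mG Hm H0H]]] HF; exists m, H0; split=> //; exact: subset_trans HF. Qed.

(** A set of size [d.+1] unshifts to a monomial of degree [d.+1] in the low variables, where by
    [sym_cm] no monomial is standard. *)
Lemma sym_shift_card F : F \in sym_shift K G -> (#|F| <= d)%N.
Proof.
move=> FD; rewrite leqNgt; apply/negP => ltdF.
pose H := [set x in take d.+1 (enum F)].
have HF : H \subset F by apply/subsetP=> x; rewrite inE => /mem_take; rewrite mem_enum.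
have sH := sorted_enum_ord H; have lH := enum_ord_lt H.
have szH : size (map val (enum H)) = d.+1.
  by rewrite set_of_take size_takel // size_map -cardE.
set f := map val (enum H) in sH lH szH; set t := unphi f.
have st : sorted leq t := sorted_unphi sH; have lt : all (gtn n) t := unphi_lt lH.
apply: (proj1 (sym_shiftP K G F) FD); apply: sym_bad_sub HF; apply: sym_bad_of_nonstd => //.
rewrite -/f -/t; have mt : mdeg (mnat n t) = d.+1 by rewrite mdeg_mnat // size_unphi.
have [q defq] := mval_exists mt.
(* The [j]-th index exceeds the shift [j] by less than n - d, because d - j larger indices follow it
   below [n]. *)
have tlow : is_low d (mnat n t).
  apply/is_lowP=> x dx; rewrite mnmE; apply/count_memPn; apply/negP=> /(nthP 0%N)[j].
  rewrite size_unphi => jf; rewrite nth_unphi // => xj.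
  have jd : (j <= d)%N by rewrite szH in jf.
  have df : (d < size f)%N by rewrite szH.
  have := ltn_sorted_nth sH jd df; have := all_nthP 0%N lH d df.
  by move: xj dx => /=; move: (nth _ f j) (nth _ f d) => a b; lia.
apply: contrapT => Nt; have [_ cB] := sym_cm d.+1.
have : q \in low_std d.+1 by rewrite inE defq tlow andbT; apply/asboolP.
by have := cB; rewrite (sedh_h0 sG) // => /eqP; rewrite cards_eq0 => /eqP->; rewrite inE.
Qed.

Lemma sym_shift_pure : pure (sym_shift K G).
Proof.
have facet_d F : facet (sym_shift K G) F -> #|F| = d.
  move=> /maxsetP[FD Fmax]; apply/eqP; rewrite eqn_leq sym_shift_card // leqNgt; apply/negP=> ltF.
  have [a aF aD] := sym_shift_extend FD ltF.
  by move/negP: aF; apply; rewrite -(Fmax _ aD (subsetUr _ _)) setU11.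
by move=> F H /facet_d-> /facet_d->.
Qed.

(** If the interval were not contained in [H], the unshifted monomial of [H] would be low with
    exponent below [d - p.*2] at the variable n - d - 1, hence in the generic initial ideal by
    [sym_nonstd_mid]. *)
Lemma sym_shift_good F : F \in sym_shift K G -> Kgood d F.
Proof.
move=> FD; split; first exact: sym_shift_card.
move=> p le_p H HF cH ltH i /andP[li ui].
have lt_p : (p.*2 < d)%N by lia.
have sH := sorted_enum_ord H; have lH := enum_ord_lt H.
have szH : size (map val (enum H)) = (d - p)%N by rewrite size_map -cardE.
apply: contrapT => /negP iH.
apply: (proj1 (sym_shiftP K G F) FD); apply: sym_bad_sub HF; apply: sym_bad_of_nonstd => //.
have fH j : (j < d - p)%N -> (nth 0%N (map val (enum H)) j < n - p.+1)%N.
  move=> jd; have : nth 0%N (map val (enum H)) j \in map val (enum H) by rewrite mem_nth // szH.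
  by case/mapP=> x; rewrite mem_enum => /ltH lt ->.
have iH' : val i \notin map val (enum H) by rewrite mem_map ?mem_enum //; exact: val_inj.
set f := map val (enum H) in sH lH szH fH iH' *; set t := unphi f.
have st : sorted leq t := sorted_unphi sH; have lt : all (gtn n) t := unphi_lt lH.
have mt : mdeg (mnat n t) = (d - p)%N by rewrite mdeg_mnat // size_unphi.
(* The indices increase strictly and the last one is below [n - p.+1]. *)
have lowf j : (j < d - p)%N -> (nth 0%N f j - j < n - d)%N.
  move=> jd; have df : ((d - p).-1 < size f)%N by rewrite szH; lia.
  have := @ltn_sorted_nth f j (d - p).-1 sH; rewrite df => /(_ _ isT) h.
  have := h _; have := fH (d - p).-1; have -> : ((d - p).-1 < d - p)%N by lia.
  by move=> /(_ isT) h1 /(_ ltac:(lia)); lia.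
apply: (sym_nonstd_mid x0 clG Kinf sG ltdn lt_p mt).
  move=> x dx; rewrite mnmE; apply/count_memPn; apply/negP=> /(nthP 0%N)[j].
  rewrite size_unphi szH => jf; rewrite nth_unphi ?szH // => xj.
  by have := lowf j jf; rewrite xj ltnNge dx.
move=> x /eqP xd; rewrite mnmE ltnNge; apply/negP=> le.
(* the last [d - 2p] indices are then all equal to [n - d - 1] *)
have tlast j : (p <= j)%N -> (j < d - p)%N -> nth 0%N t j = x.
  move=> pj jd; have jt : (j < size t)%N by rewrite size_unphi szH.
  have tj : (nth 0%N t j <= x)%N by rewrite nth_unphi ?szH //; have := lowf j jd; rewrite -xd ltnS.
  apply/eqP; rewrite eqn_leq tj leqNgt; apply/negP=> ltx.
  have : (count_mem (val x) (take j.+1 t) = 0)%N.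
    apply/count_memPn; apply/negP=> /(nthP 0%N)[k]; rewrite size_takel // => kj.
    rewrite nth_take // => kx; have := sorted_leq_nth leq_trans leqnn 0%N st k j.
    rewrite !inE jt (leq_ltn_trans _ jt) // kx => /(_ isT isT kj) /= h.
    by rewrite ltnNge h in ltx.
  have := count_size (pred1 (val x)) (drop j.+1 t); rewrite size_drop size_unphi szH.
  by move: le; rewrite -{1}(cat_take_drop j.+1 t) count_cat; lia.
have jE : (p <= i - x)%N /\ (i - x < d - p)%N by move: li ui xd ltdn lt_p; lia.
case: jE => pj jd; case/negP: iH'; apply/(nthP 0%N); exists (i - x)%N; first by rewrite szH.
have := tlast _ pj jd; rewrite nth_unphi ?szH //.
have := ltn_sorted_nth sH (leq0n (i - x)%N); rewrite szH => /(_ jd).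
move: (nth 0%N f (i - x)) => y /=; move: li ui xd ltdn lt_p; lia.
Qed.

End CharZero.
End SymCM.

(** The contraction has the same [d], and the link has [d] lower by two but shifted by one, so both
    contributions are symmetric about the same middle. *)
Lemma sedh_sym n d (G : {set {set 'I_n}}) hh k : sedh d G hh -> (k <= d)%N -> hh k = hh (d - k)%N.
Proof.
move=> sG; elim: sG k => {d G hh} [|V d _|V G i j d h1 h2 _ _ _ _ _ _ IH1 s2 IH2] k.
- by rewrite leqn0 => /eqP->.
- by rewrite leq_subr => ->.
move=> kd; rewrite (IH1 k kd); congr (_ + _)%N.
case: k kd => [_|k]; first by rewrite subn0 (sedh_h0 s2).
rewrite ltnS subSS => kd; have [->|kd'] := eqVneq k d.+1.
  by rewrite subnn (sedh_h0 s2).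
have le_kd : (k <= d)%N by rewrite -ltnS ltn_neqAle kd'.
by rewrite subSn // IH2.
Qed.

(** * Monotonicity of symmetric shifting, and its value on neighborly complexes *)

Section Comparison.
Variables (K : fieldType) (n d : nat).
Hypotheses (Kinf : infinite_field K) (K0 : [pchar K] =i pred0).
Implicit Types (F H : {set 'I_n}) (G C : {set {set 'I_n}}) (m : 'X_{1..n}).

Lemma ideal_gen_mono (R : nzRingType) (X Y : classical_sets.set R) x :
  (forall x, X x -> Y x) -> ideal_gen X x -> ideal_gen Y x.
Proof.
move=> XY; apply: ideal_gen_min; first exact: ideal_gen_ideal.
by move=> y /XY; exact: sub_ideal_gen.
Qed.

Lemma sym_nonstd_anti G C m : G \subset C -> sym_nonstd K C m -> sym_nonstd K G m.
Proof.
move=> /subsetP GC; apply: generically_mono => A _; apply: ideal_gen_mono => g [q [-> [f [f0 Cf0 <-] iq]]].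
exists q; split=> //; exists (sym_act A f0) => //; exists f0 => //.
move: Cf0; apply: ideal_gen_mono => h [F FC ->]; exists F => //.
by apply: contra FC => /GC.
Qed.

(** A larger complex has a smaller generic initial ideal. Minimal generators need not remain
    minimal, but [sym_bad_of_nonstd] only needs the monomial to be in the ideal. *)
Lemma sym_shift_mono G C : (forall F H, F \in G -> H \subset F -> H \in G) ->
  G \subset C -> sym_shift K G \subset sym_shift K C.
Proof.
move=> clG GC; apply/subsetP=> F /sym_shiftP nb; apply/sym_shiftP=> -[m [H [[Nm _] Hm HF]]].
apply: nb; apply: sym_bad_sub HF; apply: sym_bad_of_nonstd => //.
  by move=> q i j Nq iq ji; exact: (sym_stable clG Kinf ji K0 Nq iq).
by rewrite Hm unphi_Phi mindicesK; exact: sym_nonstd_anti Nm.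
Qed.

Section Neighborly.
Variables (G : {set {set 'I_n}}) (hh : nat -> nat).
Hypotheses (clG : forall F H, F \in G -> H \subset F -> H \in G)
  (sG : sedh d G hh) (ltdn : (d < n)%N) (nbG : forall F, (#|F|.*2 <= d)%N -> F \in G).
Local Notation N := (sym_nonstd K G).

Let x0 : 'I_n := Ordinal (leq_ltn_trans (leq0n d) ltdn).

Lemma neighborly_std m : ((mdeg m).*2 <= d)%N -> ~ N m.
Proof.
move=> le; apply: (sym_std_all_faces clG Kinf) => F leF; apply: nbG.
by apply: leq_trans le; rewrite leq_double.
Qed.

(* The low standard monomials of degree [d - p] are divisible by [x^(d - 2p)],
   and they are as numerous as all the low monomials of degree [p]. *)
Lemma neighborly_std_mid p m (x : 'I_n) : (p.*2 < d)%N -> x.+1 = (n - d)%N -> mdeg m = (d - p)%N ->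
  is_low d m -> (d - p.*2 <= m x)%N -> ~ N m.
Proof.
move=> lt_p xE mk mlow mx.
pose Lp := [set u : mono_deg n p | is_low d (mval u)].
pose X := [set q : mono_deg n (d - p) | is_low d (mval q) && (d - p.*2 <= mval q x)%N].
have cp (k : nat) := (sym_cm Kinf clG sG ltdn k).2.
have cL : #|Lp| = hh p.
  rewrite -(cp p); apply: eq_card => u; rewrite !inE; case: (is_low d _); rewrite ?andbF ?andbT //.
  by apply/esym/asboolP; apply: neighborly_std; rewrite mdeg_mval ltnW.
have BX : low_std K d G (d - p) \subset X.
  apply/subsetP=> q; rewrite !inE => /andP[/asboolP Nq ql]; rewrite ql /= leqNgt; apply/negP=> lt.
  apply: Nq; apply: (sym_nonstd_mid x0 clG Kinf sG ltdn lt_p (mdeg_mval q)); first exact/is_lowP.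
  by move=> y /eqP; rewrite -xE => -[/val_inj->].
have leX : (#|X| <= #|Lp|)%N.
  pose f (u : mono_deg n p) : option (mono_deg n (d - p)) :=
    [pick q | mval q == (mval u + U_(x) *+ (d - p.*2))%MM].
  apply: (@leq_trans #|f @: Lp|); last exact: leq_imset_card.
  rewrite -(card_imset _ (@Some_inj _)); apply: subset_leq_card.
  apply/subsetP=> o /imsetP[q]; rewrite inE => /andP[/is_lowP ql qx] ->.
  have le : (U_(x) *+ (d - p.*2) <= mval q)%MM.
    by apply/mnm_lepP=> y; rewrite mulmnE mnm1E; case: eqP => [<-|_]; rewrite ?mul1n ?mul0n.
  have du : mdeg (mval q - U_(x) *+ (d - p.*2))%MM = p.
    apply/eqP; rewrite -(eqn_add2r (mdeg (U_(x) *+ (d - p.*2))%MM)) -mdegD submK //.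
    by rewrite mdeg_mval mdegMn mdeg1 mul1n; lia.
  have [u defu] := mval_exists du; apply/imsetP; exists u.
    rewrite inE defu; apply/is_lowP=> y /ql e; rewrite mnmBE e; exact: sub0n.
  rewrite /f defu submK //; case: pickP => [q' /eqP/(@mval_inj n _)->|/(_ q)] //.
  by rewrite eqxx.
have XB : low_std K d G (d - p) = X.
  have le_pd : (p <= d)%N by lia.
  by apply/eqP; rewrite eqEcard BX cp -(sedh_sym sG le_pd) -cL.
have [q defq] := mval_exists mk.
have : q \in X by rewrite inE defq mlow mx.
by rewrite -XB inE defq => /andP[/asboolP].
Qed.

(** A generator excluding [F] is low, of degree at most [d]. In degrees up to d/2 all monomials are
    standard. In degree d - p, goodness puts a whole interval in its [Phi]-image, which makes it
    divisible by the power [d - p.*2] of the variable n - d - 1, hence standard by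
    [neighborly_std_mid]. *)
Lemma good_sym_shift F : Kgood d F -> F \in sym_shift K G.
Proof.
move=> [leF goodF]; apply/sym_shiftP=> -[m [H [mG Hm HF]]].
have mlow := min_generator_low Kinf clG sG ltdn mG; have [Nm _] := mG.
have szH : #|H| = mdeg m by rewrite -size_Phi -Hm size_map -cardE.
have leH := subset_leq_card HF; rewrite szH in leH.
have [le2|lt2] := leqP (mdeg m).*2 d; first exact: (neighborly_std le2 Nm).
pose p := (d - mdeg m)%N; have mk : mdeg m = (d - p)%N by rewrite /p; lia.
have lt_p : (p.*2 < d)%N by rewrite /p; lia.
have xn : ((n - d).-1 < n)%N by lia.
pose x := Ordinal xn; have xE : x.+1 = (n - d)%N by rewrite /x /=; lia.
have lows j : (j < mdeg m)%N -> (nth 0%N (mindices m) j <= x)%N.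
  move=> jm; have jm' : (j < size (mindices m))%N by rewrite size_mindices.
  have lt := all_nthP 0%N (mindices_lt m) j jm'.
  rewrite -ltnS xE ltnNge; apply/negP=> le; have /is_lowP/(_ (Ordinal lt) le) := mlow.
  rewrite -count_mindices /= => /eqP; apply/negP; rewrite -lt0n -has_count has_pred1.
  exact: mem_nth.
have sPhi : sorted ltn (Phi m) by rewrite -Hm; exact: sorted_enum_ord.
have interval : forall i : 'I_n, (n - p.+1 - (d - p.*2) <= i < n - p.+1)%N -> i \in H.
  apply: goodF => //; [by rewrite ltnW | by rewrite szH|].
  move=> i iH; have : val i \in Phi m by rewrite -Hm map_f // mem_enum.
  case/(nthP 0%N)=> j; rewrite size_Phi => jm; rewrite nth_Phi // => e.
  by have := lows j jm; move: e xE mk jm => /=; lia.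
apply: (neighborly_std_mid lt_p xE mk mlow _ Nm).
have pm : (p < mdeg m)%N by rewrite mk; lia.
(* If the index in position [p] were smaller, the [d - p.*2] values of the interval would have to
   fit in the [d - p.*2 - 1] positions after [p]. *)
have sp : nth 0%N (mindices m) p = x.
  apply/eqP; rewrite eqn_leq lows // leqNgt; apply/negP=> lt.
  have := @uniq_leq_size _ (iota (x + p) (d - p.*2)) (drop p.+1 (Phi m)) (iota_uniq _ _).
  rewrite size_iota size_drop size_Phi => h.
  suff /h : {subset iota (x + p) (d - p.*2) <= drop p.+1 (Phi m)} by rewrite mk; lia.
  move=> v; rewrite mem_iota => /andP[v1 v2]; have vn : (v < n)%N by lia.
  have : val (Ordinal vn) \in Phi m by rewrite -Hm map_f // mem_enum interval //=; lia.
  case/(nthP 0%N)=> k; rewrite size_Phi => km /= kv.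
  have [pk|kp] := ltnP p k.
    rewrite -kv -(subnKC pk) -nth_drop mem_nth // size_drop size_Phi; lia.
  have := ltn_sorted_nth sPhi kp; rewrite size_Phi => /(_ pm); rewrite kv nth_Phi //.
  by lia.
have sj j : (j < d - p.*2)%N -> nth 0%N (mindices m) (p + j) = x.
  move=> jd; have jm : (p + j < mdeg m)%N by rewrite mk; lia.
  by apply/eqP; rewrite eqn_leq lows //= -[X in (X <= _)%N]sp leq_mindices_nth // leq_addr.
rewrite -count_mindices -(cat_take_drop p (mindices m)) count_cat.
have -> : drop p (mindices m) = nseq (d - p.*2) (val x).
  apply: (@eq_from_nth _ 0%N); rewrite size_drop size_mindices mk ?size_nseq; first by lia.
  move=> j jd; rewrite nth_drop sj; last by lia.
  by rewrite nth_nseq; have -> : (j < d - p.*2)%N by lia.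
by rewrite count_nseq /= eqxx mul1n leq_addl.
Qed.

End Neighborly.
End Comparison.

(** * Gale's evenness condition as a cost on words *)

Section GaleCost.
Implicit Types l : bitseq.

(** Greedy covering of the marked positions: from left to right, each uncovered one is covered by a
    block of itself and its successor, at cost two, or alone at cost one in last position.
    [outer_cost] lets an initial run cost one per element. Sets of outer cost at most [d] are those
    satisfying the evenness condition for faces of a cyclic d-polytope. *)
Fixpoint inner_cost l : nat :=
  match l with
  | [::] => 0
  | false :: l' => inner_cost l'
  | true :: l' => if l' is _ :: l'' then (inner_cost l'').+2 else 1
  end%N.

Fixpoint outer_cost l : nat :=
  match l with
  | [::] => 0
  | true :: l' => (outer_cost l').+1
  | false :: l' => inner_cost l'
  end%N.

Lemma bitseq_ind2 (P : bitseq -> Prop) : P [::] -> P [:: true] ->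
  (forall l, P l -> P (false :: l)) -> (forall y l, P l -> P [:: true, y & l]) -> forall l, P l.
Proof.
move=> P0 P1 Pf Pt l; elim: {l}(size l) {-2}l (leqnn (size l)) => [|k IHk] [|[] [|y l]] //= sl.
- by apply: Pt; apply: IHk; apply: ltnW.
- exact: Pf.
by apply: Pf; apply: IHk.
Qed.

Lemma inner_cost_bound l : (count id l <= inner_cost l <= (count id l).*2)%N.
Proof. by elim/bitseq_ind2: l => //= [] [] l; lia. Qed.

Lemma outer_cost_bound l : (count id l <= outer_cost l <= (count id l).*2)%N.
Proof. by elim: l => //= -[] l IH; [lia | rewrite add0n inner_cost_bound]. Qed.

Lemma inner_cost_size l : (inner_cost l <= size l)%N.
Proof. by elim/bitseq_ind2: l => //= l; lia. Qed.

Lemma outer_cost_size l : (outer_cost l <= size l)%N.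
Proof. by elim: l => //= -[] l IH //; apply: leq_trans (inner_cost_size l) _. Qed.

Lemma outer_cost_full l : (outer_cost l < size l)%N = ~~ all id l.
Proof.
elim: l => //= -[] l IH /=; first by rewrite ltnS.
by rewrite ltnS inner_cost_size.
Qed.

Lemma inner_cost_nseq k : inner_cost (nseq k true) = k.
Proof.
suff h l : all id l -> inner_cost l = size l by rewrite h ?size_nseq // all_nseq orbT.
by elim/bitseq_ind2: l => //= -[] //= l IH /IH->.
Qed.

Lemma outer_cost_nseq k : outer_cost (nseq k true) = k.
Proof. by elim: k => //= k ->. Qed.

(** The rule for edge contraction at the start of the word: the second argument of the minimum
    treats the first letter as preceded by a marked one. *)
Lemma outer_costE l : outer_cost l = minn (inner_cost l) (inner_cost (true :: l)).-1.
Proof.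
elim: l => //= -[] l IH /=; last by case: l IH => [|y l] /=; lia.
by rewrite IH; case: l IH => [|y l] //= _; lia.
Qed.

(** An extra leading mark costs exactly one only when the blocks can run to the end of the word,
    which then has full cost. This is what the Link condition needs. *)
Lemma inner_cost_absorb l : inner_cost (true :: l) = (inner_cost l).+1 -> (size l <= inner_cost l)%N.
Proof.
elim: l => //= -[] l IH /=; last by lia.
move=> [e]; have h := IH _; move: e; case: l IH h => [|y l] //= IH h e.
by have := h ltac:(lia); lia.
Qed.

(** Behind the purity of [gale]: the second place of each block is filled, and further marks go into
    the tail or, if there are too many, fill the word. *)
Lemma inner_cost_extend l e : (inner_cost l <= e <= size l)%N -> exists l',
  [/\ size l' = size l, forall k, nth false l k -> nth false l' k, count id l' = e & (inner_cost l' <= e)%N].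
Proof.
elim/bitseq_ind2: l e => [|| l IH | y l IH] e.
- by move=> /= h; exists [::]; split=> //=; lia.
- by move=> /= h; exists [:: true]; split=> //=; lia.
- move=> /= /andP[le1 le2]; have [le|lt] := leqP e (size l).
    have [|l' [sl' sub cl' il']] := IH e; first by rewrite le1.
    by exists (false :: l'); split=> //=; [rewrite sl' | case].
  exists (nseq (size l).+1 true); split; first by rewrite size_nseq.
  - case=> //= k; rewrite nth_nseq; case: ltnP => // lk.
    by rewrite nth_default.
  - by rewrite count_nseq mul1n; lia.
  by rewrite inner_cost_nseq.
move=> /= /andP[le1 le2]; have [|l' [sl' sub cl' il']] := IH (e - 2)%N; first by lia.
exists [:: true, true & l']; split=> //=; [by rewrite sl' | by case=> // -[] | lia | lia].
Qed.

Lemma outer_cost_extend l e : (outer_cost l <= e <= size l)%N -> exists l',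
  [/\ size l' = size l, forall k, nth false l k -> nth false l' k, count id l' = e & (outer_cost l' <= e)%N].
Proof.
elim: l e => [|[] l IH] e /=.
- by move=> h; exists [::]; split=> //=; lia.
- move=> h; have [|l' [sl' sub cl' il']] := IH e.-1; first by lia.
  by exists (true :: l'); split=> //=; [rewrite sl' | case | lia | lia].
move=> /andP[le1 le2]; have [le|lt] := leqP e (size l).
  have [|l' [sl' sub cl' il']] := @inner_cost_extend l e; first by rewrite le1.
  by exists (false :: l'); split=> //=; [rewrite sl' | case].
exists (nseq (size l).+1 true); split; first by rewrite size_nseq.
- case=> //= k; rewrite nth_nseq; case: ltnP => // lk.
  by rewrite nth_default.
- by rewrite count_nseq mul1n; lia.
by rewrite outer_cost_nseq.
Qed.

Lemma inner_cost_mono l l' : size l = size l' -> (forall k, nth false l k -> nth false l' k) ->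
  (inner_cost l <= inner_cost l')%N.
Proof.
(* The induction also compares with a word carrying one extra leading letter, because blocks of the
   larger word may be cut one place earlier. *)
suff both : (forall l', size l = size l' -> (forall k, nth false l k -> nth false l' k) ->
    (inner_cost l <= inner_cost l')%N) /\ (forall l' y, size l = size l' -> (forall k, nth false l k -> nth false l' k) ->
    (inner_cost l <= inner_cost (y :: l'))%N) by case: both => h _; exact: h.
elim: {l l'}(size l) {-2}l (leqnn (size l)) => [|k IHk] [|x l] sl.
- by split=> l' *; exact: leq0n.
- by [].
- by split=> l' *; exact: leq0n.
have {}sl : (size l <= k)%N by [].
have [IH1 IH2] := IHk l sl.
have main l' : (size l).+1 = size l' -> (forall k, nth false (x :: l) k -> nth false l' k) ->
    (inner_cost (x :: l) <= inner_cost l')%N.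
  case: l' => // x' l' [sl'] sub; have sub' k0 : nth false l k0 -> nth false l' k0 by move/(sub k0.+1).
  case: x sub {IH2} => sub; last first.
    case: x' sub => sub; [by have [_ h] := IHk l sl; exact: (h l' true sl' sub') | exact: (IH1 l' sl' sub')].
  have -> : x' = true by exact: (sub 0%N).
  case: l l' sl' sub' {IH1 sub} sl => [|y l] [|y' l'] //= [sl'] sub' sl; rewrite !ltnS.
  have [|h _] := IHk l; first exact: ltnW.
  by apply: h => // k0; exact: (sub' k0.+1).
split; first exact: main.
move=> l' [] sl' sub; last exact: (main l' sl' sub).
case: l' sl' sub => // x' l' [sl'] sub /=.
have sub' k0 : nth false l k0 -> nth false l' k0 by move/(sub k0.+1).
case: x {sub} main => main; last by apply: leq_trans (IH1 l' sl' sub') _; rewrite ltnW.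
case: l sl' sub' {IH1 IH2 main} sl => [|y l] //= sl' sub' sl; case: l' sl' sub' => // y' l' [sl'] sub'.
have [|_ h] := IHk l; first exact: ltnW.
rewrite !ltnS /=; apply: h => // k0; exact: (sub' k0.+1).
Qed.

Lemma outer_cost_mono l l' : size l = size l' -> (forall k, nth false l k -> nth false l' k) ->
  (outer_cost l <= outer_cost l')%N.
Proof.
move=> sl sub; rewrite !outer_costE leq_min !geq_min; apply/andP; split.
  by rewrite inner_cost_mono.
apply/orP; right; rewrite -!subn1 leq_sub2r // inner_cost_mono //= ?sl //.
by case=> // k; exact: sub.
Qed.

End GaleCost.

Lemma inner_cost_true (l : bitseq) : (inner_cost l <= inner_cost (true :: l) <= (inner_cost l).+2)%N.
Proof. by elim: l => //= -[] l IH; case: l IH => [|y l] //=; lia. Qed.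

(** * The Gale complex is strongly edge decomposable *)

Section Gale.
Variable n : nat.
Implicit Types (s : seq 'I_n) (F H : {set 'I_n}).

Definition bits F s : bitseq := [seq x \in F | x <- s].

(** The vertex list is a parameter so that contraction and link of the first edge again have this
    form. *)
Definition gale s d : {set {set 'I_n}} :=
  [set F : {set 'I_n} | (F \subset [set x in s]) && (outer_cost (bits F s) <= d)%N].

Local Notation ordlt := (fun i j : 'I_n => (i < j)%N).

Lemma sorted_ord_uniq s : sorted ordlt s -> uniq s.
Proof. by apply: sorted_uniq => [a b c|a]; [exact: ltn_trans | exact: ltnn]. Qed.

Lemma bits_sub F H s k : H \subset F -> nth false (bits H s) k -> nth false (bits F s) k.
Proof.
move=> HF; have [ks|ks] := ltnP k (size s); last by rewrite nth_default ?size_map.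
case: s ks => // a s ks; rewrite !(nth_map a) //; exact: (subsetP HF).
Qed.

Lemma size_bits F s : size (bits F s) = size s.
Proof. by rewrite size_map. Qed.

Lemma count_bits F s : uniq s -> F \subset [set x in s] -> count id (bits F s) = #|F|.
Proof.
move=> us Fs; rewrite count_map -size_filter -(card_uniqP _) ?filter_uniq //.
apply: eq_card => x; rewrite mem_filter /=; have := subsetP Fs x; rewrite inE.
by case: (x \in F) => //= ->.
Qed.

Lemma eq_bits F H s : {in s, F =i H} -> bits F s = bits H s.
Proof. by move=> FH; apply/eq_in_map => x /FH. Qed.

Lemma bits_mask (b : bitseq) s : uniq s -> size b = size s -> bits [set x in mask b s] s = b.
Proof.
elim: s b => [|a s IHs] [|y b] //= /andP[as_ us] [sb].
have e : bits [set x in mask (y :: b) (a :: s)] s = b.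
  rewrite -[RHS](IHs b us sb); apply: eq_bits => x xs; rewrite !inE /=.
  by case: y; rewrite // inE; case: eqP => // xa; rewrite xa (negbTE as_) in xs.
rewrite e; congr (_ :: _); rewrite inE /=; case: y {e} => /=; first by rewrite mem_head.
by apply: contraNF as_ => /mem_mask.
Qed.

Lemma gale_sub s d F H : F \in gale s d -> H \subset F -> H \in gale s d.
Proof.
rewrite !inE => /andP[Fs le] HF; rewrite (subset_trans HF Fs) /=; apply: leq_trans le.
by apply: outer_cost_mono; [rewrite !size_bits | move=> k; exact: bits_sub].
Qed.

Lemma gale_card s d F : uniq s -> F \in gale s d -> (#|F| <= d)%N.
Proof.
move=> us; rewrite inE => /andP[Fs le]; apply: leq_trans le; rewrite -(count_bits us Fs).
by case/andP: (outer_cost_bound (bits F s)).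
Qed.

Lemma gale_small s d F : uniq s -> F \subset [set x in s] -> (#|F|.*2 <= d)%N -> F \in gale s d.
Proof.
move=> us Fs le; rewrite inE Fs /=; apply: leq_trans le; rewrite -(count_bits us Fs).
by case/andP: (outer_cost_bound (bits F s)).
Qed.

Lemma gale_extend s d F : uniq s -> (d <= size s)%N -> F \in gale s d ->
  exists2 H, H \in gale s d & (F \subset H) && (#|H| == d).
Proof.
move=> us ds; rewrite inE => /andP[Fs le].
have [|b [sb sub cb ob]] := @outer_cost_extend (bits F s) d; first by rewrite size_bits le.
rewrite size_bits in sb; exists [set x in mask b s].
  rewrite inE (bits_mask us sb) ob andbT; apply/subsetP=> x; rewrite !inE.
  exact: mem_mask.
have Hs : [set x in mask b s] \subset [set x in s] by apply/subsetP=> x; rewrite !inE; exact: mem_mask.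
rewrite -(count_bits us Hs) (bits_mask us sb) cb eqxx andbT.
apply/subsetP=> x xF; have := subsetP Fs x xF; rewrite inE => xs.
have ks : (index x s < size s)%N by rewrite index_mem.
have := sub (index x s); rewrite (nth_map x) // nth_index // xF => /(_ isT).
rewrite -{1}(bits_mask us sb) (nth_map x) // nth_index //.
Qed.

Lemma gale_pure s d : uniq s -> (d <= size s)%N -> pure (gale s d).
Proof.
move=> us ds; have facet_d F : facet (gale s d) F -> #|F| = d.
  move=> /maxsetP[FG Fmax]; have [H HG /andP[FH /eqP Hd]] := gale_extend us ds FG.
  by rewrite -(Fmax H HG FH).
by move=> F H /facet_d-> /facet_d->.
Qed.

Lemma set0_gale s d : set0 \in gale s d.
Proof.
rewrite inE sub0set /=; have -> : bits set0 s = nseq (size s) false.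
  by elim: s => //= a s ->; rewrite inE.
suff h k : inner_cost (nseq k false) = 0%N by case: (size s) => //= k; rewrite h.
by elim: k.
Qed.

Lemma gale_dim s d : uniq s -> (d <= size s)%N -> dimS (gale s d) = d.
Proof.
move=> us ds; have [H HG /andP[_ /eqP Hd]] := gale_extend us ds (set0_gale s d).
by apply: (dimS_eq _ HG Hd) => F; exact: gale_card.
Qed.

Lemma gale_complex s d : uniq s -> (1 < d)%N -> complex_on [set x in s] (gale s d).
Proof.
move=> us d1; split; first exact: set0_gale.
- by move=> v vs; apply: gale_small; rewrite ?sub1set // cards1.
- by move=> F; rewrite inE => /andP[].
by move=> F H; exact: gale_sub.
Qed.

Lemma gale0 s : uniq s -> gale s 0 = [set set0].
Proof.
move=> us; apply/setP=> F; rewrite [in RHS]inE; apply/idP/eqP => [FG|->]; last exact: set0_gale.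
by apply/eqP; rewrite -cards_eq0 -leqn0; exact: gale_card FG.
Qed.

Lemma gale_simplex s : uniq s -> s != [::] ->
  gale s (size s).-1 = [set F : {set 'I_n} | F \proper [set x in s]].
Proof.
move=> us s0; have sz : (size s).-1.+1 = size s by case: s s0 {us}.
apply/setP=> F; rewrite !inE properE; case: (boolP (F \subset _)) => //= Fs.
rewrite -ltnS sz -(size_bits F) outer_cost_full; congr negb.
apply/allP/subsetP => [h x|h _ /mapP[x xs ->]].
  by rewrite inE => xs; apply: (h (x \in F)); exact: map_f.
by apply: h; rewrite inE.
Qed.

Lemma inner_outer_le1 b l : (outer_cost (b :: false :: l) <= 1)%N = (outer_cost (b :: l) <= 1)%N.
Proof.
case: b => //=; rewrite !ltnS !leqn0.
have z (c k : nat) : (k <= c <= k.*2)%N -> (c == 0%N) = (k == 0%N) by move=> h; apply/eqP/eqP; lia.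
by rewrite (z _ _ (inner_cost_bound l)) (z _ _ (outer_cost_bound l)).
Qed.

Lemma gale1_step a x y s : uniq [:: a, x, y & s] -> gale [:: a, x, y & s] 1 = gale [:: a, y & s] 1.
Proof.
move=> us; apply/setP=> F; rewrite !inE.
have [xF|xF] := boolP (x \in F).
  have -> : (F \subset [set z in [:: a, y & s]]) = false.
    apply/negP=> /subsetP/(_ x xF); rewrite inE in_cons => /predU1P[xa|xs].
      by move: us; rewrite /= xa inE eqxx.
    by move: us => /and3P[_ + _]; rewrite xs.
  by rewrite /bits /= xF; case: (a \in F) => /=; rewrite ?andbF.
rewrite [bits _ _]/= (negbTE xF) inner_outer_le1; congr (_ && _).
apply/subsetP/subsetP => h z zF; have := h z zF; rewrite !inE.
  by case: (eqVneq z x) => [zx|_] //; rewrite zx (negbTE xF) in zF.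
by case/or3P=> ->; rewrite ?orbT.
Qed.

Section Step.
Variables (i j : 'I_n) (s : seq 'I_n) (d : nat).
Hypotheses (us : uniq [:: i, j & s]) (d1 : (1 < d)%N) (sd : (d <= size s)%N).
Local Notation G := (gale [:: i, j & s] d).

Let ij : i != j.
Proof. by move: us; rewrite /= inE negb_or => /and3P[/andP[]]. Qed.

Let iNs : i \notin s.
Proof. by move: us; rewrite /= inE negb_or => /and3P[/andP[]]. Qed.

Let jNs : j \notin s.
Proof. by case/and3P: us. Qed.

Let us' : uniq s.
Proof. by case/and3P: us. Qed.

Let cG : complex_on [set x in [:: i, j & s]] G.
Proof. exact: gale_complex. Qed.

Let mem_cases F : F \subset [set x in [:: i, j & s]] -> forall x, x \in F -> x != i -> x != j -> x \in s.
Proof.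
by move=> /subsetP h x xF xi xj; have := h x xF; rewrite !inE (negbTE xi) (negbTE xj).
Qed.

(** For [F] containing [j], its two possible preimages have costs matching the two arguments of the
    minimum in [outer_costE]. *)
Lemma gale_contraction : contraction G i j = gale (j :: s) d.
Proof.
apply/setP=> F; rewrite (mem_contraction cG ij); have [iF|iF] /= := boolP (i \in F).
  apply/esym/negbTE; rewrite inE; apply/negP=> /andP[/subsetP/(_ i iF)].
  by rewrite !inE (negbTE ij) (negbTE iNs).
have subE : (F \subset [set x in [:: i, j & s]]) = (F \subset [set x in j :: s]).
  apply/subsetP/subsetP => h x xF; have := h x xF; rewrite !inE.
    by case: (eqVneq x i) => // xi; rewrite xi (negbTE iF) in xF.
  by move=> ->; rewrite orbT.
have [jF|jF] /= := boolP (j \in F); last first.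
  by rewrite orbF !inE subE /bits /= (negbTE iF) (negbTE jF).
have -> : (i |: F :\ j \in G) = (F \subset [set x in j :: s]) && ((inner_cost (bits F s)).+1 <= d)%N.
  rewrite inE /bits /= !inE !eqxx (eq_sym j i) (negbTE ij) /=.
  have -> : [seq x \in i |: F :\ j | x <- s] = bits F s.
    apply: eq_bits => x xs; rewrite !inE.
    have -> : (x == i) = false by apply: contraNF iNs => /eqP<-.
    by have -> : (x == j) = false by apply: contraNF jNs => /eqP<-.
  congr (_ && _). apply/subsetP/subsetP => h x.
    move=> xF; rewrite !inE; case: (eqVneq x j) => //= xj.
    have := h x; rewrite !inE xj xF orbT => /(_ isT) /=.
    by case: (eqVneq x i) => [xi|_] /=; [rewrite xi (negbTE iF) in xF | rewrite ?(negbTE xj)].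
  rewrite !inE; case/predU1P => [->|/andP[xj /h]]; first by rewrite eqxx.
  by rewrite !inE => ->; rewrite orbT.
rewrite !inE subE -andb_orr; congr (_ && _); rewrite /bits /= (negbTE iF) jF.
have pos : (0 < inner_cost (true :: bits F s))%N by case: (bits F s).
have key : (inner_cost (true :: bits F s) <= d)%N || (inner_cost (bits F s) < d)%N = (outer_cost (bits F s) < d)%N.
  by rewrite outer_costE; move: (inner_cost (true :: bits F s)) (inner_cost (bits F s)) pos => c1 c0; lia.
exact: key.
Qed.

(** Two leading marks belong to the initial run and cost exactly two. *)
Lemma gale_link : link G [set i; j] = gale s (d - 2).
Proof.
apply/setP=> F; rewrite (mem_link2 G); have [iF|iF] /= := boolP (i \in F).
  apply/esym/negbTE; rewrite inE; apply/negP=> /andP[/subsetP/(_ i iF)].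
  by rewrite !inE (negbTE iNs).
have [jF|jF] /= := boolP (j \in F).
  apply/esym/negbTE; rewrite inE; apply/negP=> /andP[/subsetP/(_ j jF)].
  by rewrite !inE (negbTE jNs).
rewrite !inE /bits /= !inE !eqxx orbT /=.
have -> : [seq x \in i |: (j |: F) | x <- s] = bits F s.
  apply: eq_bits => x xs; rewrite !inE.
  have -> : (x == i) = false by apply: contraNF iNs => /eqP<-.
  by have -> : (x == j) = false by apply: contraNF jNs => /eqP<-.
congr (_ && _); last by rewrite leq_subRL // addnC || lia.
apply/subsetP/subsetP => h x.
  move=> xF; rewrite inE; apply: (mem_cases _ xF); last 2 first.
  - by apply: contraNneq iF => <-.
  - by apply: contraNneq jF => <-.
  by apply/subsetP=> z zF; apply: h; rewrite !inE zF !orbT.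
rewrite !inE; case/or3P=> [->|->|/h] //; rewrite ?orbT //.
by rewrite inE => ->; rewrite !orbT.
Qed.

Lemma mem_link1 (A : {set {set 'I_n}}) v F : (F \in link A [set v]) = (v \notin F) && (v |: F \in A).
Proof.
by rewrite inE disjoints_subset [F \subset _]subsetC sub1set !inE setUC.
Qed.

Lemma gale_link_condition : link_condition G i j.
Proof.
apply/setP=> F; rewrite (mem_link2 G) in_setI !mem_link1.
have [iF|iF] := boolP (i \in F); first by [].
have [jF|jF] := boolP (j \in F); first by rewrite andbF.
have memG (b1 b2 : bool) F' : (i \in F') = b1 -> (j \in F') = b2 -> {in s, F' =i F} ->
    (F' \in G) = (F' \subset [set x in [:: i, j & s]]) && (outer_cost [:: b1, b2 & bits F s] <= d)%N.
  by move=> e1 e2 e3; rewrite inE /bits map_cons map_cons e1 e2 -/(bits F' s) (eq_bits e3).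
have xi x : x \in s -> (x == i) = false by move=> xs; apply: contraNF iNs => /eqP<-.
have xj x : x \in s -> (x == j) = false by move=> xs; apply: contraNF jNs => /eqP<-.
rewrite (memG true false (i |: F)); first last.
- by move=> x xs; rewrite !inE xi.
- by rewrite !inE (eq_sym j i) (negbTE ij) (negbTE jF).
- by rewrite !inE eqxx.
rewrite (memG false true (j |: F)); first last.
- by move=> x xs; rewrite !inE xj.
- by rewrite !inE eqxx.
- by rewrite !inE (negbTE ij) (negbTE iF).
rewrite (memG true true (i |: (j |: F))); first last.
- by move=> x xs; rewrite !inE xi // xj.
- by rewrite !inE eqxx orbT.
- by rewrite !inE eqxx.
rewrite !subUset !sub1set !inE !eqxx !orbT /=; case: (F \subset _) => //=.
(* The only obstruction is an extra leading mark costing exactly one; then the cost is at least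
   [size s], contradicting [d <= size s]. *)
have abs := @inner_cost_absorb (bits F s); rewrite size_bits in abs.
have pos : (0 < inner_cost (true :: bits F s))%N by case: (bits F s).
have key : (inner_cost (bits F s) < d)%N && (inner_cost (true :: bits F s) <= d)%N = ((outer_cost (bits F s)).+1 < d)%N.
  have := inner_cost_true (bits F s).
  rewrite outer_costE; move: (inner_cost (true :: bits F s)) (inner_cost (bits F s)) pos abs => c1 c0 pos abs le.
  apply/andP/idP; last by lia.
  case=> h1 h2; have [e|ne] := eqVneq c1 c0.+1; last by lia.
  by have := leq_trans h1 (leq_trans sd (abs e)); rewrite ltnn.
exact: key.
Qed.

End Step.

(** Contract the first edge: the contraction has a shorter vertex list and the link has [d - 2]. The
    recursion stops at [d = 0] and at simplex boundaries, where the list has [d.+1] vertices. *)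
Theorem gale_sed s d : sorted ordlt s -> (d < size s)%N -> strongly_edge_decomposable (gale s d).
Proof.
elim: {s}(size s) {-2}s d (leqnn (size s)) => [|k IHk] s d; first by case: s.
move=> sk ss ds; have us := sorted_ord_uniq ss.
have [->|d0] := eqVneq d 0%N; first by rewrite gale0 //; exact: sed_empty.
have [sd|sd] := eqVneq (size s) d.+1.
  have s0 : s != [::] by rewrite -size_eq0 sd.
  have -> : d = (size s).-1 by rewrite sd.
  rewrite gale_simplex //; apply: sed_boundary; apply/set0Pn.
  by case: s s0 {sk ss ds us sd} => // a s _; exists a; rewrite !inE eqxx.
case: s sk ss ds us sd => [|i [|j [|y s]]] // sk ss ds us sd; try by move: ds sd d0 => /=; lia.
have [d1|d1] := eqVneq d 1%N.
  rewrite d1 gale1_step //; apply: IHk => //.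
  by move: ss => /= /and3P[ij jy ->]; rewrite andbT (ltn_trans ij).
have lt1d : (1 < d)%N by lia.
have sd' : (d <= size (y :: s))%N by move: ds sd => /=; lia.
apply: (sed_edge (V := [set x in [:: i, j, y & s]]) (i := i) (j := j)).
- exact: gale_complex.
- by apply: gale_pure => //; exact: ltnW.
- by case/andP: ss.
- have ijn : i != j by move: us; rewrite /= inE negb_or => /and3P[/andP[]].
  have : set0 \in link (gale [:: i, j, y & s] d) [set i; j] by rewrite gale_link //; exact: set0_gale.
  by rewrite (mem_link2 (gale _ _)) setU0 => /and3P[].
- exact: gale_link_condition.
- by rewrite gale_contraction //; apply: IHk => //; case/andP: ss.
rewrite gale_link //; apply: IHk => //.
- by move: sk => /=; lia.
- by case/and3P: ss => _ _; case: (s) => //= *; exact/andP.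
by move: ds => /=; lia.
Qed.

End Gale.

Lemma infinite_field_char0 (K : fieldType) : [pchar K] =i pred0 -> infinite_field K.
Proof.
move=> K0 q q0; apply: contrapT => nq.
have qt t : q.[t] = 0 by apply/eqP/negPn/negP => qt; apply: nq; exists t.
have inj : injective (fun i : nat => i%:R : K).
  suff lt i j : (i < j)%N -> i%:R <> j%:R :> K.
    by move=> i j e; case: (ltngtP i j) => // /lt; rewrite e.
  move=> ij e; have : (j - i)%:R == 0 :> K by rewrite natrB ?e ?subrr // ltnW.
  by rewrite (proj1 (pcharf0P K) K0) subn_eq0 leqNgt ij.
have roots : all (root q) [seq i%:R | i <- iota 0 (size q)] by apply/allP=> x _; apply/rootP.
have := max_poly_roots q0 roots; rewrite map_inj_uniq // iota_uniq size_map size_iota ltnn.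
by move=> /(_ isT).
Qed.

Lemma infinite_field_set (K : fieldType) : infinite_set [set: K]%classic -> infinite_field K.
Proof.
move=> Kinf q q0; apply: contrapT => nq.
have qt t : q.[t] = 0 by apply/eqP/negPn/negP => qt; apply: nq; exists t.
have [B _ sB] := infinite_set_fset (size q) Kinf.
have roots : all (root q) (finmap.enum_fset B) by apply/allP=> x _; apply/rootP.
by have := max_poly_roots q0 roots (finmap.fset_uniq B); rewrite ltnNge sB.
Qed.

Lemma sorted_enum_all n : sorted (fun i j : 'I_n => (i < j)%N) (enum 'I_n).
Proof.
have : sorted ltn (map val (enum 'I_n)) by rewrite val_enum_ord iota_ltn_sorted.
by rewrite sorted_map.
Qed.

(** * Gale sets are faces of the cyclic polytope *)

Section MomentCurve.
Import Order.TTheory Num.Theory.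
Variables (R : realFieldType) (n : nat) (t : 'I_n -> R).
Hypothesis t_mono : forall i j : 'I_n, (i < j)%N -> t i < t j.
Implicit Types (s : seq 'I_n) (F : {set 'I_n}) (p : {poly R}).
Local Notation ordlt := (fun i j : 'I_n => (i < j)%N).

Definition supports F s p : Prop :=
  forall x, x \in s -> 0 <= p.[t x] /\ (p.[t x] == 0) = (x \in F).

Let t_lt a s x : path ordlt a s -> x \in s -> t a < t x.
Proof.
move=> ps xs; apply: t_mono; move: x xs; apply/allP; apply: order_path_min ps => ? ? ?; exact: ltn_trans.
Qed.

Lemma size_mul_XsubC p (a : R) : (size (('X - a%:P) * p)%R <= (size p).+1)%N.
Proof. by apply: leq_trans (size_polyMleq _ _) _; rewrite size_XsubC. Qed.

(** A block contributes (X - t_a)(X - t_b), or (X - t_a)^2 when [b] is not in [F], positive before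
    and after the block; a last single vertex contributes t_a - X. Positivity to the left lets the
    product be extended backwards. *)
Lemma inner_poly F s : sorted ordlt s -> exists p,
  [/\ (size p <= (inner_cost (bits F s)).+1)%N,
      forall y, (forall x, x \in s -> y < t x) -> 0 < p.[y] & supports F s p].
Proof.
elim: {s}(size s) {-2}s (leqnn (size s)) => [|k IHk] [|a s] //= sk ss.
- by exists 1; split=> [|y _|x] //; rewrite ?size_poly1 ?hornerC ?ltr01.
- by exists 1; split=> [|y _|x] //; rewrite ?size_poly1 ?hornerC ?ltr01.
have [aF|aF] /= := boolP (a \in F); last first.
  have [p [sp pp sup]] := IHk s sk (path_sorted ss).
  exists p; split=> // [y ys|x]; first by apply: pp => x xs; apply: ys; rewrite inE xs orbT.
  rewrite inE => /predU1P[->|/sup//]; have pa : 0 < p.[t a] by apply: pp => z; exact: t_lt.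
  by rewrite (negbTE aF) gt_eqF // ltW.
case: s sk ss => [|b s] /= sk ss.
  exists ((t a)%:P - 'X); split=> [|y ya|x].
  - by rewrite -opprB size_polyN size_XsubC.
  - by rewrite hornerD hornerN hornerC hornerX subr_gt0 ya // mem_head.
  by rewrite inE => /eqP->; rewrite hornerD hornerN hornerC hornerX subrr eqxx aF.
case/andP: ss => ab ps; have tab := t_mono ab.
have [p [sp pp sup]] := IHk s (ltnW sk) (path_sorted ps).
have pb : 0 < p.[t b] by apply: pp => z; exact: t_lt.
pose c := if b \in F then t b else t a.
exists (('X - (t a)%:P) * (('X - c%:P) * p)); split=> [|y ys|x].
- by do 2!(apply: leq_trans (size_mul_XsubC _ _) _; rewrite ltnS).
- have ya := ys a (mem_head _ _).
  have yb : y < t b by apply: ys; rewrite !inE eqxx orbT.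
  have py : 0 < p.[y] by apply: pp => x xs; apply: ys; rewrite !inE xs !orbT.
  rewrite !hornerM !hornerXsubC mulrA mulr_gt0 // nmulr_rgt0 ?subr_lt0 //.
  by rewrite /c; case: ifP.
rewrite !hornerM !hornerXsubC !inE => /or3P[/eqP->|/eqP->|xs].
- by rewrite subrr mul0r eqxx aF.
- rewrite /c; case: ifP => bF; first by rewrite subrr mul0r mulr0 eqxx.
  have ba : 0 < t b - t a by rewrite subr_gt0.
  by rewrite gt_eqF ?ltW ?mulr_gt0.
have [p0 pE] := sup x xs; have bx := t_lt ps xs.
have ax : 0 < t x - t a by rewrite subr_gt0 (lt_trans tab).
have cx : 0 < t x - c by rewrite subr_gt0 /c; case: ifP => // _; exact: lt_trans bx.
by rewrite !mulf_eq0 (gt_eqF ax) (gt_eqF cx) /= pE !mulr_ge0 // ltW.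
Qed.

(** Vertices of the initial run contribute X - t_a, which is positive at all later points. *)
Lemma outer_poly F s : sorted ordlt s -> exists p,
  [/\ p != 0, (size p <= (outer_cost (bits F s)).+1)%N & supports F s p].
Proof.
elim: s => [|a s IHs] /= ss.
  by exists 1; split=> //; rewrite ?oner_eq0 ?size_poly1.
have [aF|aF] /= := boolP (a \in F); last first.
  have [p [sp pp sup]] := inner_poly F (path_sorted ss).
  have pa : 0 < p.[t a] by apply: pp => z; exact: t_lt.
  exists p; split=> // [|x]; first by apply: contraTneq pa => ->; rewrite horner0 ltxx.
  rewrite inE => /predU1P[->|/sup//].
  by rewrite (negbTE aF) gt_eqF // ltW.
have [p [p0 sp sup]] := IHs (path_sorted ss).
exists (('X - (t a)%:P) * p); split.
- by rewrite mulf_neq0 // polyXsubC_eq0.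
- by apply: leq_trans (size_mul_XsubC _ _) _; rewrite ltnS.
move=> x; rewrite !hornerM !hornerXsubC !inE => /orP[/eqP->|xs].
  by rewrite subrr mul0r eqxx aF.
have [px pE] := sup x xs; have ax : 0 < t x - t a by rewrite subr_gt0 (t_lt ss).
by rewrite mulf_eq0 (gt_eqF ax) /= pE mulr_ge0 // ltW.
Qed.

(** Affine functions on the moment curve are polynomials of degree at most [d] in the parameter, and
    the cost bounds the degree of the polynomial vanishing exactly on [F]. *)
Lemma gale_cyclic d : gale (enum 'I_n) d \subset cyclic_boundary d t.
Proof.
apply/subsetP=> F; rewrite !inE => /andP[_ le]; apply/asboolP.
have [p [p0 sp sup]] := outer_poly F (@sorted_enum_all n).
have {}sp : (size p <= d.+1)%N by apply: leq_trans sp _; rewrite ltnS.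
(* With this choice [value i] equals p_0 - p(t_i), so validity is nonnegativity of [p] and equality
   is a root. *)
exists (\row_k - p`_k.+1), p`_0 => value.
have valueE i : value i = p`_0 - p.[t i].
  rewrite (horner_coef_wide _ sp) big_ord_recl expr0 mulr1 opprD addrA subrr add0r -sumrN.
  by apply: eq_bigr => k _; rewrite !mxE mulNr.
have supE i : 0 <= p.[t i] /\ (p.[t i] == 0) = (i \in F) by apply: sup; rewrite mem_enum.
split.
- apply: contraNneq p0 => -[/rowP c0 b0]; apply/eqP/polyP=> -[|k]; rewrite coef0 //.
  have [kd|dk] := ltnP k d; last by rewrite nth_default // (leq_trans sp).
  by have := c0 (Ordinal kd); rewrite !mxE => /eqP; rewrite oppr_eq0 => /eqP.
- by move=> i; rewrite valueE gerBl; case: (supE i).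
apply/setP=> i; rewrite inE valueE; have [_ <-] := supE i.
by rewrite -[X in _ = (_ == X)]subr0 (inj_eq (addrI _)) eqr_opp.
Qed.

End MomentCurve.

Theorem theorem1p3 (n d : nat)
    (Delta : {set {set 'I_n}} -> {set {set 'I_n}}) (Gamma : {set {set 'I_n}})
    (L : fieldType) (R : realFieldType) (t : 'I_n -> R) :
  algebraic_shifting Delta ->
  complex_on [set: 'I_n] Gamma ->
  dimS Gamma = d ->
  strongly_edge_decomposable Gamma ->
  [pchar L] =i pred0 ->
  (forall i j : 'I_n, (i < j)%N -> t i < t j) ->
  [/\ pure (Delta Gamma),
      forall i : nat, (i <= d)%N -> hnum Gamma i = hnum Gamma (d - i)%N
    & Delta Gamma \subset sym_shift L (cyclic_boundary d t)].
Proof.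
move=> shift cG dG sedG L0 t_mono; have [hh sG] := sed_sedh sedG.
have Linf := infinite_field_char0 L0.
have clG (F H : {set 'I_n}) : F \in Gamma -> H \subset F -> H \in Gamma by exact: (complex_sub cG).
have hsym i : (i <= d)%N -> hnum Gamma i = hnum Gamma (d - i)%N.
  rewrite dG in sG => le_id; rewrite !(hnum_sedh (hh := hh)) ?dG ?leq_subr //.
  by rewrite (sedh_sym sG le_id).
rewrite dG in sG.
(* Without vertices [d < n] fails, and the counting arguments do not apply; every set is then
   empty. *)
have [n0|n_gt0] := posnP n.
  have all0 (F : {set 'I_n}) : F = set0 by apply/setP=> i; have := ltn_ord i; rewrite {2}n0.
  split=> //; first by move=> F H _ _; rewrite (all0 F) (all0 H).
  apply/subsetP=> F _; apply/sym_shiftP=> -[m [_ [[Nm _] _ _]]].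
  apply: (sym_std_all_faces (G := cyclic_boundary d t) _ Linf _ Nm) => [F1 H1 F1G _|F1 _].
    by rewrite (all0 H1) -(all0 F1).
  by rewrite (all0 F1); apply: (subsetP (gale_cyclic t_mono d)); exact: set0_gale.
(* Otherwise the full vertex set would be a face, and [Gamma] a cone. *)
have ltdn : (d < n)%N.
  rewrite ltnNge; apply/negP=> le_nd.
  have Gpos : (0 < #|Gamma|)%N by apply/card_gt0P; exists set0; case: cG.
  have [F0 F0G F0d] := eq_bigmax_cond (fun F : {set 'I_n} => #|F|) Gpos.
  have F0T : F0 = setT.
    by apply/eqP; rewrite eqEcard subsetT cardsT card_ord -F0d -/(dimS Gamma) dG.
  have [F FG vF] := sed_not_cone (Ordinal n_gt0) sedG.
  by case/negP: vF; apply: clG F0G _; rewrite F0T subsetT.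
have us := enum_uniq 'I_n; have szn : size (enum 'I_n) = n by rewrite size_enum_ord.
have le_dn : (d <= size (enum 'I_n))%N by rewrite szn ltnW.
have [|hh' sGale] := @sed_sedh n (gale (enum 'I_n) d).
  by apply: gale_sed; [exact: sorted_enum_all | rewrite szn].
rewrite gale_dim // in sGale.
(* Goodness involves no field, so a face shifted over one field is compared with the cyclic polytope
   shifted over [L]. *)
have good_sub F : Kgood d F -> F \in sym_shift L (cyclic_boundary d t).
  move=> gF; have clGale := @gale_sub n (enum 'I_n) d.
  apply: (subsetP (sym_shift_mono Linf L0 clGale (gale_cyclic t_mono d))).
  apply: (good_sym_shift Linf clGale sGale ltdn) gF => H le; apply: gale_small => //.
  by apply/subsetP=> x _; rewrite inE mem_enum.
split=> //; case: shift => K K1.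
- exact: (ext_shift_pure (infinite_field_set K1) cG sG ltdn).
- exact: (sym_shift_pure (infinite_field_char0 K1) clG sG ltdn).
- apply/subsetP=> F FD; apply: good_sub.
  exact: (ext_shift_good (infinite_field_set K1) cG sG ltdn FD).
apply/subsetP=> F FD; apply: good_sub.
exact: (sym_shift_good (infinite_field_char0 K1) clG sG ltdn K1 FD).
Qed.
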